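(* Let $\Bbbk$ be a field of characteristic zero, let $\lambda$ be a nonzero dominant integral weight of $\mathfrak{sl}_\infty$ of level $d$, and let $K_0(\mathcal{H}^\lambda)$ be the split Grothendieck ring of the monoidal category $\mathcal{H}^\lambda$. There is an injective ring homomorphism $$\mathfrak{h}_d \hookrightarrow K_0(\mathcal{H}^\lambda),\qquad s_\mu^\pm \mapsto [Q_\pm^\mu]\quad\text{for every partition } \mu,$$ where $\mathfrak{h}_d$ is the level $d$ Heisenberg algebra and $s_\mu^\pm$ is the Schur function of $\mu$ in the subring $\mathrm{Sym}^\pm\subseteq\mathfrak{h}_d$. In particular, this homomorphism maps $h_n^\pm$ to $[Q_\pm^{(n)}]$ for all $n\ge 1$.
   Context: Weight. $I\cong\mathbb{Z}$ is the image of $\mathbb{Z}$ in $\Bbbk$; $\lambda=\sum_{i\in I}\lambda_i\omega_i$ with $\lambda_i\in\mathbb{N}$, finitely many nonzero, $\lambda\neq 0$; $d=\sum_i\lambda_i$. The category $\tilde{\mathcal{H}}^\lambda$. It is the additive $\Bbbk$-linear strict monoidal category whose objects are formal direct sums of words $Q_\epsilon=Q_{\epsilon_1}\cdots Q_{\epsilon_k}$ in two generating objects $Q_+,Q_-$ (juxtaposition is tensor product, $\mathbf 1$ is the empty word). Morphisms $Q_\epsilon\to Q_{\epsilon'}$ are $\Bbbk$-linear combinations of planar diagrams: oriented compact 1-manifolds immersed in $\mathbb{R}\times[0,1]$ with only double intersections, with boundary $\epsilon$ at the bottom and $\epsilon'$ at the top ($+$ is oriented up, $-$ down), whose strands may carry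 dots (dots move freely along strands, including over cups and caps, but not through crossings), modulo isotopy fixing the boundary and modulo the local relations below. $f\circ g$ stacks $f$ on top of $g$; $\otimes$ is horizontal juxtaposition. In terms of generators: $x:Q_+\to Q_+$ (a dot on an upward strand), $s:Q_+Q_+\to Q_+Q_+$ (upward crossing), right cup $\eta:\mathbf 1\to Q_-Q_+$, right cap $\varepsilon:Q_+Q_-\to\mathbf 1$, left cup $\eta':\mathbf 1\to Q_+Q_-$, left cap $\varepsilon':Q_-Q_+\to\mathbf 1$. Isotopy invariance means: $(\varepsilon\otimes 1_{Q_+})(1_{Q_+}\otimes\eta)=1_{Q_+}=(1_{Q_+}\otimes\varepsilon')(\eta'\otimes 1_{Q_+})$, $(1_{Q_-}\otimes\varepsilon)(\eta\otimes 1_{Q_-})=1_{Q_-}=(\varepsilon'\otimes 1_{Q_-})(1_{Q_-}\otimes\eta')$, and the left and right mates (rotations by $180^\circ$) of $x$ coincide (giving the dot $x^-:Q_-\to Q_-$), as do those of $s$ (giving the downward crossing $s^-$). Sideways crossings: $t=(1_{Q_-Q_+}\otimes\varepsilon)(1_{Q_-}\otimes s\otimes 1_{Q_-})(\eta\otimes 1_{Q_+Q_-}):Q_+Q_-\to Q_-Q_+$ and $t'=(\varepsilon'\otimes 1_{Q_+Q_-})(1_{Q_-}\otimes s\otimes 1_{Q_-})(1_{Q_-Q_+}\otimes\eta'):Q_-Q_+\to Q_+Q_-$. Counterclockwise bubbles: $\gamma_j=\varepsilon'(1_{Q_-}\otimes x^j)\eta\in\mathrm{End}(\mathbf 1)$.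 Put $c_0=1$, $c_s=(-1)^s\det(\gamma_{d+j-i})_{i,j=1,\dots,s}$ for $1\le s\le d$, and for $0\le j\le d-1$ let $x_j^\vee=\sum_{i=j}^{d-1}x^{i-j}\otimes c_{d-1-i}\in\mathrm{End}(Q_+)$ (dual dots). Local relations: $s^2=1$; the braid relation $(s\otimes 1)(1\otimes s)(s\otimes 1)=(1\otimes s)(s\otimes 1)(1\otimes s)$; $s(x\otimes 1)-(1\otimes x)s=1_{Q_+Q_+}=(x\otimes 1)s-s(1\otimes x)$; $1_{Q_-Q_+}=t\,t'+\sum_{j=0}^{d-1}(1_{Q_-}\otimes x^j)\,\eta\,\varepsilon'\,(1_{Q_-}\otimes x_j^\vee)$; $t'\,t=1_{Q_+Q_-}$; $\gamma_j=0$ for $j<d-1$, $\gamma_{d-1}=1$, $\gamma_d=\sum_{i\in I}i\lambda_i$; and $(\varepsilon'\otimes 1_{Q_+})(1_{Q_-}\otimes s)(\eta\otimes 1_{Q_+})=0$. $\mathcal{H}^\lambda$ is the idempotent completion (Karoubi envelope) of $\tilde{\mathcal{H}}^\lambda$. Objects $Q_\pm^\mu$. For a partition $\mu$ of $n$, let $e_\mu\in\Bbbk S_n$ be the corresponding minimal (primitive) idempotent, so $\Bbbk S_ne_\mu$ is the Specht module of $\mu$; $e_{(n)}=\frac1{n!}\sum_{w\in S_n}w$. View $e_\mu$ in $\mathrm{End}(Q_+^n)$ by sending the simple transposition $s_i$ to the crossing of the $i$-th and $(i+1)$-st strands (numbered from right to left), and, via adjunction (rotation by $180^\circ$), in $\mathrm{End}(Q_-^n)$.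 Put $Q_\pm^\mu=(Q_\pm^n,e_\mu)\in\mathcal{H}^\lambda$, $Q_\pm^\varnothing=\mathbf 1$. Heisenberg algebra. $\mathfrak{h}_d$ is the unital associative $\mathbb{Z}$-algebra generated by $h_n^\pm$, $n\in\mathbb{N}$, with relations $h_0^\pm=1$, $h_n^+h_m^+=h_m^+h_n^+$, $h_n^-h_m^-=h_m^-h_n^-$, $h_n^-h_m^+=\sum_{r=0}^{\min\{m,n\}}\binom{d+r-1}{r}h_{m-r}^+h_{n-r}^-$. The $h_n^\pm$ ($n\ge1$) generate a copy $\mathrm{Sym}^\pm$ of the ring of symmetric functions over $\mathbb{Z}$, with $h_n^\pm$ the $n$-th complete symmetric function; $s_\mu^\pm$ is the Schur function, so $s_{(n)}^\pm=h_n^\pm$. $K_0$ denotes the split Grothendieck group, with ring structure induced by the tensor product. *)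

(* Defs.v *)
Set Warnings "-notation-overridden,-ambiguous-paths,-notation-incompatible-prefix,-redundant-canonical-projection".
From HB Require Import structures.
From mathcomp Require Import mpoly.
From mathcomp Require Import all_boot all_fingroup all_algebra.
From mathcomp Require Import finmap boolp classical_sets.

Set Implicit Arguments.
Unset Strict Implicit.
Unset Printing Implicit Defensive.

Import GRing.Theory.

Local Open Scope ring_scope.
Local Open Scope quotient_scope.

Record equivalence_on (T : Type) := EquivalenceOn {
  eqv : T -> T -> Prop;
  eqv_refl : forall x, eqv x x;
  eqv_sym : forall x y, eqv x y -> eqv y x;
  eqv_trans : forall x y z, eqv x y -> eqv y z -> eqv x z }.

Section Quotient.
Context (T : Type) (E : equivalence_on T).

Definition eqvb (x y : {classic T}) : bool := `[< eqv E x y >].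

Lemma eqvb_refl : reflexive eqvb.
Proof. by move=> x; apply/asboolP/eqv_refl. Qed.

Lemma eqvb_sym : symmetric eqvb.
Proof.
by move=> x y; apply: asbool_equiv_eq; split; apply: eqv_sym.
Qed.

Lemma eqvb_trans : transitive eqvb.
Proof.
by move=> y x z /asboolP xy /asboolP yz; apply/asboolP/(eqv_trans xy yz).
Qed.

Canonical eqvb_equiv := EquivRel eqvb eqvb_refl eqvb_sym eqvb_trans.

Definition quot : Type := {eq_quot eqvb_equiv}.
HB.instance Definition _ := Choice.copy quot {eq_quot eqvb_equiv}.

Definition cl (x : T) : quot := \pi_({eq_quot eqvb_equiv}) (x : {classic T}).
Definition rep (q : quot) : T := generic_quotient.repr (q : {eq_quot eqvb_equiv}).

Lemma clP (x y : T) : cl x = cl y <-> eqv E x y.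
Proof.
split=> [/eqmodP /asboolP //|xy].
by apply/eqmodP/asboolP.
Qed.

Lemma repK (q : quot) : cl (rep q) = q.
Proof. exact: reprK. Qed.

Lemma eqv_rep (x : T) : eqv E (rep (cl x)) x.
Proof. by apply/clP; rewrite repK. Qed.

Lemma quotW (P : quot -> Prop) : (forall x, P (cl x)) -> forall q, P q.
Proof. by move=> Px q; rewrite -(repK q). Qed.

End Quotient.
Arguments cl {T E}.
Arguments rep {T E}.
Arguments eqv_rep {T} E.

Inductive rterm (G : Type) : Type :=
  | RGen of G
  | RZero
  | ROne
  | RAdd of rterm G & rterm G
  | ROpp of rterm G
  | RMul of rterm G & rterm G.
Arguments RZero {G}.
Arguments ROne {G}.

Definition RNat (G : Type) (n : nat) : rterm G := iter n (RAdd ROne) RZero.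
Arguments RNat {G}.

Fixpoint reval (G : Type) (A : pzRingType) (v : G -> A) (t : rterm G) : A :=
  match t with
  | RGen g => v g
  | RZero => 0
  | ROne => 1
  | RAdd s t => reval v s + reval v t
  | ROpp t => - reval v t
  | RMul s t => reval v s * reval v t
  end.

Section PresentedRing.
Context (G : Type) (R : rterm G -> rterm G -> Prop).

Inductive rcong : rterm G -> rterm G -> Prop :=
  | rc_rel s t : R s t -> rcong s t
  | rc_refl t : rcong t t
  | rc_sym s t : rcong s t -> rcong t s
  | rc_trans s t u : rcong s t -> rcong t u -> rcong s u
  | rc_add s s' t t' :
      rcong s s' -> rcong t t' -> rcong (RAdd s t) (RAdd s' t')
  | rc_opp t t' : rcong t t' -> rcong (ROpp t) (ROpp t')
  | rc_mul s s' t t' :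
      rcong s s' -> rcong t t' -> rcong (RMul s t) (RMul s' t')
  | rc_addA s t u : rcong (RAdd s (RAdd t u)) (RAdd (RAdd s t) u)
  | rc_addC s t : rcong (RAdd s t) (RAdd t s)
  | rc_add0 t : rcong (RAdd RZero t) t
  | rc_addN t : rcong (RAdd (ROpp t) t) RZero
  | rc_mulA s t u : rcong (RMul s (RMul t u)) (RMul (RMul s t) u)
  | rc_mul1l t : rcong (RMul ROne t) t
  | rc_mul1r t : rcong (RMul t ROne) t
  | rc_mulDl s t u : rcong (RMul (RAdd s t) u) (RAdd (RMul s u) (RMul t u))
  | rc_mulDr s t u : rcong (RMul s (RAdd t u)) (RAdd (RMul s t) (RMul s u)).

Definition rcong_equiv := EquivalenceOn rc_refl rc_sym rc_trans.

Definition presring : Type := quot rcong_equiv.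
HB.instance Definition _ := Choice.on presring.

Implicit Types x y z : presring.

Definition pr_zero : presring := cl RZero.
Definition pr_one : presring := cl ROne.
Definition pr_add x y : presring := cl (RAdd (rep x) (rep y)).
Definition pr_opp x : presring := cl (ROpp (rep x)).
Definition pr_mul x y : presring := cl (RMul (rep x) (rep y)).

Lemma pr_addE s t : pr_add (cl s) (cl t) = cl (RAdd s t).
Proof. by apply/clP; apply: rc_add; apply: (eqv_rep rcong_equiv). Qed.
Lemma pr_oppE t : pr_opp (cl t) = cl (ROpp t).
Proof. by apply/clP; apply: rc_opp; apply: (eqv_rep rcong_equiv). Qed.
Lemma pr_mulE s t : pr_mul (cl s) (cl t) = cl (RMul s t).
Proof. by apply/clP; apply: rc_mul; apply: (eqv_rep rcong_equiv). Qed.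

Lemma pr_addA : associative pr_add.
Proof.
elim/quotW=> s; elim/quotW=> t; elim/quotW=> u.
by rewrite !pr_addE; apply/clP/rc_addA.
Qed.
Lemma pr_addC : commutative pr_add.
Proof.
by elim/quotW=> s; elim/quotW=> t; rewrite !pr_addE; apply/clP/rc_addC.
Qed.
Lemma pr_add0 : left_id pr_zero pr_add.
Proof. by elim/quotW=> s; rewrite pr_addE; apply/clP/rc_add0. Qed.
Lemma pr_addN : left_inverse pr_zero pr_opp pr_add.
Proof. by elim/quotW=> s; rewrite pr_oppE pr_addE; apply/clP/rc_addN. Qed.

HB.instance Definition _ :=
  GRing.isZmodule.Build presring pr_addA pr_addC pr_add0 pr_addN.

Lemma pr_plusE s t : (cl s : presring) + cl t = cl (RAdd s t).
Proof. exact: pr_addE. Qed.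

Lemma pr_mulA : associative pr_mul.
Proof.
elim/quotW=> s; elim/quotW=> t; elim/quotW=> u.
by rewrite !pr_mulE; apply/clP/rc_mulA.
Qed.
Lemma pr_mul1l : left_id pr_one pr_mul.
Proof. by elim/quotW=> s; rewrite pr_mulE; apply/clP/rc_mul1l. Qed.
Lemma pr_mul1r : right_id pr_one pr_mul.
Proof. by elim/quotW=> s; rewrite pr_mulE; apply/clP/rc_mul1r. Qed.
Lemma pr_mulDl : left_distributive pr_mul +%R.
Proof.
elim/quotW=> s; elim/quotW=> t; elim/quotW=> u.
by rewrite (pr_plusE s t) !pr_mulE pr_plusE; apply/clP/rc_mulDl.
Qed.
Lemma pr_mulDr : right_distributive pr_mul +%R.
Proof.
elim/quotW=> s; elim/quotW=> t; elim/quotW=> u.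
by rewrite (pr_plusE t u) !pr_mulE pr_plusE; apply/clP/rc_mulDr.
Qed.

HB.instance Definition _ := GRing.Zmodule_isPzRing.Build presring
  pr_mulA pr_mul1l pr_mul1r pr_mulDl pr_mulDr.

End PresentedRing.

(* (true, n) stands for h_n^+ and (false, n) for h_n^-. *)
Section Heisenberg.
Context (d : nat).

Local Notation h b n := (RGen (b, n%N) : rterm (bool * nat)).

Inductive heis_rel : rterm (bool * nat) -> rterm (bool * nat) -> Prop :=
  | heis_one b : heis_rel (h b 0) ROne
  | heis_comm b n m :
      heis_rel (RMul (h b n) (h b m)) (RMul (h b m) (h b n))
  | heis_cross n m : heis_rel (RMul (h false n) (h true m))
      (\big[@RAdd _/RZero]_(r < (minn m n).+1)
         RMul (RNat 'C((d + r).-1, r)) (RMul (h true (m - r)) (h false (n - r)))).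

Definition heis : Type := presring heis_rel.
HB.instance Definition _ := GRing.PzRing.on heis.

Definition hgen (b : bool) (n : nat) : heis := cl (h b n).

End Heisenberg.

Section GroupCompletion.
Context (S : pzSemiRingType).
Implicit Types x y z : S * S.

Definition gc_eq x y := exists t : S, x.1 + y.2 + t = y.1 + x.2 + t.

Lemma gc_refl x : gc_eq x x.
Proof. by exists 0. Qed.
Lemma gc_sym x y : gc_eq x y -> gc_eq y x.
Proof. by case=> t xy; exists t. Qed.
Lemma gc_trans x y z : gc_eq x y -> gc_eq y z -> gc_eq x z.
Proof.
case: x y z => [a b] [c d] [e f] [t /= ht] [u /= hu].
exists (c + d + t + u) => /=.
have -> : a + f + (c + d + t + u) = (a + d + t) + (c + f + u).
  by rewrite (AC (2*4) ((1*4*5)*(3*2*6))).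
rewrite ht hu.
by rewrite (AC (3*3) ((4*2)*(1*5*3*6))).
Qed.

Definition gc_equiv := EquivalenceOn gc_refl gc_sym gc_trans.

Definition groth : Type := quot gc_equiv.
HB.instance Definition _ := Choice.on groth.

(* (a, b) stands for the formal difference a - b. *)
Definition gp_zero : S * S := (0, 0).
Definition gp_one : S * S := (1, 0).
Definition gp_add x y : S * S := (x.1 + y.1, x.2 + y.2).
Definition gp_opp x : S * S := (x.2, x.1).
Definition gp_mul x y : S * S :=
  (x.1 * y.1 + x.2 * y.2, x.1 * y.2 + x.2 * y.1).

Lemma gp_add_eq x x' y y' :
  gc_eq x x' -> gc_eq y y' -> gc_eq (gp_add x y) (gp_add x' y').
Proof.
case: x x' y y' => [a b] [a' b'] [c d] [c' d'] [t /= ht] [u /= hu].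
exists (t + u) => /=.
have -> : a + c + (b' + d') + (t + u) = (a + b' + t) + (c + d' + u).
  by rewrite (AC ((2*2)*2) ((1*3*5)*(2*4*6))).
rewrite ht hu.
by rewrite (AC (3*3) (((1*4)*(2*5))*(3*6))).
Qed.

Lemma gp_opp_eq x x' : gc_eq x x' -> gc_eq (gp_opp x) (gp_opp x').
Proof. by case=> t ht; exists t; rewrite /= [x.2 + _]addrC [x'.2 + _]addrC. Qed.

Lemma gp_mul_eq x x' y y' :
  gc_eq x x' -> gc_eq y y' -> gc_eq (gp_mul x y) (gp_mul x' y').
Proof.
move=> xx' yy'; apply: (@gc_trans _ (gp_mul x' y)).
  case: x x' xx' {yy'} => [a b] [a' b'] [t /= ht].
  exists (t * y.1 + t * y.2) => /=.
  have -> : a * y.1 + b * y.2 + (a' * y.2 + b' * y.1) + (t * y.1 + t * y.2)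
    = (a + b' + t) * y.1 + (a' + b + t) * y.2.
    by rewrite !mulrDl (AC ((2*2)*2) ((1*4*5)*(3*2*6))).
  rewrite ht -{2}ht !mulrDl.
  have -> : a' * y.1 + b * y.1 + t * y.1 + (a * y.2 + b' * y.2 + t * y.2)
    = a' * y.1 + b' * y.2 + (a * y.2 + b * y.1) + (t * y.1 + t * y.2).
    by rewrite (AC (3*3) (((1*5)*(4*2))*(3*6))).
  by [].
case: y y' yy' {xx'} => [a b] [a' b'] [t /= ht].
exists (x'.1 * t + x'.2 * t) => /=.
have -> : x'.1 * a + x'.2 * b + (x'.1 * b' + x'.2 * a') + (x'.1 * t + x'.2 * t)
  = x'.1 * (a + b' + t) + x'.2 * (a' + b + t).
  by rewrite !mulrDr (AC ((2*2)*2) ((1*3*5)*(4*2*6))).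
rewrite ht -{2}ht !mulrDr.
by rewrite (AC (3*3) (((1*5)*(2*4))*(3*6))).
Qed.

Definition gr_zero : groth := cl gp_zero.
Definition gr_one : groth := cl gp_one.
Definition gr_add (p q : groth) : groth := cl (gp_add (rep p) (rep q)).
Definition gr_opp (p : groth) : groth := cl (gp_opp (rep p)).
Definition gr_mul (p q : groth) : groth := cl (gp_mul (rep p) (rep q)).

Lemma gr_addE x y : gr_add (cl x) (cl y) = cl (gp_add x y).
Proof. by apply/clP; apply: gp_add_eq; apply: (eqv_rep gc_equiv). Qed.
Lemma gr_oppE x : gr_opp (cl x) = cl (gp_opp x).
Proof. by apply/clP; apply: gp_opp_eq; apply: (eqv_rep gc_equiv). Qed.
Lemma gr_mulE x y : gr_mul (cl x) (cl y) = cl (gp_mul x y).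
Proof. by apply/clP; apply: gp_mul_eq; apply: (eqv_rep gc_equiv). Qed.

Lemma gr_addA : associative gr_add.
Proof.
elim/quotW=> x; elim/quotW=> y; elim/quotW=> z.
by rewrite !gr_addE /gp_add /= !addrA.
Qed.
Lemma gr_addC : commutative gr_add.
Proof.
elim/quotW=> x; elim/quotW=> y.
by rewrite !gr_addE /gp_add [x.1 + _]addrC [x.2 + _]addrC.
Qed.
Lemma gr_add0 : left_id gr_zero gr_add.
Proof. by elim/quotW=> -[a b]; rewrite gr_addE /gp_add /= !add0r. Qed.
Lemma gr_addN : left_inverse gr_zero gr_opp gr_add.
Proof.
elim/quotW=> -[a b]; rewrite gr_oppE gr_addE; apply/clP.
by exists 0; rewrite /= !addr0 add0r addrC.
Qed.

HB.instance Definition _ :=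
  GRing.isZmodule.Build groth gr_addA gr_addC gr_add0 gr_addN.

Lemma gr_plusE x y : (cl x : groth) + cl y = cl (gp_add x y).
Proof. exact: gr_addE. Qed.

Lemma gr_mulA : associative gr_mul.
Proof.
elim/quotW=> -[a b]; elim/quotW=> -[c d]; elim/quotW=> -[e f].
rewrite !gr_mulE; congr cl; rewrite /gp_mul /= !mulrDl !mulrDr !mulrA.
congr (_, _).
  by rewrite (AC (2*2) ((1*4)*(2*3))).
by rewrite (AC (2*2) ((1*4)*(2*3))).
Qed.
Lemma gr_mul1l : left_id gr_one gr_mul.
Proof.
by elim/quotW=> -[a b]; rewrite gr_mulE /gp_mul /= !mul1r !mul0r !addr0.
Qed.
Lemma gr_mul1r : right_id gr_one gr_mul.
Proof.
by elim/quotW=> -[a b]; rewrite gr_mulE /gp_mul /= !mulr1 !mulr0 !addr0 add0r.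
Qed.
Lemma gr_mulDl : left_distributive gr_mul +%R.
Proof.
elim/quotW=> -[a b]; elim/quotW=> -[c d]; elim/quotW=> -[e f].
rewrite (gr_plusE (a, b)) !gr_mulE gr_plusE; congr cl.
rewrite /gp_mul /gp_add /= !mulrDl.
by congr (_, _); rewrite addrACA.
Qed.
Lemma gr_mulDr : right_distributive gr_mul +%R.
Proof.
elim/quotW=> -[a b]; elim/quotW=> -[c d]; elim/quotW=> -[e f].
rewrite (gr_plusE (c, d)) !gr_mulE gr_plusE; congr cl.
rewrite /gp_mul /gp_add /= !mulrDr.
by congr (_, _); rewrite addrACA.
Qed.

HB.instance Definition _ := GRing.Zmodule_isPzRing.Build groth
  gr_mulA gr_mul1l gr_mul1r gr_mulDl gr_mulDr.

End GroupCompletion.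

(* true stands for Q_+ and false for Q_-; the tensor product of words is ++. *)
Definition word := seq bool.

Declare Scope diagram_scope.
Delimit Scope diagram_scope with D.

Inductive diagram (k : Type) : word -> word -> Type :=
  | DId u : diagram k u u
  | DComp u v w : diagram k v w -> diagram k u v -> diagram k u w
  | DTens u v u' v' :
      diagram k u v -> diagram k u' v' -> diagram k (u ++ u') (v ++ v')
  | DDot : diagram k [:: true] [:: true]
  | DCross : diagram k [:: true; true] [:: true; true]
  | DRCup : diagram k [::] [:: false; true]
  | DRCap : diagram k [:: true; false] [::]
  | DLCup : diagram k [::] [:: true; false]
  | DLCap : diagram k [:: false; true] [::]
  | DZero u v : diagram k u v
  | DAdd u v : diagram k u v -> diagram k u v -> diagram k u v
  | DScale u v : k -> diagram k u v -> diagram k u v.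

Arguments DId {k} u.
Arguments DDot {k}.
Arguments DCross {k}.
Arguments DRCup {k}.
Arguments DRCap {k}.
Arguments DLCup {k}.
Arguments DLCap {k}.
Arguments DZero {k u v}.

Bind Scope diagram_scope with diagram.
Notation "f ∘ g" := (DComp f g) (at level 40, left associativity)
  : diagram_scope.
Notation "f ⊗ g" := (DTens f g) (at level 35, right associativity)
  : diagram_scope.
Notation "f + g" := (DAdd f g) : diagram_scope.
Notation "a *: f" := (DScale a f) : diagram_scope.

(* The identity of u, regarded as a morphism between two words that are only
   propositionally equal. *)
Definition didto (k : Type) (u v : word) (p : u = v) : diagram k u v :=
  ecast w (diagram k u w) p (DId u).

Section LocalRelations.
Context (k : fieldType) (lam : {fsfun int -> nat with 0%N}).
Local Open Scope diagram_scope.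
Local Notation diagram := (diagram k).
Local Notation Qp := (DId [:: true] : diagram _ _).
Local Notation Qm := (DId [:: false] : diagram _ _).
Local Notation Qpp := (DId [:: true; true] : diagram _ _).
Local Notation Qpm := (DId [:: true; false] : diagram _ _).
Local Notation Qmp := (DId [:: false; true] : diagram _ _).
Local Notation Qmm := (DId [:: false; false] : diagram _ _).
Local Notation x := (DDot : diagram _ _).
Local Notation s := (DCross : diagram _ _).
Local Notation η := (DRCup : diagram _ _).
Local Notation ε := (DRCap : diagram _ _).
Local Notation η' := (DLCup : diagram _ _).
Local Notation ε' := (DLCap : diagram _ _).

Definition level : nat := \sum_(i <- finsupp lam) lam i.
Local Notation d := level.

Definition dots (j : nat) : diagram [:: true] [:: true] := iter j (DComp x) Qp.

Definition rcross : diagram [:: true; false] [:: false; true] :=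
  (Qmp ⊗ ε) ∘ (Qm ⊗ s ⊗ Qm) ∘ (η ⊗ Qpm).
Definition lcross : diagram [:: false; true] [:: true; false] :=
  (ε' ⊗ Qpm) ∘ (Qm ⊗ s ⊗ Qm) ∘ (Qmp ⊗ η').

Definition bubble (j : nat) : diagram [::] [::] := ε' ∘ (Qm ⊗ dots j) ∘ η.

(* (-1)^n det (γ_{d+j-i})_{1 <= i,j <= n}, by the Leibniz formula: End(1) has
   no ring structure yet. The truncated subtraction is exact for n <= d, and
   n = 0 gives the identity. *)
Definition bubble_det (n : nat) : diagram [::] [::] :=
  \big[@DAdd k [::] [::]/DZero]_(w : 'S_n)
    (((-1) ^+ n * (-1) ^+ w)%R *:
       \big[@DComp k [::] [::] [::]/DId [::]]_(i < n) bubble (d + w i - i)).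

Definition dual_dots (j : nat) : diagram [:: true] [:: true] :=
  \big[@DAdd k [:: true] [:: true]/DZero]_(j <= i < d)
    (dots (i - j) ⊗ bubble_det (d.-1 - i)).

Inductive deq : forall u v : word, diagram u v -> diagram u v -> Prop :=
  | deq_refl u v (f : diagram u v) : deq f f
  | deq_sym u v (f g : diagram u v) : deq f g -> deq g f
  | deq_trans u v (f g h : diagram u v) : deq f g -> deq g h -> deq f h
  | deq_comp u v w (f f' : diagram v w) (g g' : diagram u v) :
      deq f f' -> deq g g' -> deq (f ∘ g) (f' ∘ g')
  | deq_tens u v u' v' (f f' : diagram u v) (g g' : diagram u' v') :
      deq f f' -> deq g g' -> deq (f ⊗ g) (f' ⊗ g')
  | deq_add u v (f f' g g' : diagram u v) :
      deq f f' -> deq g g' -> deq (f + g) (f' + g')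
  | deq_scale u v a (f f' : diagram u v) : deq f f' -> deq (a *: f) (a *: f')
  | deq_addA u v (f g h : diagram u v) : deq (f + (g + h)) ((f + g) + h)
  | deq_addC u v (f g : diagram u v) : deq (f + g) (g + f)
  | deq_add0 u v (f : diagram u v) : deq (DZero + f) f
  | deq_scaleA u v a b (f : diagram u v) : deq (a *: (b *: f)) ((a * b)%R *: f)
  | deq_scale0 u v (f : diagram u v) : deq (0%R *: f) DZero
  | deq_scale1 u v (f : diagram u v) : deq (1%R *: f) f
  | deq_scaleDr u v a (f g : diagram u v) :
      deq (a *: (f + g)) (a *: f + a *: g)
  | deq_scaleDl u v a b (f : diagram u v) :
      deq ((a + b)%R *: f) (a *: f + b *: f)
  | deq_compDl u v w (f f' : diagram v w) (g : diagram u v) :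
      deq ((f + f') ∘ g) (f ∘ g + f' ∘ g)
  | deq_compDr u v w (f : diagram v w) (g g' : diagram u v) :
      deq (f ∘ (g + g')) (f ∘ g + f ∘ g')
  | deq_compZl u v w a (f : diagram v w) (g : diagram u v) :
      deq ((a *: f) ∘ g) (a *: (f ∘ g))
  | deq_compZr u v w a (f : diagram v w) (g : diagram u v) :
      deq (f ∘ (a *: g)) (a *: (f ∘ g))
  | deq_tensDl u v u' v' (f f' : diagram u v) (g : diagram u' v') :
      deq ((f + f') ⊗ g) (f ⊗ g + f' ⊗ g)
  | deq_tensDr u v u' v' (f : diagram u v) (g g' : diagram u' v') :
      deq (f ⊗ (g + g')) (f ⊗ g + f ⊗ g')
  | deq_tensZl u v u' v' a (f : diagram u v) (g : diagram u' v') :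
      deq ((a *: f) ⊗ g) (a *: (f ⊗ g))
  | deq_tensZr u v u' v' a (f : diagram u v) (g : diagram u' v') :
      deq (f ⊗ (a *: g)) (a *: (f ⊗ g))
  | deq_compA u v w z (f : diagram w z) (g : diagram v w) (h : diagram u v) :
      deq (f ∘ (g ∘ h)) ((f ∘ g) ∘ h)
  | deq_idl u v (f : diagram u v) : deq (DId v ∘ f) f
  | deq_idr u v (f : diagram u v) : deq (f ∘ DId u) f
  | deq_tens_id u v : deq (DId u ⊗ DId v) (DId (u ++ v))
  | deq_interchange u v w u' v' w' (f : diagram v w) (g : diagram u v)
      (f' : diagram v' w') (g' : diagram u' v') :
      deq ((f ⊗ f') ∘ (g ⊗ g')) ((f ∘ g) ⊗ (f' ∘ g'))
  | deq_unitl u v (f : diagram u v) : deq (DId [::] ⊗ f) f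
  | deq_unitr u v (f : diagram u v) :
      deq (didto k (cats0 v) ∘ (f ⊗ DId [::])) (f ∘ didto k (cats0 u))
  | deq_tensA u v u' v' u'' v''
      (f : diagram u v) (g : diagram u' v') (h : diagram u'' v'') :
      deq (didto k (catA v v' v'') ∘ (f ⊗ (g ⊗ h)))
          (((f ⊗ g) ⊗ h) ∘ didto k (catA u u' u''))
  | deq_zigzag1 : deq ((ε ⊗ Qp) ∘ (Qp ⊗ η)) Qp
  | deq_zigzag2 : deq ((Qp ⊗ ε') ∘ (η' ⊗ Qp)) Qp
  | deq_zigzag3 : deq ((Qm ⊗ ε) ∘ (η ⊗ Qm)) Qm
  | deq_zigzag4 : deq ((ε' ⊗ Qm) ∘ (Qm ⊗ η')) Qm
  | deq_dot_mates :
      deq ((Qm ⊗ ε) ∘ (Qm ⊗ x ⊗ Qm) ∘ (η ⊗ Qm))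
          ((ε' ⊗ Qm) ∘ (Qm ⊗ x ⊗ Qm) ∘ (Qm ⊗ η'))
  | deq_cross_mates :
      deq ((Qmm ⊗ (ε ∘ (Qp ⊗ ε ⊗ Qm))) ∘ (Qmm ⊗ s ⊗ Qmm)
             ∘ (((Qm ⊗ η ⊗ Qp) ∘ η) ⊗ Qmm))
          (((ε' ∘ (Qm ⊗ ε' ⊗ Qp)) ⊗ Qmm) ∘ (Qmm ⊗ s ⊗ Qmm)
             ∘ (Qmm ⊗ ((Qp ⊗ η' ⊗ Qm) ∘ η')))
  | deq_crossK : deq (s ∘ s) Qpp
  | deq_braid :
      deq ((s ⊗ Qp) ∘ (Qp ⊗ s) ∘ (s ⊗ Qp)) ((Qp ⊗ s) ∘ (s ⊗ Qp) ∘ (Qp ⊗ s))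
  | deq_dot_cross1 :
      deq (s ∘ (x ⊗ Qp) + (-1)%R *: ((Qp ⊗ x) ∘ s)) Qpp
  | deq_dot_cross2 :
      deq ((x ⊗ Qp) ∘ s + (-1)%R *: (s ∘ (Qp ⊗ x))) Qpp
  | deq_mp :
      deq Qmp (rcross ∘ lcross +
        \big[@DAdd k [:: false; true] [:: false; true]/DZero]_(j < d)
           ((Qm ⊗ dots j) ∘ η ∘ ε' ∘ (Qm ⊗ dual_dots j)))
  | deq_pm : deq (lcross ∘ rcross) Qpm
  | deq_bubble_lt j : (j < d.-1)%N -> deq (bubble j) DZero
  | deq_bubble_pred : deq (bubble d.-1) (DId [::])
  | deq_bubble_level :
      deq (bubble d)
          ((\sum_(i <- finsupp lam) i%:~R * (lam i)%:R)%R *: DId [::])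
  | deq_curl : deq ((ε' ⊗ Qp) ∘ (Qm ⊗ s) ∘ (η ⊗ Qp)) DZero.

Definition deq_equiv u v :=
  EquivalenceOn (@deq_refl u v) (@deq_sym u v) (@deq_trans u v).

End LocalRelations.

Section QHom.
Context (k : fieldType) (lam : {fsfun int -> nat with 0%N}).
Implicit Types u v w : word.

Definition QHom (u v : word) : Type := quot (@deq_equiv k lam u v).
HB.instance Definition _ u v := Choice.on (QHom u v).

Definition hid u : QHom u u := cl (DId u).
Definition hzero u v : QHom u v := cl DZero.
Definition hadd u v (f g : QHom u v) : QHom u v := cl (DAdd (rep f) (rep g)).
Definition hscale u v (a : k) (f : QHom u v) : QHom u v := cl (DScale a (rep f)).
Definition hopp u v (f : QHom u v) : QHom u v := hscale (-1) f.
Definition hcomp u v w (f : QHom v w) (g : QHom u v) : QHom u w :=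
  cl (DComp (rep f) (rep g)).
Definition htens u v u' v' (f : QHom u v) (g : QHom u' v') :
  QHom (u ++ u') (v ++ v') := cl (DTens (rep f) (rep g)).
Definition idto u v (p : u = v) : QHom u v := cl (didto k p).

Lemma deq_rep u v (f : diagram k u v) : deq lam (rep (cl f : QHom u v)) f.
Proof. exact: (eqv_rep (deq_equiv k lam u v)). Qed.

Lemma haddE u v (f g : diagram k u v) :
  hadd (cl f) (cl g) = cl (DAdd f g) :> QHom u v.
Proof. by apply/clP; apply: deq_add; apply: deq_rep. Qed.
Lemma hscaleE u v a (f : diagram k u v) :
  hscale a (cl f) = cl (DScale a f) :> QHom u v.
Proof. by apply/clP; apply: deq_scale; apply: deq_rep. Qed.
Lemma hcompE u v w (f : diagram k v w) (g : diagram k u v) :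
  hcomp (cl f) (cl g) = cl (DComp f g).
Proof. by apply/clP; apply: deq_comp; apply: deq_rep. Qed.
Lemma htensE u v u' v' (f : diagram k u v) (g : diagram k u' v') :
  htens (cl f) (cl g) = cl (DTens f g).
Proof. by apply/clP; apply: deq_tens; apply: deq_rep. Qed.

Section Zmodule.
Context (u v : word).

Lemma haddA : associative (@hadd u v).
Proof.
elim/quotW=> f; elim/quotW=> g; elim/quotW=> h.
by rewrite !haddE; apply/clP/deq_addA.
Qed.
Lemma haddC : commutative (@hadd u v).
Proof.
by elim/quotW=> f; elim/quotW=> g; rewrite !haddE; apply/clP/deq_addC.
Qed.
Lemma hadd0 : left_id (@hzero u v) (@hadd u v).
Proof. by elim/quotW=> f; rewrite haddE; apply/clP/deq_add0. Qed.
Lemma haddN : left_inverse (@hzero u v) (@hopp u v) (@hadd u v).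
Proof.
elim/quotW=> f; rewrite /hopp hscaleE haddE; apply/clP.
apply: (deq_trans (deq_add (deq_refl _ _) (deq_sym (deq_scale1 _ f)))).
apply: (deq_trans (deq_sym (deq_scaleDl _ _ _ _))).
by rewrite addNr; apply: deq_scale0.
Qed.

HB.instance Definition _ :=
  GRing.isZmodule.Build (QHom u v) haddA haddC hadd0 haddN.

Lemma hplusE (f g : diagram k u v) : (cl f : QHom u v) + cl g = cl (DAdd f g).
Proof. exact: haddE. Qed.

Lemma hscaleA a b (f : QHom u v) : hscale a (hscale b f) = hscale (a * b) f.
Proof.
by elim/quotW: f => f; rewrite !hscaleE; apply/clP/deq_scaleA.
Qed.
Lemma hscale1 : left_id 1 (@hscale u v).
Proof. by elim/quotW=> f; rewrite hscaleE; apply/clP/deq_scale1. Qed.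
Lemma hscaleDr : right_distributive (@hscale u v) +%R.
Proof.
move=> a; elim/quotW=> f; elim/quotW=> g.
by rewrite (hplusE f) !hscaleE hplusE; apply/clP/deq_scaleDr.
Qed.
Lemma hscaleDl (f : QHom u v) : {morph (@hscale u v)^~ f : a b / a + b}.
Proof.
elim/quotW: f => f a b.
by rewrite !hscaleE hplusE; apply/clP/deq_scaleDl.
Qed.

HB.instance Definition _ := GRing.Zmodule_isLmodule.Build k (QHom u v)
  hscaleA hscale1 hscaleDr hscaleDl.

End Zmodule.

Lemma hzmulE u v a (f : diagram k u v) :
  a *: (cl f : QHom u v) = cl (DScale a f).
Proof. exact: hscaleE. Qed.

Local Notation "f ∘ g" := (hcomp f g) (at level 40, left associativity).
Local Notation "f ⊗ g" := (htens f g) (at level 35, right associativity).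

Lemma hcompDl u v w (f f' : QHom v w) (g : QHom u v) :
  (f + f') ∘ g = f ∘ g + f' ∘ g.
Proof.
elim/quotW: f => f; elim/quotW: f' => f'; elim/quotW: g => g.
by rewrite (hplusE f) !hcompE hplusE; apply/clP/deq_compDl.
Qed.
Lemma hcompDr u v w (f : QHom v w) (g g' : QHom u v) :
  f ∘ (g + g') = f ∘ g + f ∘ g'.
Proof.
elim/quotW: f => f; elim/quotW: g => g; elim/quotW: g' => g'.
by rewrite (hplusE g) !hcompE hplusE; apply/clP/deq_compDr.
Qed.
Lemma hcomp0l u v w (g : QHom u v) : (0 : QHom v w) ∘ g = 0.
Proof. by apply: (addIr (0 ∘ g)); rewrite -hcompDl !add0r. Qed.
Lemma hcomp0r u v w (f : QHom v w) : f ∘ (0 : QHom u v) = 0.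
Proof. by apply: (addIr (f ∘ 0)); rewrite -hcompDr !add0r. Qed.
Lemma htensDl u v u' v' (f f' : QHom u v) (g : QHom u' v') :
  (f + f') ⊗ g = f ⊗ g + f' ⊗ g.
Proof.
elim/quotW: f => f; elim/quotW: f' => f'; elim/quotW: g => g.
by rewrite (hplusE f) !htensE hplusE; apply/clP/deq_tensDl.
Qed.
Lemma htensDr u v u' v' (f : QHom u v) (g g' : QHom u' v') :
  f ⊗ (g + g') = f ⊗ g + f ⊗ g'.
Proof.
elim/quotW: f => f; elim/quotW: g => g; elim/quotW: g' => g'.
by rewrite (hplusE g) !htensE hplusE; apply/clP/deq_tensDr.
Qed.
Lemma htens0l u v u' v' (g : QHom u' v') : (0 : QHom u v) ⊗ g = 0.
Proof. by apply: (addIr (0 ⊗ g)); rewrite -htensDl !add0r. Qed.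
Lemma htens0r u v u' v' (f : QHom u v) : f ⊗ (0 : QHom u' v') = 0.
Proof. by apply: (addIr (f ⊗ 0)); rewrite -htensDr !add0r. Qed.

Lemma hcompA u v w z (f : QHom w z) (g : QHom v w) (h : QHom u v) :
  f ∘ (g ∘ h) = (f ∘ g) ∘ h.
Proof.
elim/quotW: f => f; elim/quotW: g => g; elim/quotW: h => h.
by rewrite !hcompE; apply/clP/deq_compA.
Qed.
Lemma hidl u v (f : QHom u v) : hid v ∘ f = f.
Proof. by elim/quotW: f => f; rewrite hcompE; apply/clP/deq_idl. Qed.
Lemma hidr u v (f : QHom u v) : f ∘ hid u = f.
Proof. by elim/quotW: f => f; rewrite hcompE; apply/clP/deq_idr. Qed.
Lemma htens_id u v : hid u ⊗ hid v = hid (u ++ v).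
Proof. by rewrite htensE; apply/clP/deq_tens_id. Qed.
Lemma hinterchange u v w u' v' w' (f : QHom v w) (g : QHom u v)
    (f' : QHom v' w') (g' : QHom u' v') :
  (f ⊗ f') ∘ (g ⊗ g') = (f ∘ g) ⊗ (f' ∘ g').
Proof.
elim/quotW: f => f; elim/quotW: g => g; elim/quotW: f' => f'.
elim/quotW: g' => g'; rewrite (hcompE f) (hcompE f') !htensE hcompE.
exact/clP/deq_interchange.
Qed.
Lemma hunitl u v (f : QHom u v) : hid [::] ⊗ f = f.
Proof. by elim/quotW: f => f; rewrite htensE; apply/clP/deq_unitl. Qed.
Lemma hunitr u v (f : QHom u v) :
  idto (cats0 v) ∘ (f ⊗ hid [::]) = f ∘ idto (cats0 u).
Proof.
by elim/quotW: f => f; rewrite /idto htensE !hcompE; apply/clP/deq_unitr.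
Qed.
Lemma htensA u v u' v' u'' v''
    (f : QHom u v) (g : QHom u' v') (h : QHom u'' v'') :
  idto (catA v v' v'') ∘ (f ⊗ (g ⊗ h)) = ((f ⊗ g) ⊗ h) ∘ idto (catA u u' u'').
Proof.
elim/quotW: f => f; elim/quotW: g => g; elim/quotW: h => h.
by rewrite /idto !htensE !hcompE; apply/clP/deq_tensA.
Qed.

Lemma idto_id u (p : u = u) : idto p = hid u.
Proof. by rewrite (eq_axiomK p). Qed.
Lemma idtoK u v (p : u = v) : idto (esym p) ∘ idto p = hid u.
Proof. by case: _ / p; rewrite idto_id hidl. Qed.

Lemma hcomp_suml (I : finType) u v w (F : I -> QHom v w) (g : QHom u v) :
  (\sum_i F i) ∘ g = \sum_i (F i ∘ g).
Proof.
by apply: (big_morph (fun f => f ∘ g)) => [f f'|]; rewrite ?hcompDl ?hcomp0l.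
Qed.
Lemma hcomp_sumr (I : finType) u v w (f : QHom v w) (G : I -> QHom u v) :
  f ∘ (\sum_i G i) = \sum_i (f ∘ G i).
Proof.
by apply: (big_morph (fun g => f ∘ g)) => [g g'|]; rewrite ?hcompDr ?hcomp0r.
Qed.
Lemma htens_suml (I : finType) u v u' v' (F : I -> QHom u v) (g : QHom u' v') :
  (\sum_i F i) ⊗ g = \sum_i (F i ⊗ g).
Proof.
by apply: (big_morph (fun f => f ⊗ g)) => [f f'|]; rewrite ?htensDl ?htens0l.
Qed.
Lemma htens_sumr (I : finType) u v u' v' (f : QHom u v) (G : I -> QHom u' v') :
  f ⊗ (\sum_i G i) = \sum_i (f ⊗ G i).
Proof.
by apply: (big_morph (fun g => f ⊗ g)) => [g g'|]; rewrite ?htensDr ?htens0r.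
Qed.

(* Additive envelope: a formal direct sum of words is a finite family of words,
   and a morphism from X to Y is a matrix f with f i j : X_i -> Y_j. *)

Definition mhom (I J : finType) (X : I -> word) (Y : J -> word) : Type :=
  forall (i : I) (j : J), QHom (X i) (Y j).

Definition mcomp (I J K : finType) (X : I -> word) (Y : J -> word)
    (Z : K -> word) (g : mhom Y Z) (f : mhom X Y) : mhom X Z :=
  fun i l => \sum_j (g j l ∘ f i j).

Lemma mhomP (I J : finType) (X : I -> word) (Y : J -> word) (f g : mhom X Y) :
  (forall i j, f i j = g i j) -> f = g.
Proof.
move=> fg; apply: functional_extensionality_dep => i.
exact: functional_extensionality_dep.
Qed.

Lemma mcompA (I J K L : finType) (X : I -> word) (Y : J -> word)
    (Z : K -> word) (W : L -> word)
    (h : mhom Z W) (g : mhom Y Z) (f : mhom X Y) :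
  mcomp h (mcomp g f) = mcomp (mcomp h g) f.
Proof.
apply: mhomP => i l; rewrite /mcomp.
under eq_bigr do rewrite hcomp_sumr.
under [RHS]eq_bigr do rewrite hcomp_suml.
rewrite exchange_big /=; apply: eq_bigr => j _; apply: eq_bigr => j' _.
exact: hcompA.
Qed.

(* (X, e) and (Y, e') are isomorphic in the Karoubi envelope: its morphisms are
   the f with e' f e = f, and e is the identity of (X, e). *)
Definition karoubi_iso (I J : finType) (X : I -> word) (e : mhom X X)
    (Y : J -> word) (e' : mhom Y Y) : Prop :=
  exists (f : mhom X Y) (g : mhom Y X),
    [/\ mcomp e' (mcomp f e) = f, mcomp e (mcomp g e') = g,
        mcomp g f = e & mcomp f g = e'].

Definition midem (I : finType) (X : I -> word) (e : mhom X X) : Prop :=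
  mcomp e e = e.

Section KaroubiIso.
Context (I J K : finType) (X : I -> word) (Y : J -> word) (Z : K -> word).
Context (e : mhom X X) (e' : mhom Y Y) (e'' : mhom Z Z).

Lemma karoubi_iso_refl : midem e -> karoubi_iso e e.
Proof. by move=> ee; exists e, e; rewrite !ee. Qed.

Lemma karoubi_iso_sym : karoubi_iso e e' -> karoubi_iso e' e.
Proof. by case=> f [g [? ? ? ?]]; exists g, f. Qed.

Lemma karoubi_iso_trans : midem e' ->
  karoubi_iso e e' -> karoubi_iso e' e'' -> karoubi_iso e e''.
Proof.
move=> ee [f [g [fE gE gf fg]]] [f' [g' [f'E g'E g'f' f'g']]].
have fe' : mcomp e' f = f by rewrite -fE !mcompA ee.
have g'e' : mcomp e' g' = g' by rewrite -g'E !mcompA ee.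
have f'e' : mcomp f' e' = f' by rewrite -f'E -!mcompA ee.
have ge' : mcomp g e' = g by rewrite -gE -!mcompA ee.
have e''f' : mcomp e'' f' = f' by rewrite -f'g' -mcompA g'f' f'e'.
have fe : mcomp f e = f by rewrite -gf mcompA fg fe'.
have eg : mcomp e g = g by rewrite -gf -mcompA fg ge'.
have g'e'' : mcomp g' e'' = g' by rewrite -f'g' mcompA g'f' g'e'.
exists (mcomp f' f), (mcomp g g'); split.
- by rewrite -[mcomp (mcomp f' f) e]mcompA fe mcompA e''f'.
- by rewrite -[mcomp (mcomp g g') e'']mcompA g'e'' mcompA eg.
- by rewrite mcompA -[mcomp (mcomp g g') f']mcompA g'f' -mcompA fe'.
- by rewrite mcompA -[mcomp (mcomp f' f) g]mcompA fg -mcompA g'e'.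
Qed.

Lemma reindex_iso (h : I -> J) (q : forall i, X i = Y (h i)) :
  bijective h -> midem e' ->
  (forall i i', idto (q i') ∘ e i i' = e' (h i) (h i') ∘ idto (q i)) ->
  karoubi_iso e e'.
Proof.
move=> hbij e'e' ee'.
have e'sum i j : \sum_j' (e' j' j ∘ e' i j') = e' i j.
  by rewrite -[in RHS]e'e'.
have e'sumh i j : \sum_i' (e' (h i') j ∘ e' i (h i')) = e' i j.
  by rewrite -e'sum (reindex h) //; apply: onW_bij.
pose f : mhom X Y := fun i j => e' (h i) j ∘ idto (q i).
pose g : mhom Y X := fun j i => idto (esym (q i)) ∘ e' j (h i).
have e'f : mcomp e' f = f.
  apply: mhomP => i j; rewrite /mcomp /f.
  under eq_bigr do rewrite hcompA.
  by rewrite -hcomp_suml e'sum.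
have ge' : mcomp g e' = g.
  apply: mhomP => j i; rewrite /mcomp /g.
  under eq_bigr do rewrite -hcompA.
  by rewrite -hcomp_sumr e'sum.
have gf : mcomp g f = e.
  apply: mhomP => i i'; rewrite /mcomp /g /f.
  under eq_bigr do rewrite -hcompA [X in _ ∘ X]hcompA.
  by rewrite -hcomp_sumr -hcomp_suml e'sum -ee' hcompA idtoK hidl.
have fg : mcomp f g = e'.
  apply: mhomP => j j'; rewrite /mcomp /g /f.
  under eq_bigr do rewrite hcompA -[X in X ∘ _]hcompA.
  have idtoKV i : idto (q i) ∘ idto (esym (q i)) = hid _.
    by have := idtoK (esym (q i)); rewrite esymK.
  under eq_bigr do rewrite idtoKV hidr.
  exact: e'sumh.
exists f, g; split=> //.
- by rewrite -gf !mcompA e'f fg e'f.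
- by rewrite ge' -gf -mcompA fg ge'.
Qed.

End KaroubiIso.

Definition sumfam (I J : finType) (X : I -> word) (Y : J -> word) :
  I + J -> word := fun s => match s with inl i => X i | inr j => Y j end.

Definition summx (I J I' J' : finType) (X : I -> word) (Y : J -> word)
    (X' : I' -> word) (Y' : J' -> word) (f : mhom X X') (g : mhom Y Y') :
    mhom (sumfam X Y) (sumfam X' Y') :=
  fun s t => match s, t with
    | inl i, inl i' => f i i'
    | inr j, inr j' => g j j'
    | _, _ => 0
    end.

Definition tensfam (I J : finType) (X : I -> word) (Y : J -> word) :
  I * J -> word := fun p => X p.1 ++ Y p.2.

Definition tensmx (I J I' J' : finType) (X : I -> word) (Y : J -> word)
    (X' : I' -> word) (Y' : J' -> word) (f : mhom X X') (g : mhom Y Y') :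
    mhom (tensfam X Y) (tensfam X' Y') :=
  fun p q => f p.1 q.1 ⊗ g p.2 q.2.

Definition relabel (I J : finType) (h : I -> J) (Y : J -> word)
    (e : mhom Y Y) : mhom (Y \o h) (Y \o h) := fun i i' => e (h i) (h i').

Section Functoriality.
Context (I J I' J' I'' J'' : finType).
Context (X : I -> word) (Y : J -> word) (X' : I' -> word) (Y' : J' -> word).
Context (X'' : I'' -> word) (Y'' : J'' -> word).

Lemma summx_comp (f : mhom X X') (g : mhom Y Y') (f' : mhom X' X'')
    (g' : mhom Y' Y'') :
  mcomp (summx f' g') (summx f g) = summx (mcomp f' f) (mcomp g' g).
Proof.
apply: mhomP => -[i|j] [i''|j'']; rewrite /mcomp big_sumType /=.
- by rewrite [X in _ + X]big1 ?addr0 // => j' _; rewrite hcomp0l.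
- by rewrite !big1 ?addr0 // => ? _; rewrite ?hcomp0l ?hcomp0r.
- by rewrite !big1 ?addr0 // => ? _; rewrite ?hcomp0l ?hcomp0r.
- by rewrite [X in X + _]big1 ?add0r // => i' _; rewrite hcomp0l.
Qed.

Lemma tensmx_comp (f : mhom X X') (g : mhom Y Y') (f' : mhom X' X'')
    (g' : mhom Y' Y'') :
  mcomp (tensmx f' g') (tensmx f g) = tensmx (mcomp f' f) (mcomp g' g).
Proof.
apply: mhomP => -[i j] [i'' j'']; rewrite /mcomp /tensmx /=.
rewrite htens_suml.
under [RHS]eq_bigr do rewrite htens_sumr.
rewrite pair_bigA /=; apply: eq_bigr => -[i' j'] _ /=.
exact: hinterchange.
Qed.

End Functoriality.

Lemma relabel_idem (I J : finType) (h : I -> J) (Y : J -> word)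
    (e : mhom Y Y) : bijective h -> midem e -> midem (relabel h e).
Proof.
move=> hbij ee; apply: mhomP => i i'; rewrite /mcomp /relabel -[in RHS]ee.
by rewrite /mcomp (reindex h) //; apply: onW_bij.
Qed.

Lemma relabel_iso (I J : finType) (h : I -> J) (Y : J -> word)
    (e : mhom Y Y) : bijective h -> midem e -> karoubi_iso (relabel h e) e.
Proof.
move=> hbij ee; apply: (reindex_iso (h := h) (q := fun=> erefl)) => // i i'.
by rewrite !idto_id hidl hidr.
Qed.

Section Congruence.
Context (I J I' J' : finType).
Context (X : I -> word) (Y : J -> word) (X' : I' -> word) (Y' : J' -> word).
Context (e : mhom X X) (g : mhom Y Y) (e' : mhom X' X') (g' : mhom Y' Y').

Lemma summx_idem : midem e -> midem g -> midem (summx e g).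
Proof. by move=> ee gg; rewrite /midem summx_comp ee gg. Qed.

Lemma tensmx_idem : midem e -> midem g -> midem (tensmx e g).
Proof. by move=> ee gg; rewrite /midem tensmx_comp ee gg. Qed.

Lemma summx_iso :
  karoubi_iso e e' -> karoubi_iso g g' -> karoubi_iso (summx e g) (summx e' g').
Proof.
case=> [a [b [aE bE ba ab]]] [a' [b' [a'E b'E b'a' a'b']]].
exists (summx a a'), (summx b b').
by rewrite !summx_comp aE bE ba ab a'E b'E b'a' a'b'.
Qed.

Lemma tensmx_iso :
  karoubi_iso e e' -> karoubi_iso g g' ->
  karoubi_iso (tensmx e g) (tensmx e' g').
Proof.
case=> [a [b [aE bE ba ab]]] [a' [b' [a'E b'E b'a' a'b']]].
exists (tensmx a a'), (tensmx b b').
by rewrite !tensmx_comp aE bE ba ab a'E b'E b'a' a'b'.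
Qed.

End Congruence.

End QHom.

Section GrothendieckRing.
Context (k : fieldType) (lam : {fsfun int -> nat with 0%N}).
Local Notation QHom := (QHom k lam).
Local Notation mhom := (@mhom k lam _ _).

(* An object (X_1 + ... + X_n, e) of the Karoubi envelope. *)
Record kobj := KObj {
  krank : nat;
  kword : 'I_krank -> word;
  kidem : mhom kword kword;
  kidemP : midem kidem }.
Arguments kword : clear implicits.
Arguments kidem : clear implicits.

Definition kiso (A B : kobj) : Prop := karoubi_iso (kidem A) (kidem B).

Lemma kiso_refl A : kiso A A.
Proof. exact/karoubi_iso_refl/kidemP. Qed.
Lemma kiso_sym A B : kiso A B -> kiso B A.
Proof. exact: karoubi_iso_sym. Qed.
Lemma kiso_trans A B C : kiso A B -> kiso B C -> kiso A C.
Proof. exact/karoubi_iso_trans/kidemP. Qed.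

Definition kiso_equiv := EquivalenceOn kiso_refl kiso_sym kiso_trans.

Definition wmx (u : word) (e : QHom u u) : mhom (fun _ : 'I_1 => u) (fun _ : 'I_1 => u) :=
  fun _ _ => e.

Definition hidem (u : word) (e : QHom u u) : Prop := hcomp e e = e.

Lemma wmx_idem u (e : QHom u u) : hidem e -> midem (wmx e).
Proof. by move=> ee; apply: mhomP => i j; rewrite /mcomp big_ord1. Qed.

(* (u, e), for a word u and an idempotent e of End(u). *)
Definition kobj_of (u : word) (e : QHom u u) (ee : hidem e) : kobj :=
  KObj (wmx_idem ee).

Definition kone : kobj := kobj_of (hidl (hid k lam [::])).

Lemma ord0_any (T : Type) : 'I_0 -> T.
Proof. by case. Qed.

Lemma mhom0_idem (X : 'I_0 -> word) (e : mhom X X) : midem e.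
Proof. by apply: mhomP => -[]. Qed.

Definition kzero : kobj :=
  KObj (@mhom0_idem (fun=> [::]) (fun _ _ => 0)).

Lemma split_bij m n : bijective (@split m n).
Proof. exact: (Bijective (@splitK m n) (@unsplitK m n)). Qed.

Definition ksum (A B : kobj) : kobj :=
  KObj (relabel_idem (@split_bij (krank A) (krank B))
          (summx_idem (kidemP A) (kidemP B))).

Definition ord_pair m n (i : 'I_(m * n)) : 'I_m * 'I_n :=
  enum_val (cast_ord (esym (mxvec_cast m n)) i).

Lemma ord_pair_bij m n : bijective (@ord_pair m n).
Proof.
apply: bij_comp; first exact: enum_val_bij.
exact: (Bijective (cast_ordK _) (cast_ordKV _)).
Qed.

Definition ktens (A B : kobj) : kobj :=
  KObj (relabel_idem (@ord_pair_bij (krank A) (krank B))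
          (tensmx_idem (kidemP A) (kidemP B))).

Lemma ksumE A B : karoubi_iso (kidem (ksum A B)) (summx (kidem A) (kidem B)).
Proof. exact/relabel_iso/summx_idem/kidemP/kidemP/split_bij. Qed.

Lemma ktensE A B : karoubi_iso (kidem (ktens A B)) (tensmx (kidem A) (kidem B)).
Proof. exact/relabel_iso/tensmx_idem/kidemP/kidemP/ord_pair_bij. Qed.

Hint Resolve kidemP summx_idem tensmx_idem : core.

(* Reduces an isomorphism between iterated sums and tensor products of objects
   to one between the families indexed by the corresponding finite types. *)
Lemma kiso_via (I J : finType) (X : I -> word) (Y : J -> word)
    (e : mhom X X) (e' : mhom Y Y) (A B : kobj) :
  midem e -> midem e' -> karoubi_iso (kidem A) e -> karoubi_iso (kidem B) e' ->
  karoubi_iso e e' -> kiso A B.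
Proof.
move=> ie ie' Ae Be ee'.
apply: karoubi_iso_trans ie Ae _; apply: karoubi_iso_trans ie' ee' _.
exact: karoubi_iso_sym.
Qed.

Lemma krefl A : karoubi_iso (kidem A) (kidem A).
Proof. exact: kiso_refl. Qed.
Hint Resolve krefl : core.

Lemma ksum_via (I J : finType) (X : I -> word) (Y : J -> word)
    (e : mhom X X) (e' : mhom Y Y) A B :
  karoubi_iso (kidem A) e -> karoubi_iso (kidem B) e' ->
  karoubi_iso (kidem (ksum A B)) (summx e e').
Proof.
by move=> Ae Be; apply: karoubi_iso_trans (ksumE A B) (summx_iso Ae Be); auto.
Qed.

Lemma ktens_via (I J : finType) (X : I -> word) (Y : J -> word)
    (e : mhom X X) (e' : mhom Y Y) A B :
  karoubi_iso (kidem A) e -> karoubi_iso (kidem B) e' ->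
  karoubi_iso (kidem (ktens A B)) (tensmx e e').
Proof.
by move=> Ae Be; apply: karoubi_iso_trans (ktensE A B) (tensmx_iso Ae Be); auto.
Qed.

Lemma ksum_iso A A' B B' :
  kiso A A' -> kiso B B' -> kiso (ksum A B) (ksum A' B').
Proof.
move=> AA' BB'; apply: kiso_via (ksum_via AA' BB') (ksumE _ _) _; auto.
by apply: karoubi_iso_refl; auto.
Qed.

Lemma ktens_iso A A' B B' :
  kiso A A' -> kiso B B' -> kiso (ktens A B) (ktens A' B').
Proof.
move=> AA' BB'; apply: kiso_via (ktens_via AA' BB') (ktensE _ _) _; auto.
by apply: karoubi_iso_refl; auto.
Qed.

Lemma ksumA A B C : kiso (ksum A (ksum B C)) (ksum (ksum A B) C).
Proof.
apply: kiso_via (ksum_via (krefl A) (ksumE B C))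
  (ksum_via (ksumE A B) (krefl C)) _; auto.
pose h (s : 'I_(krank A) + ('I_(krank B) + 'I_(krank C))) :=
  match s with
  | inl i => inl (inl i) | inr (inl i) => inl (inr i) | inr (inr i) => inr i
  end.
pose h' (s : 'I_(krank A) + 'I_(krank B) + 'I_(krank C)) :=
  match s with
  | inl (inl i) => inl i | inl (inr i) => inr (inl i) | inr i => inr (inr i)
  end.
have q s : sumfam (kword A) (sumfam (kword B) (kword C)) s
    = sumfam (sumfam (kword A) (kword B)) (kword C) (h s).
  by case: s => [|[]].
apply: (reindex_iso (h := h) (q := q)); auto.
  by exists h' => [[|[]]|[[]|]].
by case=> [i|[i|i]] [i'|[i'|i']] /=;
  rewrite !idto_id hidl hidr.
Qed.

Lemma ksumC A B : kiso (ksum A B) (ksum B A).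
Proof.
apply: kiso_via (ksumE A B) (ksumE B A) _; auto.
pose h I J (s : I + J) : J + I :=
  match s with inl i => inr i | inr j => inl j end.
have q s : sumfam (kword A) (kword B) s
    = sumfam (kword B) (kword A) (h _ _ s) by case: s.
apply: (reindex_iso (h := @h _ _) (q := q)); auto.
  by exists (@h _ _) => [[]|[]].
by case=> i [] i' /=; rewrite !idto_id hidl hidr.
Qed.

Lemma ksum0 A : kiso (ksum kzero A) A.
Proof.
apply: kiso_via (ksumE _ _) (krefl A) _; auto; apply: karoubi_iso_sym.
apply: (reindex_iso (h := inr) (q := fun=> erefl)); auto.
  by exists (fun s : 'I_0 + _ => match s with inr i => i | inl i =>
    ord0_any _ i end) => [|[[]|]].
by move=> i i'; rewrite !idto_id hidl hidr.
Qed.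

Lemma ktensA A B C : kiso (ktens A (ktens B C)) (ktens (ktens A B) C).
Proof.
apply: kiso_via (ktens_via (krefl A) (ktensE B C))
  (ktens_via (ktensE A B) (krefl C)) _; auto.
pose h (p : 'I_(krank A) * ('I_(krank B) * 'I_(krank C))) :=
  (p.1, p.2.1, p.2.2).
apply: (reindex_iso (h := h) (q := fun=> catA _ _ _)); auto.
  by exists (fun p => (p.1.1, (p.1.2, p.2))) => [[? []]|[[]]].
by move=> p p'; apply: htensA.
Qed.

Lemma ktens1l A : kiso (ktens kone A) A.
Proof.
apply: kiso_via (ktensE _ _) (krefl A) _; auto.
apply: (reindex_iso (h := snd) (q := fun=> erefl)); auto.
  exists (pair ord0) => [[i j]|//]; by rewrite (ord1 i).
by move=> p p'; rewrite !idto_id hidl hidr; apply: hunitl.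
Qed.

Lemma ktens1r A : kiso (ktens A kone) A.
Proof.
apply: kiso_via (ktensE _ _) (krefl A) _; auto.
apply: (reindex_iso (h := fst) (q := fun=> cats0 _)); auto.
  exists (pair^~ ord0) => [[i j]|//]; by rewrite (ord1 j).
by move=> p p'; apply: hunitr.
Qed.

Lemma ktens0l A : kiso (ktens kzero A) kzero.
Proof.
apply: kiso_via (ktensE _ _) (krefl _) _; auto.
apply: (reindex_iso (h := fst) (e' := kidem kzero) (q := fun p => ord0_any _ p.1));
  [|exact: (kidemP kzero)|].
  by exists (fun i : 'I_0 => ord0_any _ i) => [[[]]|[]].
by case=> -[].
Qed.

Lemma ktens0r A : kiso (ktens A kzero) kzero.
Proof.
apply: kiso_via (ktensE _ _) (krefl _) _; auto.
apply: (reindex_iso (h := snd) (e' := kidem kzero) (q := fun p => ord0_any _ p.2));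
  [|exact: (kidemP kzero)|].
  by exists (fun i : 'I_0 => ord0_any _ i) => [[? []]|[]].
by case=> ? -[].
Qed.

Lemma ktensDl A B C :
  kiso (ktens (ksum A B) C) (ksum (ktens A C) (ktens B C)).
Proof.
apply: kiso_via (ktens_via (ksumE A B) (krefl C))
  (ksum_via (ktensE A C) (ktensE B C)) _; auto.
pose h (p : ('I_(krank A) + 'I_(krank B)) * 'I_(krank C)) :=
  match p with (inl i, j) => inl (i, j) | (inr i, j) => inr (i, j) end.
pose h' (p : 'I_(krank A) * 'I_(krank C) + 'I_(krank B) * 'I_(krank C)) :=
  match p with inl (i, j) => (inl i, j) | inr (i, j) => (inr i, j) end.
have q p : tensfam (sumfam (kword A) (kword B)) (kword C) p
   = sumfam (tensfam (kword A) (kword C)) (tensfam (kword B) (kword C)) (h p).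
  by case: p => -[].
apply: (reindex_iso (h := h) (q := q)); auto.
  by exists h' => [[[]]|[[]|[]]].
by case=> -[] i j [[] i' j']; rewrite !idto_id hidl hidr // /tensmx /= htens0l.
Qed.

Lemma ktensDr A B C :
  kiso (ktens A (ksum B C)) (ksum (ktens A B) (ktens A C)).
Proof.
apply: kiso_via (ktens_via (krefl A) (ksumE B C))
  (ksum_via (ktensE A B) (ktensE A C)) _; auto.
pose h (p : 'I_(krank A) * ('I_(krank B) + 'I_(krank C))) :=
  match p with (i, inl j) => inl (i, j) | (i, inr j) => inr (i, j) end.
pose h' (p : 'I_(krank A) * 'I_(krank B) + 'I_(krank A) * 'I_(krank C)) :=
  match p with inl (i, j) => (i, inl j) | inr (i, j) => (i, inr j) end.
have q p : tensfam (kword A) (sumfam (kword B) (kword C)) p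
   = sumfam (tensfam (kword A) (kword B)) (tensfam (kword A) (kword C)) (h p).
  by case: p => ? [].
apply: (reindex_iso (h := h) (q := q)); auto.
  by exists h' => [[? []]|[[]|[]]].
by case=> i [] j [i' [] j']; rewrite !idto_id hidl hidr // /tensmx /= htens0r.
Qed.

Definition kclass : Type := quot kiso_equiv.
HB.instance Definition _ := Choice.on kclass.

Definition kc_zero : kclass := cl kzero.
Definition kc_one : kclass := cl kone.
Definition kc_add (a b : kclass) : kclass := cl (ksum (rep a) (rep b)).
Definition kc_mul (a b : kclass) : kclass := cl (ktens (rep a) (rep b)).

Lemma kc_addE A B : kc_add (cl A) (cl B) = cl (ksum A B).
Proof. by apply/clP; apply: ksum_iso; apply: (eqv_rep kiso_equiv). Qed.
Lemma kc_mulE A B : kc_mul (cl A) (cl B) = cl (ktens A B).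
Proof. by apply/clP; apply: ktens_iso; apply: (eqv_rep kiso_equiv). Qed.

Lemma kc_addA : associative kc_add.
Proof.
elim/quotW=> A; elim/quotW=> B; elim/quotW=> C.
by rewrite (kc_addE B) (kc_addE A B) !kc_addE; apply/clP/ksumA.
Qed.
Lemma kc_addC : commutative kc_add.
Proof.
by elim/quotW=> A; elim/quotW=> B; rewrite !kc_addE; apply/clP/ksumC.
Qed.
Lemma kc_add0 : left_id kc_zero kc_add.
Proof. by elim/quotW=> A; rewrite kc_addE; apply/clP/ksum0. Qed.
Lemma kc_mulA : associative kc_mul.
Proof.
elim/quotW=> A; elim/quotW=> B; elim/quotW=> C.
by rewrite (kc_mulE B) (kc_mulE A B) !kc_mulE; apply/clP/ktensA.
Qed.
Lemma kc_mul1l : left_id kc_one kc_mul.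
Proof. by elim/quotW=> A; rewrite kc_mulE; apply/clP/ktens1l. Qed.
Lemma kc_mul1r : right_id kc_one kc_mul.
Proof. by elim/quotW=> A; rewrite kc_mulE; apply/clP/ktens1r. Qed.
Lemma kc_mulDl : left_distributive kc_mul kc_add.
Proof.
elim/quotW=> A; elim/quotW=> B; elim/quotW=> C.
by rewrite (kc_addE A B) (kc_mulE A) (kc_mulE B) kc_mulE kc_addE;
  apply/clP/ktensDl.
Qed.
Lemma kc_mulDr : right_distributive kc_mul kc_add.
Proof.
elim/quotW=> A; elim/quotW=> B; elim/quotW=> C.
by rewrite (kc_addE B C) (kc_mulE A B) (kc_mulE A C) kc_mulE kc_addE;
  apply/clP/ktensDr.
Qed.
Lemma kc_mul0l : left_zero kc_zero kc_mul.
Proof. by elim/quotW=> A; rewrite kc_mulE; apply/clP/ktens0l. Qed.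
Lemma kc_mul0r : right_zero kc_zero kc_mul.
Proof. by elim/quotW=> A; rewrite kc_mulE; apply/clP/ktens0r. Qed.

HB.instance Definition _ := GRing.isPzSemiRing.Build kclass
  kc_addA kc_addC kc_add0 kc_mulA kc_mul1l kc_mul1r kc_mulDl kc_mulDr
  kc_mul0l kc_mul0r.

Definition K0 : Type := groth kclass.
HB.instance Definition _ := GRing.PzRing.on K0.

Definition K0cl (A : kobj) : K0 := cl ((cl A : kclass), 0 : kclass).

End GrothendieckRing.

(* Partitions are weakly decreasing sequences of positive integers. *)
Definition is_part (mu : seq nat) : bool := sorted geq mu && (0%N \notin mu).

(* The cells of mu in row-reading order; the row-reading tableau of shape mu
   puts i : 'I_(sumn mu) in the cell (cell_row mu i, cell_col mu i). *)
Definition cells (mu : seq nat) : seq (nat * nat) :=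
  [seq (i, j) | i <- iota 0 (size mu), j <- iota 0 (nth 0%N mu i)].
Definition cell_row (mu : seq nat) (i : nat) : nat := (nth (0, 0)%N (cells mu) i).1.
Definition cell_col (mu : seq nat) (i : nat) : nat := (nth (0, 0)%N (cells mu) i).2.

Section GroupAlgebra.
Context (k : fieldType).

(* The group algebra of S_n. Permutations act on the left, so that the product
   of u and w is u o w, which MathComp writes w * u; hence the argument of b. *)
Definition galg (n : nat) : Type := {ffun 'S_n -> k}.
HB.instance Definition _ n := GRing.Zmodule.on (galg n).

Definition gmul n (a b : galg n) : galg n :=
  [ffun w => \sum_(u : 'S_n) a u * b (w * u^-1)%g].

Definition gideal n (e x : galg n) : Prop := exists a, x = gmul a e.

Definition gideal_iso n (e c : galg n) : Prop :=
  exists f : galg n -> galg n,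
    [/\ forall x, gideal e x -> gideal c (f x),
        forall x y, gideal e x -> gideal e y -> f (x + y) = f x + f y,
        forall a x, gideal e x -> f (gmul a x) = gmul a (f x),
        forall x y, gideal e x -> gideal e y -> f x = f y -> x = y
      & forall y, gideal c y -> exists2 x, gideal e x & f x = y].

Definition primitive_idem n (e : galg n) : Prop :=
  [/\ gmul e e = e, e <> 0 &
      forall a b : galg n, gmul a a = a -> gmul b b = b ->
        gmul a b = 0 -> gmul b a = 0 -> e = a + b -> a = 0 \/ b = 0].

(* For the row-reading tableau t of shape mu, the polytabloid of t in the
   permutation module k S_n rho_t on tabloids: kappa_t rho_t, with rho_t the sum
   over the row stabilizer and kappa_t the signed sum over the column
   stabilizer. It generates the Specht module. *)
Definition row_sum (mu : seq nat) : galg (sumn mu) :=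
  [ffun w : 'S_(sumn mu) => [forall i, cell_row mu (w i) == cell_row mu i]%:R].
Definition col_sum (mu : seq nat) : galg (sumn mu) :=
  [ffun w : 'S_(sumn mu) =>
     [forall i, cell_col mu (w i) == cell_col mu i]%:R * (-1) ^+ w].
Definition polytabloid (mu : seq nat) : galg (sumn mu) :=
  gmul (col_sum mu) (row_sum mu).

Definition specht_idem (mu : seq nat) (e : galg (sumn mu)) : Prop :=
  primitive_idem e /\ gideal_iso e (polytabloid mu).

Definition sym_idem (n : nat) : galg n := [ffun=> (n`!%:R)^-1].

End GroupAlgebra.

Section Schur.

Definition complete_poly (N r : nat) : {mpoly int[N]} :=
  \sum_(t : r.-tuple 'I_N | sorted leq (map val t)) \prod_(i <- t) 'X_i.

Definition semistandard (mu : seq nat) (N : nat)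
    (T : {ffun 'I_(sumn mu) -> 'I_N}) : bool :=
  [forall i : 'I_(sumn mu), forall j : 'I_(sumn mu),
     ((cell_row mu i == cell_row mu j) && (cell_col mu i <= cell_col mu j) ==> (T i <= T j)) &&
     ((cell_col mu i == cell_col mu j) && (cell_row mu i < cell_row mu j) ==> (T i < T j))]%N.

Definition schur_poly (mu : seq nat) (N : nat) : {mpoly int[N]} :=
  \sum_(T : {ffun 'I_(sumn mu) -> 'I_N} | semistandard T) \prod_i 'X_(T i).

(* P expresses s_mu as a polynomial in the complete symmetric functions; an
   identity of symmetric functions is one in any number N of variables. *)
Definition schur_expr (mu : seq nat) (P : rterm nat) : Prop :=
  forall N, reval (complete_poly N) P = schur_poly mu N.

(* s_mu^+ or s_mu^-: the image of s_mu under the map from symmetric functions to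
   the Heisenberg algebra sending the complete symmetric functions to h_n^+ or
   h_n^-. Such an element exists and is unique; the default 0 is irrelevant. *)
Definition schur (d : nat) (b : bool) (mu : seq nat) : heis d :=
  xget 0 [set z | exists2 P, schur_expr mu P & z = reval (hgen d b) P].

End Schur.

Section Strands.
Context (k : fieldType) (lam : {fsfun int -> nat with 0%N}).
Local Notation QHom := (QHom k lam).
Local Notation hid := (hid k lam).
Local Notation idto := (idto k lam).
Local Notation "f ∘ g" := (hcomp f g) (at level 40, left associativity).
Local Notation "f ⊗ g" := (htens f g) (at level 35, right associativity).

Local Notation Qp n := (nseq n true).
Local Notation Qm n := (nseq n false).

Lemma nseq_cross a b n : n = (a + b.+2)%N ->
  nseq a true ++ [:: true; true] ++ nseq b true = nseq n true.
Proof. by move=> ->; rewrite nseqD. Qed.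

Lemma nseq_catSr (c : bool) n (w : word) :
  nseq n c ++ c :: w = nseq n.+1 c ++ w.
Proof. by elim: n => //= n ->. Qed.

Lemma nseq_cup n :
  Qm n ++ [:: false; true] ++ Qp n = Qm n.+1 ++ Qp n.+1.
Proof. exact: nseq_catSr. Qed.

Lemma nseq_cap n :
  Qp n.+1 ++ Qm n.+1 = Qp n ++ [:: true; false] ++ Qm n.
Proof. exact/esym/(nseq_catSr true). Qed.

(* The crossing of the strands i and i + 1 (counted from 0, from right to
   left) among n. *)
Lemma cross_at_subproof n (i j : 'I_n) : j = i.+1 :> nat ->
  nseq (n - i.+2) true ++ [:: true; true] ++ nseq i true = nseq n true.
Proof.
by move=> ji; apply: nseq_cross; rewrite subnK // -ji.
Qed.

Definition cross_at n (i j : 'I_n) (ji : j = i.+1 :> nat) :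
  QHom (Qp n) (Qp n) :=
  idto (cross_at_subproof ji)
    ∘ (hid (Qp (n - i.+2)) ⊗ (cl DCross : QHom _ _) ⊗ hid (Qp i))
    ∘ idto (esym (cross_at_subproof ji)).

(* The action of S_n on Q_+^n; it is determined by the images of the simple
   transpositions. *)
Definition strand_action n (p : 'S_n -> QHom (Qp n) (Qp n)) : Prop :=
  [/\ p 1%g = hid (Qp n),
      forall u w : 'S_n, p (w * u)%g = p u ∘ p w
    & forall (i j : 'I_n) (ji : j = i.+1 :> nat), p (tperm i j) = cross_at ji].

Definition galg_map n (p : 'S_n -> QHom (Qp n) (Qp n)) (a : galg k n) :
  QHom (Qp n) (Qp n) := \sum_(w : 'S_n) a w *: p w.

Fixpoint cups n : QHom [::] (Qm n ++ Qp n) :=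
  if n is n'.+1 then
    idto (nseq_cup n')
      ∘ (hid (Qm n') ⊗ (cl DRCup : QHom _ _) ⊗ hid (Qp n')) ∘ cups n'
  else hid [::].

Fixpoint caps n : QHom (Qp n ++ Qm n) [::] :=
  if n is n'.+1 then
    caps n' ∘ (hid (Qp n') ⊗ (cl DRCap : QHom _ _) ⊗ hid (Qm n'))
      ∘ idto (nseq_cap n')
  else hid [::].

(* The right mate of f, that is, its rotation by 180 degrees. *)
Definition rotate n (f : QHom (Qp n) (Qp n)) : QHom (Qm n) (Qm n) :=
  idto (cats0 (Qm n)) ∘ (hid (Qm n) ⊗ caps n) ∘ (hid (Qm n) ⊗ f ⊗ hid (Qm n))
    ∘ idto (esym (catA (Qm n) (Qp n) (Qm n))) ∘ (cups n ⊗ hid (Qm n)).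

(* The endomorphism of Q_+^n or Q_-^n given by an element of k S_n. *)
Definition Qendo n (p : 'S_n -> QHom (Qp n) (Qp n)) (b : bool) (e : galg k n) :
  QHom (nseq n b) (nseq n b) :=
  match b with
  | true => galg_map p e
  | false => rotate (galg_map p e)
  end.

End Strands.

(* Main.v *)
(* In K_0 the minus and plus generators satisfy the Heisenberg relation because Q_-^n Q_+^m decomposes: by adjunction, maps
   out of Q_+^n into Q_+^m Q_- R split, using the local relations, into those where some strands end on Q_+^m, dotted by
   powers x^j with j < d, and those which pass to Q_-; symmetrizing leaves C(d+r-1, r) sorted families of r dots.

   For Schur functions, an additive function on the idempotents of k S_n is determined by the bilinear form
   rank (e kS_n f). The Jacobi-Trudi determinant is a signed sum of Young idempotents; the number of semistandard tableaux
   shows that it has norm one and pairs positively with a primitive idempotent of the Specht module, so it represents that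
   idempotent. The same form shows that a relation between complete symmetric functions holds between the [Q^(n)].

   Injectivity: commuting with power sums differentiates with respect to the generators, so a nonzero kernel would contain a
   nonzero integer. But 1 has infinite order in K_0: the strands act on a Fock space of particle configurations (a form of
   the level d Fock space over k, with the weights given by partial fractions), and the trace on the paths starting at a
   configuration with d addable and no removable particle is an additive invariant with value 1 at the unit object. *)
Require Import Defs.
Set Warnings "-notation-overridden,-ambiguous-paths,-notation-incompatible-prefix".
From HB Require Import structures.
From mathcomp Require Import mpoly.
From mathcomp Require Import all_boot all_fingroup all_algebra finmap.
From mathcomp Require Import ring zify.
From mathcomp Require Import boolp.

Set Implicit Arguments.
Unset Strict Implicit.
Unset Printing Implicit Defensive.

Import GRing.Theory.

(** The Fock space can be chosen freely because the relations see little of a configuration. With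
    addable sites a and removable sites r, let w_a be the residue at a of prod (u - r) / prod (u -
    a); the bubble gamma_j acts by the sum of w_a a^j, and the relations only prescribe the first
    coefficients of the expansion u^-d + (sum i lambda_i) u^(-d-1) + ... at infinity. Any starting
    configuration with these coefficients will do, so the d tops are spread over distinct classes
    modulo 1. The other relations become sums of residues, that is, Lagrange interpolation.

    Uniqueness in the decomposition of Q_-^n Q_+^m rests on triangularity. Moving a dot through a
    crossing costs one dot, so the total number of dots is a filtration; the leading coefficients
    produced by the symmetrizer are nonnegative rationals, hence cannot cancel.

    In the injectivity argument, differentiating creates integer factors, and the image lives in a
    group completion that could have torsion. The induction therefore treats all elements whose
    image is torsion, a condition that survives division by such factors. *)

(** * Calculus of morphisms in the diagram category *)

Module MonoidalCalculus.

Local Open Scope ring_scope.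

Declare Scope hom_scope.
Notation "f ∘ g" := (hcomp f g) (at level 40, left associativity) : hom_scope.
Notation "f ⊗ g" := (htens f g) (at level 35, right associativity) : hom_scope.
Local Open Scope hom_scope.

Fact hom_key : unit. Proof. exact: tt. Qed.

Section Cat.
Context (k : fieldType) (lam : {fsfun int -> nat with 0%N}).
Local Notation QHom := (QHom k lam).
Local Notation hid := (hid k lam).
Local Notation idto := (idto k lam).
Implicit Types u v w R : word.

Lemma hcompZl u v w a (f : QHom v w) (g : QHom u v) : (a *: f) ∘ g = a *: (f ∘ g).
Proof.
elim/quotW: f => f; elim/quotW: g => g.
by rewrite hzmulE !hcompE hzmulE; apply/clP/deq_compZl.
Qed.
Lemma hcompZr u v w a (f : QHom v w) (g : QHom u v) : f ∘ (a *: g) = a *: (f ∘ g).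
Proof.
elim/quotW: f => f; elim/quotW: g => g.
by rewrite hzmulE !hcompE hzmulE; apply/clP/deq_compZr.
Qed.
Lemma htensZl u v u' v' a (f : QHom u v) (g : QHom u' v') :
  (a *: f) ⊗ g = a *: (f ⊗ g).
Proof.
elim/quotW: f => f; elim/quotW: g => g.
by rewrite hzmulE !htensE hzmulE; apply/clP/deq_tensZl.
Qed.
Lemma htensZr u v u' v' a (f : QHom u v) (g : QHom u' v') :
  f ⊗ (a *: g) = a *: (f ⊗ g).
Proof.
elim/quotW: f => f; elim/quotW: g => g.
by rewrite hzmulE !htensE hzmulE; apply/clP/deq_tensZr.
Qed.
Lemma hcompNl u v w (f : QHom v w) (g : QHom u v) : (- f) ∘ g = - (f ∘ g).
Proof. by rewrite -scaleN1r hcompZl scaleN1r. Qed.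
Lemma hcompNr u v w (f : QHom v w) (g : QHom u v) : f ∘ (- g) = - (f ∘ g).
Proof. by rewrite -scaleN1r hcompZr scaleN1r. Qed.
Lemma hcompBl u v w (f f' : QHom v w) (g : QHom u v) : (f - f') ∘ g = f ∘ g - f' ∘ g.
Proof. by rewrite hcompDl hcompNl. Qed.
Lemma hcompBr u v w (f : QHom v w) (g g' : QHom u v) : f ∘ (g - g') = f ∘ g - f ∘ g'.
Proof. by rewrite hcompDr hcompNr. Qed.
Lemma hcomp_bigl (I : Type) (r : seq I) (P : pred I) u v w (F : I -> QHom v w) (g : QHom u v) :
  (\sum_(i <- r | P i) F i) ∘ g = \sum_(i <- r | P i) (F i ∘ g).
Proof. by apply: (big_morph (fun f => f ∘ g)) => [f f'|]; rewrite ?hcompDl ?hcomp0l. Qed.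
Lemma hcomp_bigr (I : Type) (r : seq I) (P : pred I) u v w (f : QHom v w) (G : I -> QHom u v) :
  f ∘ (\sum_(i <- r | P i) G i) = \sum_(i <- r | P i) (f ∘ G i).
Proof. by apply: (big_morph (fun g => f ∘ g)) => [g g'|]; rewrite ?hcompDr ?hcomp0r. Qed.
Lemma htens_bigl (I : Type) (r : seq I) (P : pred I) u v u' v' (F : I -> QHom u v) (g : QHom u' v') :
  (\sum_(i <- r | P i) F i) ⊗ g = \sum_(i <- r | P i) (F i ⊗ g).
Proof. by apply: (big_morph (fun f => f ⊗ g)) => [f f'|]; rewrite ?htensDl ?htens0l. Qed.
Lemma htens_bigr (I : Type) (r : seq I) (P : pred I) u v u' v' (f : QHom u v) (G : I -> QHom u' v') :
  f ⊗ (\sum_(i <- r | P i) G i) = \sum_(i <- r | P i) (f ⊗ G i).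
Proof. by apply: (big_morph (fun g => f ⊗ g)) => [g g'|]; rewrite ?htensDr ?htens0r. Qed.

Lemma cl_bigadd (I : Type) (r : seq I) (P : pred I) u v (F : I -> diagram k u v) :
  cl (\big[@DAdd k u v/DZero]_(i <- r | P i) F i)
  = \sum_(i <- r | P i) (cl (F i) : QHom u v).
Proof. by apply: (big_morph cl) => [f g|] //; rewrite hplusE. Qed.

(* Equality of morphisms between words that are only propositionally equal. *)
Definition heq u v u' v' (f : QHom u v) (g : QHom u' v') : Prop :=
  exists (p : u = u') (q : v = v'), idto q ∘ f = g ∘ idto p.

Lemma heq_eq u v (f g : QHom u v) : heq f g -> f = g.
Proof. by case=> p [q]; rewrite !idto_id hidl hidr. Qed.
Lemma eq_heq u v (f g : QHom u v) : f = g -> heq f g.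
Proof. by move=> ->; exists erefl, erefl; rewrite !idto_id hidl hidr. Qed.
Lemma heq_refl u v (f : QHom u v) : heq f f. Proof. exact: eq_heq. Qed.
Lemma heq_sym u v u' v' (f : QHom u v) (g : QHom u' v') : heq f g -> heq g f.
Proof.
by case=> p [q]; case: _ / p g; case: _ / q => g; rewrite !idto_id hidl hidr => ->; apply: heq_refl.
Qed.
Lemma heq_trans u v u' v' u'' v'' (f : QHom u v) (g : QHom u' v') (h : QHom u'' v'') :
  heq f g -> heq g h -> heq f h.
Proof.
by case=> p [q]; case: _ / p g; case: _ / q => g; rewrite !idto_id hidl hidr => ->.
Qed.
Lemma heq_comp u v w u' v' w' (f : QHom v w) (g : QHom u v) (f' : QHom v' w') (g' : QHom u' v') :
  heq f f' -> heq g g' -> heq (f ∘ g) (f' ∘ g').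
Proof.
case=> p [q E] [p' [q' E']]; move: E E'.
rewrite (eq_irrelevance q' p); case: _ / p f' g' {q'}; case: _ / q; case: _ / p' => f' g'.
by rewrite !idto_id !hidl !hidr => -> ->; apply: heq_refl.
Qed.
Lemma heq_tens u v u' v' a b a' b' (f : QHom u v) (g : QHom a b) (f' : QHom u' v') (g' : QHom a' b') :
  heq f f' -> heq g g' -> heq (f ⊗ g) (f' ⊗ g').
Proof.
case=> p [q E] [p' [q' E']]; move: E E'.
case: _ / p f'; case: _ / q; case: _ / p' g'; case: _ / q' => g' f'.
by rewrite !idto_id !hidl !hidr => -> ->; apply: heq_refl.
Qed.
Lemma heq_hid u v : u = v -> heq (hid u) (hid v).
Proof. by move=> ->; apply: heq_refl. Qed.
Lemma heq_idto u v (p : u = v) : heq (idto p) (hid u).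
Proof. by case: _ / p; rewrite idto_id; apply: heq_refl. Qed.
Lemma heq_idtol u v w (p : v = w) (f : QHom u v) : heq (idto p ∘ f) f.
Proof. by case: _ / p; rewrite idto_id hidl; apply: heq_refl. Qed.
Lemma heq_idtor u v w (p : u = v) (f : QHom v w) : heq (f ∘ idto p) f.
Proof. by case: _ / p f => f; rewrite idto_id hidr; apply: heq_refl. Qed.
Lemma heqA u v u' v' u'' v'' (f : QHom u v) (g : QHom u' v') (h : QHom u'' v'') :
  heq (f ⊗ (g ⊗ h)) ((f ⊗ g) ⊗ h).
Proof. by exists (catA _ _ _), (catA _ _ _); apply: htensA. Qed.
Lemma heq_unitr u v (f : QHom u v) : heq (f ⊗ hid [::]) f.
Proof. by exists (cats0 _), (cats0 _); apply: hunitr. Qed.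
Lemma heq_scale u v u' v' a (f : QHom u v) (g : QHom u' v') :
  heq f g -> heq (a *: f) (a *: g).
Proof.
by case=> p [q]; case: _ / p g; case: _ / q => g; rewrite !idto_id hidl hidr => ->; apply: heq_refl.
Qed.
Lemma heq_sum (I : Type) (r : seq I) u v u' v' (F : I -> QHom u v) (G : I -> QHom u' v') :
  u = u' -> v = v' -> (forall i, heq (F i) (G i)) ->
  heq (\sum_(i <- r) F i) (\sum_(i <- r) G i).
Proof.
move=> p q; case: _ / p G; case: _ / q => G FG; apply: eq_heq.
by apply: eq_bigr => i _; apply: heq_eq.
Qed.

(** Adding strands one at a time on the left keeps source and target as literal [cons] words, so
    that iterated whiskerings compose without transport along word equalities. *)
Definition wh (b : bool) u v (f : QHom u v) : QHom (b :: u) (b :: v) := hid [:: b] ⊗ f.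

Lemma wh_comp b u v w (f : QHom v w) (g : QHom u v) : wh b (f ∘ g) = wh b f ∘ wh b g.
Proof. by have := hinterchange (hid [:: b]) (hid [:: b]) f g; rewrite hidl => /esym. Qed.
Lemma wh_id b u : wh b (hid u) = hid (b :: u).
Proof. exact: (htens_id k lam [:: b] u). Qed.
Lemma whD b u v (f g : QHom u v) : wh b (f + g) = wh b f + wh b g.
Proof. exact: (htensDr (hid [:: b]) f g). Qed.
Lemma whZ b u v a (f : QHom u v) : wh b (a *: f) = a *: wh b f.
Proof. exact: (htensZr a (hid [:: b]) f). Qed.
Lemma wh0 b u v : wh b (0 : QHom u v) = 0.
Proof. exact: (htens0r _ _ (hid [:: b])). Qed.
Lemma wh_sum (I : Type) (r : seq I) (P : pred I) b u v (F : I -> QHom u v) :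
  wh b (\sum_(i <- r | P i) F i) = \sum_(i <- r | P i) wh b (F i).
Proof. exact: (htens_bigr _ _ (hid [:: b])). Qed.

Lemma hid_cons b w u v (f : QHom u v) : hid (b :: w) ⊗ f = wh b (hid w ⊗ f).
Proof.
rewrite -[hid (b :: w)]/(hid ([:: b] ++ w)) -htens_id.
exact/esym/heq_eq/(heqA (hid [:: b])).
Qed.

Lemma wh_tens b u v u' v' (f : QHom u v) (g : QHom u' v') : wh b f ⊗ g = wh b (f ⊗ g).
Proof. exact/esym/heq_eq/(heqA (hid [:: b])). Qed.

Lemma tens_hid u v R R' (f : QHom u v) : heq ((f ⊗ hid R) ⊗ hid R') (f ⊗ hid (R ++ R')).
Proof. by rewrite -htens_id; apply: heq_sym; apply: heqA. Qed.

Lemma tens_natural u v R R' (g : QHom u v) (f : QHom R R') :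
  (g ⊗ hid R') ∘ (hid u ⊗ f) = (hid v ⊗ f) ∘ (g ⊗ hid R).
Proof. by rewrite !hinterchange !hidl !hidr. Qed.

Local Notation Dot := (cl DDot : QHom [:: true] [:: true]).
Local Notation Cross := (cl DCross : QHom [:: true; true] [:: true; true]).
Local Notation RCup := (cl DRCup : QHom [::] [:: false; true]).
Local Notation RCap := (cl DRCap : QHom [:: true; false] [::]).
Local Notation LCup := (cl DLCup : QHom [::] [:: true; false]).
Local Notation LCap := (cl DLCap : QHom [:: false; true] [::]).

(** Generators act at the left end of a word, with an arbitrary rest [R] to their right. Together
    with [wh] this reaches every position, and the interchange law becomes the naturality lemmas
    below. *)
Definition gX R : QHom (true :: R) (true :: R) := Dot ⊗ hid R.
Definition gS R : QHom (true :: true :: R) (true :: true :: R) := Cross ⊗ hid R.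
Definition gU R : QHom R (false :: true :: R) := RCup ⊗ hid R.
Definition gC R : QHom (true :: false :: R) R := RCap ⊗ hid R.
Definition gU' R : QHom R (true :: false :: R) := LCup ⊗ hid R.
Definition gC' R : QHom (false :: true :: R) R := LCap ⊗ hid R.

Section Naturality.
Context u v (f : QHom u v).
Lemma gX_nat : gX v ∘ wh true f = wh true f ∘ gX u.
Proof. exact: (tens_natural Dot f). Qed.
Lemma gS_nat : gS v ∘ wh true (wh true f) = wh true (wh true f) ∘ gS u.
Proof. by have := tens_natural Cross f; rewrite !hid_cons hunitl. Qed.
Lemma gU_nat : gU v ∘ f = wh false (wh true f) ∘ gU u.
Proof. by have := tens_natural RCup f; rewrite !hid_cons !hunitl. Qed.
Lemma gC_nat : gC v ∘ wh true (wh false f) = f ∘ gC u.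
Proof. by have := tens_natural RCap f; rewrite !hid_cons !hunitl. Qed.
Lemma gU'_nat : gU' v ∘ f = wh true (wh false f) ∘ gU' u.
Proof. by have := tens_natural LCup f; rewrite !hid_cons !hunitl. Qed.
Lemma gC'_nat : gC' v ∘ wh false (wh true f) = f ∘ gC' u.
Proof. by have := tens_natural LCap f; rewrite !hid_cons !hunitl. Qed.
End Naturality.

Lemma tens_comp u v w (f : QHom v w) (g : QHom u v) R : (f ∘ g) ⊗ hid R = (f ⊗ hid R) ∘ (g ⊗ hid R).
Proof. by rewrite hinterchange hidl. Qed.

End Cat.

End MonoidalCalculus.
Import MonoidalCalculus.

(** * Inverse of a power series by Toeplitz determinants *)

Module Toeplitz.

Local Open Scope ring_scope.

Section Toeplitz.
Context (R : comPzRingType) (h : nat -> R) (h0 : h 0%N = 1).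

(** The n-th coefficient of the inverse of the power series with coefficients [h]; this is the shape
    of the elements c_s in the dual dots. *)
Definition hess_det (n : nat) : R :=
  \sum_(w : 'S_n) ((-1) ^+ n * (-1) ^+ w) *
    \prod_(i < n) (if (i <= (w i).+1)%N then h ((w i).+1 - i) else 0).

Let T n : 'M[R]_n.+1 := \matrix_(i, j) if (j <= i)%N then h (i - j) else 0.

Let detT n : \det (T n) = 1.
Proof.
rewrite det_trig; last first.
  by apply/is_trig_mxP => i j ij; rewrite mxE leqNgt ij.
by rewrite big1 // => i _; rewrite mxE leqnn subnn.
Qed.

Let adjT_rec n (t : 'I_n.+1) :
  \sum_(s < n.+1 | (s <= t)%N) h (t - s) * (\adj (T n)) s ord0 = (t == ord0)%:R.
Proof.
have /matrixP/(_ t ord0) := mul_mx_adj (T n); rewrite detT !mxE => <-.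
rewrite big_mkcond; apply: eq_bigr => s _; rewrite [in RHS]mxE.
by case: leqP; rewrite ?mul0r.
Qed.

Let adjT_last n : (\adj (T n)) ord_max ord0 = hess_det n.
Proof.
rewrite mxE /cofactor /= add0n -det_tr /determinant /hess_det mulr_sumr.
apply: eq_bigr => w _; rewrite mulrA; congr (_ * _); apply: eq_bigr => i _.
rewrite !mxE lift0 lift_max.
by [].
Qed.

(** The signed determinant is the corner cofactor of a unitriangular Toeplitz matrix, hence an entry
    of its inverse. *)
Lemma hess_det_rec t : \sum_(s < t.+1) h (t - s) * hess_det s = (t == 0%N)%:R.
Proof.
(* The recursion [adjT_rec] determines the first column of the adjugate from the top, independently
   of the size of the matrix; so each entry is the last entry for a smaller size. *)
have key m : forall n (s : 'I_n.+1), val s = m -> \adj (T n) s ord0 = hess_det m.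
  elim/ltn_ind: m => m IH.
  suff E n (s : 'I_n.+1) n' (s' : 'I_n'.+1) : val s = m -> val s' = m ->
      \adj (T n) s ord0 = \adj (T n') s' ord0.
    by move=> n s sm; rewrite (E _ s m ord_max) // adjT_last.
  have split N (r : 'I_N.+1) : val r = m -> \adj (T N) r ord0
      = (m == 0%N)%:R - \sum_(i < m) h (m - i) * hess_det i.
    move=> rm; have := adjT_rec r; rewrite (bigD1 r) //= subnn h0 mul1r -val_eqE /= rm => <-.
    have mN : (m <= N.+1)%N by rewrite -rm; apply: ltnW (ltn_ord r).
    rewrite (big_ord_widen _ (fun i => h (m - i) * hess_det i) mN).
    apply/esym/(canLR (addrK _)); congr (_ + _); apply: eq_big => [i|i /andP[im ir]].
      by rewrite -val_eqE /= rm ltn_neqAle andbC.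
    have im' : (i < m)%N by rewrite ltn_neqAle im andbT -rm.
    by rewrite (IH _ im' N i).
  by move=> /split -> /split ->.
have := adjT_rec (@ord_max t); rewrite -val_eqE /= => <-.
apply: eq_big => [s|s _]; first by rewrite leq_ord.
by rewrite (key s t s).
Qed.

End Toeplitz.

End Toeplitz.
Import Toeplitz.

(** * The local relations at the left end of a word *)

Module LocalRelations.

Local Open Scope ring_scope.
Local Open Scope hom_scope.

Section End1.
Context (k : fieldType) (lam : {fsfun int -> nat with 0%N}).
Local Notation QHom := (QHom k lam).
Local Notation hid := (hid k lam).

Definition end1 : Type := QHom [::] [::].
HB.instance Definition _ := GRing.Zmodule.on end1.

Lemma end1_tensr (f : end1) : f ⊗ hid [::] = f.
Proof. exact: heq_eq (heq_unitr f). Qed.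

(** Eckmann-Hilton: both composites equal the tensor product [g ⊗ f]. *)
Lemma end1C : commutative (fun f g : end1 => f ∘ g : end1).
Proof.
move=> f g.
have E1 : (g ⊗ f : end1) = f ∘ g.
  have := hinterchange (hid [::]) g f (hid [::]).
  by rewrite hidl hidr hunitl end1_tensr => <-.
have E2 : (g ⊗ f : end1) = g ∘ f.
  have := hinterchange g (hid [::]) (hid [::]) f.
  by rewrite hidl hidr hunitl end1_tensr => <-.
by rewrite -E1 E2.
Qed.

Lemma end1A : associative (fun f g : end1 => f ∘ g : end1).
Proof. by move=> f g h; apply: hcompA. Qed.
Lemma end1_1l : left_id (hid [::] : end1) (fun f g : end1 => f ∘ g : end1).
Proof. by move=> f; apply: hidl. Qed.
Lemma end1_Dl : left_distributive (fun f g : end1 => f ∘ g : end1) +%R.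
Proof. by move=> f g h; apply: hcompDl. Qed.
HB.instance Definition _ := GRing.Zmodule_isComPzRing.Build end1
  end1A end1C end1_1l end1_Dl.

End End1.

Section BaseRelations.
Context (k : fieldType) (lam : {fsfun int -> nat with 0%N}).
Local Notation QHom := (QHom k lam).
Local Notation hid := (hid k lam).
Local Notation d := (level lam).
Local Notation gX := (gX k lam).
Local Notation gS := (gS k lam).
Local Notation gU := (gU k lam).
Local Notation gC := (gC k lam).
Local Notation gU' := (gU' k lam).
Local Notation gC' := (gC' k lam).
Implicit Types u v w R : word.

Local Notation Dot := (cl DDot : QHom [:: true] [:: true]).
Local Notation Cross := (cl DCross : QHom [:: true; true] [:: true; true]).
Local Notation RCup := (cl DRCup : QHom [::] [:: false; true]).
Local Notation RCap := (cl DRCap : QHom [:: true; false] [::]).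
Local Notation LCup := (cl DLCup : QHom [::] [:: true; false]).
Local Notation LCap := (cl DLCap : QHom [:: false; true] [::]).

Lemma hcomp3E u v w z (f : diagram k w z) (g : diagram k v w) (h : diagram k u v) :
  (cl f : QHom w z) ∘ (cl g : QHom v w) ∘ (cl h : QHom u v) = cl (DComp (DComp f g) h).
Proof. by rewrite (hcompE lam f g) hcompE. Qed.

Lemma hcomp4E u v w z t (f : diagram k z t) (g : diagram k w z) (h : diagram k v w)
    (i : diagram k u v) :
  (cl f : QHom z t) ∘ (cl g : QHom w z) ∘ (cl h : QHom v w) ∘ (cl i : QHom u v)
  = cl (DComp (DComp (DComp f g) h) i).
Proof. by rewrite hcomp3E hcompE. Qed.

Lemma gC_zig R : gC (true :: R) ∘ wh true (gU R) = hid (true :: R).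
Proof.
have E : (RCap ⊗ hid [:: true] : QHom [:: true; false; true] _) ∘ (hid [:: true] ⊗ RCup)
    = hid [:: true].
  by rewrite !htensE hcompE; apply/clP/deq_zigzag1.
have := congr1 (fun f => f ⊗ hid R) E; rewrite /= tens_comp.
rewrite (heq_eq (tens_hid [:: true] R RCap)) -[hid [:: true] ⊗ RCup]/(wh true RCup).
by rewrite wh_tens htens_id.
Qed.

Lemma gC_zag R : wh false (gC R) ∘ gU (false :: R) = hid (false :: R).
Proof.
have E : (hid [:: false] ⊗ RCap : QHom [:: false; true; false] _) ∘ (RCup ⊗ hid [:: false])
    = hid [:: false].
  by rewrite !htensE hcompE; apply/clP/deq_zigzag3.
have := congr1 (fun f => f ⊗ hid R) E; rewrite /= tens_comp.
rewrite (heq_eq (tens_hid [:: false] R RCup)) -[hid [:: false] ⊗ RCap]/(wh false RCap).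
by rewrite wh_tens htens_id.
Qed.

Lemma gS_sq R : gS R ∘ gS R = hid (true :: true :: R).
Proof.
have E : Cross ∘ Cross = hid _ by rewrite hcompE; apply/clP/deq_crossK.
by have := congr1 (fun f => f ⊗ hid R) E; rewrite /= tens_comp htens_id.
Qed.

Lemma gS_braid R : gS (true :: R) ∘ wh true (gS R) ∘ gS (true :: R)
  = wh true (gS R) ∘ gS (true :: R) ∘ wh true (gS R).
Proof.
have E : (Cross ⊗ hid [:: true] : QHom [:: true; true; true] [:: true; true; true])
   ∘ (hid [:: true] ⊗ Cross) ∘ (Cross ⊗ hid [:: true])
   = (hid [:: true] ⊗ Cross : QHom [:: true; true; true] [:: true; true; true])
   ∘ (Cross ⊗ hid [:: true]) ∘ (hid [:: true] ⊗ Cross).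
  by rewrite !htensE !hcomp3E; apply/clP/deq_braid.
have := congr1 (fun f => f ⊗ hid R) E; rewrite /= !tens_comp.
rewrite (heq_eq (tens_hid [:: true] R Cross)) -[hid [:: true] ⊗ Cross]/(wh true Cross).
by rewrite wh_tens.
Qed.

Lemma gX_cross1 R : gS R ∘ gX (true :: R) = wh true (gX R) ∘ gS R + hid (true :: true :: R).
Proof.
have E : Cross ∘ (Dot ⊗ hid [:: true]) - (hid [:: true] ⊗ Dot : QHom [:: true; true] _) ∘ Cross
    = hid [:: true; true].
  rewrite !htensE !hcompE -scaleN1r hzmulE hplusE; apply/clP.
  exact: deq_dot_cross1.
have := congr1 (fun f => f ⊗ hid R) E.
rewrite /= htensDl -scaleN1r htensZl scaleN1r !tens_comp.
rewrite (heq_eq (tens_hid [:: true] R Dot)) -[hid [:: true] ⊗ Dot]/(wh true Dot).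
by rewrite wh_tens htens_id => /(canRL (subrK _)) ->; rewrite addrC.
Qed.

(** Conjugation of [gX_cross1] by the involution [gS]. *)
Lemma gX_cross2 R : gX (true :: R) ∘ gS R = gS R ∘ wh true (gX R) + hid (true :: true :: R).
Proof.
have := congr1 (fun f => gS R ∘ f ∘ gS R) (gX_cross1 R).
rewrite /= hcompA gS_sq hidl => ->.
by rewrite !hcompDr !hcompDl -!hcompA gS_sq !hidr hidl gS_sq.
Qed.

Definition gXn j R : QHom (true :: R) (true :: R) := iter j (hcomp (gX R)) (hid _).

Lemma gXnS j R : gXn j.+1 R = gX R ∘ gXn j R. Proof. by []. Qed.
Lemma gXnD i j R : gXn (i + j) R = gXn i R ∘ gXn j R.
Proof. by elim: i => [|i IH]; rewrite ?hidl // addSn !gXnS IH hcompA. Qed.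
Lemma gXnSr j R : gXn j.+1 R = gXn j R ∘ gX R.
Proof. by rewrite -addn1 gXnD gXnS hidr. Qed.
Lemma gXn_nat j u v (f : QHom u v) : gXn j v ∘ wh true f = wh true f ∘ gXn j u.
Proof.
elim: j => [|j IH]; first by rewrite hidl hidr.
by rewrite !gXnS -hcompA IH !hcompA gX_nat.
Qed.

Lemma dotsE j R : (cl (dots k j) : QHom _ _) ⊗ hid R = gXn j R.
Proof.
elim: j => [|j IH]; first exact: htens_id.
by rewrite gXnS -IH; have := tens_comp Dot (cl (dots k j)) R; rewrite hcompE.
Qed.

(** A closed diagram placed to the left of [R]; by [act_nat] it passes through every morphism, so
    bubbles can be moved freely. *)
Definition act (c : end1 k lam) R : QHom R R := c ⊗ hid R.
Lemma act_nat c u v (f : QHom u v) : act c v ∘ f = f ∘ act c u.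
Proof. by have := tens_natural c f; rewrite !hunitl. Qed.
Lemma actM c c' R : act (c * c') R = act c R ∘ act c' R.
Proof. exact: (tens_comp c c' R). Qed.
Lemma act1 R : act 1 R = hid R. Proof. exact: (htens_id k lam [::] R). Qed.
Lemma act0 R : act 0 R = 0. Proof. exact: (htens0l [::] [::] (hid R)). Qed.
Lemma act_sum (I : Type) (r : seq I) (P : pred I) (F : I -> end1 k lam) R :
  act (\sum_(i <- r | P i) F i) R = \sum_(i <- r | P i) act (F i) R.
Proof. exact: (htens_bigl r P F (hid R)). Qed.

Definition gamma j : end1 k lam := cl (bubble k j).
Definition gcoef n : end1 k lam := cl (bubble_det k lam n).

Lemma act_gamma j R : act (gamma j) R = gC' R ∘ wh false (gXn j R) ∘ gU R.
Proof.
have E : gamma j = LCap ∘ (hid [:: false] ⊗ cl (dots k j)) ∘ RCup.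
  by rewrite htensE hcomp3E.
rewrite /act E !tens_comp.
by rewrite -[hid [:: false] ⊗ _]/(wh false _) wh_tens dotsE.
Qed.

Lemma gammaE m : (m < d)%N -> gamma m = (m == d.-1)%:R.
Proof.
move=> md; case: eqP => [->|/eqP ne].
  by apply/clP/deq_bubble_pred.
apply/clP/deq_bubble_lt; rewrite ltn_neqAle ne /=; case: (d) md => //.
Qed.

Lemma sgn_scale m (f : end1 k lam) : (-1) ^+ m *: f = (-1) ^+ m * f.
Proof.
rewrite -signr_odd -[in RHS]signr_odd; case: (odd m); rewrite ?expr1 ?expr0.
  by rewrite scaleN1r mulN1r.
by rewrite scale1r mul1r.
Qed.

(** The entries that [hess_det] replaces by zero are bubbles of index below d - 1, which vanish; for
    [n <= d] the truncated subtractions in [bubble_det] are exact. *)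
Lemma gcoefE n : (n <= d)%N -> gcoef n = hess_det (fun i => gamma (d.-1 + i)) n.
Proof.
move=> nd; rewrite /gcoef /bubble_det cl_bigadd /hess_det.
apply: eq_bigr => w _; rewrite -hzmulE.
have -> : cl (\big[@DComp k [::] [::] [::]/DId [::]]_(i < n) bubble k (d + w i - i))
   = \prod_(i < n) gamma (d + w i - i) :> end1 k lam.
  by apply: (big_morph (cl : diagram k [::] [::] -> end1 k lam)) => // f g; rewrite -hcompE.
have -> : \prod_(i < n) (if (i <= (w i).+1)%N then gamma (d.-1 + ((w i).+1 - i)) else 0)
   = \prod_(i < n) gamma (d + w i - i).
  apply: eq_bigr => i _; have ilt := ltn_ord i; case: leqP => wi /=.
    by have -> : (d.-1 + ((w i).+1 - i) = d + w i - i)%N by lia.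
  have wd : (d + w i - i < d.-1)%N by lia.
  by rewrite gammaE ?(ltn_eqF wd) // (leq_trans wd) // leq_pred.
by move: (\prod_(i < n) _) => f; rewrite -scalerA !sgn_scale mulrA.
Qed.

Definition gD j R : QHom (true :: R) (true :: R) :=
  \sum_(j <= i < d) gXn (i - j) R ∘ wh true (act (gcoef (d.-1 - i)) R).

Lemma dual_dotsE j R : (cl (dual_dots k lam j) : QHom _ _) ⊗ hid R = gD j R.
Proof.
rewrite /dual_dots cl_bigadd htens_bigl; apply: eq_bigr => i _.
transitivity (((cl (dots k (i - j)) : QHom [:: true] [:: true]) ⊗ gcoef (d.-1 - i)
   : QHom [:: true] [:: true]) ⊗ hid R); first by rewrite /gcoef htensE.
have H : heq (u := true :: R) (v := true :: R) (u' := true :: R) (v' := true :: R)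
    ((cl (dots k (i - j)) : QHom [:: true] [:: true]) ⊗ act (gcoef (d.-1 - i)) R)
    (((cl (dots k (i - j)) : QHom [:: true] [:: true]) ⊗ gcoef (d.-1 - i)
   : QHom [:: true] [:: true]) ⊗ hid R) :=
  heqA (cl (dots k (i - j)) : QHom [:: true] [:: true]) (gcoef (d.-1 - i)) (hid R).
rewrite -(heq_eq H) -dotsE.
have := hinterchange (cl (dots k (i - j)) : QHom [:: true] [:: true]) (hid [:: true])
  (hid R) (act (gcoef (d.-1 - i)) R).
by rewrite hidr hidl.
Qed.

Definition gT R : QHom (true :: false :: R) (false :: true :: R) := locked_with hom_key
  (wh false (wh true (gC R)) ∘ wh false (gS (false :: R)) ∘ gU (true :: false :: R)).
Definition gT' R : QHom (false :: true :: R) (true :: false :: R) := locked_with hom_key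
  (gC' (true :: false :: R) ∘ wh false (gS (false :: R)) ∘ wh false (wh true (gU' R))).
Lemma gTE R : gT R =
  wh false (wh true (gC R)) ∘ wh false (gS (false :: R)) ∘ gU (true :: false :: R).
Proof. by rewrite /gT unlock. Qed.
Lemma gT'E R : gT' R =
  gC' (true :: false :: R) ∘ wh false (gS (false :: R)) ∘ wh false (wh true (gU' R)).
Proof. by rewrite /gT' unlock. Qed.

Lemma rcrossE R : (cl (rcross k) : QHom _ _) ⊗ hid R = gT R.
Proof.
have -> : cl (rcross k) = (hid [:: false; true] ⊗ RCap : QHom [:: false; true; true; false] _)
    ∘ (hid [:: false] ⊗ (Cross ⊗ hid [:: false])) ∘ (RCup ⊗ hid [:: true; false]).
  by rewrite (htensE lam DCross (DId [:: false])) !htensE hcomp3E.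
rewrite !tens_comp (heq_eq (tens_hid [:: true; false] R RCup)).
rewrite -[hid [:: false] ⊗ (Cross ⊗ _)]/(wh false (Cross ⊗ hid [:: false])).
rewrite wh_tens (heq_eq (tens_hid [:: false] R Cross)).
have -> : (hid [:: false; true] ⊗ RCap : QHom [:: false; true; true; false] [:: false; true])
   = wh false (wh true RCap) by rewrite hid_cons.
by rewrite gTE !wh_tens.
Qed.

Lemma lcrossE R : (cl (lcross k) : QHom _ _) ⊗ hid R = gT' R.
Proof.
have -> : cl (lcross k) = (LCap ⊗ hid [:: true; false] : QHom [:: false; true; true; false] _)
    ∘ (hid [:: false] ⊗ (Cross ⊗ hid [:: false])) ∘ (hid [:: false; true] ⊗ LCup).
  by rewrite (htensE lam DCross (DId [:: false])) !htensE hcomp3E.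
rewrite !tens_comp (heq_eq (tens_hid [:: true; false] R LCap)).
rewrite -[hid [:: false] ⊗ (Cross ⊗ _)]/(wh false (Cross ⊗ hid [:: false])).
rewrite wh_tens (heq_eq (tens_hid [:: false] R Cross)).
have -> : (hid [:: false; true] ⊗ LCup : QHom [:: false; true] [:: false; true; true; false])
   = wh false (wh true LCup) by rewrite hid_cons.
by rewrite gT'E !wh_tens.
Qed.

Definition eta j R : QHom R (false :: true :: R) := wh false (gXn j R) ∘ gU R.
Definition epsd i R : QHom (false :: true :: R) R := gC' R ∘ wh false (gD i R).

Lemma gT_res R : hid (false :: true :: R)
  = gT R ∘ gT' R + \sum_(j < d) eta j R ∘ epsd j R.
Proof.
have E : hid [:: false; true] = cl (rcross k) ∘ cl (lcross k) +
   \sum_(j < d) ((hid [:: false] ⊗ cl (dots k j)) ∘ RCup ∘ LCap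
       ∘ (hid [:: false] ⊗ cl (dual_dots k lam j))).
  have -> : \sum_(j < d) ((hid [:: false] ⊗ cl (dots k j)) ∘ RCup ∘ LCap
       ∘ (hid [:: false] ⊗ cl (dual_dots k lam j))) = cl (\big[@DAdd k [:: false; true] [:: false; true]/DZero]_(j < d)
       (DComp (DComp (DComp (DTens (DId [:: false]) (dots k j)) DRCup) DLCap) (DTens (DId [:: false]) (dual_dots k lam j)))).
    rewrite cl_bigadd; apply: eq_bigr => j _.
    by rewrite !htensE hcomp4E.
  by rewrite hcompE hplusE; apply/clP/deq_mp.
have := congr1 (fun f => f ⊗ hid R) E.
rewrite htens_id htensDl tens_comp rcrossE lcrossE htens_bigl => ->; congr (_ + _).
apply: eq_bigr => j _; rewrite !tens_comp.
rewrite -[hid [:: false] ⊗ cl (dots _ _)]/(wh false (cl (dots _ _))).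
rewrite -[hid [:: false] ⊗ cl (dual_dots _ _ _)]/(wh false (cl (dual_dots _ _ _))).
by rewrite !wh_tens dotsE dual_dotsE -!hcompA.
Qed.

Lemma gT'T R : gT' R ∘ gT R = hid (true :: false :: R).
Proof.
have E : cl (lcross k) ∘ cl (rcross k) = hid [:: true; false] by rewrite hcompE; apply/clP/deq_pm.
by have := congr1 (fun f => f ⊗ hid R) E; rewrite tens_comp rcrossE lcrossE htens_id.
Qed.

(** Closing dots and dual dots gives the sum of gamma_(l-i+j) c_(d-1-l), and by [hess_det_rec] the
    c's are the coefficients inverse to the bubbles. This is why the [x_j^∨] are dual to the powers
    of the dot. *)
Lemma eps_eta i j R : (i < d)%N -> (j < d)%N ->
  epsd i R ∘ eta j R = (i == j)%:R *: hid R.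
Proof.
move=> id' jd; rewrite /epsd /eta /gD.
have -> : gC' R ∘ wh false (\sum_(i <= i0 < d) gXn (i0 - i) R ∘ wh true (act (gcoef (d.-1 - i0)) R))
    ∘ (wh false (gXn j R) ∘ gU R)
  = act (\sum_(i <= l < d) gamma (l - i + j) * gcoef (d.-1 - l)) R.
  rewrite act_sum wh_sum hcomp_bigr hcomp_bigl; apply: eq_bigr => l _.
  rewrite actM act_gamma gXnD !wh_comp.
  have E : wh false (wh true (act (gcoef (d.-1 - l)) R)) ∘ (wh false (gXn j R) ∘ gU R)
     = wh false (gXn j R) ∘ gU R ∘ act (gcoef (d.-1 - l)) R.
    by rewrite hcompA -wh_comp -gXn_nat wh_comp -!hcompA gU_nat.
  by rewrite -!hcompA E !hcompA.
suff -> : \sum_(i <= l < d) gamma (l - i + j) * gcoef (d.-1 - l) = (i == j)%:R.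
  case: (i == j); first by rewrite act1 scale1r.
  by rewrite act0 scale0r.
case: (leqP i j) => ij; last first.
  rewrite big_nat_cond big1 => [|l /andP[/andP[l1 l2] _]]; first by rewrite gtn_eqF.
  have lt : (l - i + j < d.-1)%N by lia.
  by rewrite gammaE ?(ltn_eqF lt) ?mul0r // (leq_trans lt) // leq_pred.
have h0 : gamma (d.-1 + 0) = 1 by rewrite addn0 gammaE ?eqxx //; lia.
have := hess_det_rec (h := fun m => gamma (d.-1 + m)) h0 (j - i)%N.
have -> : (j - i == 0)%N = (i == j) by apply/eqP/eqP; lia.
move=> <-; have jid : ((j - i).+1 <= d)%N by lia.
(* Substituting s = d - 1 - l gives the recursion of [hess_det] at j - i; the terms with s > j - i
   contain a bubble of index below d - 1. *)
rewrite big_geq_mkord (reindex_inj rev_ord_inj) /=.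
rewrite (big_ord_widen d (fun s => gamma (d.-1 + (j - i - s)) *
  hess_det (fun m => gamma (d.-1 + m)) s) jid).
rewrite big_mkcond [RHS]big_mkcond; apply: eq_bigr => s _; have sd := ltn_ord s.
rewrite ltnS; case: (leqP s (j - i)) => sj.
  have -> : (i <= d - s.+1)%N by lia.
  have -> : (d - s.+1 - i + j = d.-1 + (j - i - s))%N by lia.
  have -> : (d.-1 - (d - s.+1) = s)%N by lia.
  by rewrite gcoefE // ltnW.
case: ifP => // il.
have lt : (d - s.+1 - i + j < d.-1)%N by lia.
by rewrite gammaE ?(ltn_eqF lt) ?mul0r // (leq_trans lt) // leq_pred.
Qed.

(** Composing [gT_res] with [eta j] and using [eps_eta] leaves [gT ∘ gT' ∘ eta j = 0], and [gT] has
    the left inverse [gT']. With [epsd_gT], this makes Q_- Q_+ the direct sum of Q_+ Q_- and d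
    copies of the unit. *)
Lemma gT'_eta j R : (j < d)%N -> gT' R ∘ eta j R = 0.
Proof.
move=> jd.
have E : gT R ∘ gT' R ∘ eta j R = 0.
  have := congr1 (fun f => f ∘ eta j R) (gT_res R).
  rewrite /= hidl hcompDl hcomp_suml (bigD1 (Ordinal jd)) //= -(hcompA (eta j R)) eps_eta // eqxx scale1r hidr.
  rewrite big1 ?addr0 => [/eqP|l lj]; first by rewrite -subr_eq subrr => /eqP/esym.
  rewrite -val_eqE /= in lj.
  by rewrite -hcompA eps_eta // (negbTE lj) scale0r hcomp0r.
by rewrite -[LHS]hidl -(gT'T R) -hcompA; rewrite -hcompA in E; rewrite E hcomp0r.
Qed.

Lemma epsd_gT j R : (j < d)%N -> epsd j R ∘ gT R = 0.
Proof.
move=> jd.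
have E : (\sum_(l < d) eta l R ∘ epsd l R) ∘ gT R = 0.
  have := congr1 (fun f => f ∘ gT R) (gT_res R).
  rewrite /= hidl hcompDl -hcompA gT'T hidr => /eqP.
  by rewrite addrC -subr_eq subrr => /eqP/esym.
have := congr1 (fun f => epsd j R ∘ f) E.
rewrite /= hcomp0r hcompA hcomp_sumr (bigD1 (Ordinal jd)) //= hcompA eps_eta // eqxx scale1r hidl.
rewrite big1 ?addr0 // => l lj.
rewrite -val_eqE /= in lj.
by rewrite hcompA eps_eta // eq_sym (negbTE lj) scale0r hcomp0l.
Qed.

End BaseRelations.

End LocalRelations.
Import LocalRelations.

(** * Symmetrizers, and moving strands through adjunction *)

Module Symmetrizer.

Local Open Scope ring_scope.
Local Open Scope hom_scope.

Section Strands.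
Context (k : fieldType) (char0 : [pchar k] =i pred0).
Context (lam : {fsfun int -> nat with 0%N}).
Local Notation QHom := (QHom k lam).
Local Notation hid := (hid k lam).
Local Notation gS := (gS k lam).
Local Notation gU := (gU k lam).
Local Notation gC := (gC k lam).
Local Notation gU' := (gU' k lam).
Local Notation gC' := (gC' k lam).
Local Notation gT := (gT k lam).
Local Notation gT' := (gT' k lam).
Local Notation up f := (wh true f).
Local Notation dn f := (wh false f).
Implicit Types u v w R W : word.
Local Notation Qp n := (nseq n true).

Lemma natk_neq0 n : (n.+1%:R : k) != 0.
Proof. by have /pcharf0P -> := char0. Qed.

Fixpoint ups n u v (f : QHom u v) : QHom (Qp n ++ u) (Qp n ++ v) :=
  match n return QHom (Qp n ++ u) (Qp n ++ v) with
  | 0 => f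
  | m.+1 => up (ups m f)
  end.

Lemma ups_comp n u v w (f : QHom v w) (g : QHom u v) : ups n (f ∘ g) = ups n f ∘ ups n g.
Proof. by elim: n => //= n ->; rewrite wh_comp. Qed.
Lemma ups_id n u : ups n (hid u) = hid _.
Proof. by elim: n => //= n ->; rewrite wh_id. Qed.

(* The symmetrizer of the first n strands, by recursion over the double cosets of S_(n-1) in S_n. *)
Fixpoint sy_def n W : QHom (Qp n ++ W) (Qp n ++ W) :=
  match n return QHom (Qp n ++ W) (Qp n ++ W) with
  | 0 => hid W
  | n'.+1 => n'.+1%:R^-1 *: (up (sy_def n' W) +
      match n' return QHom (true :: Qp n' ++ W) (true :: Qp n' ++ W) ->
                      QHom (true :: Qp n' ++ W) (true :: Qp n' ++ W) with
      | 0 => fun=> 0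
      | m.+1 => fun e => m.+1%:R *: (e ∘ gS (Qp m ++ W) ∘ e)
      end (up (sy_def n' W)))
  end.
Definition sy n W : QHom (Qp n ++ W) (Qp n ++ W) := locked_with hom_key (sy_def n W).

Lemma sy1 W : sy 1 W = hid _.
Proof. by rewrite /sy unlock /= addr0 wh_id invr1 scale1r. Qed.

Lemma syE m W : sy m.+2 W = m.+2%:R^-1 *: (up (sy m.+1 W) +
  m.+1%:R *: (up (sy m.+1 W) ∘ gS (Qp m ++ W) ∘ up (sy m.+1 W))).
Proof. by rewrite /sy !unlock. Qed.

Lemma sy0 W : sy 0 W = hid W. Proof. by rewrite /sy !unlock. Qed.

Lemma scaleS_sum (V : lmodType k) n (v : V) : n.+2%:R^-1 *: (v + n.+1%:R *: v) = v.
Proof.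
rewrite -{1}[v]scale1r -scalerDl scalerA -[X in X + _]/(1%:R) -natrD add1n.
by rewrite mulVf ?scale1r // natk_neq0.
Qed.

Lemma sy_nat n u v (f : QHom u v) : sy n v ∘ ups n f = ups n f ∘ sy n u.
Proof.
elim: n => [|[|n] IH]; first by rewrite !sy0 hidl hidr.
  by rewrite !sy1 hidl hidr.
rewrite !syE hcompZl hcompZr; congr (_ *: _).
have E : up (sy n.+1 v) ∘ ups n.+2 f = ups n.+2 f ∘ up (sy n.+1 u).
  by rewrite /= -!wh_comp IH.
rewrite hcompDl hcompDr E hcompZl hcompZr; congr (_ + _ *: _).
by rewrite -!hcompA E ![gS _ ∘ (_ ∘ _)]hcompA gS_nat !hcompA E.
Qed.

(** Expanding one outer [e1] in [e1 ∘ s1 ∘ e1] gives [s1 ∘ e1] plus a multiple of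
    [e2 ∘ s2 ∘ s1 ∘ e1]. Left multiplication by [s1] exchanges [s1 ∘ e1] with the lone [e1], and
    fixes the second term by the braid relation; the other side is symmetric. *)
Lemma cross_sym_step u N (e1 e2 s1 s2 : QHom u u) :
  N.+1%:R *: e1 = e2 + N%:R *: (e2 ∘ s2 ∘ e2) ->
  e2 ∘ e1 = e1 -> e1 ∘ e2 = e1 -> s2 ∘ e1 = e1 -> e1 ∘ s2 = e1 ->
  s1 ∘ e2 = e2 ∘ s1 -> s1 ∘ s1 = hid u -> s1 ∘ s2 ∘ s1 = s2 ∘ s1 ∘ s2 ->
  s1 ∘ (e1 + N.+1%:R *: (e1 ∘ s1 ∘ e1)) = e1 + N.+1%:R *: (e1 ∘ s1 ∘ e1) /\
  (e1 + N.+1%:R *: (e1 ∘ s1 ∘ e1)) ∘ s1 = e1 + N.+1%:R *: (e1 ∘ s1 ∘ e1).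
Proof.
move=> E e21 e12 s2e es2 se ss sss.
have e21' (x : QHom u u) : x ∘ e2 ∘ e1 = x ∘ e1 by rewrite -hcompA e21.
have s2e' (x : QHom u u) : x ∘ s2 ∘ e1 = x ∘ e1 by rewrite -hcompA s2e.
have se' (x : QHom u u) : x ∘ e2 ∘ s1 = x ∘ s1 ∘ e2 by rewrite -!hcompA se.
have ss' (x : QHom u u) : x ∘ s1 ∘ s1 = x by rewrite -hcompA ss hidr.
have sss' (x : QHom u u) : x ∘ s1 ∘ s2 ∘ s1 = x ∘ s2 ∘ s1 ∘ s2.
  by rewrite -!hcompA [s1 ∘ (s2 ∘ s1)]hcompA sss !hcompA.
have El : N.+1%:R *: (e1 ∘ s1 ∘ e1) = s1 ∘ e1 + N%:R *: (e2 ∘ s2 ∘ s1 ∘ e1).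
  by rewrite -!hcompZl E !hcompDl -se e21' !hcompZl se' e21'.
have Er : N.+1%:R *: (e1 ∘ s1 ∘ e1) = e1 ∘ s1 + N%:R *: (e1 ∘ s1 ∘ s2 ∘ e2).
  by rewrite -!hcompZr E !hcompDr -se' e12 !hcompZr !hcompA -se' e12.
split.
  by rewrite {1}El hcompDr hcompDr hcompA ss hidl hcompZr !hcompA se sss' s2e' El addrCA.
by rewrite {1}Er hcompDl hcompDl ss' hcompZl se' sss' es2 Er addrCA.
Qed.

Lemma sy_abs n W : sy n W ∘ sy n W = sy n W ->
  up (sy n W) ∘ sy n.+1 W = sy n.+1 W /\ sy n.+1 W ∘ up (sy n W) = sy n.+1 W.
Proof.
move=> id; have id' : up (sy n W) ∘ up (sy n W) = up (sy n W) by rewrite -wh_comp id.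
case: n id id' => [|n] id id'; first by rewrite sy1 sy0 wh_id hidl.
rewrite syE hcompZl hcompZr hcompDl hcompDr hcompZl hcompZr.
by rewrite id' !hcompA id' -!hcompA id'.
Qed.

Lemma sy_props n W :
  [/\ sy n.+1 W ∘ sy n.+1 W = sy n.+1 W,
      gS (Qp n ++ W) ∘ sy n.+2 W = sy n.+2 W
    & sy n.+2 W ∘ gS (Qp n ++ W) = sy n.+2 W].
Proof.
have idem m : sy m.+1 W ∘ sy m.+1 W = sy m.+1 W ->
    gS (Qp m ++ W) ∘ sy m.+2 W = sy m.+2 W -> sy m.+2 W ∘ sy m.+2 W = sy m.+2 W.
  move=> /sy_abs [a _] b; rewrite {1}syE hcompZl hcompDl hcompZl a.
  by rewrite -!hcompA a b a scaleS_sum.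
elim: n => [|n [idn b b']].
  rewrite sy1 hidl syE sy1 wh_id scale1r !hidl hidr; split=> //.
    by rewrite hcompZr hcompDr hidr gS_sq addrC.
  by rewrite hcompZl hcompDl hidl gS_sq addrC.
have idS := idem _ idn b; have [a a'] := sy_abs idn; split=> //.
all: have [||||||||c1 c2] := @cross_sym_step (true :: true :: true :: Qp n ++ W) n.+1 (up (sy n.+2 W))
  (up (up (sy n.+1 W))) (gS (true :: Qp n ++ W)) (up (gS (Qp n ++ W)));
  rewrite -?wh_comp ?a ?a' ?b ?b' ?gS_nat ?gS_sq ?gS_braid //.
- by rewrite [sy n.+2 W]syE whZ scalerA divff ?natk_neq0 // scale1r whD whZ. 
- by rewrite [sy n.+3 W]syE hcompZr c1.
- by rewrite [sy n.+2 W]syE whZ scalerA divff ?natk_neq0 // scale1r whD whZ.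
- by rewrite [sy n.+3 W]syE hcompZl c2.
Qed.

Lemma sy_idem n W : sy n W ∘ sy n W = sy n W.
Proof. by case: n => [|n]; [rewrite !sy0 hidl | case: (sy_props n W)]. Qed.
Lemma sy_gSl n W : gS (Qp n ++ W) ∘ sy n.+2 W = sy n.+2 W.
Proof. by case: (sy_props n W). Qed.
Lemma sy_gSr n W : sy n.+2 W ∘ gS (Qp n ++ W) = sy n.+2 W.
Proof. by case: (sy_props n W). Qed.
Lemma sy_upl n W : up (sy n W) ∘ sy n.+1 W = sy n.+1 W.
Proof. by case: (sy_abs (sy_idem n W)). Qed.
Lemma sy_upr n W : sy n.+1 W ∘ up (sy n W) = sy n.+1 W.
Proof. by case: (sy_abs (sy_idem n W)). Qed.

(** The leftmost strand crosses m upward strands and is then capped off against the downward strand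
    behind them; in [tp_def] the downward strand itself travels to the right through sideways
    crossings. *)
Fixpoint kp_def m R : QHom (true :: Qp m ++ false :: R) (Qp m ++ R) :=
  match m with
  | 0 => gC R
  | m'.+1 => up (kp_def m' R) ∘ gS (Qp m' ++ false :: R)
  end.

Fixpoint tp_def m R : QHom (false :: Qp m ++ R) (Qp m ++ false :: R) :=
  match m with
  | 0 => hid (false :: R)
  | m'.+1 => up (tp_def m' R) ∘ gT' (Qp m' ++ R)
  end.

Definition kp m R : QHom (true :: Qp m ++ false :: R) (Qp m ++ R) := locked_with hom_key (kp_def m R).
Definition tp m R : QHom (false :: Qp m ++ R) (Qp m ++ false :: R) := locked_with hom_key (tp_def m R).
Lemma kp0 R : kp 0 R = gC R. Proof. by rewrite /kp unlock. Qed.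
Lemma kpS m R : kp m.+1 R = up (kp m R) ∘ gS (Qp m ++ false :: R).
Proof. by rewrite /kp !unlock. Qed.
Lemma tp0 R : tp 0 R = hid (false :: R). Proof. by rewrite /tp unlock. Qed.
Lemma tpS m R : tp m.+1 R = up (tp m R) ∘ gT' (Qp m ++ R).
Proof. by rewrite /tp !unlock. Qed.

Lemma gT_nat u v (f : QHom u v) : gT v ∘ up (dn f) = dn (up f) ∘ gT u.
Proof.
rewrite !gTE -!hcompA gU_nat !hcompA; congr (_ ∘ _).
by rewrite -!wh_comp -!hcompA gS_nat !hcompA -wh_comp gC_nat wh_comp.
Qed.

Lemma gT'_nat u v (f : QHom u v) : gT' v ∘ dn (up f) = up (dn f) ∘ gT' u.
Proof.
rewrite !gT'E !hcompA -gC'_nat -!hcompA; congr (_ ∘ _).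
by rewrite -!wh_comp gU'_nat [up (_ ∘ _)]wh_comp hcompA gS_nat -hcompA.
Qed.

Lemma gC'_zag R : up (gC' R) ∘ gU' (true :: R) = hid (true :: R).
Proof.
have E : (hid [:: true] ⊗ (cl DLCap : QHom _ _) : QHom [:: true; false; true] [:: true])
    ∘ ((cl DLCup : QHom _ _) ⊗ hid [:: true]) = hid [:: true].
  by rewrite !htensE hcompE; apply/clP/deq_zigzag2.
have := congr1 (fun f => f ⊗ hid R) E; rewrite /= tens_comp.
rewrite (heq_eq (tens_hid [:: true] R (cl DLCup : QHom _ _))).
by rewrite -[hid [:: true] ⊗ cl DLCap]/(wh true (cl DLCap : QHom _ _)) wh_tens htens_id.
Qed.

Lemma gT_gU R : gT (true :: R) ∘ up (gU R) = dn (gS R) ∘ gU (true :: R).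
Proof.
rewrite !gTE -!hcompA gU_nat !hcompA -!wh_comp; congr (dn _ ∘ _).
by rewrite -hcompA gS_nat hcompA -wh_comp gC_zig wh_id hidl.
Qed.

Lemma gT'_gU' R : up (gT' R) ∘ gU' (true :: R) = gS (false :: R) ∘ up (gU' R).
Proof.
rewrite gT'E !wh_comp -!hcompA -gU'_nat.
by rewrite [up (dn _) ∘ _]hcompA -gU'_nat -!hcompA hcompA gC'_zag hidl.
Qed.

(** A crossing slides through a downward strand: once the sideways crossings are unbent into upward
    ones, this is the braid relation. *)
Lemma gT'_gS R : up (gT' R) ∘ gT' (true :: R) ∘ dn (gS R) = gS (false :: R) ∘ (up (gT' R) ∘ gT' (true :: R)).
Proof.
have -> : up (gT' R) ∘ gT' (true :: R) = gC' _ ∘ dn (gS (true :: false :: R) ∘ up (gS (false :: R)))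
    ∘ dn (up (up (gU' R))).
  rewrite [gT' (true :: R)]gT'E !hcompA -gC'_nat -!hcompA; congr (_ ∘ _).
  rewrite -!wh_comp hcompA -gS_nat -!hcompA; congr (dn (_ ∘ _)).
  by rewrite -wh_comp gT'_gU' wh_comp.
rewrite !hcompA -gC'_nat -!hcompA; congr (_ ∘ _).
rewrite -!wh_comp; congr (dn _).
by rewrite -!hcompA -gS_nat !hcompA gS_braid.
Qed.

Lemma kp_nat m u v (f : QHom u v) : kp m v ∘ up (ups m (dn f)) = ups m f ∘ kp m u.
Proof.
elim: m => [|m IH]; first by rewrite !kp0; apply: gC_nat.
by rewrite !kpS -hcompA gS_nat !hcompA -!wh_comp IH.
Qed.

Lemma kp_sy m R : kp m R ∘ up (sy m (false :: R)) = sy m R ∘ kp m R.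
Proof.
elim: m => [|[|m] IH]; first by rewrite !sy0 /= wh_id hidl hidr.
  by rewrite !sy1 wh_id hidl hidr.
have A : kp m.+2 R ∘ up (up (sy m.+1 (false :: R))) = up (sy m.+1 R) ∘ kp m.+2 R.
  by rewrite [kp m.+2 R]kpS -[in LHS]hcompA gS_nat !hcompA -!wh_comp IH.
have B : kp m.+2 R ∘ up (gS (Qp m ++ false :: R)) = gS (Qp m ++ R) ∘ kp m.+2 R.
  rewrite !kpS wh_comp -!hcompA [up _ ∘ (gS _ ∘ up _)]hcompA -gS_braid.
  by rewrite !hcompA -gS_nat ?hcompA.
rewrite !syE whZ hcompZl hcompZr whD whZ hcompDr hcompDl hcompZl hcompZr A; congr (_ *: (_ + _ *: _)).
rewrite !wh_comp !hcompA A -(hcompA _ (kp m.+2 R)) B hcompA -(hcompA _ (kp m.+2 R)) A.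
by rewrite hcompA.
Qed.

Lemma tp_sy m R : tp m R ∘ dn (sy m R) = sy m (false :: R) ∘ tp m R.
Proof.
elim: m => [|[|m] IH]; first by rewrite !sy0 /= wh_id hidl hidr.
  by rewrite !sy1 wh_id hidl hidr.
have A : tp m.+2 R ∘ dn (up (sy m.+1 R)) = up (sy m.+1 (false :: R)) ∘ tp m.+2 R.
  by rewrite [tp m.+2 R]tpS -[in LHS]hcompA gT'_nat !hcompA -!wh_comp IH.
have B : tp m.+2 R ∘ dn (gS (Qp m ++ R)) = gS (Qp m ++ false :: R) ∘ tp m.+2 R.
  rewrite !tpS wh_comp -!hcompA [up (gT' _) ∘ _]hcompA (gT'_gS (Qp m ++ R)).
  by rewrite !hcompA -gS_nat ?hcompA.
rewrite !syE whZ hcompZl hcompZr whD whZ hcompDr hcompDl hcompZl hcompZr A; congr (_ *: (_ + _ *: _)).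
rewrite !wh_comp !hcompA A -(hcompA _ (tp m.+2 R)) B hcompA -(hcompA _ (tp m.+2 R)) A.
by rewrite hcompA.
Qed.

Definition ad u v (f : QHom (true :: u) v) : QHom u (false :: v) := dn f ∘ gU u.

Lemma ad_can u v (f : QHom (true :: u) v) : gC v ∘ up (ad f) = f.
Proof. by rewrite /ad wh_comp hcompA gC_nat -hcompA gC_zig hidr. Qed.
Lemma ad_inj u v : injective (@ad u v).
Proof. by move=> f g fg; rewrite -[f]ad_can fg ad_can. Qed.
Lemma ad_compl u v w (f : QHom v w) (g : QHom (true :: u) v) : ad (f ∘ g) = dn f ∘ ad g.
Proof. by rewrite /ad wh_comp hcompA. Qed.
Lemma ad_compr u v w (f : QHom (true :: v) w) (g : QHom u v) : ad (f ∘ up g) = ad f ∘ g.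
Proof. by rewrite /ad wh_comp -hcompA -gU_nat hcompA. Qed.
Lemma adD u v (f g : QHom (true :: u) v) : ad (f + g) = ad f + ad g.
Proof. by rewrite /ad whD hcompDl. Qed.
Lemma ad0 u v : ad (0 : QHom (true :: u) v) = 0.
Proof. by rewrite /ad wh0 hcomp0l. Qed.
Lemma adZ u v a (f : QHom (true :: u) v) : ad (a *: f) = a *: ad f.
Proof. by rewrite /ad whZ hcompZl. Qed.
Lemma ad_sum (I : Type) (r : seq I) (P : pred I) u v (F : I -> QHom (true :: u) v) :
  ad (\sum_(i <- r | P i) F i) = \sum_(i <- r | P i) ad (F i).
Proof. by rewrite /ad wh_sum hcomp_bigl. Qed.

(** [kap] and [phi] trade an upward strand at the source for a downward strand behind Q_+^m at the
    target. [phi] inverts [kap] on one side; on the other side there is an error of dotted terms,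
    measured in [kap_phi_decomp]. *)
Definition kap m R W (h : QHom W (Qp m ++ false :: R)) : QHom (true :: W) (Qp m ++ R) :=
  kp m R ∘ up h.
Definition phi m R W (f : QHom (true :: W) (Qp m ++ R)) : QHom W (Qp m ++ false :: R) :=
  tp m R ∘ ad f.

(** The adjunction turns each crossing of [kp] into a [gT], which the matching [gT'] of [tp]
    cancels; the base case is a zigzag. *)
Lemma phi_kap m R W (h : QHom W (Qp m ++ false :: R)) : phi (kap h) = h.
Proof.
rewrite /phi /kap ad_compr hcompA -[RHS]hidl; congr (_ ∘ _).
elim: m {h} => [|m IH]; first by rewrite tp0 kp0 hidl /ad gC_zag.
rewrite tpS kpS.
have -> : ad (up (kp m R) ∘ gS (Qp m ++ false :: R)) = gT (Qp m ++ R) ∘ up (ad (kp m R)).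
  rewrite ad_compl /ad [up (_ ∘ _)]wh_comp [gT _ ∘ _]hcompA gT_nat -hcompA.
  by rewrite (gT_gU (Qp m ++ false :: R)).
by rewrite hcompA -[up _ ∘ _ ∘ _]hcompA gT'T hidr -wh_comp IH wh_id.
Qed.

Lemma phi_nat m R W W' (f : QHom (true :: W) (Qp m ++ R)) (g : QHom W' W) :
  phi (f ∘ up g) = phi f ∘ g.
Proof. by rewrite /phi ad_compr hcompA. Qed.
Lemma kap_nat m R W W' (f : QHom W (Qp m ++ false :: R)) (g : QHom W' W) :
  kap (f ∘ g) = kap f ∘ up g.
Proof. by rewrite /kap wh_comp hcompA. Qed.
Lemma phi_sy m R W (f : QHom (true :: W) (Qp m ++ R)) : phi (sy m R ∘ f) = sy m (false :: R) ∘ phi f.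
Proof. by rewrite /phi ad_compl !hcompA tp_sy. Qed.
Lemma kap_sy m R W (f : QHom W (Qp m ++ false :: R)) : kap (sy m (false :: R) ∘ f) = sy m R ∘ kap f.
Proof. by rewrite /kap wh_comp !hcompA kp_sy. Qed.
Lemma phiD m R W (f g : QHom (true :: W) (Qp m ++ R)) : phi (f + g) = phi f + phi g.
Proof. by rewrite /phi adD hcompDr. Qed.
Lemma phiZ m R W a (f : QHom (true :: W) (Qp m ++ R)) : phi (a *: f) = a *: phi f.
Proof. by rewrite /phi adZ hcompZr. Qed.
Lemma phi0 m R W : phi (0 : QHom (true :: W) (Qp m ++ R)) = 0.
Proof. by rewrite /phi ad0 hcomp0r. Qed.
Lemma phi_sum m R W (I : Type) (r : seq I) (P : pred I) (F : I -> QHom (true :: W) (Qp m ++ R)) :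
  phi (\sum_(i <- r | P i) F i) = \sum_(i <- r | P i) phi (F i).
Proof. by rewrite /phi ad_sum hcomp_bigr. Qed.
Lemma kapD m R W (f g : QHom W (Qp m ++ false :: R)) : kap (f + g) = kap f + kap g.
Proof. by rewrite /kap whD hcompDr. Qed.
Lemma kapZ m R W a (f : QHom W (Qp m ++ false :: R)) : kap (a *: f) = a *: kap f.
Proof. by rewrite /kap whZ hcompZr. Qed.
Lemma kap0 m R W : kap (0 : QHom W (Qp m ++ false :: R)) = 0.
Proof. by rewrite /kap wh0 hcomp0r. Qed.

End Strands.

End Symmetrizer.
Import Symmetrizer.

(** * Strands ending on Q_+^m with fewer than d dots *)

Module DottedCups.

Local Open Scope ring_scope.
Local Open Scope hom_scope.

Section Strands.
Context (k : fieldType) (char0 : [pchar k] =i pred0).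
Context (lam : {fsfun int -> nat with 0%N}).
Local Notation QHom := (QHom k lam).
Local Notation d := (level lam).
Local Notation gXn := (gXn k lam).
Local Notation gS := (gS k lam).
Local Notation gU := (gU k lam).
Local Notation gC := (gC k lam).
Local Notation gT := (gT k lam).
Local Notation gT' := (gT' k lam).
Local Notation eta := (LocalRelations.eta k lam).
Local Notation epsd := (epsd k lam).
Local Notation sy := (sy k lam).
Local Notation kp := (kp k lam).
Local Notation tp := (tp k lam).
Local Notation up f := (wh true f).
Local Notation dn f := (wh false f).
Implicit Types u v w R W : word.
Local Notation Qp n := (nseq n true).

(** A new strand with j dots runs to the top and is symmetrized with the others. The index [m.-1]
    and the value 0 at [m = 0] let [Aop] be iterated along a list of dots without side conditions in
    the types. *)
Definition Aop_def j m R W : QHom W (Qp m.-1 ++ R) -> QHom (true :: W) (Qp m ++ R) :=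
  match m return QHom W (Qp m.-1 ++ R) -> QHom (true :: W) (Qp m ++ R) with
  | 0 => fun=> 0
  | m'.+1 => fun g => sy m'.+1 R ∘ gXn j (Qp m' ++ R) ∘ up g
  end.
Definition Aop j m R W (g : QHom W (Qp m.-1 ++ R)) : QHom (true :: W) (Qp m ++ R) :=
  locked_with hom_key (@Aop_def j m R W) g.

Lemma Aop0 j R W (g : QHom W (Qp 0.-1 ++ R)) : Aop j (m := 0) g = 0.
Proof. by rewrite /Aop unlock. Qed.
Lemma AopS j m R W (g : QHom W (Qp m ++ R)) :
  Aop j (m := m.+1) g = sy m.+1 R ∘ gXn j (Qp m ++ R) ∘ up g.
Proof. by rewrite /Aop unlock. Qed.

Lemma AopD j m R W (f g : QHom W (Qp m.-1 ++ R)) : Aop j (f + g) = Aop j f + Aop j g.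
Proof. by case: m f g => [|m] f g; rewrite ?Aop0 ?addr0 // !AopS whD hcompDr. Qed.
Lemma AopZ j m R W a (f : QHom W (Qp m.-1 ++ R)) : Aop j (a *: f) = a *: Aop j f.
Proof. by case: m f => [|m] f; rewrite ?Aop0 ?scaler0 // !AopS whZ hcompZr. Qed.
Lemma Aop_0 j m R W : Aop j (0 : QHom W (Qp m.-1 ++ R)) = 0.
Proof. by rewrite -[0](scale0r (0 : QHom W (Qp m.-1 ++ R))) AopZ scale0r. Qed.
Lemma Aop_sum j m R W (I : Type) (r : seq I) (P : pred I) (F : I -> QHom W (Qp m.-1 ++ R)) :
  Aop j (\sum_(i <- r | P i) F i) = \sum_(i <- r | P i) Aop j (F i).
Proof. by apply: (big_morph (@Aop j m R W)) => [f g|]; rewrite ?AopD ?Aop_0. Qed.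
Lemma Aop_nat j m R W W' (g : QHom W (Qp m.-1 ++ R)) (u : QHom W' W) :
  Aop j (g ∘ u) = Aop j g ∘ up u.
Proof. by case: m g => [|m] g; rewrite ?Aop0 ?hcomp0l // !AopS wh_comp hcompA. Qed.
Lemma sy_Aop j m R W (g : QHom W (Qp m.-1 ++ R)) : sy m R ∘ Aop j g = Aop j g.
Proof. by case: m g => [|m] g; rewrite ?Aop0 ?hcomp0r // !AopS !hcompA sy_idem. Qed.
Lemma Aop_sy j m R W (g : QHom W (Qp m.-1 ++ R)) : Aop j (sy m.-1 R ∘ g) = Aop j g.
Proof.
case: m g => [|m] g; rewrite ?Aop0 // !AopS /= wh_comp hcompA.
by rewrite -(hcompA _ (gXn _ _)) gXn_nat hcompA sy_upr.
Qed.

Lemma ad_gXn j R : ad (gXn j R) = eta j R. Proof. by []. Qed.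

(** Bending the dotted strand gives the cup [eta j], which the first sideways crossing in [tp]
    annihilates for j below d. *)
Lemma phi_Aop j m R W (g : QHom W (Qp m.-1 ++ R)) : (j < d)%N -> phi (Aop j g) = 0.
Proof.
move=> jd; case: m g => [|m] g; first by rewrite Aop0 phi0.
rewrite AopS -hcompA phi_sy // /phi ad_compr ad_gXn tpS.
have E : gT' (Qp m ++ R) ∘ (eta j (Qp m ++ R) ∘ g) = 0 by rewrite hcompA gT'_eta // hcomp0l.
by rewrite -(hcompA (up (tp m R))) E !hcomp0r.
Qed.

Lemma gXn_comm a b R : gXn a (true :: R) ∘ up (gXn b R) = up (gXn b R) ∘ gXn a (true :: R).
Proof. exact: gXn_nat. Qed.

Lemma gS_gXn j R : gS R ∘ gXn j (true :: R) = up (gXn j R) ∘ gS R +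
  \sum_(a < j) gXn a (true :: R) ∘ up (gXn (j.-1 - a) R).
Proof.
elim: j => [|j IH]; first by rewrite big_ord0 addr0 hidr wh_id hidl.
rewrite gXnSr hcompA IH hcompDl -hcompA gX_cross1 hcompDr hidr hcompA -wh_comp -gXnSr -addrA.
congr (_ + _); rewrite big_ord_recl subn0 hidl; congr (_ + _).
rewrite hcomp_suml; apply: eq_bigr => a _; have aj := ltn_ord a.
rewrite -hcompA -gX_nat hcompA -gXnSr lift0.
by congr (_ ∘ up (gXn _ _)); lia.
Qed.

Lemma gXn_gS j R : gXn j (true :: R) ∘ gS R = gS R ∘ up (gXn j R) +
  \sum_(a < j) gXn a (true :: R) ∘ up (gXn (j.-1 - a) R).
Proof.
elim: j => [|j IH]; first by rewrite big_ord0 addr0 hidl wh_id hidr.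
rewrite gXnS -hcompA IH hcompDr hcompA gX_cross2 hcompDl hidl -hcompA -wh_comp -gXnS -addrA.
congr (_ + _); rewrite big_ord_recl subn0 hidl; congr (_ + _).
rewrite hcomp_sumr; apply: eq_bigr => a _; have aj := ltn_ord a.
rewrite hcompA -gXnS lift0.
by congr (_ ∘ up (gXn _ _)); lia.
Qed.

(* The crossing slides off an undotted strand; each dot it passes leaves a term without crossing. *)
Lemma kap_Aop l m R W (f : QHom W (Qp m.-1 ++ false :: R)) :
  kap (Aop l f) = Aop l (kap f) ∘ gS W
    - \sum_(a < l) Aop a (kap f ∘ gXn (l.-1 - a) W).
Proof.
case: m f => [|m] f.
  rewrite !Aop0 kap0 hcomp0l sub0r big1 ?oppr0 // => a _; exact: Aop0.
have E : gS (Qp m ++ false :: R) ∘ up (gXn l (Qp m ++ false :: R))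
   = gXn l _ ∘ gS _ - \sum_(a < l) gXn a _ ∘ up (gXn (l.-1 - a) (Qp m ++ false :: R)).
  by rewrite gXn_gS addrK.
rewrite !AopS -hcompA kap_sy // /kap kpS.
rewrite [up (gXn _ _ ∘ _)]wh_comp !hcompA -(hcompA _ (gS _)) E hcompBr hcompBl; congr (_ - _).
  rewrite -!hcompA; congr (_ ∘ _); rewrite gS_nat !hcompA; congr (_ ∘ _).
  by rewrite -gXn_nat wh_comp !hcompA.
rewrite hcomp_sumr hcomp_suml; apply: eq_bigr => a _.
have E2 b : up (kp m R) ∘ (gXn a (true :: Qp m ++ false :: R) ∘ up (gXn b (Qp m ++ false :: R))) ∘ up (up f)
    = gXn a (Qp m ++ R) ∘ up (kp m R ∘ up f ∘ gXn b W).
  by rewrite (hcompA (up (kp m R))) -(gXn_nat a) -!hcompA -!wh_comp (gXn_nat b).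
by rewrite AopS -(hcompA (sy m.+1 R) (gXn a _)) -E2 !hcompA.
Qed.

Lemma AopAop a b m R W (f : QHom W (Qp m ++ R)) :
  Aop a (m := m.+2) (Aop b (m := m.+1) f) =
  sy m.+2 R ∘ gXn a (true :: Qp m ++ R) ∘ up (gXn b (Qp m ++ R)) ∘ up (up f).
Proof.
rewrite !AopS -!hcompA -wh_comp; have := Aop_sy a (m := m.+2) (gXn b (Qp m ++ R) ∘ up f).
by rewrite !AopS -!hcompA.
Qed.

Lemma sum_nat_diff (V : zmodType) (G : nat -> V) j l :
  \sum_(b < j) G b - \sum_(b < l) G b
  = \sum_(l <= b < j) G b - \sum_(j <= b < l) G b.
Proof.
rewrite -!(big_mkord xpredT); case: (leqP j l) => jl.
  by rewrite [X in _ = X - _]big_geq // (big_cat_nat (n := j) (p := l)) //= opprD addrA subrr.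
by rewrite [X in _ = _ - X]big_geq ?(ltnW jl) // (big_cat_nat (n := l) (p := j)) ?(ltnW jl) //= addrAC subrr add0r subr0.
Qed.

(** Crossing two source strands exchanges their numbers of dots up to corrections with j + l - 1
    dots in total. In these both numbers lie from the smaller of j and l up to, but excluding, the
    larger, so a bound by d is preserved. *)
Lemma Aop_gS j l m R W (f : QHom W (Qp m.-2 ++ R)) :
  Aop j (Aop l (m := m.-1) f) ∘ gS W = Aop l (Aop j (m := m.-1) f)
   + \sum_(l <= b < j) Aop (j + l - b.+1) (Aop b (m := m.-1) f)
   - \sum_(j <= b < l) Aop (j + l - b.+1) (Aop b (m := m.-1) f).
Proof.
case: m f => [|[|m]] f.
- by rewrite !Aop0 hcomp0l !big1 ?subr0 ?addr0 // => b _; rewrite Aop0.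
- by rewrite /= !Aop0 !Aop_0 hcomp0l !big1 ?subr0 ?addr0 // => b _; rewrite Aop0 Aop_0.
rewrite -addrA -sum_nat_diff addrA /= !AopAop.
rewrite -(hcompA _ (up (up f)) (gS W)) -gS_nat hcompA -(hcompA _ _ (gS _)).
have -> : up (gXn l (Qp m ++ R)) ∘ gS (Qp m ++ R) = gS (Qp m ++ R) ∘ gXn l _ -
   \sum_(a < l) gXn a (true :: Qp m ++ R) ∘ up (gXn (l.-1 - a) (Qp m ++ R)).
  by rewrite gS_gXn addrK.
rewrite hcompBr hcompBl; congr (_ - _); last first.
  rewrite hcomp_sumr hcomp_suml (reindex_inj rev_ord_inj); apply: eq_bigr => a _ /=.
  have al := ltn_ord a; rewrite AopAop; congr (_ ∘ _).
  rewrite hcompA -(hcompA _ (gXn j _)) -gXnD.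
  by congr (_ ∘ gXn _ _ ∘ up (gXn _ _)); lia.
rewrite !hcompA -(hcompA _ (gXn j _)) gXn_gS hcompDr !hcompDl hcompA sy_gSr //.
congr (_ + _); first by rewrite -(hcompA _ (up (gXn j _))) -gXn_comm !hcompA.
rewrite hcomp_sumr !hcomp_suml (reindex_inj rev_ord_inj); apply: eq_bigr => a _ /=.
have aj := ltn_ord a; rewrite AopAop; congr (_ ∘ _).
rewrite -!hcompA -gXn_comm (hcompA (gXn _ _)) -gXnD !hcompA.
by congr (_ ∘ gXn _ _ ∘ up (gXn _ _)); lia.
Qed.

Definition SA m R W (f : QHom (true :: W) (Qp m ++ R)) : Prop :=
  exists g : 'I_d -> QHom W (Qp m.-1 ++ R), f = \sum_(j < d) Aop j (g j).

Lemma SA0 m R W : SA (0 : QHom (true :: W) (Qp m ++ R)).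
Proof. by exists (fun=> 0); rewrite big1 // => j _; apply: Aop_0. Qed.
Lemma SAD m R W (f g : QHom (true :: W) (Qp m ++ R)) : SA f -> SA g -> SA (f + g).
Proof.
case=> f' -> [g' ->]; exists (fun j => f' j + g' j).
by rewrite -big_split; apply: eq_bigr => j _; rewrite AopD.
Qed.
Lemma SAZ m R W a (f : QHom (true :: W) (Qp m ++ R)) : SA f -> SA (a *: f).
Proof.
case=> f' ->; exists (fun j => a *: f' j).
by rewrite scaler_sumr; apply: eq_bigr => j _; rewrite AopZ.
Qed.
Lemma SAN m R W (f : QHom (true :: W) (Qp m ++ R)) : SA f -> SA (- f).
Proof. by rewrite -scaleN1r; apply: SAZ. Qed.
Lemma SA_sum m R W (I : Type) (r : seq I) (P : pred I) (F : I -> QHom (true :: W) (Qp m ++ R)) :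
  (forall i, P i -> SA (F i)) -> SA (\sum_(i <- r | P i) F i).
Proof. by move=> FS; apply: (big_ind _ (@SA0 m R W) (@SAD m R W)). Qed.
Lemma SA_Aop j m R W (g : QHom W (Qp m.-1 ++ R)) : (j < d)%N -> SA (Aop j g).
Proof.
move=> jd; exists (fun i : 'I_d => ((i : nat) == j)%:R *: g).
rewrite (bigD1 (Ordinal jd)) //= eqxx scale1r big1 ?addr0 // => i ij.
by rewrite -val_eqE /= in ij; rewrite (negbTE ij) scale0r Aop_0.
Qed.

(** The first strand of a symmetrized morphism either passes to Q_- or ends on Q_+^m with fewer than
    d dots; the resolution of the identity of Q_- Q_+ separates the two possibilities. *)
Lemma kap_phi_decomp m R W (f : QHom (true :: W) (Qp m ++ R)) :
  sy m R ∘ f = f -> SA (f - kap (phi f)).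
Proof.
(* Any such [h] must be [phi f], since [phi] kills the dotted terms and inverts [kap]. *)
suff key : sy m R ∘ f = f -> exists h, SA (f - kap h).
  move=> syf; have [h [g E]] := key syf.
  have fE : f = kap h + \sum_(j < d) Aop j (g j) by rewrite -E addrC subrK.
  have -> : phi f = h.
    by rewrite fE phiD phi_kap // phi_sum big1 ?addr0 // => j _; rewrite phi_Aop.
  by exists g.
elim: m R W f => [|m IH] R W f syf.
  exists (ad f); rewrite /kap kp0 ad_can subrr; exact: SA0.
set Y := Qp m ++ R; set h0 := gT' Y ∘ ad f; pose v j := epsd j Y ∘ ad f.
(* [gT_res], applied to the bent strand, gives a crossing part and d dotted cups; bent back and
   symmetrized, the latter are already of the form [Aop]. *)
have fE : f = up (gC Y) ∘ gS (false :: Y) ∘ up h0 + \sum_(j < d) gXn j Y ∘ up (v j).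
  apply: ad_inj; rewrite adD ad_compr ad_compl ad_sum /ad hcompA -gTE.
  rewrite -[LHS]hidl -/(ad f) (gT_res k lam Y) hcompDl -hcompA; congr (_ + _).
  rewrite hcomp_suml; apply: eq_bigr => j _.
  by rewrite -[RHS]/(ad _) ad_compr ad_gXn -hcompA.
(* In the crossing part the strand is capped off to the left of Q_+^m; induction on m moves the
   symmetrized cap to its right, up to dotted terms. *)
have [h' [g' E1]] : exists h, SA (sy m R ∘ gC Y - kap h).
  by apply: IH; rewrite hcompA sy_idem.
have f1E : sy m R ∘ gC Y = kap h' + \sum_(j < d) Aop j (g' j) by rewrite -E1 addrC subrK.
exists (sy m.+1 (false :: R) ∘ (up h' ∘ h0)).
have -> : f - kap (sy m.+1 (false :: R) ∘ (up h' ∘ h0)) =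
    \sum_(j < d) (sy m.+1 R ∘ up (Aop j (g' j)) ∘ gS (false :: Y) ∘ up h0)
    + \sum_(j < d) Aop j (m := m.+1) (v j).
  rewrite -{1}syf {1}fE hcompDr.
  have -> : sy m.+1 R ∘ (up (gC Y) ∘ gS (false :: Y) ∘ up h0)
     = sy m.+1 R ∘ up (kap h') ∘ gS (false :: Y) ∘ up h0 +
       \sum_(j < d) (sy m.+1 R ∘ up (Aop j (g' j)) ∘ gS (false :: Y) ∘ up h0).
    rewrite -{1}sy_upr // !hcompA -(hcompA _ (up (sy m R))) -wh_comp f1E whD hcompDr !hcompDl.
    by congr (_ + _); rewrite wh_sum hcomp_sumr !hcomp_suml.
  have -> : sy m.+1 R ∘ up (kap h') ∘ gS (false :: Y) ∘ up h0 = kap (sy m.+1 (false :: R) ∘ (up h' ∘ h0)).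
    rewrite kap_sy // /kap kpS !wh_comp !hcompA -(hcompA _ (up (up h'))) -gS_nat.
    by rewrite !hcompA.
  set KX := kap _; rewrite -[KX + _ + _]addrA [KX + _]addrC addrK; congr (_ + _).
  rewrite hcomp_sumr; apply: eq_bigr => j _; by rewrite AopS hcompA.
apply: SAD; apply: SA_sum => j _; last exact: SA_Aop.
case: (m) R f syf @Y h0 v fE h' g' E1 f1E => [|m'] R f syf Y h0 v fE h' g' E1 f1E.
  by rewrite Aop0 wh0 hcomp0r !hcomp0l; apply: SA0.
set w := up (g' j) ∘ h0.
(* The dots slide through the crossing, which the symmetrizer absorbs; the corrections carry a < j
   dots on the first strand and so remain below d. *)
have -> : sy m'.+2 R ∘ up (Aop j (g' j)) ∘ gS (false :: Y) ∘ up h0 =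
   Aop j (m := m'.+2) w - \sum_(a < j) Aop a (m := m'.+2) (gXn (j.-1 - a) (Qp m' ++ R) ∘ w).
  rewrite [X in up X]AopS !wh_comp !hcompA sy_upr // -(hcompA _ (up (up _)) (gS _)) -gS_nat.
  rewrite hcompA -(hcompA _ (up (up _)) (up h0)) -wh_comp -/w.
  transitivity (sy m'.+2 R ∘ (up (gXn j (Qp m' ++ R)) ∘ (gS (Qp m' ++ R) ∘ up w))).
    by rewrite !hcompA.
  have -> : up (gXn j (Qp m' ++ R)) ∘ (gS (Qp m' ++ R) ∘ up w) =
     gS (Qp m' ++ R) ∘ gXn j _ ∘ up w -
     \sum_(a < j) gXn a (true :: Qp m' ++ R) ∘ up (gXn (j.-1 - a) (Qp m' ++ R) ∘ w).
    have -> : gS (Qp m' ++ R) ∘ gXn j (true :: Qp m' ++ R) = up (gXn j (Qp m' ++ R)) ∘ gS _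
        + \sum_(a < j) gXn a (true :: Qp m' ++ R) ∘ up (gXn (j.-1 - a) (Qp m' ++ R)).
      exact: gS_gXn.
    rewrite hcompDl hcomp_suml hcompA -addrA -sumrB big1 ?addr0 // => a _.
    by rewrite wh_comp hcompA subrr.
  rewrite hcompBr !hcompA sy_gSr // AopS; congr (_ - _).
  by rewrite hcomp_sumr; apply: eq_bigr => a _; rewrite AopS !hcompA.
apply: SAD; first exact: SA_Aop.
apply: SAN; apply: SA_sum => a _; apply: SA_Aop; exact: ltn_trans (ltn_ord a) (ltn_ord j).
Qed.

Lemma gD_nat i u v (f : QHom u v) : gD k lam i v ∘ up f = up f ∘ gD k lam i u.
Proof.
rewrite /gD hcomp_bigl hcomp_bigr; apply: eq_bigr => j _.
by rewrite -hcompA -wh_comp act_nat wh_comp !hcompA gXn_nat.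
Qed.

Lemma epsd_nat i u v (f : QHom u v) : epsd i v ∘ dn (up f) = f ∘ epsd i u.
Proof. by rewrite /epsd -hcompA -wh_comp gD_nat wh_comp !hcompA gC'_nat. Qed.

(** The leading term is the part of the symmetrizer that leaves the new strand leftmost. The rest
    begins with a crossing: without dots it is killed by [epsd_gT], and sliding dots through it
    leaves fewer than j dots, which [epsd i] does not see when j is at most i. *)
Lemma Aop_expand i j m R W (g : QHom W (Qp m ++ R)) : (i < d)%N -> (j < d)%N -> sy m R ∘ g = g ->
  exists rest, [/\ m.+1%:R *: Aop j (m := m.+1) g = gXn j (Qp m ++ R) ∘ up g + rest,
    (g = 0 -> rest = 0) & ((j <= i)%N -> epsd i (Qp m ++ R) ∘ ad rest = 0)].
Proof.
move=> id' jd syg; case: m g syg => [|m] g syg.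
  by exists 0; rewrite AopS sy1 hidl scale1r addr0 ad0 hcomp0r.
set e := sy m.+1 R in syg *; set F := gXn j (Qp m.+1 ++ R) ∘ up g.
have eF : up e ∘ F = F by rewrite /F hcompA -gXn_nat -hcompA -wh_comp syg.
exists (m.+1%:R *: (up e ∘ (gS (Qp m ++ R) ∘ F))); split.
- rewrite AopS syE -hcompA -/F hcompZl scalerA divff ?natk_neq0 // scale1r.
  by rewrite hcompDl hcompZl -!hcompA eF.
- by move=> g0; rewrite /F g0 wh0 !hcomp0r scaler0.
move=> ji; rewrite adZ hcompZr ad_compl (hcompA (epsd _ _)) epsd_nat -hcompA.
have -> : gS (Qp m ++ R) ∘ F = up (gXn j (Qp m ++ R)) ∘ (gS (Qp m ++ R) ∘ up g) +
   \sum_(a < j) gXn a (true :: Qp m ++ R) ∘ up (gXn (j.-1 - a) (Qp m ++ R) ∘ g).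
  have -> : gS (Qp m ++ R) ∘ F = gS (Qp m ++ R) ∘ gXn j (true :: Qp m ++ R) ∘ up g by rewrite -hcompA.
  rewrite gS_gXn hcompDl -hcompA hcomp_suml; congr (_ + _).
  by apply: eq_bigr => a _; rewrite wh_comp hcompA.
rewrite adD ad_sum hcompDr hcomp_sumr big1 => [|a _].
  have E : epsd i (true :: Qp m ++ R) ∘ ad (gS (Qp m ++ R)) = 0.
    by rewrite /ad -gT_gU hcompA epsd_gT // hcomp0l.
  rewrite addr0 ad_compl (hcompA (epsd _ _)) epsd_nat -hcompA ad_compr.
  by rewrite (hcompA (epsd _ _)) E hcomp0l !hcomp0r scaler0.
have aj := ltn_ord a; rewrite ad_compr ad_gXn hcompA eps_eta //; last by lia.
by rewrite (_ : (i == a)%N = false) ?scale0r ?hcomp0l //; apply/eqP; lia.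
Qed.

(** Triangularity, by downward induction on the number of dots: once the terms with more than i dots
    vanish, [epsd i] isolates [g i] by [Aop_expand]. *)
Lemma Aop_sum_inj m R W (g : 'I_d -> QHom W (Qp m ++ R)) :
  (forall j, sy m R ∘ g j = g j) ->
  \sum_(j < d) Aop j (m := m.+1) (g j) = 0 -> forall j, g j = 0.
Proof.
move=> syg g0.
have step (i : 'I_d) : (forall j : 'I_d, (i < j)%N -> g j = 0) -> g i = 0.
  move=> gj.
  have /choice [rest restP] : forall j : 'I_d, exists rest,
    [/\ m.+1%:R *: Aop j (m := m.+1) (g j) = gXn j (Qp m ++ R) ∘ up (g j) + rest,
    (g j = 0 -> rest = 0) & ((j <= i)%N -> epsd i (Qp m ++ R) ∘ ad rest = 0)].
    by move=> j; apply: Aop_expand.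
  have := congr1 (fun f => epsd i (Qp m ++ R) ∘ ad (m.+1%:R *: f)) g0.
  rewrite scaler0 ad0 hcomp0r scaler_sumr ad_sum hcomp_sumr (bigD1 i) //= big1 ?addr0.
    have [-> _ /(_ (leqnn _)) E] := restP i.
    by rewrite adD hcompDr E addr0 ad_compr ad_gXn hcompA eps_eta // eqxx scale1r hidl.
  move=> j ij; have [-> g0r jr] := restP j; rewrite adD hcompDr.
  case: (leqP j i) => ji.
    rewrite jr // addr0 ad_compr ad_gXn hcompA eps_eta // eq_sym.
    by rewrite -val_eqE /= in ij; rewrite (negbTE ij) scale0r hcomp0l.
  by rewrite g0r gj // wh0 hcomp0r ad0 hcomp0r addr0.
move=> j; have [t] := ubnP (d - j); elim: t j => // t IH j jt; apply: step => i ji.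
by apply: IH; have := ltn_ord i; lia.
Qed.

End Strands.

End DottedCups.
Import DottedCups.

(** * Symmetrized maps out of Q_+^n: spanning families *)

Module MixedWords.

Local Open Scope ring_scope.
Local Open Scope hom_scope.

Section Strands.
Context (k : fieldType) (char0 : [pchar k] =i pred0).
Context (lam : {fsfun int -> nat with 0%N}).
Local Notation QHom := (QHom k lam).
Local Notation d := (level lam).
Local Notation gXn := (gXn k lam).
Local Notation gS := (gS k lam).
Local Notation sy := (sy k lam).
Local Notation up f := (wh true f).
Implicit Types u v w R W : word.
Local Notation Qp n := (nseq n true).
(** Transport with default value 0 when the words differ. It lets families indexed by numbers be
    defined first and their length conditions be supplied only in lemmas. *)
Definition recast u v u' v' (f : QHom u v) : QHom u' v' :=
  match @eqP _ u u', @eqP _ v v' with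
  | ReflectT e1, ReflectT e2 => idto k lam e2 ∘ f ∘ idto k lam (esym e1)
  | _, _ => 0
  end.

Lemma recast_id u v (f : QHom u v) : recast u v f = f.
Proof. by rewrite /recast; case: eqP => // p; case: eqP => // q; rewrite !idto_id hidl hidr. Qed.
Lemma recastD u v u' v' (f g : QHom u v) : recast u' v' (f + g) = recast u' v' f + recast u' v' g.
Proof. by rewrite /recast; case: (@eqP _ u u') => ?; case: (@eqP _ v v') => ?; rewrite ?addr0 // hcompDr hcompDl. Qed.
Lemma recastZ u v u' v' a (f : QHom u v) : recast u' v' (a *: f) = a *: recast u' v' f.
Proof. by rewrite /recast; case: (@eqP _ u u') => ?; case: (@eqP _ v v') => ?; rewrite ?scaler0 // hcompZr hcompZl. Qed.

(** Downward strands are accumulated next to [R], so that the recursion of [kq] on words holds by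
    computation. *)
Fixpoint nw q R : word := if q is q'.+1 then nw q' (false :: R) else R.

Fixpoint kq_def q m R W : QHom W (Qp m ++ nw q R) -> QHom (Qp q ++ W) (Qp m ++ R) :=
  match q return QHom W (Qp m ++ nw q R) -> QHom (Qp q ++ W) (Qp m ++ R) with
  | 0 => fun g => g
  | q'.+1 => fun g => kap (@kq_def q' m (false :: R) W g)
  end.
Definition kq q m R W (g : QHom W (Qp m ++ nw q R)) : QHom (Qp q ++ W) (Qp m ++ R) :=
  locked_with hom_key (@kq_def q m R W) g.
Lemma kq0 m R W (g : QHom W (Qp m ++ R)) : kq (q := 0) g = g.
Proof. by rewrite /kq unlock. Qed.
Lemma kqS q m R W (g : QHom W (Qp m ++ nw q (false :: R))) : kq (q := q.+1) g = kap (kq g).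
Proof. by rewrite /kq !unlock. Qed.

Lemma kqD q m R W (f g : QHom W (Qp m ++ nw q R)) : kq (f + g) = kq f + kq g.
Proof. by elim: q R f g => [|q IH] R f g; rewrite ?kq0 // !kqS IH kapD. Qed.
Lemma kqZ q m R W a (f : QHom W (Qp m ++ nw q R)) : kq (a *: f) = a *: kq f.
Proof. by elim: q R f => [|q IH] R f; rewrite ?kq0 // !kqS IH kapZ. Qed.
Lemma kq_nat q m R W W' (f : QHom W (Qp m ++ nw q R)) (g : QHom W' W) :
  kq (f ∘ g) = kq f ∘ ups q g.
Proof. by elim: q R f => [|q IH] R f; rewrite ?kq0 // !kqS IH kap_nat. Qed.
Lemma kq_sy q m R W (f : QHom W (Qp m ++ nw q R)) : kq (sy m _ ∘ f) = sy m R ∘ kq f.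
Proof. by elim: q R f => [|q IH] R f; rewrite ?kq0 // !kqS IH kap_sy. Qed.
Lemma kq_inj q m R W : injective (@kq q m R W).
Proof.
elim: q R => [|q IH] R f g; rewrite ?kq0 // !kqS => E; apply: IH.
by rewrite -[LHS]phi_kap E phi_kap.
Qed.

Section AK.
Context (R W : word) (q p : nat) (g : QHom W (Qp p ++ nw q R)).
(** Of the source strands the leftmost ones end on Q_+^m with the dots listed in [L], the other [q]
    become the downward strands of the target of [g]. Meaningful when [n = size L + q] and
    [m = size L + p]; all other values are defaults. *)
Fixpoint AK_def (L : seq nat) n m : QHom (Qp n ++ W) (Qp m ++ R) :=
  match L with
  | [::] => recast _ _ (kq g)
  | l :: L' => match n return QHom (Qp n ++ W) (Qp m ++ R) with
               | 0 => 0
               | n'.+1 => Aop l (AK_def L' n' m.-1)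
               end
  end.
End AK.
Definition AK R W q p (g : QHom W (Qp p ++ nw q R)) L n m : QHom (Qp n ++ W) (Qp m ++ R) :=
  locked_with hom_key (@AK_def R W q p) g L n m.

Lemma AK_nil R W q p (g : QHom W (Qp p ++ nw q R)) : AK g [::] q p = kq g.
Proof. by rewrite /AK unlock /= recast_id. Qed.
Lemma AK_cons R W q p (g : QHom W (Qp p ++ nw q R)) l L n m :
  AK g (l :: L) n.+1 m = Aop l (AK g L n m.-1).
Proof. by rewrite /AK unlock. Qed.
Lemma AKD R W q p (f g : QHom W (Qp p ++ nw q R)) L n m : AK (f + g) L n m = AK f L n m + AK g L n m.
Proof.
rewrite /AK unlock; elim: L n m => [|l L IH] [|n] m /=; rewrite ?kqD ?recastD ?addr0 //.
by rewrite IH AopD.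
Qed.
Lemma AKZ R W q p a (f : QHom W (Qp p ++ nw q R)) L n m : AK (a *: f) L n m = a *: AK f L n m.
Proof.
rewrite /AK unlock; elim: L n m => [|l L IH] [|n] m /=; rewrite ?kqZ ?recastZ ?scaler0 //.
by rewrite IH AopZ.
Qed.
Lemma AK0 R W q p L n m : AK (0 : QHom W (Qp p ++ nw q R)) L n m = 0.
Proof. by rewrite -[0](scale0r (0 : QHom W (Qp p ++ nw q R))) AKZ scale0r. Qed.
Lemma AK_sum R W q p L n m (I : Type) (r : seq I) (P : pred I) (F : I -> QHom W (Qp p ++ nw q R)) :
  AK (\sum_(i <- r | P i) F i) L n m = \sum_(i <- r | P i) AK (F i) L n m.
Proof. by apply: (big_morph (fun h => AK h L n m)) => [f g|]; rewrite ?AKD ?AK0. Qed.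

Lemma sy_AK R W q p (g : QHom W (Qp p ++ nw q R)) L n m : sy p _ ∘ g = g ->
  (size L + q = n)%N -> (size L + p = m)%N -> sy m R ∘ AK g L n m = AK g L n m.
Proof.
move=> syg; case: L n m => [|l L] n m <- <-; first by rewrite AK_nil -kq_sy syg.
by rewrite AK_cons sy_Aop.
Qed.

(* Symmetrizing the source is harmless under an Aop that is itself going to be symmetrized. *)
Lemma Aop_sy_sy l m n R W (f : QHom (Qp n ++ W) (Qp m.-1 ++ R)) :
  Aop l (f ∘ sy n W) ∘ sy n.+1 W = Aop l f ∘ sy n.+1 W.
Proof. by rewrite Aop_nat -hcompA sy_upl. Qed.
Lemma kap_sy_sy m n R W (f : QHom (Qp n ++ W) (Qp m ++ false :: R)) :
  kap (f ∘ sy n W) ∘ sy n.+1 W = kap f ∘ sy n.+1 W.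
Proof. by rewrite kap_nat -hcompA sy_upl. Qed.

Inductive Span n m R W : QHom (Qp n ++ W) (Qp m ++ R) -> Prop :=
  | Span0 : Span 0
  | SpanD f g : Span f -> Span g -> Span (f + g)
  | SpanAK L q p (g : QHom W (Qp p ++ nw q R)) : all (fun l => l < d)%N L ->
      (size L + q = n)%N -> (size L + p = m)%N -> sy p _ ∘ g = g -> Span (AK g L n m ∘ sy n W).

Lemma Span_sum n m R W (I : Type) (r : seq I) (P : pred I) (F : I -> QHom (Qp n ++ W) (Qp m ++ R)) :
  (forall i, P i -> Span (F i)) -> Span (\sum_(i <- r | P i) F i).
Proof. by move=> FS; apply: (big_ind _ (@Span0 n m R W) (@SpanD n m R W)). Qed.
Lemma SpanN n m R W (f : QHom (Qp n ++ W) (Qp m ++ R)) : Span f -> Span (- f).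
Proof.
elim=> [|f1 f2 _ IH1 _ IH2|L q p g Ld nE mE syg]; first by rewrite oppr0; apply: Span0.
  by rewrite opprD; apply: SpanD.
by rewrite -scaleN1r -hcompZl -AKZ; apply: SpanAK => //; rewrite hcompZr syg.
Qed.

Lemma Span_Aop l n m R W (f : QHom (Qp n ++ W) (Qp m.-1 ++ R)) :
  (l < d)%N -> (0 < m)%N -> Span f -> Span (Aop l f ∘ sy n.+1 W).
Proof.
move=> ld m0; elim=> [|f1 f2 _ IH1 _ IH2|L q p g Ld nE mE syg].
- by rewrite Aop_0 hcomp0l; apply: Span0.
- by rewrite AopD hcompDl; apply: SpanD.
rewrite Aop_sy_sy -AK_cons; apply: SpanAK => //=; rewrite ?ld // ?addSn ?nE //.
by rewrite mE prednK.
Qed.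

Definition all_span n := forall m R W (f : QHom (Qp n ++ W) (Qp m ++ R)),
  sy m R ∘ f = f -> f ∘ sy n W = f -> Span f.

Lemma all_span_Aop n l m R W (f : QHom (Qp n ++ W) (Qp m.-1 ++ R)) : all_span n -> (l < d)%N ->
  sy m.-1 R ∘ f = f -> Span (Aop l f ∘ sy n.+1 W).
Proof.
move=> IH ld syf; case: m f syf => [|m] f syf; first by rewrite Aop0 hcomp0l; apply: Span0.
rewrite -Aop_sy_sy; apply: Span_Aop => //; apply: IH; first by rewrite hcompA syf.
by rewrite -hcompA sy_idem.
Qed.

(** The new strand slides through the dotted strands by [kap_Aop], and the symmetrizer absorbs the
    crossings. Each correction is an [Aop] of a map with at most n source strands, to which the
    hypothesis applies. *)
Lemma all_span_kap L n m q p R W (g : QHom W (Qp p ++ nw q (false :: R))) :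
  (forall n', (n' <= n)%N -> all_span n') -> all (fun l => l < d)%N L ->
  (size L + q = n)%N -> (size L + p = m)%N -> sy p _ ∘ g = g ->
  Span (kap (AK g L n m) ∘ sy n.+1 W).
Proof.
move=> IH Ld nE mE syg; elim: L Ld n m nE mE IH => [|l L IHL] /= Ld n m nE mE IH.
  by case: _ / nE; case: _ / mE; rewrite AK_nil -kqS -AK_nil; apply: SpanAK.
case/andP: Ld => ld Ld; case: n nE IH => // n [nE] IH.
case: m mE => // m [mE]; rewrite AK_cons kap_Aop // /=.
have IHn n' : (n' <= n)%N -> all_span n' by move=> n'n; apply: IH; apply: leqW.
have syAK := sy_AK syg nE mE.
rewrite hcompBl -hcompA sy_gSl //; apply: SpanD.
  rewrite -(Aop_sy_sy (n := n.+1) (m := m.+1) l (kap (AK g L n m))).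
  apply: (Span_Aop (m := m.+1)) => //=; exact: IHL.
rewrite hcomp_suml; apply: SpanN; apply: Span_sum => a _.
apply: (all_span_Aop (m := m.+1)); [exact: IH | exact: ltn_trans (ltn_ord a) ld | ].
by rewrite /= hcompA -kap_sy // syAK.
Qed.

(** Strong induction on n: [kap_phi_decomp] peels off the first strand, and both [phi f] and the
    coefficients of the dotted terms have one source strand fewer. *)
Lemma sym_span n : all_span n.
Proof.
have [t] := ubnP n; elim: t n => // t IHt n nt m R W f syf fsy.
case: n nt f fsy syf => [|n] nt f fsy syf.
  rewrite -fsy -[X in X ∘ _]kq0 -(AK_nil (q := 0) f); exact: SpanAK.
have IH n' : (n' <= n)%N -> all_span n' by move=> n'n; apply: IHt; lia.
have [g E] := kap_phi_decomp char0 syf.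
have fE : f = kap (phi f) + \sum_(j < d) Aop j (g j) by rewrite -E addrC subrK.
rewrite -fsy [in X in Span X]fE hcompDl; apply: SpanD; last first.
  rewrite hcomp_suml; apply: Span_sum => j _; rewrite -Aop_sy //.
  by apply: all_span_Aop => //; [exact: IH | rewrite hcompA sy_idem].
rewrite -(kap_sy_sy (phi f)).
have syphi : sy m (false :: R) ∘ phi f = phi f by rewrite -phi_sy // syf.
have : Span (phi f ∘ sy n W).
  apply: (IH n (leqnn n)); first by rewrite (hcompA (sy _ _)) syphi.
  by rewrite -(hcompA (phi f)) sy_idem.
elim=> [|f1 f2 _ IH1 _ IH2|L q p h Ld nE mE syh].
- by rewrite kap0 hcomp0l; apply: Span0.
- by rewrite kapD hcompDl; apply: SpanD.
by rewrite kap_sy_sy; apply: (all_span_kap IH).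
Qed.

(** Splitting [f] by [kap_phi_decomp], the dotted part gives only strands with fewer than d dots,
    killed by [phi], while the [kap] part is computed by [kap_Aop]. *)
Lemma phi_Aop_gS l m R W (f : QHom (true :: W) (Qp m.-1 ++ R)) : (l < d)%N ->
  sy m.-1 R ∘ f = f -> phi (Aop l f ∘ gS W) = Aop l (phi f).
Proof.
move=> ld syf; have [g E] := kap_phi_decomp char0 syf.
have fE : f = kap (phi f) + \sum_(j < d) Aop j (g j) by rewrite -E addrC subrK.
rewrite [in LHS]fE AopD hcompDl phiD Aop_sum hcomp_suml phi_sum big1 ?addr0.
  have -> : Aop l (kap (phi f)) ∘ gS W = kap (Aop l (phi f)) + \sum_(a < l) Aop a (kap (phi f) ∘ gXn (l.-1 - a) W).
    by rewrite kap_Aop // subrK.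
  rewrite phiD phi_kap // phi_sum big1 ?addr0 // => a _.
  by rewrite phi_Aop //; apply: ltn_trans (ltn_ord a) ld.
move=> j _; have jd := ltn_ord j; rewrite Aop_gS // phiD phiD phi_Aop // add0r.
rewrite -scaleN1r phiZ !phi_sum !big_nat !big1 ?scaler0 ?addr0 // => b /andP[b1 b2]; apply: phi_Aop; lia.
Qed.

(** The factor is the proportion of the n + 1 averaged strands that pass to Q_-: [phi] only sees the
    arrangements in which the leftmost strand is one of these q + 1. *)
Lemma phi_AK R W q p (g : QHom W (Qp p ++ nw q (false :: R))) L n m :
  all (fun l => l < d)%N L -> sy p _ ∘ g = g -> kq (q := q.+1) g ∘ sy q.+1 W = kq (q := q.+1) g ->
  (size L + q = n)%N -> (size L + p = m)%N ->
  phi (AK (q := q.+1) g L n.+1 m ∘ sy n.+1 W) = (q.+1%:R / n.+1%:R) *: (AK g L n m ∘ sy n W).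
Proof.
move=> Ld syg kg; elim: L Ld n m => [|l L IH] /= Ld n m nE mE.
  case: _ / nE; case: _ / mE; rewrite AK_nil kg divff ?natk_neq0 // scale1r kqS phi_kap // AK_nil.
  have := congr1 (fun f => phi (f ∘ up (sy q W))) kg; rewrite -hcompA sy_upr // kg kqS phi_nat !phi_kap //.
case/andP: Ld => ld Ld; case: n nE => // n [nE]; case: m mE => // m [mE].
have syAK : sy m R ∘ AK (q := q.+1) g L n.+1 m = AK (q := q.+1) g L n.+1 m.
  by apply: sy_AK => //; rewrite addnS nE.
rewrite AK_cons syE hcompZr phiZ hcompDr phiD -Aop_nat phi_Aop // add0r hcompZr phiZ !hcompA.
rewrite -Aop_nat phi_nat phi_Aop_gS //; last by rewrite /= hcompA syAK.
rewrite /= (IH Ld n m) // AopZ hcompZl !scalerA AK_cons.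
rewrite -(Aop_sy_sy (m := m.+1) l (AK g L n m)); congr (_ *: _).
have n1 := natk_neq0 char0 n; have n2 := natk_neq0 char0 n.+1.
by rewrite -mulrA [n.+1%:R * _]mulrCA divff // mulr1 mulrC.
Qed.

Lemma phi_AK0 R W p (g : QHom W (Qp p ++ R)) L n m :
  all (fun l => l < d)%N L -> sy p _ ∘ g = g -> (size L = n.+1)%N -> (size L + p = m)%N ->
  phi (AK (q := 0) g L n.+1 m ∘ sy n.+1 W) = 0.
Proof.
move=> Ld syg; elim: L Ld n m => [|l L IH] //= /andP[ld Ld] n m [nE] mE.
case: m mE => // m [mE]; case: n nE => [|n] nE; first by rewrite sy1 hidr AK_cons phi_Aop.
have syAK : sy m R ∘ AK (q := 0) g L n.+1 m = AK (q := 0) g L n.+1 m.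
  by apply: sy_AK => //; rewrite addn0 nE.
rewrite AK_cons syE hcompZr phiZ hcompDr phiD -Aop_nat phi_Aop // add0r hcompZr phiZ !hcompA.
rewrite -Aop_nat phi_nat phi_Aop_gS //; last by rewrite /= hcompA syAK.
by rewrite /= (IH Ld n m) // Aop_0 hcomp0l !scaler0.
Qed.

End Strands.

End MixedWords.
Import MixedWords.

(** * Symmetrizers of downward strands, and sorting of dots *)

Module DownwardStrands.

Local Open Scope ring_scope.
Local Open Scope hom_scope.

Section Strands.
Context (k : fieldType) (char0 : [pchar k] =i pred0).
Context (lam : {fsfun int -> nat with 0%N}).
Local Notation QHom := (QHom k lam).
Local Notation hid := (hid k lam).
Local Notation d := (level lam).
Local Notation gS := (gS k lam).
Local Notation gC := (gC k lam).
Local Notation sy := (sy k lam).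
Local Notation kp := (kp k lam).
Local Notation up f := (wh true f).
Local Notation dn f := (wh false f).
Implicit Types u v w R W : word.
Local Notation Qp n := (nseq n true).
(** The downward crossing, defined as the double adjoint of the upward one between nested caps, so
    that [gSmE] holds by construction. *)
Definition gSm R : QHom (false :: false :: R) (false :: false :: R) :=
  locked_with hom_key (ad (ad (gC R ∘ up (gC (false :: R)) ∘ gS (false :: false :: R)))).

Lemma gSmE R : gC R ∘ up (gC (false :: R)) ∘ up (up (gSm R)) = gC R ∘ up (gC (false :: R)) ∘ gS _.
Proof. by rewrite /gSm unlock -hcompA -wh_comp !ad_can. Qed.

Lemma kp_gSm m R : kp m R ∘ up (kp m (false :: R)) ∘ gS (Qp m ++ false :: false :: R) =
  kp m R ∘ up (kp m (false :: R)) ∘ up (up (ups m (gSm R))).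
Proof.
elim: m => [|m IH]; first by rewrite !kp0 gSmE.
rewrite !kpS !wh_comp.
have E : up (kp m R) ∘ gS (Qp m ++ false :: R) ∘ (up (up (kp m (false :: R))) ∘ up (gS (Qp m ++ false :: false :: R)))
  = up (kp m R ∘ up (kp m (false :: R))) ∘ (gS _ ∘ up (gS (Qp m ++ false :: false :: R))).
  by rewrite !hcompA -(hcompA _ (gS _)) gS_nat wh_comp !hcompA.
rewrite E -(hcompA _ _ (gS (Qp m.+1 ++ _))) gS_braid -!hcompA (hcompA (up _) (up (gS _))) -wh_comp IH.
set X := kp m R ∘ up (kp m (false :: R)); set U := ups m (gSm R).
transitivity (up X ∘ (up (up (up U)) ∘ (gS (true :: Qp m ++ false :: false :: R) ∘ up (gS _)))).
  by rewrite wh_comp hcompA.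
congr (_ ∘ _); rewrite -[ups m.+1 _]/(up U).
by rewrite hcompA -gS_nat -!hcompA -!wh_comp gS_nat.
Qed.

Lemma kap_kap_gSm m R W (f : QHom W (Qp m ++ false :: false :: R)) :
  kap (kap (ups m (gSm R) ∘ f)) = kap (kap f) ∘ gS W.
Proof.
rewrite /kap !wh_comp !hcompA -kp_gSm -!hcompA; do 2 congr (_ ∘ _).
by rewrite gS_nat.
Qed.

Fixpoint wn q u v (f : QHom u v) : QHom (nw q u) (nw q v) :=
  match q return QHom (nw q u) (nw q v) with 0 => f | q'.+1 => wn q' (dn f) end.

Lemma kq_wn q m u v W (f : QHom u v) (g : QHom W (Qp m ++ nw q u)) :
  kq (ups m (wn q f) ∘ g) = ups m f ∘ kq g.
Proof.
elim: q u v f g => [|q IH] u v f g; first by rewrite !kq0.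
by rewrite !kqS /= IH /kap wh_comp !hcompA kp_nat.
Qed.

(** The recursion is that of [sy_def], read through the adjunction [kq]; this makes [kq_ms] an
    induction without further geometry. *)
Fixpoint ms_def q R : QHom (nw q R) (nw q R) :=
  match q return QHom (nw q R) (nw q R) with
  | 0 => hid R
  | q1.+1 => match q1 return QHom (nw q1.+1 R) (nw q1.+1 R) -> QHom (nw q1.+1 R) (nw q1.+1 R) with
    | 0 => id
    | q2.+1 => fun s => q2.+2%:R^-1 *: (s + q2.+1%:R *: (s ∘ wn q2 (gSm R) ∘ s))
    end (ms_def q1 (false :: R))
  end.
Definition ms q R := locked_with hom_key (ms_def q R).
Lemma ms0 R : ms 0 R = hid R. Proof. by rewrite /ms unlock. Qed.
Lemma ms1 R : ms 1 R = hid (false :: R). Proof. by rewrite /ms unlock. Qed.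
Lemma msE q R : ms q.+2 R = q.+2%:R^-1 *: (ms q.+1 (false :: R) +
   q.+1%:R *: (ms q.+1 (false :: R) ∘ wn q (gSm R) ∘ ms q.+1 (false :: R))).
Proof. by rewrite /ms !unlock. Qed.

Lemma upsD n u v (f g : QHom u v) : ups n (f + g) = ups n f + ups n g.
Proof. by elim: n => //= n ->; rewrite whD. Qed.
Lemma upsZ n u v a (f : QHom u v) : ups n (a *: f) = a *: ups n f.
Proof. by elim: n => //= n ->; rewrite whZ. Qed.

(** Symmetrizing the downward strands of the target is symmetrizing the corresponding upward strands
    of the source. As [kq] is injective, properties of [ms] follow from those of [sy]. *)
Lemma kq_ms q m R W (g : QHom W (Qp m ++ nw q R)) : kq (ups m (ms q R) ∘ g) = kq g ∘ sy q W.
Proof.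
elim: q R W g => [|[|q] IH] R W g; first by rewrite ms0 ups_id hidl sy0 hidr.
  by rewrite ms1 ups_id hidl sy1 hidr.
rewrite msE syE upsZ upsD upsZ !ups_comp hcompZl hcompDl hcompZl kqZ kqD kqZ hcompZr hcompDr hcompZr.
have E h : kq (q := q.+2) (ups m (ms q.+1 (false :: R)) ∘ h) = kq (q := q.+2) h ∘ up (sy q.+1 W).
  by rewrite kqS IH kap_nat -kqS.
congr (_ *: (_ + _ *: _)); first exact: E.
transitivity (kq (q := q.+2) (ups m (ms q.+1 (false :: R)) ∘ (ups m (wn q (gSm R)) ∘ (ups m (ms q.+1 (false :: R)) ∘ g)))).
  by rewrite !hcompA.
rewrite E !hcompA; congr (_ ∘ _).
transitivity (kq (q := q.+2) (ups m (ms q.+1 (false :: R)) ∘ g) ∘ gS (Qp q ++ W)); last by rewrite E.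
by rewrite -(hcompA (ups m _)) !kqS kq_wn kap_kap_gSm.
Qed.

Lemma ms_idem q R : ms q R ∘ ms q R = ms q R.
Proof.
apply: (kq_inj (m := 0)).
transitivity (kq (m := 0) (ups 0 (ms q R) ∘ (ups 0 (ms q R) ∘ hid (nw q R)))); first by rewrite hidr.
by rewrite !kq_ms -hcompA sy_idem // -(kq_ms (m := 0)) hidr.
Qed.

Definition sm p q R : QHom (Qp p ++ nw q R) (Qp p ++ nw q R) := sy p (nw q R) ∘ ups p (ms q R).

Lemma sm_idem p q R : sm p q R ∘ sm p q R = sm p q R.
Proof.
rewrite /sm hcompA -(hcompA (sy p _) (ups _ _) (sy p _)) -sy_nat hcompA sy_idem // -(hcompA _ _ (ups p _)).
by rewrite -ups_comp ms_idem.
Qed.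

Lemma sm_sy p q R W (g : QHom W (Qp p ++ nw q R)) : sm p q R ∘ g = g -> sy p _ ∘ g = g.
Proof. by move=> <-; rewrite /sm !hcompA sy_idem. Qed.
Lemma sm_kq p q R W (g : QHom W (Qp p ++ nw q R)) : sm p q R ∘ g = g -> kq g ∘ sy q W = kq g.
Proof.
move=> <-; rewrite /sm sy_nat -hcompA -kq_ms !hcompA.
by rewrite -ups_comp ms_idem.
Qed.

Lemma AK_ms R W q p (g : QHom W (Qp p ++ nw q R)) L n m :
  (size L + q = n)%N -> (size L + p = m)%N ->
  AK (ups p (ms q R) ∘ g) L n m ∘ sy n W = AK g L n m ∘ sy n W.
Proof.
elim: L n m => [|l L IH] /= n m <- <-; first by rewrite !AK_nil kq_ms -hcompA sy_idem.
rewrite !addSn !AK_cons -Aop_sy_sy // [in RHS]/= -(Aop_sy_sy char0 (m := (size L + p).+1) l (AK g L _ _)).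
by rewrite /= IH.
Qed.

Section Sorting.
Context (R W : word) (q p : nat) (g : QHom W (Qp p ++ nw q R)).

Inductive Low r D n m : QHom (Qp n ++ W) (Qp m ++ R) -> Prop :=
  | Low0 : Low r D 0
  | LowD f h : Low r D f -> Low r D h -> Low r D (f + h)
  | LowAK a L : all (fun l => l < d)%N L -> size L = r -> (sumn L < D)%N ->
      Low r D (a *: (AK g L n m ∘ sy n W)).

Lemma Low_mono r D D' n m (f : QHom (Qp n ++ W) (Qp m ++ R)) : (D <= D')%N -> Low r D f -> Low r D' f.
Proof.
move=> DD; elim=> [|f1 f2 _ IH1 _ IH2|a L Ld Lr LD]; [exact: Low0|exact: LowD|].
by apply: LowAK => //; apply: leq_trans DD.
Qed.
Lemma LowZ r D n m b (f : QHom (Qp n ++ W) (Qp m ++ R)) : Low r D f -> Low r D (b *: f).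
Proof.
elim=> [|f1 f2 _ IH1 _ IH2|a L Ld Lr LD]; first by rewrite scaler0; apply: Low0.
  by rewrite scalerDr; apply: LowD.
by rewrite scalerA; apply: LowAK.
Qed.
Lemma LowB r D n m (f h : QHom (Qp n ++ W) (Qp m ++ R)) : Low r D f -> Low r D h -> Low r D (f - h).
Proof. by move=> Lf Lh; rewrite -scaleN1r; apply: LowD => //; apply: LowZ. Qed.
Lemma Low_sum r D n m (I : Type) (s : seq I) (P : pred I) (F : I -> QHom (Qp n ++ W) (Qp m ++ R)) :
  (forall i, P i -> Low r D (F i)) -> Low r D (\sum_(i <- s | P i) F i).
Proof. by move=> FS; apply: (big_ind _ (@Low0 r D n m) (@LowD r D n m)). Qed.

Lemma Low_Aop l r D n m (f : QHom (Qp n ++ W) (Qp m.-1 ++ R)) : (l < d)%N ->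
  Low r D f -> Low r.+1 (l + D) (Aop l f ∘ sy n.+1 W).
Proof.
move=> ld; elim=> [|f1 f2 _ IH1 _ IH2|a L Ld Lr LD].
- by rewrite Aop_0 hcomp0l; apply: Low0.
- by rewrite AopD hcompDl; apply: LowD.
rewrite AopZ hcompZl Aop_sy_sy // -AK_cons; apply: LowAK => /=; rewrite ?ld ?Lr //.
by rewrite ltn_add2l.
Qed.

(** The symmetrizer absorbs a crossing of the first two source strands, so [Aop_gS] compares the two
    orders of dots; its corrections have one dot fewer. *)
Lemma AK_swap a b L n m : all (fun l => l < d)%N [:: a, b & L] ->
  Low (size L).+2 (a + (b + sumn L)) (AK g [:: a, b & L] n.+2 m ∘ sy n.+2 W - AK g [:: b, a & L] n.+2 m ∘ sy n.+2 W).
Proof.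
move=> /= /and3P[ad bd Ld].
have E : AK g [:: a, b & L] n.+2 m ∘ sy n.+2 W = AK g [:: a, b & L] n.+2 m ∘ gS (Qp n ++ W) ∘ sy n.+2 W.
  by rewrite -hcompA sy_gSl.
have E' (V : zmodType) (x y z : V) : x + y - z - x = y - z by rewrite addrAC [x + y]addrC addrK.
rewrite E !AK_cons /= Aop_gS // hcompBl hcompDl E'.
have Lb c : (minn a b <= c < maxn a b)%N ->
    Low (size L).+2 (a + (b + sumn L)) (Aop (a + b - c.+1) (m := m) (Aop c (AK g L n m.-2)) ∘ sy n.+2 W).
  move=> cab; have -> : Aop (a + b - c.+1) (m := m) (Aop c (AK g L n m.-2)) = AK g [:: a + b - c.+1, c & L]%N n.+2 m.
    by rewrite !AK_cons.
  by rewrite -[_ ∘ _]scale1r; apply: LowAK => //=; lia.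
apply: LowB.
  rewrite hcomp_bigl big_nat; apply: Low_sum => c cab; apply: Lb; lia.
rewrite hcomp_bigl big_nat; apply: Low_sum => c cab; apply: Lb; lia.
Qed.

Lemma AK_congr l r D n m L L' : (l < d)%N ->
  Low r D (AK g L n m.-1 ∘ sy n W - AK g L' n m.-1 ∘ sy n W) ->
  Low r.+1 (l + D) (AK g (l :: L) n.+1 m ∘ sy n.+1 W - AK g (l :: L') n.+1 m ∘ sy n.+1 W).
Proof.
move=> ld /(Low_Aop ld); rewrite -[_ - _]addr0 -scaleN1r addr0 AopD AopZ hcompDl hcompZl !Aop_sy_sy //.
by rewrite scaleN1r !AK_cons.
Qed.

Lemma AK_move a L1 L2 n m : all (fun l => l < d)%N (a :: L1 ++ L2) -> (size (a :: L1 ++ L2) + q = n)%N ->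
  Low (size L1 + size L2).+1 (a + sumn (L1 ++ L2))
    (AK g (a :: L1 ++ L2) n m ∘ sy n W - AK g (L1 ++ a :: L2) n m ∘ sy n W).
Proof.
elim: L1 n m => [|b L1 IH] n m; first by move=> *; rewrite /= subrr; apply: Low0.
move=> /= /and3P[ad bd Ld]; case: n => // -[|n] // nE.
rewrite -[X in Low _ _ X](subrKA (AK g [:: b, a & L1 ++ L2] n.+2 m ∘ sy n.+2 W)).
apply: LowD.
  by have := @AK_swap a b (L1 ++ L2) n m; rewrite size_cat /= ad bd Ld; apply.
apply: (Low_mono (D := (b + (a + sumn (L1 ++ L2)))%N)); first by lia.
apply: AK_congr => //; apply: IH; first by rewrite /= ad.
by move: nE => /= [<-].
Qed.

Lemma AK_perm L L' n m : perm_eq L L' -> all (fun l => l < d)%N L -> (size L + q = n)%N ->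
  Low (size L) (sumn L) (AK g L n m ∘ sy n W - AK g L' n m ∘ sy n W).
Proof.
elim: L L' n m => [|a L IH] L' n m.
  by rewrite perm_sym => /perm_nilP -> _ _; rewrite subrr; apply: Low0.
move=> pL Ld nE.
have [L2 [L3 [-> pLL]]] : exists L2 L3, L' = L2 ++ a :: L3 /\ perm_eq L (L2 ++ L3).
  have aL' : a \in L' by rewrite -(perm_mem pL) mem_head.
  case/splitPr: aL' pL => L2 L3 pL; exists L2, L3; split=> //.
  by move: pL; rewrite perm_sym -[a :: L3]cat1s perm_catCA perm_cons perm_sym.
have := Ld => /= /andP[ad Ld']; case: n nE => // n [nE].
rewrite -[X in Low _ _ X](subrKA (AK g (a :: L2 ++ L3) n.+1 m ∘ sy n.+1 W)).
apply: LowD; first by apply: AK_congr => //; apply: IH.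
have [sz sm'] : size L = (size L2 + size L3)%N /\ sumn L = sumn (L2 ++ L3).
  by rewrite -size_cat (perm_size pLL) (perm_sumn pLL).
rewrite sz sm'; apply: AK_move; first by rewrite /= ad -(perm_all _ pLL).
by rewrite /= size_cat -sz -nE.
Qed.

End Sorting.
End Strands.

End DownwardStrands.
Import DownwardStrands.

(** * Linear independence by leading numbers of dots *)

Module Independence.

Local Open Scope ring_scope.
Local Open Scope hom_scope.

Section Strands.
Context (k : fieldType) (char0 : [pchar k] =i pred0).
Context (lam : {fsfun int -> nat with 0%N}).
Local Notation QHom := (QHom k lam).
Local Notation d := (level lam).
Local Notation gS := (gS k lam).
Local Notation sy := (sy k lam).
Local Notation up f := (wh true f).
Implicit Types u v w R W : word.
Local Notation Qp n := (nseq n true).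
Lemma tuple_of_bounded n e (L : seq nat) : all (fun l => l < e)%N L -> size L = n ->
  exists t : n.-tuple 'I_e, map val t = L.
Proof.
move=> Ld <-; elim: L Ld => [|l L IH] /= => [_|/andP[ld /IH[t tE]]]; first by exists [tuple].
by exists [tuple of Ordinal ld :: t]; rewrite /= tE.
Qed.

Section Leading.
Context (R W : word) (p : nat) (g : QHom W (Qp p ++ R)).
Local Notation AK := (AK (q := 0)).

(** Nonnegative rationals inside [k]. The field carries no order, and this stands in for the
    positivity that prevents leading coefficients from cancelling. *)
Definition nnk (c : k) := exists a b : nat, c = a%:R / b.+1%:R.
Lemma nnk0 : nnk 0. Proof. by exists 0%N, 0%N; rewrite mul0r. Qed.
Lemma nnk_nat a b : nnk (a%:R / b.+1%:R). Proof. by exists a, b. Qed.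
Lemma nnkM c e : nnk c -> nnk e -> nnk (c * e).
Proof.
case=> a [b ->] [a' [b' ->]]; exists (a * a')%N, (b'.+1 * b + b')%N.
have -> : (b'.+1 * b + b').+1 = (b.+1 * b'.+1)%N by lia.
by rewrite 2!natrM invfM mulrACA.
Qed.
Lemma nnkD c e : nnk c -> nnk e -> nnk (c + e).
Proof.
case=> a [b ->] [a' [b' ->]]; exists (a * b'.+1 + a' * b.+1)%N, (b'.+1 * b + b')%N.
have -> : (b'.+1 * b + b').+1 = (b.+1 * b'.+1)%N by lia.
have n1 := natk_neq0 char0 b; have n2 := natk_neq0 char0 b'.
by rewrite addf_div // natrD 3!natrM.
Qed.
Lemma nnk_add_neq0 a b c : nnk c -> a.+1%:R / b.+1%:R + c != 0.
Proof.
case=> a' [b' ->]; have n1 := natk_neq0 char0 b; have n2 := natk_neq0 char0 b'.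
rewrite addf_div // mulf_neq0 //; last by rewrite invr_eq0 mulf_neq0.
have -> : a.+1%:R * b'.+1%:R + a'%:R * b.+1%:R = ((a.+1 * b' + a + a' * b.+1).+1)%:R :> k.
  by rewrite -2!natrM -natrD; congr (_%:R); lia.
exact: natk_neq0.
Qed.

Definition okc (L0 : seq nat) (c : k) (L : seq nat) : Prop :=
  [/\ all (fun l => l < d)%N L, size L = size L0 &
     ((sumn L < sumn L0)%N \/ perm_eq L L0 /\ nnk c)].

Inductive NN (L0 : seq nat) n m : QHom (Qp n ++ W) (Qp m ++ R) -> Prop :=
  | NN0 : NN L0 0
  | NNs c L f : okc L0 c L -> NN L0 f -> NN L0 (c *: AK g L n m + f).

Lemma NND L0 n m (f h : QHom (Qp n ++ W) (Qp m ++ R)) : NN L0 f -> NN L0 h -> NN L0 (f + h).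
Proof. by elim=> [|c L f' ok _ IH] Nh; rewrite ?add0r // -addrA; apply: NNs => //; apply: IH. Qed.
Lemma NN_sum L0 n m (I : Type) (s : seq I) (P : pred I) (F : I -> QHom (Qp n ++ W) (Qp m ++ R)) :
  (forall i, P i -> NN L0 (F i)) -> NN L0 (\sum_(i <- s | P i) F i).
Proof. by move=> FS; apply: (big_ind _ (@NN0 L0 n m) (@NND L0 n m)). Qed.

Lemma NN_scale L0 L1 c n m (f : QHom (Qp n ++ W) (Qp m ++ R)) : okc L0 c L1 -> NN L1 f -> NN L0 (c *: f).
Proof.
case=> _ s1 b1; elim=> [|e L f' [Ld sL bL] _ IH]; first by rewrite scaler0; apply: NN0.
rewrite scalerDr scalerA; apply: NNs => //; split=> //; first by rewrite sL.
case: b1 => [b1|[b1 b1n]]; case: bL => [bL|[bL bLn]].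
- by left; apply: ltn_trans b1.
- by left; rewrite (perm_sumn bL).
- by left; rewrite -(perm_sumn b1).
by right; split; [apply: perm_trans b1|apply: nnkM].
Qed.

Lemma NN_Aop L0 l n m (f : QHom (Qp n ++ W) (Qp m.-1 ++ R)) : (l < d)%N ->
  NN L0 f -> @NN (l :: L0) n.+1 m (Aop l f).
Proof.
move=> ld; elim=> [|e L f' [Ld sL bL] _ IH]; first by rewrite Aop_0; apply: NN0.
rewrite AopD AopZ -AK_cons; apply: NNs => //; split; rewrite /= ?ld ?sL //.
by case: bL => [bL|[bL bn]]; [left; rewrite ltn_add2l|right; rewrite perm_cons].
Qed.

(* The identity term of the symmetrizer contributes positively, all others nonnegatively. *)
Lemma AK_sy_leading L n m : all (fun l => l < d)%N L -> size L = n -> (size L + p)%N = m ->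
  exists a b f, AK g L n m ∘ sy n W = (a.+1%:R / b.+1%:R) *: AK g L n m + f /\ NN L f.
Proof.
elim: n L m => [|n IH] L m.
  move=> _ _ _; exists 0%N, 0%N, 0; split; last exact: NN0.
  by rewrite sy0 hidr divr1 scale1r addr0.
case: n IH => [|n] IH.
  move=> _ _ _; exists 0%N, 0%N, 0; split; last exact: NN0.
  by rewrite sy1 hidr divr1 scale1r addr0.
have IHN L1 m1 : all (fun l => l < d)%N L1 -> size L1 = n.+1 -> (size L1 + p)%N = m1 ->
    NN L1 (AK g L1 n.+1 m1 ∘ sy n.+1 W).
  move=> L1d s1 m1E; have [a [b [f [-> Nf]]]] := IH L1 m1 L1d s1 m1E.
  by apply: NNs => //; split=> //; right; split=> //; apply: nnk_nat.
case: L m => // l L [|m] //= /andP[ld Ld] [sL] [mE].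
have [a [b [f [E Nf]]]] := IH L m Ld sL mE.
set X := AK g L n.+1 m ∘ sy n.+1 W in E *.
have XN : NN L X by apply: IHN.
have main : @NN (l :: L) n.+2 m.+1 (Aop l (m := m.+1) X ∘ gS (Qp n ++ W) ∘ up (sy n.+1 W)).
  elim: XN => [|c L1 f' ok _ IH2]; first by rewrite Aop_0 !hcomp0l; apply: NN0.
  rewrite AopD AopZ !hcompDl !hcompZl; apply: NND IH2.
  case: ok => L1d s1 bL1; case: L1 L1d s1 bL1 => [|l1 L2] L1d s1 bL1; first by rewrite -s1 in sL.
  have /= /andP[l1d L2d] := L1d; have s2 : size L2 = n by move: s1; rewrite sL => -[].
  rewrite AK_cons; have := Aop_gS char0 l l1 (m := m.+1) (AK g L2 n m.-1) => /= ->.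
  have pm : (size (l1 :: L2) + p)%N = m by rewrite s1.
  have key a' b' c' : (a' < d)%N -> (b' < d)%N -> okc (l :: L) c' [:: a', b' & L2] ->
      @NN (l :: L) n.+2 m.+1 (c' *: (Aop a' (m := m.+1) (Aop b' (m := m) (AK g L2 n m.-1)) ∘ up (sy n.+1 W))).
    move=> a'd b'd ok; rewrite -Aop_nat -AK_cons; apply: NN_scale ok _.
    by apply: NN_Aop => //; apply: IHN => /=; rewrite ?b'd ?s2 // -pm /= s2.
  have low a' b' c' : (a' + b' < l + l1)%N -> (a' < d)%N -> (b' < d)%N -> okc (l :: L) c' [:: a', b' & L2].
    move=> ab a'd b'd; split; rewrite /= ?a'd ?b'd ?s2 ?sL //; left.
    by case: bL1 => [/=|[/perm_sumn /=]]; lia.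
  rewrite hcompBl hcompDl scalerBr scalerDr; apply: NND; first apply: NND.
  - apply: key => //; split; rewrite /= ?l1d ?ld ?s2 ?sL //.
    case: bL1 => [/= bL1|[pL1 nc]]; [left; lia|right; split=> //].
    by rewrite (perm_catCA [:: l1] [:: l] L2) /= perm_cons.
  - rewrite hcomp_bigl scaler_sumr big_nat; apply: NN_sum => i ib.
    by apply: key; [lia|lia|apply: low; lia].
  rewrite -scaleN1r scalerA hcomp_bigl scaler_sumr big_nat; apply: NN_sum => i ib.
  by apply: key; [lia|lia|apply: low; lia].
have EE : AK g (l :: L) n.+2 m.+1 ∘ sy n.+2 W = n.+2%:R^-1 *: (Aop l (m := m.+1) X +
    n.+1%:R *: (Aop l (m := m.+1) X ∘ gS (Qp n ++ W) ∘ up (sy n.+1 W))).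
  by rewrite /X (Aop_nat l (m := m.+1) (AK g L n.+1 m)) AK_cons syE hcompZr hcompDr hcompZr !hcompA.
rewrite {}EE; exists a, (n.+2 * b + n.+1)%N; eexists; split.
  rewrite {1}E AopD AopZ -AK_cons scalerDr scalerDr scalerA -addrA; congr (_ *: _ + _).
  have -> : (n.+2 * b + n.+1).+1 = (n.+2 * b.+1)%N by lia.
  by rewrite natrM invfM mulrCA.
have okn c : nnk c -> okc (l :: L) c (l :: L) by move=> nc; split; rewrite /= ?ld //; right.
have n1 : nnk (n.+2%:R^-1) by exists 1%N, n.+1; rewrite mul1r.
apply: NND; first by apply: NN_scale (okn _ n1) _; apply: NN_Aop.
apply: NN_scale (okn _ n1) _; apply: NN_scale (okn _ _) main.
by exists n.+1, 0%N; rewrite divr1.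
Qed.

Lemma AK_coefs L n m : all (fun l => l < d)%N L -> size L = n -> (size L + p)%N = m ->
  exists c : seq nat -> k,
    [/\ AK g L n m ∘ sy n W = \sum_(t : n.-tuple 'I_d) c (map val t) *: AK g (map val t) n m,
      (forall s, (sumn L <= sumn s)%N -> c s != 0 -> perm_eq s L) & c L != 0].
Proof.
move=> Ld sL mE; have [a [b [f [-> Nf]]]] := AK_sy_leading Ld sL mE.
have one e L1 : all (fun l => l < d)%N L1 -> size L1 = n ->
    e *: AK g L1 n m = \sum_(t : n.-tuple 'I_d) (if L1 == map val t then e else 0) *: AK g (map val t) n m.
  move=> L1d s1; have [t tE] : exists t : n.-tuple 'I_d, map val t = L1.
    exact: tuple_of_bounded.

  rewrite (bigD1 t) //= tE eqxx big1 ?addr0 // => t' tt'.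
  case: eqP => [E|_]; last by rewrite scale0r.
  by move: tt'; rewrite -tE in E; rewrite (val_inj (inj_map val_inj (esym E))) eqxx.
have [c' [-> c'P]] : exists c', f = \sum_(t : n.-tuple 'I_d) c' (map val t) *: AK g (map val t) n m /\
    forall s, (sumn L <= sumn s)%N -> nnk (c' s) /\ (c' s != 0 -> perm_eq s L).
  elim: Nf => [|e L1 h [L1d s1 bL1] _ [c' [-> c'P]]].
    exists (fun=> 0); split; first by rewrite big1 // => t _; rewrite scale0r.
    by move=> s _; split; [apply: nnk0|rewrite eqxx].
  exists (fun s => (if L1 == s then e else 0) + c' s); split.
    rewrite (one e L1) ?s1 // -big_split; apply: eq_bigr => t _; by rewrite scalerDl.
  move=> s Ls; have [c1 c2] := c'P s Ls; case: eqP => [E|_]; last by rewrite add0r.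
  have [pL ne] : perm_eq L1 L /\ nnk e by case: bL1 => //; rewrite E; lia.
  by split; [apply: nnkD|rewrite -E].
exists (fun s => (if L == s then a.+1%:R / b.+1%:R else 0) + c' s); split.
- rewrite (one _ L) // -big_split; apply: eq_bigr => t _; by rewrite scalerDl.
- move=> s Ls; case: (L =P s) => [->|_]; rewrite ?perm_refl // add0r; by have [] := c'P s Ls.
rewrite eqxx; apply: nnk_add_neq0; by have [] := c'P L (leqnn _).
Qed.

End Leading.

Lemma big_tuple_cons n (V : nmodType) (F : n.+1.-tuple 'I_d -> V) :
  \sum_t F t = \sum_(j < d) \sum_(t : n.-tuple 'I_d) F [tuple of j :: t].
Proof.
rewrite pair_bigA /= (reindex (fun x : 'I_d * n.-tuple 'I_d => [tuple of x.1 :: x.2])) //=.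
exists (fun t => (thead t, [tuple of behead t])) => [[j t] _|t _] /=.
  by congr (_, _); apply: val_inj.
by apply: val_inj; case: (tupleP t) => a s /=; rewrite theadE.
Qed.

(** Before symmetrization of the source, all lists of dots give independent families, by
    [Aop_sum_inj] applied to one strand after the other. *)
Lemma AK_indep n m R W p (G : n.-tuple 'I_d -> QHom W (Qp p ++ R)) : (n + p)%N = m ->
  (forall t, sy p R ∘ G t = G t) ->
  \sum_t AK (q := 0) (G t) (map val t) n m = 0 -> forall t, G t = 0.
Proof.
elim: n m G => [|n IH] m G mE syG E t.
  move: E; rewrite (bigD1 t) //= big1 ?addr0 => [|t' t't]; last by rewrite tuple0 (tuple0 t) eqxx in t't.
  by rewrite tuple0 /=; case: _ / mE; rewrite (AK_nil (q := 0)) kq0.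
case: m mE E => // m [mE]; rewrite big_tuple_cons => E.
have E2 : \sum_(j < d) Aop j (m := m.+1) (\sum_(t : n.-tuple 'I_d) AK (q := 0) (G [tuple of j :: t]) (map val t) n m) = 0.
  rewrite -[RHS]E; apply: eq_bigr => j _; rewrite Aop_sum; apply: eq_bigr => t' _.
  by rewrite -AK_cons.
case: (tupleP t) => j t'; apply: (IH m (fun t' => G [tuple of j :: t'])) => //.
apply: (Aop_sum_inj char0 _ E2) => i; rewrite hcomp_sumr; apply: eq_bigr => s _.
by apply: (@sy_AK k char0 lam _ _ 0 p (G [tuple of i :: s])); rewrite ?syG // size_map size_tuple // addn0.
Qed.

(** After symmetrization only sorted lists can be independent. A coefficient that is nonzero and has
    maximal total number of dots is detected at its own list: any other term reaching that list has
    a rearrangement of it, hence the same sorted list. *)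
Lemma AK_pure_inj n m R W p (I : finType) (P : pred I) (L : I -> seq nat) (g : I -> QHom W (Qp p ++ R)) :
  (n + p)%N = m ->
  (forall i, P i -> [/\ all (fun l => l < d)%N (L i), size (L i) = n, sorted leq (L i) & sy p R ∘ g i = g i]) ->
  {in P &, injective L} ->
  \sum_(i | P i) AK (q := 0) (g i) (L i) n m ∘ sy n W = 0 -> forall i, P i -> g i = 0.
Proof.
move=> mE HP Linj E i Pi; apply: contrapT => gi0.
have Qi : P i && (g i != 0) by rewrite Pi; apply/eqP.
(* Among the terms with nonzero coefficient, one with the most dots is chosen. *)
case: (@arg_maxnP I i (fun i => P i && (g i != 0)) (fun i => sumn (L i)) Qi) => i0 /andP[Pi0 gi0'] i0max.
have /choice [c cP] : forall i, exists c : seq nat -> k, P i ->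
   [/\ AK (q := 0) (g i) (L i) n m ∘ sy n W = \sum_(t : n.-tuple 'I_d) c (map val t) *: AK (q := 0) (g i) (map val t) n m,
      (forall s, (sumn (L i) <= sumn s)%N -> c s != 0 -> perm_eq s (L i)) & c (L i) != 0].
  move=> j; case: (boolP (P j)) => Pj; last by exists (fun=> 0).
  have [Ld Ln _ _] := HP j Pj.
  have mE' : (size (L j) + p)%N = m by rewrite Ln.
  by have [c cP] := AK_coefs (g j) Ld Ln mE'; exists c.
have [Ld Ln Ls syg] := HP i0 Pi0.
have [t0 t0E] : exists t : n.-tuple 'I_d, map val t = L i0 by apply: tuple_of_bounded.
have := @AK_indep n m R W p (fun t => \sum_(i | P i) c i (map val t) *: g i) mE.
move/(_ _ _ t0) => H.
have {}H : \sum_(i | P i) c i (L i0) *: g i = 0.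
  rewrite -t0E; apply: H.
    move=> t; rewrite hcomp_bigr; apply: eq_bigr => j Pj; rewrite hcompZr.
    by have [_ _ _ ->] := HP j Pj.
  rewrite -[RHS]E.
  transitivity (\sum_(t : n.-tuple 'I_d) \sum_(i | P i) c i (map val t) *: AK (q := 0) (g i) (map val t) n m).
    by apply: eq_bigr => t _; rewrite AK_sum; apply: eq_bigr => j _; rewrite AKZ.
  rewrite exchange_big /=; apply: eq_bigr => j Pj; by have [-> _ _] := cP j Pj.
move: H; rewrite (bigD1 i0) //= big1 ?addr0 => [|j /andP[Pj ji0]].
  move/eqP; rewrite scaler_eq0 (negbTE gi0') orbF; apply/negP.
  by have [_ _] := cP i0 Pi0.
case: (eqVneq (g j) 0) => [->|gj]; first by rewrite scaler0.
case: (eqVneq (c j (L i0)) 0) => [->|cj]; first by rewrite scale0r.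
have [_ /(_ (L i0)) cj2 _] := cP j Pj; have [_ _ Lsj _] := HP j Pj.
have pL : perm_eq (L i0) (L j) by apply: cj2 => //; apply: i0max; rewrite Pj.
case/eqP: ji0; apply: Linj => //.
by apply: (sorted_eq leq_trans anti_leq) => //; rewrite perm_sym.
Qed.
End Strands.

End Independence.
Import Independence.

(** * Unique decomposition of symmetrized maps *)

Module Decomposition.

Local Open Scope ring_scope.
Local Open Scope hom_scope.

Section Strands.
Context (k : fieldType) (char0 : [pchar k] =i pred0).
Context (lam : {fsfun int -> nat with 0%N}).
Local Notation QHom := (QHom k lam).
Local Notation d := (level lam).
Local Notation sy := (sy k lam).
Local Notation up f := (wh true f).
Implicit Types u v w R W : word.
Local Notation Qp n := (nseq n true).
Lemma kq_pred q m R W (g : QHom W (Qp m ++ nw q (false :: R))) :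
  kq (q := q.+1) g ∘ sy q.+1 W = kq (q := q.+1) g -> kq g ∘ sy q W = kq g.
Proof.
move=> kg; have := congr1 (fun f => phi (f ∘ up (sy q W))) kg.
by rewrite -hcompA sy_upr // kg kqS phi_nat !phi_kap.
Qed.

Lemma phi_AK_pred R W q p (g : QHom W (Qp p ++ nw q R)) L n m :
  all (fun l => l < d)%N L -> sy p _ ∘ g = g -> kq g ∘ sy q W = kq g ->
  (size L + q = n.+1)%N -> (size L + p = m)%N ->
  phi (AK g L n.+1 m ∘ sy n.+1 W) = if q == 0%N then 0 else
    AK (q := q.-1) ((q%:R / n.+1%:R) *: recast W (Qp p ++ nw q.-1 (false :: R)) g) L n m ∘ sy n W.
Proof.
case: q g => [|q] g Ld syg kg nE mE; first by apply: (phi_AK0 char0 Ld syg) => //; rewrite -nE addn0.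
rewrite /= AKZ hcompZl.
have -> : recast W (Qp p ++ nw q (false :: R)) (g : QHom W (Qp p ++ nw q (false :: R))) = g by apply: recast_id.
by apply: phi_AK => //; move: nE; rewrite addnS => -[].
Qed.

Lemma recast_eq0 u v u' v' (f : QHom u v) : u = u' -> v = v' -> recast u' v' f = 0 -> f = 0.
Proof. by move=> E1 E2; case: _ / E1; case: _ / E2; rewrite recast_id. Qed.

(** The types of the coefficients depend on the index; once those with downward strands vanish, the
    others have the common target [Qp (m - n) ++ R] and [recast] brings them into [AK_pure_inj]. *)
Lemma AK_inj_pure n m R W (I : finType) (P : pred I) (L : I -> seq nat) (q p : I -> nat)
    (g : forall i, QHom W (Qp (p i) ++ nw (q i) R)) :
  (forall i, P i -> [/\ all (fun l => l < d)%N (L i), sorted leq (L i),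
     (size (L i) + q i = n /\ size (L i) + p i = m)%N & sy (p i) _ ∘ g i = g i]) ->
  {in P &, injective L} -> (forall i, P i -> q i != 0%N -> g i = 0) ->
  \sum_(i | P i) AK (g i) (L i) n m ∘ sy n W = 0 -> forall i, P i -> g i = 0.
Proof.
move=> HP Linj g0 E i Pi; case: (eqVneq (q i) 0%N) => [qi|]; last exact: g0.
have mE : (n + (m - n) = m)%N by have [_ _ [? ?] _] := HP i Pi; lia.
pose gg j := recast W (Qp (m - n) ++ R) (g j).
have wE j : P j -> q j = 0%N -> Qp (p j) ++ nw (q j) R = Qp (m - n) ++ R.
  move=> Pj qj; have [_ _ [? ?] _] := HP j Pj; rewrite qj /=; congr (nseq _ _ ++ _); lia.
have ggP j : P j -> q j = 0%N -> AK (q := 0) (gg j) (L j) n m = AK (g j) (L j) n m /\ sy (m - n) R ∘ gg j = gg j.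
  move=> Pj qj; have [_ _ [h1 h2] syj] := HP j Pj.
  have pj : p j = (m - n)%N by lia.
  rewrite /gg; move: (g j) syj; rewrite qj pj => h syh.
  by rewrite (recast_id (h : QHom W (Qp (m - n) ++ R))).
apply: (recast_eq0 (erefl W) (wE i Pi qi)).
apply: (@AK_pure_inj k char0 lam n m R W (m - n) I (fun j => P j && (q j == 0%N)) L gg mE); last by rewrite Pi qi eqxx.
- move=> j /andP[Pj /eqP qj]; have [? ? [? ?] _] := HP j Pj; have [_ ->] := ggP j Pj qj; split=> //; lia.
- by move=> j1 j2 /andP[P1 _] /andP[P2 _]; apply: Linj.
rewrite -[RHS]E [RHS](bigID (fun j => q j == 0%N)) /= [X in _ = _ + X]big1 ?addr0.
  by apply: eq_bigr => j /andP[Pj /eqP qj]; have [-> _] := ggP j Pj qj.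
by move=> j /andP[Pj qj]; rewrite g0 // AK0 hcomp0l.
Qed.

Lemma recast_pred R W q p (g : QHom W (Qp p ++ nw q R)) : q != 0%N ->
  sy p _ ∘ g = g -> kq g ∘ sy q W = kq g ->
  let g' := recast W (Qp p ++ nw q.-1 (false :: R)) g in
  [/\ sy p _ ∘ g' = g', kq g' ∘ sy q.-1 W = kq g' & (g' = 0 -> g = 0)].
Proof.
case: q g => // q g _ syg kg /=.
have -> : recast W (Qp p ++ nw q (false :: R)) (g : QHom W (Qp p ++ nw q (false :: R))) = g by apply: recast_id.
by split=> //; apply: kq_pred.
Qed.

(** [phi] kills the terms without downward strands and, up to the nonzero factor of [phi_AK], turns
    the others into terms with one strand fewer. Induction on n gives the vanishing of the latter,
    and [AK_inj_pure] that of the former. *)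
Lemma AK_inj n m R W (I : finType) (P : pred I) (L : I -> seq nat) (q p : I -> nat)
    (g : forall i, QHom W (Qp (p i) ++ nw (q i) R)) :
  (forall i, P i -> [/\ all (fun l => l < d)%N (L i), sorted leq (L i),
     (size (L i) + q i = n /\ size (L i) + p i = m)%N, sy (p i) _ ∘ g i = g i &
     kq (g i) ∘ sy (q i) W = kq (g i)]) ->
  {in P &, injective L} ->
  \sum_(i | P i) AK (g i) (L i) n m ∘ sy n W = 0 -> forall i, P i -> g i = 0.
Proof.
elim: n m R P q p g => [|n IH] m R P q p g HP Linj E.
  apply: AK_inj_pure E => // j Pj; first by have [? ? ? ? _] := HP j Pj.
  by have [_ _ [qj _] _ _] := HP j Pj; rewrite -leqn0 -qj leq_addl.
apply: AK_inj_pure (E) => // [j Pj|i Pi qi].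
  by have [? ? ? ? _] := HP j Pj.
have [_ _ [qiE _] syi kqi] := HP i Pi; have [_ _ gi0] := recast_pred qi syi kqi; apply: gi0.
pose c j : k := (q j)%:R / n.+1%:R.
have ci : c i != 0.
  by rewrite /c; case: (q i) qi => // qj _; rewrite mulf_neq0 ?invr_eq0 ?natk_neq0.
pose g' j := c j *: recast W (Qp (p j) ++ nw (q j).-1 (false :: R)) (g j).
have : g' i = 0.
  apply: (IH m (false :: R) (fun j => P j && (q j != 0%N)) (fun j => (q j).-1) p g'); last by rewrite Pi.
  - move=> j /andP[Pj qj]; have [? ? [h1 h2] syj kqj] := HP j Pj; have [s1 s2 _] := recast_pred qj syj kqj.
    split=> //; first by split=> //; lia.
      by rewrite hcompZr s1.
    by rewrite kqZ hcompZl s2.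
  - by move=> j1 j2 /andP[P1 _] /andP[P2 _]; apply: Linj.
  have := congr1 (fun f => phi f) E; rewrite phi0 phi_sum => E2; rewrite -[RHS]E2 big_mkcondr.
  apply: eq_bigr => j Pj; have [? ? [h1 h2] syj kqj] := HP j Pj.
  by rewrite phi_AK_pred //; case: eqP.
by move/eqP; rewrite scaler_eq0 (negbTE ci) => /eqP.
Qed.

(** The index set of the summands of Q_-^n Q_+^m: a sorted list of r numbers of dots stands for one
    copy of Q_+^(m-r) Q_-^(n-r), symmetrized. *)
Definition dl n m := {x : {r : 'I_(minn n m).+1 & r.-tuple 'I_d} | sorted leq (map val (tagged x))}.
Definition jL n m (x : dl n m) : seq nat := map val (tagged (val x)).

Lemma jL_size n m (x : dl n m) : size (jL x) = tag (val x).
Proof. by rewrite size_map size_tuple. Qed.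
Lemma jL_sorted n m (x : dl n m) : sorted leq (jL x). Proof. exact: valP x. Qed.
Lemma jL_lt n m (x : dl n m) : all (fun l => l < d)%N (jL x).
Proof. apply/allP => l /mapP[i _ ->]; exact: ltn_ord. Qed.
Lemma jL_le n m (x : dl n m) : (size (jL x) <= n)%N /\ (size (jL x) <= m)%N.
Proof. by rewrite jL_size; have := ltn_ord (tag (val x)); rewrite ltnS leq_min => /andP. Qed.
Lemma jL_inj n m : injective (@jL n m).
Proof.
case=> [[r t] st] [[r' t'] st']; rewrite /jL /= => E; apply: val_inj => /= {st st'}.
have rr : r = r' by apply: val_inj; rewrite /= -(size_tuple t) -(size_tuple t') -(size_map val t) -(size_map val t') /=; congr size.
case: _ / rr t' E => t' E; congr existT; apply: val_inj; exact: inj_map val_inj _ _ E.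
Qed.
Lemma jL_surj n m L : all (fun l => l < d)%N L -> sorted leq L -> (size L <= n)%N -> (size L <= m)%N ->
  exists x : dl n m, jL x = L.
Proof.
move=> Ld Ls Ln Lm; have Lr : (size L < (minn n m).+1)%N by rewrite ltnS leq_min Ln.
have [t tE] := tuple_of_bounded Ld (erefl (size L)).
pose x : {r : 'I_(minn n m).+1 & r.-tuple 'I_d} :=
  @existT _ (fun r : 'I_(minn n m).+1 => r.-tuple 'I_d) (Ordinal Lr) t.
have xs : sorted leq (map val (tagged x)) by rewrite /= tE.
by exists (exist _ x xs).
Qed.

Section SortedSpan.
Context (n m : nat) (R W : word).

Definition SS (f : QHom (Qp n ++ W) (Qp m ++ R)) : Prop :=
  exists G : forall x : dl n m, QHom W (Qp (m - size (jL x)) ++ nw (n - size (jL x)) R),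
    f = \sum_x AK (G x) (jL x) n m ∘ sy n W.

Lemma SS0 : SS 0.
Proof. by exists (fun=> 0); rewrite big1 // => x _; rewrite AK0 hcomp0l. Qed.
Lemma SSD f g : SS f -> SS g -> SS (f + g).
Proof.
case=> F -> [G ->]; exists (fun x => F x + G x); rewrite -big_split.
by apply: eq_bigr => x _; rewrite AKD hcompDl.
Qed.
Lemma SSZ a f : SS f -> SS (a *: f).
Proof.
case=> F ->; exists (fun x => a *: F x); rewrite scaler_sumr.
by apply: eq_bigr => x _; rewrite AKZ hcompZl.
Qed.

Lemma SS_sorted q p (g : QHom W (Qp p ++ nw q R)) L : all (fun l => l < d)%N L -> sorted leq L ->
  (size L + q = n)%N -> (size L + p = m)%N -> SS (AK g L n m ∘ sy n W).
Proof.
move=> Ld Ls nE mE; have [||x xE] := @jL_surj n m L Ld Ls; [lia|lia|].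
exists (fun y => recast W _ ((y == x)%:R *: g)).
rewrite (bigD1 x) //= big1 ?addr0 => [|y yx]; last first.
  rewrite (negbTE yx) scale0r (_ : recast _ _ _ = 0) ?AK0 ?hcomp0l //.
  by rewrite -[0](scale0r (0 : QHom W (Qp p ++ nw q R))) recastZ scale0r.
rewrite eqxx scale1r xE; have pE : p = (m - size L)%N by lia.
have qE : q = (n - size L)%N by lia.
by move: g; rewrite pE qE => g; rewrite recast_id.
Qed.

(** Sorting costs terms with fewer dots in total, whence the induction on that total. *)
Lemma SS_AK q p (g : QHom W (Qp p ++ nw q R)) L : all (fun l => l < d)%N L ->
  (size L + q = n)%N -> (size L + p = m)%N -> SS (AK g L n m ∘ sy n W).
Proof.
have [t] := ubnP (sumn L); elim: t L => // t IH L Lt Ld nE mE.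
rewrite -[X in SS X](subrK (AK g (sort leq L) n m ∘ sy n W)).
have pL : perm_eq L (sort leq L) by rewrite perm_sym perm_sort.
apply: SSD; last first.
  by apply: SS_sorted; rewrite ?size_sort ?all_sort //; apply: sort_sorted; apply: leq_total.
elim: (AK_perm char0 g m pL Ld nE) => [|f h _ IHf _ IHh|a L' L'd L's L'L]; [exact: SS0|exact: SSD|].
by apply: SSZ; apply: IH; rewrite ?L's //; lia.
Qed.

Lemma Span_SS f : Span f -> SS f.
Proof.
elim=> [|f1 f2 _ IH1 _ IH2|L q p g Ld nE mE _]; [exact: SS0|exact: SSD|exact: SS_AK].
Qed.

End SortedSpan.

Lemma AK_nat R W W' q p (g : QHom W (Qp p ++ nw q R)) (u : QHom W' W) L n m :
  (size L + q = n)%N -> (size L + p = m)%N -> AK (g ∘ u) L n m = AK g L n m ∘ ups n u.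
Proof.
elim: L n m => [|l L IH] /= n m <- <-; first by rewrite !AK_nil kq_nat.
by rewrite !addSn !AK_cons /= (IH (size L + q) (size L + p))%N // Aop_nat.
Qed.

Lemma AK_syl R W q p (g : QHom W (Qp p ++ nw q R)) L n m :
  (size L + q = n)%N -> (size L + p = m)%N -> AK (sy p _ ∘ g) L n m = sy m R ∘ AK g L n m.
Proof.
elim: L n m => [|l L IH] /= n m <- <-; first by rewrite !AK_nil kq_sy.
rewrite !addSn !AK_cons [RHS](sy_Aop char0 l (m := (size L + p).+1) (AK g L _ _)) /=.
by rewrite (IH (size L + q) (size L + p))%N //; apply: (Aop_sy char0 l (m := (size L + p).+1)).
Qed.

Lemma kq0_surj q R W (f : QHom (Qp q ++ W) R) : exists h : QHom W (nw q R), kq (m := 0) h = f.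
Proof.
elim: q R f => [|q IH] R f; first by exists f; rewrite kq0.
have [h hE] := IH (false :: R) (ad f); exists h.
by rewrite kqS hE /kap kp0 ad_can.
Qed.

(* U is the direct sum of the V_x: maps into U decompose, and uniquely. *)
Lemma karoubi_decomp (I : finType) u (V : I -> word) (E : QHom u u) (e : forall x, QHom (V x) (V x))
    (a : forall x, QHom (V x) u) :
  E ∘ E = E -> (forall x, e x ∘ e x = e x) -> (forall x, E ∘ a x = a x) -> (forall x, a x ∘ e x = a x) ->
  (exists b : forall x, QHom u (V x), E = \sum_x a x ∘ b x) ->
  (forall w (g : forall x, QHom w (V x)), (forall x, e x ∘ g x = g x) -> \sum_x a x ∘ g x = 0 -> forall x, g x = 0) ->
  exists b : forall x, QHom u (V x), [/\ E = \sum_x a x ∘ b x, (forall x, e x ∘ b x ∘ E = b x) &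
     forall x y, b x ∘ a y = if x =P y is ReflectT xy then ecast z (QHom (V y) (V z)) (esym xy) (e y) else 0].
Proof.
move=> EE ee Ea ae [b0 E0] inj; pose b x := e x ∘ b0 x ∘ E.
have Eb : E = \sum_x a x ∘ b x.
  rewrite -{1}EE {1}E0 hcomp_suml; apply: eq_bigr => x _.
  by rewrite /b !hcompA ae.
have eb x : e x ∘ b x = b x by rewrite /b !hcompA ee.
exists b; split=> // [x|x y]; first by rewrite /b !hcompA ee -hcompA EE.
pose D x : QHom (V y) (V x) := if x =P y is ReflectT xy then ecast z (QHom (V y) (V z)) (esym xy) (e y) else 0.
apply/eqP; rewrite -subr_eq0; apply/eqP; rewrite -/(D x).
apply: (inj _ (fun x => b x ∘ a y - D x)) => [x'|].
  rewrite hcompBr hcompA eb /D; case: eqP => [xy|_]; last by rewrite hcomp0r.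
  by case: _ / (esym xy) => /=; rewrite ee.
under eq_bigr do rewrite hcompBr hcompA.
rewrite sumrB -hcomp_suml -Eb Ea (bigD1 y) //= big1 ?addr0 => [|x' x'y].
  rewrite /D; case: eqP => // yy; rewrite (eq_axiomK yy) /= ae subrr //.
by rewrite /D; case: eqP => [xy|_]; rewrite ?hcomp0r //; rewrite xy eqxx in x'y.
Qed.
End Strands.

End Decomposition.
Import Decomposition.

(** * Classes of idempotents in the Karoubi envelope *)

Module KaroubiClasses.

Local Open Scope ring_scope.
Local Open Scope hom_scope.

Section Strands.
Context (k : fieldType) (char0 : [pchar k] =i pred0).
Context (lam : {fsfun int -> nat with 0%N}).
Local Notation QHom := (QHom k lam).
Local Notation hid := (hid k lam).
Local Notation gS := (gS k lam).
Local Notation gU := (gU k lam).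
Local Notation gC := (gC k lam).
Local Notation sy := (sy k lam).
Local Notation up f := (wh true f).
Local Notation dn f := (wh false f).
Implicit Types u v w R W : word.
Local Notation Qp n := (nseq n true).
Lemma heqD u v u' v' (f g : QHom u v) (f' g' : QHom u' v') :
  heq f f' -> heq g g' -> heq (f + g) (f' + g').
Proof.
case=> a [b E] [a' [b' E']]; move: E E'; rewrite (Prop_irrelevance a' a) (Prop_irrelevance b' b).
by move=> E E'; exists a, b; rewrite hcompDr E E' hcompDl.
Qed.
Lemma heq_wh b u v u' v' (f : QHom u v) (f' : QHom u' v') : heq f f' -> heq (wh b f) (wh b f').
Proof. exact: heq_tens (heq_refl (hid [:: b])). Qed.
Lemma heq_ups n u v u' v' (f : QHom u v) (f' : QHom u' v') : heq f f' -> heq (ups n f) (ups n f').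
Proof. by move=> ff; elim: n => //= n; apply: heq_wh. Qed.
Lemma gS_tens R R' : heq (gS (R ++ R')) (gS R ⊗ hid R').
Proof. exact: heq_sym (tens_hid R R' (cl DCross : QHom _ _)). Qed.
Lemma gC_tens R R' : heq (gC (R ++ R')) (gC R ⊗ hid R').
Proof. exact: heq_sym (tens_hid R R' (cl DRCap : QHom _ _)). Qed.
Lemma gU_tens R R' : heq (gU (R ++ R')) (gU R ⊗ hid R').
Proof. exact: heq_sym (tens_hid R R' (cl DRCup : QHom _ _)). Qed.

Lemma sy_tens n R R' : heq (sy n (R ++ R')) (sy n R ⊗ hid R').
Proof.
elim: n => [|[|n] IH]; first by rewrite !sy0 htens_id; apply: heq_refl.
  by rewrite !sy1 htens_id; apply: heq_refl.
have IHu : heq (up (sy n.+1 (R ++ R'))) (up (sy n.+1 R) ⊗ hid R').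
  by rewrite wh_tens; apply: heq_wh.
rewrite !syE htensZl htensDl htensZl 2!tens_comp.
apply: heq_scale; apply: heqD => //; apply: heq_scale.
apply: heq_comp => //; apply: heq_comp => //.
apply: heq_trans (gS_tens (Qp n ++ R) R').
by rewrite -catA; apply: heq_refl.
Qed.

Lemma ad_tens u v R' u' v' (f' : QHom (true :: u') v') (f : QHom (true :: u) v) :
  u' = u ++ R' -> v' = v ++ R' -> heq f' (f ⊗ hid R') -> heq (ad f') (ad f ⊗ hid R').
Proof.
move=> uE vE ff; rewrite /ad tens_comp wh_tens; apply: heq_comp; first exact: heq_wh.
rewrite uE; exact: gU_tens.
Qed.

Lemma gSm_tens R R' : heq (gSm k lam (R ++ R')) (gSm k lam R ⊗ hid R').
Proof.
rewrite /gSm !unlock; do 2 (apply: ad_tens => //).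
rewrite !tens_comp; apply: heq_comp; last exact: (gS_tens (false :: false :: R)).
apply: heq_comp; first exact: gC_tens.
rewrite wh_tens; apply: heq_wh; exact: (gC_tens (false :: R)).
Qed.

Lemma nw_cat q R R' : nw q (R ++ R') = nw q R ++ R'.
Proof. by elim: q R => //= q IH R; rewrite -IH. Qed.
Lemma nwE q R : nw q R = nseq q false ++ R.
Proof. by elim: q R => //= q IH R; rewrite IH (nseq_catSr false). Qed.

Lemma heq_wn q u v u' v' (f : QHom u v) (f' : QHom u' v') : heq f f' -> heq (wn q f) (wn q f').
Proof. by elim: q u v u' v' f f' => //= q IH u v u' v' f f' ff; apply: IH; apply: heq_wh. Qed.
Lemma wn_tens q u v R' (f : QHom u v) : heq (wn q (f ⊗ hid R')) (wn q f ⊗ hid R').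
Proof.
elim: q u v f => [|q IH] u v f; first exact: heq_refl.
by rewrite /= -wh_tens; apply: (IH (false :: u) (false :: v) (dn f)).
Qed.
Lemma wnE q u v (f : QHom u v) : heq (wn q f) (hid (nseq q false) ⊗ f).
Proof.
elim: q u v f => [|q IH] u v f; first by rewrite /= hunitl; apply: heq_refl.
have H := IH (false :: u) (false :: v) (dn f); apply: (heq_trans H); rewrite /wh.
have H2 := heqA (hid (nseq q false)) (hid [:: false]) f; apply: (heq_trans H2).
rewrite htens_id; apply: heq_tens; last exact: heq_refl.
by apply: heq_hid; rewrite (nseq_catSr false) cats0.
Qed.
Lemma upsE q u v (f : QHom u v) : heq (ups q f) (hid (nseq q true) ⊗ f).
Proof.
elim: q => [|q IH] /=; first by rewrite hunitl; apply: heq_refl.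
by rewrite hid_cons; apply: heq_wh.
Qed.

Lemma ms_tens q R R' : heq (ms k lam q (R ++ R')) (ms k lam q R ⊗ hid R').
Proof.
elim: q R => [|[|q] IH] R; first by rewrite !ms0 htens_id; apply: heq_refl.
  by rewrite !ms1 htens_id; apply: heq_refl.
have IHu := IH (false :: R).
rewrite !msE htensZl htensDl htensZl 2!tens_comp.
apply: heq_scale; apply: heqD => //; apply: heq_scale.
apply: heq_comp => //; apply: heq_comp => //.
apply: heq_trans (wn_tens _ _ _); apply: heq_wn; exact: gSm_tens.
Qed.

Section Classes.

Lemma hidem_heq u u' (e : QHom u u) (e' : QHom u' u') : heq e e' -> hidem e -> hidem e'.
Proof.
case=> p [q E] ee; move: E; rewrite (Prop_irrelevance q p); case: _ / p e' {q} => e'.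
by rewrite !idto_id hidl hidr => <-.
Qed.

Lemma kiso_heq u u' (e : QHom u u) (e' : QHom u' u') (ee : hidem e) (ee' : hidem e') :
  heq e e' -> kiso (kobj_of ee) (kobj_of ee').
Proof.
case=> p [q E]; apply: (reindex_iso (h := id) (q := fun=> p)); first by exists id.
  exact: wmx_idem.
by move=> i j; rewrite /= /wmx -E (Prop_irrelevance q p).
Qed.

Lemma tens_idem u v (e : QHom u u) (f : QHom v v) : hidem e -> hidem f -> hidem (e ⊗ f).
Proof. by move=> ee ff; rewrite /hidem hinterchange ee ff. Qed.

Definition kc u (e : QHom u u) (ee : hidem e) : kclass k lam := cl (kobj_of ee).

Lemma kc_heq u u' (e : QHom u u) (e' : QHom u' u') (ee : hidem e) (ee' : hidem e') :
  heq e e' -> kc ee = kc ee'.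
Proof. by move=> h; apply/clP; apply: kiso_heq. Qed.

Lemma kc_tens u v (e : QHom u u) (f : QHom v v) (ee : hidem e) (ff : hidem f) :
  kc ee * kc ff = kc (tens_idem ee ff).
Proof.
rewrite [LHS]kc_mulE; apply/clP; apply: karoubi_iso_trans (ktensE _ _) _.
  by apply: tensmx_idem; apply: wmx_idem.
apply: (reindex_iso (h := fun=> ord0) (q := fun=> erefl)).
- by exists (fun=> (ord0, ord0)) => [[i j]|i]; rewrite ?(ord1 i) ?(ord1 j).
- exact: (@kidemP _ _ (kobj_of (tens_idem ee ff))).
by move=> i j; rewrite !idto_id hidl hidr.
Qed.

Lemma kc_iso u v (e : QHom u u) (f : QHom v v) (ee : hidem e) (ff : hidem f) (x : QHom v u) (y : QHom u v) :
  e ∘ x ∘ f = x -> f ∘ y ∘ e = y -> x ∘ y = e -> y ∘ x = f -> kc ee = kc ff.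
Proof.
move=> xE yE xy yx; apply/clP; exists (fun _ _ => y), (fun _ _ => x); split;
  by apply: mhomP => i j; rewrite /mcomp !big_ord1 /= /wmx ?hcompA.
Qed.

(** A block-diagonal idempotent. The words [V x] and [V y] agree only through the equality of
    indices, which the test must therefore return as a proof. *)
Definition diag (I : finType) (V : I -> word) (e : forall x, QHom (V x) (V x)) : @mhom k lam I I V V :=
  fun x y => if y =P x is ReflectT yx then ecast z (QHom (V x) (V z)) (esym yx) (e x) else 0.

Lemma diag_id (I : finType) (V : I -> word) (e : forall x, QHom (V x) (V x)) x : diag e x x = e x.
Proof. by rewrite /diag; case: eqP => // xx; rewrite (eq_axiomK (esym xx)). Qed.
Lemma diag_neq (I : finType) (V : I -> word) (e : forall x, QHom (V x) (V x)) x y : y != x -> diag e x y = 0.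
Proof. by rewrite /diag; case: eqP. Qed.

Lemma diag_suml (I : finType) (V : I -> word) (e : forall x, QHom (V x) (V x)) u (h : forall x, QHom u (V x)) y :
  \sum_x (diag e x y ∘ h x) = e y ∘ h y.
Proof.
rewrite (bigD1 y) //= diag_id big1 ?addr0 // => x xy.
by rewrite diag_neq 1?eq_sym // hcomp0l.
Qed.
Lemma diag_sumr (I : finType) (V : I -> word) (e : forall x, QHom (V x) (V x)) u (h : forall x, QHom (V x) u) y :
  \sum_x (h x ∘ diag e y x) = h y ∘ e y.
Proof.
rewrite (bigD1 y) //= diag_id big1 ?addr0 // => x xy.
by rewrite diag_neq // hcomp0r.
Qed.

Lemma diag_idem (I : finType) (V : I -> word) (e : forall x, QHom (V x) (V x)) :
  (forall x, hidem (e x)) -> midem (diag e).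
Proof.
move=> ee; apply: mhomP => x y; rewrite /mcomp (diag_suml e (fun z => diag e x z)).
case: (eqVneq y x) => [->|yx]; first by rewrite diag_id ee.
by rewrite diag_neq // hcomp0r.
Qed.

Lemma diag_relabel (I J : finType) (h : I -> J) (V : J -> word) (e : forall x, QHom (V x) (V x)) :
  injective h -> relabel h (diag e) = diag (V := V \o h) (fun i => e (h i)).
Proof.
move=> hinj; apply: mhomP => i i'; rewrite /relabel.
case: (eqVneq i' i) => [->|ii]; first by rewrite !diag_id.
by rewrite !diag_neq // (inj_eq hinj).
Qed.

Lemma kc_sum_ord N (V : 'I_N -> word) (e : forall x, QHom (V x) (V x)) (ee : forall x, hidem (e x)) (A : kobj k lam) :
  karoubi_iso (@kidem _ _ A) (diag e) -> (cl A : kclass k lam) = \sum_x kc (ee x).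
Proof.
elim: N V e ee A => [|N IH] V e ee A Ae.
  rewrite big_ord0; apply/clP; apply: karoubi_iso_trans Ae _; first exact: diag_idem.
  have -> : diag e = @kidem _ _ (KObj (diag_idem ee)) by [].
  apply: (reindex_iso (h := id) (q := fun i => ord0_any _ i)); [by exists id|exact: mhom0_idem|by case].
rewrite big_ord_recl.
pose e' i := e (lift ord0 i).
pose ee' i : hidem (e' i) := ee (lift ord0 i).
have E := IH (fun i => V (lift ord0 i)) e' ee' (KObj (diag_idem ee')) (karoubi_iso_refl (diag_idem ee')).
transitivity (kc (ee ord0) + (cl (KObj (diag_idem ee')) : kclass k lam)); last by congr (_ + _); apply: E.
rewrite [RHS]kc_addE; apply/clP; apply: karoubi_iso_trans Ae _; first exact: diag_idem.
apply: karoubi_iso_sym; apply: karoubi_iso_trans (ksumE _ _) _.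
  by apply: summx_idem; [apply: wmx_idem|apply: diag_idem].
pose h (x : 'I_1 + 'I_N) : 'I_N.+1 := match x with inl _ => ord0 | inr i => lift ord0 i end.
pose q (x : 'I_1 + 'I_N) : sumfam (fun=> V ord0) (fun i => V (lift ord0 i)) x = V (h x) :=
  match x with inl _ => erefl | inr _ => erefl end.
apply: (reindex_iso (h := h) (q := q)).
- exists (fun i => if unlift ord0 i is Some j then inr j else inl ord0) => [[i|i]|i] /=.
  + by rewrite unlift_none (ord1 i).
  + by rewrite liftK.
  by case: unliftP => [j ->|->].
- exact: diag_idem.
case=> [i|i] [j|j] /=; rewrite !idto_id hidl hidr /wmx ?diag_id //.
- by rewrite diag_neq.
- by rewrite diag_neq.
case: (eqVneq j i) => [->|ji]; first by rewrite !diag_id.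
by rewrite !diag_neq // (inj_eq lift_inj).
Qed.

Lemma kc_sum (I : finType) (V : I -> word) (e : forall x, QHom (V x) (V x)) (ee : forall x, hidem (e x)) (A : kobj k lam) :
  karoubi_iso (@kidem _ _ A) (diag e) -> (cl A : kclass k lam) = \sum_x kc (ee x).
Proof.
move=> Ae; rewrite (reindex (@enum_val I I)) /=; last exact/onW_bij/enum_val_bij.
apply: (@kc_sum_ord _ (V \o @enum_val I I) (fun i => e (enum_val i)) (fun i => ee (enum_val i))).
apply: karoubi_iso_trans Ae _; first exact: diag_idem.
apply: karoubi_iso_sym; rewrite -diag_relabel; last exact: enum_val_inj.
by apply: relabel_iso; [apply: enum_val_bij|apply: diag_idem].
Qed.

(** [karoubi_decomp] supplies projections to the given inclusions [a x]; together they are mutually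
    inverse matrices between [E] and the block-diagonal sum. *)
Lemma kc_decomp (I : finType) u (V : I -> word) (E : QHom u u) (e : forall x, QHom (V x) (V x))
    (a : forall x, QHom (V x) u) (EE : hidem E) (ee : forall x, hidem (e x)) :
  (forall x, E ∘ a x = a x) -> (forall x, a x ∘ e x = a x) ->
  (exists b : forall x, QHom u (V x), E = \sum_x a x ∘ b x) ->
  (forall w (g : forall x, QHom w (V x)), (forall x, e x ∘ g x = g x) -> \sum_x a x ∘ g x = 0 -> forall x, g x = 0) ->
  kc EE = \sum_x kc (ee x).
Proof.
move=> Ea ae Eb inj; apply: kc_sum.
have [b [bE be ba]] := karoubi_decomp EE ee Ea ae Eb inj.
have eb x : e x ∘ b x = b x by rewrite -(be x) !hcompA ee.
exists (fun _ x => b x), (fun x _ => a x); split; apply: mhomP => i j; rewrite /mcomp /= /wmx ?big_ord1.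
- under eq_bigr do rewrite big_ord1.
  by rewrite (diag_suml e (fun x => b x ∘ E)) hcompA be.
- by rewrite (diag_sumr e a) ae Ea.
- by rewrite bE.
exact: ba.
Qed.

End Classes.
End Strands.

End KaroubiClasses.
Import KaroubiClasses.

(** * The relation between Q_- and Q_+ in the Grothendieck ring *)

Module CrossRelation.

Local Open Scope ring_scope.
Local Open Scope hom_scope.

Section Strands.
Context (k : fieldType) (char0 : [pchar k] =i pred0).
Context (lam : {fsfun int -> nat with 0%N}).
Local Notation QHom := (QHom k lam).
Local Notation hid := (hid k lam).
Local Notation d := (level lam).
Local Notation sy := (sy k lam).
Implicit Types u v w R W : word.
Local Notation Qp n := (nseq n true).
Local Notation ms := (ms k lam).
Local Notation sm := (sm k lam).

Lemma kq_sum q m R W (I : Type) (r : seq I) (P : pred I) (F : I -> QHom W (Qp m ++ nw q R)) :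
  kq (\sum_(i <- r | P i) F i) = \sum_(i <- r | P i) kq (F i).
Proof.
apply: (big_morph (@kq k lam q m R W)) => [f g|]; first exact: kqD.
by rewrite -[0](scale0r (0 : QHom W (Qp m ++ nw q R))) kqZ scale0r.
Qed.

Definition Kplus p : kclass k lam := kc (sy_idem char0 lam p [::]).
Definition Kminus q : kclass k lam := kc (ms_idem char0 lam q [::]).

Lemma sm_heq p q : heq (sm p q [::]) (sy p [::] ⊗ ms q [::]).
Proof.
rewrite /sm -[sy p [::] ⊗ _](_ : (sy p [::] ⊗ hid (nw q [::])) ∘ (hid (Qp p ++ [::]) ⊗ ms q [::]) = _).
  by apply: heq_comp; [apply: (sy_tens k lam p [::])|apply: heq_trans (upsE _ _) _; rewrite cats0; apply: heq_refl].
by rewrite hinterchange hidl hidr.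
Qed.

Lemma cross_heq n m : heq (ms n (Qp m ++ [::]) ∘ wn n (sy m [::])) (ms n [::] ⊗ sy m [::]).
Proof.
rewrite -[ms n [::] ⊗ _](_ : (ms n [::] ⊗ hid (Qp m ++ [::])) ∘ (hid (nw n [::]) ⊗ sy m [::]) = _).
  apply: heq_comp; first exact: (ms_tens k lam n [::]).
  by apply: heq_trans (wnE _ _) _; apply: heq_tens; [apply: heq_hid; rewrite nwE cats0|apply: heq_refl].
by rewrite hinterchange hidl hidr.
Qed.

(** Under the adjunction [kq], maps from [W] to the symmetrized Q_-^n Q_+^m become maps from Q_+^n W
    to Q_+^m symmetrized on both sides. [sym_span] and [AK_inj] decompose these uniquely. *)
Lemma K_cross_dl n m :
  Kminus n * Kplus m = \sum_(x : dl lam n m) Kplus (m - size (jL x)) * Kminus (n - size (jL x)).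
Proof.
set Z := nw n (Qp m ++ [::]); pose E : QHom Z Z := ms n (Qp m ++ [::]) ∘ wn n (sy m [::]).
pose e (x : dl lam n m) := sm (m - size (jL x)) (n - size (jL x)) [::].
have EE : hidem E by apply: hidem_heq (heq_sym (cross_heq n m)) _; apply: tens_idem; [apply: ms_idem|apply: sy_idem].
have ee x : hidem (e x) by apply: sm_idem.
have -> : Kminus n * Kplus m = kc EE by rewrite /Kminus /Kplus kc_tens; apply: kc_heq; apply: heq_sym; apply: cross_heq.
under eq_bigr => x _ do rewrite /Kminus /Kplus kc_tens.
transitivity (\sum_x kc (ee x)); last by apply: eq_bigr => x _; apply: kc_heq; apply: sm_heq.
have dE (x : dl lam n m) : (size (jL x) + (n - size (jL x)) = n)%N by have [? ?] := jL_le x; lia.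
have dE' (x : dl lam n m) : (size (jL x) + (m - size (jL x)) = m)%N by have [? ?] := jL_le x; lia.
(* The inclusion of the summand [x] is the map whose adjoint is the dotted family of [x] with the
   identity [e x] of that summand as coefficient. *)
have aH x : exists h : QHom (Qp (m - size (jL x)) ++ nw (n - size (jL x)) [::]) Z,
    kq (m := 0) h = AK (e x) (jL x) n m ∘ sy n _ by apply: kq0_surj.
pose a x := projT1 (cid (aH x)).
have aE x : kq (m := 0) (a x) = AK (e x) (jL x) n m ∘ sy n _ by exact: projT2 (cid (aH x)).
have kqE W (h : QHom W Z) : kq (m := 0) (E ∘ h) = sy m [::] ∘ kq (m := 0) h ∘ sy n W.
  transitivity (kq (m := 0) (ups 0 (ms n (Qp m ++ [::])) ∘ (wn n (sy m [::]) ∘ h))).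
    by rewrite /E -(hcompA _ _ h).
  rewrite kq_ms //; congr (_ ∘ _).
  by transitivity (kq (m := 0) (ups 0 (wn n (sy m [::])) ∘ h)); rewrite ?(kq_wn (m := 0)).
have kag x W (g : QHom W _) : kq (m := 0) (a x ∘ g) = AK (e x ∘ g) (jL x) n m ∘ sy n W.
  rewrite (AK_nat (e x) g (dE x) (dE' x)) kq_nat aE -[LHS]hcompA -[RHS]hcompA; congr (_ ∘ _).
  exact: sy_nat.
have esy x : sy _ _ ∘ e x = e x by apply: (sm_sy char0); exact: ee.
apply: (kc_decomp (a := a)).
- by move=> x; apply: (kq_inj (m := 0)); rewrite kqE aE -!hcompA sy_idem // hcompA (sy_AK char0).
- by move=> x; apply: (kq_inj (m := 0)); rewrite kag aE ee.
- have kE : kq (m := 0) E = sy m [::] ∘ kq (m := 0) E ∘ sy n Z by rewrite -[in LHS]EE kqE.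
  (* The spanning statement is applied to the universal map, the adjoint of [E] itself; the
     coefficients are then the projections. *)
  have [|G GE] := @Span_SS k char0 lam n m [::] Z (kq (m := 0) E).
    apply: sym_span => //; rewrite kE ?hcompA ?sy_idem //.
    by rewrite -!hcompA sy_idem.
  exists G; apply: (kq_inj (m := 0)); rewrite kq_sum kE -hcompA GE.
  rewrite hcomp_bigl hcomp_bigr; apply: eq_bigr => x _; rewrite kag /e /sm -[(sy _ _ ∘ _) ∘ _]hcompA.
  by rewrite AK_syl // -!hcompA sy_idem // AK_ms.
move=> W g eg E0 x.
apply: (@AK_inj k char0 lam n m [::] W _ predT (@jL lam n m) _ _ g) => //.
- move=> y _; split=> //; [exact: jL_lt|exact: jL_sorted|exact: (sm_sy char0)|exact: (sm_kq char0)].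
- by move=> y y' _ _; apply: jL_inj.
have := congr1 (@kq k lam n 0 (Qp m ++ [::]) W) E0; rewrite kq_sum => E1.
transitivity (\sum_x kq (m := 0) (a x ∘ g x)); first by apply: eq_bigr => y _; rewrite kag eg.
by rewrite E1 -[0](scale0r (0 : QHom W Z)) (kqZ (m := 0)) scale0r.
Qed.

Lemma card_dl r : d != 0%N ->
  #|[pred t : r.-tuple 'I_d | sorted leq (map val t)]| = 'C((d + r).-1, r).
Proof.
case: (d) => // d' _; rewrite addSn /= addnC -card_sorted_tuples cardsE.
by apply: eq_card => t; rewrite inE.
Qed.

Lemma K_cross n m : d != 0%N ->
  Kminus n * Kplus m = \sum_(r < (minn m n).+1) (Kplus (m - r) * Kminus (n - r)) *+ 'C((d + r).-1, r).
Proof.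
move=> d0; rewrite (minnC m n) K_cross_dl.
pose F r := Kplus (m - r) * Kminus (n - r).
transitivity (\sum_(x : {r : 'I_(minn n m).+1 & r.-tuple 'I_d} | sorted leq (map val (tagged x))) F (tag x)).
  rewrite [RHS](reindex_omap (val : dl lam n m -> _) insub) /=; last by move=> x xs; rewrite insubT.
  by apply: eq_big => [x|x _]; [rewrite valK eqxx (valP x)|rewrite jL_size].
have /= <- := @sig_big_dep _ _ _ _ (fun r : 'I_(minn n m).+1 => r.-tuple 'I_d) xpredT
  (fun r (t : r.-tuple 'I_d) => sorted leq (map val t)) (fun r _ => F r).
by apply: eq_bigr => r _; rewrite sumr_const card_dl.
Qed.
End Strands.

End CrossRelation.
Import CrossRelation.

(** * Coxeter presentation of the symmetric groups *)

Module CoxeterWords.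

Import GroupScope.

Section Words.
Context (N : nat) (R : seq nat -> seq nat -> Prop).
Hypotheses (Rrefl : forall u, R u u) (Rtrans : forall u v w, R u v -> R v w -> R u w).
Hypothesis Rcat : forall u u' v v', R u u' -> R v v' -> R (u ++ v) (u' ++ v').
Hypothesis Rsq : forall a, (a < N)%N -> R [:: a; a] [::].
Hypothesis Rcomm : forall a b, (a < N)%N -> (b < N)%N -> (a.+1 < b)%N || (b.+1 < a)%N -> R [:: a; b] [:: b; a].
Hypothesis Rbraid : forall a, (a.+1 < N)%N -> R [:: a.+1; a; a.+1] [:: a; a.+1; a].

Definition cyc i k := iota i (k - i).

Lemma R_comm_word a u : (a < N)%N -> all (fun b => (b < N)%N && ((a.+1 < b)%N || (b.+1 < a)%N)) u ->
  R (a :: u) (u ++ [:: a]).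
Proof.
move=> aN; elim: u => [|b u IH] //= /andP[/andP[bN ab] uN].
apply: (@Rtrans _ (b :: a :: u)); first exact: (Rcat (Rcomm aN bN ab) (Rrefl u)).
exact: (Rcat (Rrefl [:: b]) (IH uN)).
Qed.

Lemma cyc_split i j k : (i <= j <= k)%N -> cyc i k = cyc i j ++ cyc j k.
Proof.
case/andP=> ij jk; rewrite /cyc (_ : (k - i = (j - i) + (k - j))%N); last by lia.
by rewrite iotaD subnKC.
Qed.
Lemma cycS i k : (i < k)%N -> cyc i k = i :: cyc i.+1 k.
Proof. by move=> ik; rewrite /cyc (_ : (k - i = (k - i.+1).+1)%N) //; lia. Qed.
Lemma mem_cyc i k b : (b \in cyc i k) = (i <= b < k)%N.
Proof. by rewrite mem_iota; case: (leqP i b) => //= ib; case: (leqP i k) => ik; apply/idP/idP; lia. Qed.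

(** The words [cyc i k] represent the cosets of the subgroup generated by the first k - 1 generators
    in that generated by the first k. Prepending one letter permutes these forms modulo the
    subgroup. *)
Lemma normal_form k w : (k <= N)%N -> all (fun a => (a < k)%N) w ->
  exists i w', [/\ (i <= k)%N, all (fun a => (a < k.-1)%N) w' & R w (cyc i k ++ w')].
Proof.
move=> kN; elim: w => [|a w IH] /= => [_|/andP[ak wk]].
  by exists k, [::]; split=> //; rewrite /cyc subnn.
have [i [w' [ik w'k Rw]]] := IH wk; have aN : (a < N)%N by lia.
suff [j [v [jk vk Rv]]] : exists j v, [/\ (j <= k)%N, all (fun a => (a < k.-1)%N) v & R (a :: cyc i k) (cyc j k ++ v)].
  exists j, (v ++ w'); split=> //; first by rewrite all_cat vk.
  apply: (@Rtrans _ (a :: cyc i k ++ w')); first exact: (Rcat (Rrefl [:: a]) Rw).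
  by rewrite catA; apply: (Rcat Rv (Rrefl w')).
case: (ltngtP a i) => ai.
- case: (ltngtP a.+1 i) => ai'; [|lia|].
    exists i, [:: a]; split=> //; first by rewrite /= andbT; lia.
    apply: R_comm_word => //; apply/allP => b; rewrite mem_cyc => /andP[b1 b2]; lia.
  by exists a, [::]; split=> //; [lia|rewrite cats0 [cyc a k]cycS // ai'].
(* The letter [a] commutes up to the factor [a.-1, a] of the cycle; the braid relation turns
   [a, a.-1, a] into [a.-1, a, a.-1], whose last letter commutes to the end. *)
- exists i, [:: a.-1]; split=> //; first by rewrite /= andbT; lia.
  have E : cyc i k = cyc i a.-1 ++ [:: a.-1; a] ++ cyc a.+1 k.
    rewrite (@cyc_split i a.-1 k); last by lia.
    by rewrite [cyc a.-1 k]cycS 1?[cyc a.-1.+1 k]cycS ?prednK //; lia.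
  rewrite E; apply: (@Rtrans _ (cyc i a.-1 ++ ([:: a; a.-1; a] ++ cyc a.+1 k))).
    have RC : R (a :: cyc i a.-1) (cyc i a.-1 ++ [:: a]).
      by apply: R_comm_word => //; apply/allP => b; rewrite mem_cyc => /andP[b1 b2]; lia.
    by have := Rcat RC (Rrefl ([:: a.-1; a] ++ cyc a.+1 k)); rewrite -catA.
  apply: (@Rtrans _ (cyc i a.-1 ++ ([:: a.-1; a; a.-1] ++ cyc a.+1 k))).
    apply: Rcat => //; apply: Rcat => //.
    by have := @Rbraid a.-1; rewrite prednK //; [apply|]; lia.
  rewrite -!catA; apply: Rcat => //.
  have RD : R (a.-1 :: cyc a.+1 k) (cyc a.+1 k ++ [:: a.-1]).
    by apply: R_comm_word; [lia|apply/allP => b; rewrite mem_cyc => /andP[b1 b2]; lia].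
  exact: (Rcat (Rrefl [:: a.-1; a]) RD).
exists i.+1, [::]; split=> //; first by rewrite -ai.
rewrite ai [cyc i k]cycS -?ai // cats0.
exact: (Rcat (Rsq aN) (Rrefl (cyc a.+1 k))).
Qed.
End Words.

Section SymGroup.
Context (N : nat).
Local Notation st a := (tperm (inord a) (inord a.+1) : 'S_N.+1).

Fixpoint pev (w : seq nat) : 'S_N.+1 := if w is a :: w' then pev w' * st a else 1.

Lemma pev_cat u v : pev (u ++ v) = pev v * pev u.
Proof. by elim: u => [|a u IH] /=; rewrite ?mulg1 // IH mulgA. Qed.

Lemma st_val a (i : 'I_N.+1) : (a < N)%N ->
  val (st a i) = if (i : nat) == a then a.+1 else if (i : nat) == a.+1 then a else i.
Proof.
move=> aN; have v1 : nat_of_ord (inord a : 'I_N.+1) = a by rewrite inordK //; lia.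
have v2 : nat_of_ord (inord a.+1 : 'I_N.+1) = a.+1 by rewrite inordK //; lia.
case: tpermP => [->|->|/eqP h1 /eqP h2]; rewrite /= ?v1 ?v2 ?eqxx //.
  by case: eqP => // E; lia.
rewrite -val_eqE /= v1 in h1; rewrite -val_eqE /= v2 in h2.
by rewrite (negbTE h1) (negbTE h2).
Qed.

Lemma pev_fix w k (i : 'I_N.+1) : (k <= N)%N -> all (fun a => (a < k)%N) w -> (k < i)%N -> pev w i = i.
Proof.
move=> kN; elim: w => [|a w IH] /= => [_ _|/andP[ak wk] ki]; first by rewrite perm1.
rewrite permM IH //; apply: val_inj; rewrite st_val; last by lia.
by rewrite !ifF //; apply/eqP; lia.
Qed.

Lemma pev_cyc i k : (i <= k)%N -> (k <= N)%N -> val (pev (cyc i k) (inord k)) = i.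
Proof.
move=> ik kN; rewrite /cyc; move def_t: (k - i)%N => t; elim: t i ik def_t => [|t IH] i ik def_t.
  by rewrite /= perm1 inordK; lia.
rewrite /= permM st_val; last by lia.
by rewrite IH; [|lia|lia]; rewrite ifF ?eqxx //; apply/eqP; lia.
Qed.

(** The blocks of a monotone [T] are intervals, so the cycle that restores the last moved point uses
    only simple transpositions inside one block. Young subgroups are thus generated by their simple
    transpositions; for constant [T] this is the whole group. *)
Lemma pev_gen (T : 'I_N.+1 -> nat) (w : 'S_N.+1) : (forall i j : 'I_N.+1, (i <= j)%N -> (T i <= T j)%N) ->
  (forall i, T (w i) = T i) ->
  exists u, all (fun a => (a < N)%N && (T (inord a) == T (inord a.+1))) u /\ pev u = w.
Proof.
move=> Tmon; suff gen k : (k <= N)%N -> forall w : 'S_N.+1, (forall i : 'I_N.+1, (k < i)%N -> w i = i) ->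
    (forall i, T (w i) = T i) -> exists u, all (fun a => (a < N)%N && (T (inord a) == T (inord a.+1))) u /\ pev u = w.
  move=> wT; apply: (gen N) => // i; have := ltn_ord i; lia.
elim: k => [|k IH] kN {}w wk wT.
  exists [::]; split=> //; apply/esym/permP => i; rewrite perm1.
  case: (posnP i) => [i0|]; last exact: wk.
  apply: contrapT => /eqP wi; have wi0 : (0 < w i)%N by rewrite lt0n; apply: contra_neq wi => E; apply: val_inj; rewrite /= E.
  by have /perm_inj := wk _ wi0 => E; rewrite E eqxx in wi.
pose c := w (inord k.+1); have kE : nat_of_ord (inord k.+1 : 'I_N.+1) = k.+1 by rewrite inordK.
have ck : (c <= k.+1)%N.
  rewrite leqNgt; apply/negP => ck; have /perm_inj E := wk _ ck.
  by rewrite E kE ltnn in ck.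
have cT : T c = T (inord k.+1) by apply: wT.
have blk : all (fun a => (a < N)%N && (T (inord a) == T (inord a.+1))) (cyc c k.+1).
  apply/allP => a; rewrite mem_cyc => /andP[a1 a2]; apply/andP; split; first by lia.
  have va : nat_of_ord (inord a : 'I_N.+1) = a by rewrite inordK; lia.
  have va' : nat_of_ord (inord a.+1 : 'I_N.+1) = a.+1 by rewrite inordK; lia.
  have l1 : (T c <= T (inord a))%N by apply: Tmon; rewrite va.
  have l2 : (T (inord a) <= T (inord a.+1))%N by apply: Tmon; rewrite va va'.
  have l3 : (T (inord a.+1) <= T (inord k.+1))%N by apply: Tmon; rewrite va' kE.
  by rewrite eqn_leq l2 (leq_trans l3) // -cT.
have cycT i : T (pev (cyc c k.+1) i) = T i.
  elim: (cyc c k.+1) blk i => [|a u IHu] /= => [_ i|/andP[/andP[aN /eqP aT] uN] i]; first by rewrite perm1.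
  rewrite permM -(IHu uN i); case: tpermP => [->|->|] //.
have [|i|i|u [uN uE]] := IH _ (w * (pev (cyc c k.+1))^-1); first by lia.
- move=> ki; rewrite permM; apply: (canLR (permK _)).
  case: (ltngtP i k.+1) => ik; first by lia.
    rewrite wk // (@pev_fix _ k.+1) //; apply/allP => a; rewrite mem_cyc; lia.
  have -> : i = inord k.+1 by apply: val_inj; rewrite /= kE.
  by apply: val_inj; rewrite pev_cyc.
- by rewrite permM -[in RHS]wT -{2}[w i](permKV (pev (cyc c k.+1))) cycT.
exists (cyc c k.+1 ++ u); split; first by rewrite all_cat blk.
by rewrite pev_cat uE mulgKV.
Qed.

(** The cycle in a normal form can be read off the permutation as the image of the last point, so
    equal permutations have equal cycles and the remaining words involve one generator fewer. *)
Lemma pev_inj (R : seq nat -> seq nat -> Prop) :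
  (forall u, R u u) -> (forall u v w, R u v -> R v w -> R u w) -> (forall u v, R u v -> R v u) ->
  (forall u u' v v', R u u' -> R v v' -> R (u ++ v) (u' ++ v')) ->
  (forall a, (a < N)%N -> R [:: a; a] [::]) ->
  (forall a b, (a < N)%N -> (b < N)%N -> (a.+1 < b)%N || (b.+1 < a)%N -> R [:: a; b] [:: b; a]) ->
  (forall a, (a.+1 < N)%N -> R [:: a.+1; a; a.+1] [:: a; a.+1; a]) ->
  forall u v, all (fun a => (a < N)%N) u -> all (fun a => (a < N)%N) v -> pev u = pev v -> R u v.
Proof.
move=> Rrefl Rtrans Rsym Rcat Rsq Rcomm Rbraid.
(* Carrying the equality of permutations along with [R] makes the normal form valid for both. *)
pose S u v := R u v /\ pev u = pev v.
have NF k w : (k <= N)%N -> all (fun a => (a < k)%N) w ->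
   exists i w', [/\ (i <= k)%N, all (fun a => (a < k.-1)%N) w' & S w (cyc i k ++ w')].
  apply: (@normal_form N S) => //.
  - by move=> x y z [r1 e1] [r2 e2]; split; [apply: Rtrans r2|rewrite e1].
  - by move=> x x' y y' [r1 e1] [r2 e2]; split; [apply: Rcat|rewrite !pev_cat e1 e2].
  - by move=> a aN; split; [apply: Rsq|rewrite /= mul1g tperm2].
  - move=> a b aN bN ab; split; first exact: Rcomm.
    rewrite /= !mul1g; apply/permP => i; rewrite !permM; apply: val_inj.
    rewrite !st_val //; repeat case: ifP; lia.
  move=> a aN; split; first exact: Rbraid.
  rewrite /= !mul1g; apply/permP => i; rewrite !permM; apply: val_inj.
  have aN' : (a < N)%N by lia.
  rewrite !st_val //; repeat case: ifP; lia.
suff main k u v : (k <= N)%N -> all (fun a => (a < k)%N) u -> all (fun a => (a < k)%N) v -> pev u = pev v -> R u v.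
  by move=> u v; apply: main.
elim: k u v => [|k IH] u v kN.
  by case: u => [|//]; case: v.
move=> uk vk uv.
have [i [u' [ik u'k [Ru Eu]]]] := NF _ _ kN uk; have [j [v' [jk v'k [Rv Ev]]]] := NF _ _ kN vk.
have val_at x w' : (x <= k.+1)%N -> all (fun a => (a < k)%N) w' -> val (pev (cyc x k.+1 ++ w') (inord k.+1)) = x.
  move=> xk w'k; have E : pev w' (inord k.+1) = inord k.+1.
    by apply: (@pev_fix _ k) => //; [lia|rewrite inordK; lia].
  by rewrite pev_cat permM E; apply: pev_cyc.
have ij : i = j by rewrite -(val_at i u') // -(val_at j v') // -Eu -Ev uv.
rewrite -ij in Rv Ev; apply: (Rtrans _ _ _ Ru); apply: Rtrans _ _ _ _ (Rsym _ _ Rv).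
apply: Rcat => //; apply: IH => //; first by lia.
by apply: (mulIg (pev (cyc i k.+1))); rewrite -!pev_cat -Eu -Ev.
Qed.
End SymGroup.

End CoxeterWords.
Import CoxeterWords.

(** * Action of the symmetric group on Q_+^n and block symmetrizers *)

Module SymmetricAction.

Local Open Scope ring_scope.
Local Open Scope hom_scope.

Section Strands.
Context (k : fieldType) (char0 : [pchar k] =i pred0).
Context (lam : {fsfun int -> nat with 0%N}).
Local Notation QHom := (QHom k lam).
Local Notation hid := (hid k lam).
Local Notation gS := (gS k lam).
Local Notation sy := (sy k lam).
Local Notation up f := (wh true f).
Implicit Types u v w R W : word.
Local Notation Qp n := (nseq n true).
Fixpoint Tg_def n i W : QHom (Qp n ++ W) (Qp n ++ W) :=
  match n return QHom (Qp n ++ W) (Qp n ++ W) with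
  | 0 => hid W
  | n1.+1 => match n1 return QHom (Qp n1 ++ W) (Qp n1 ++ W) -> QHom (Qp n1.+1 ++ W) (Qp n1.+1 ++ W) with
    | 0 => fun=> hid (true :: W)
    | n2.+1 => fun f => if i == n2 then gS (Qp n2 ++ W) else up f
    end (Tg_def n1 i W)
  end.
Definition Tg n i W := locked_with hom_key (Tg_def n i W).
Lemma TgE n i W : Tg n.+2 i W = if i == n then gS (Qp n ++ W) else up (Tg n.+1 i W).
Proof. by rewrite /Tg !unlock. Qed.
Lemma Tg_up n i W : (i.+1 < n)%N -> Tg n.+1 i W = up (Tg n i W).
Proof. by case: n => // -[|n] // ni; rewrite TgE ifF //; apply/eqP; lia. Qed.

Lemma Tg_sq n i W : (i.+1 < n)%N -> Tg n i W ∘ Tg n i W = hid _.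
Proof.
elim: n => // -[|n] // IH ni; rewrite TgE; case: eqP => [_|i_n]; first exact: gS_sq.
by rewrite -wh_comp IH ?wh_id //; lia.
Qed.

Lemma Tg_far n a b W : (a.+1 < b)%N -> (b.+1 < n)%N -> Tg n a W ∘ Tg n b W = Tg n b W ∘ Tg n a W.
Proof.
move=> ab; elim: n => // -[|n] // IH bn.
case: (eqVneq b n) => [b_n|bn']; last by rewrite !(@Tg_up n.+1) -?wh_comp ?IH //; move/eqP: bn'; lia.
rewrite [Tg _ b W]TgE b_n eqxx; case: n bn b_n IH => [|n] bn b_n _; first by lia.
by rewrite !(@Tg_up n.+2) ?(@Tg_up n.+1) -?gS_nat //; lia.
Qed.

Lemma Tg_braid n a W : (a.+2 < n)%N ->
  Tg n a.+1 W ∘ Tg n a W ∘ Tg n a.+1 W = Tg n a W ∘ Tg n a.+1 W ∘ Tg n a W.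
Proof.
elim: n => // -[|[|n]] // IH an.
case: (eqVneq a n) => [->|an']; last by rewrite !(@Tg_up n.+2) -?wh_comp ?IH //; move/eqP: an'; lia.
by rewrite [Tg _ n.+1 W]TgE eqxx [Tg _ n W]Tg_up // TgE eqxx; apply: gS_braid.
Qed.

Definition Tev n W (w : seq nat) := foldr (fun a f => Tg n a W ∘ f) (hid (Qp n ++ W)) w.
Lemma Tev_cat n W (s t : seq nat) : Tev n W (s ++ t) = Tev n W s ∘ Tev n W t.
Proof. by elim: s => [|a s IH] /=; rewrite ?hidl // IH hcompA. Qed.

Lemma word_exists N (w : 'S_N.+1) : exists u : seq nat, all (fun a => (a < N)%N) u /\ pev N u = w.
Proof.
have [u [uN uw]] := @pev_gen N (fun=> 0%N) w (fun _ _ _ => leqnn _) (fun=> erefl).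
by exists u; split=> //; apply: sub_all uN => a /andP[].
Qed.
(** A word is chosen for each permutation; [pS_word] shows that the choice is immaterial, by
    [pev_inj] applied to equality of the resulting morphisms. *)
Definition pS n W : 'S_n -> QHom (Qp n ++ W) (Qp n ++ W) :=
  match n return 'S_n -> QHom (Qp n ++ W) (Qp n ++ W) with 0 => fun=> hid W | N.+1 => fun g : 'S_N.+1 => Tev N.+1 W (projT1 (cid (word_exists (g : 'S_N.+1)))) end.

Lemma pS_word N W (u : seq nat) : all (fun a => (a < N)%N) u -> pS W (pev N u) = Tev N.+1 W u.
Proof.
move=> uN; have [vN vE] := projT2 (cid (word_exists (pev N u))).
apply: (@pev_inj N (fun u v : seq nat => Tev N.+1 W u = Tev N.+1 W v)) => //.
- by move=> x y z -> ->.
- by move=> x x' y y' E E'; rewrite !Tev_cat E E'.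
- by move=> a aN; rewrite /Tev /= hidr; apply: (@Tg_sq N.+1).
- by move=> a b aN bN /orP[] ab; rewrite /Tev /= !hidr; [|apply/esym]; apply: (@Tg_far N.+1).
by move=> a aN; rewrite /Tev /= !hidr !hcompA; apply: (@Tg_braid N.+1).
Qed.

Lemma pS_1 n W : pS W (1%g : 'S_n) = hid _.
Proof. by case: n => // N; rewrite -[1%g]/(pev N [::]) pS_word. Qed.
Lemma pS_mul n W (u w : 'S_n) : pS W (w * u)%g = pS W u ∘ pS W w.
Proof.
case: n u w => [|N] u w; first by rewrite /= hidl.
have [a [aN <-]] := word_exists u; have [b [bN <-]] := word_exists w.
by rewrite -pev_cat !pS_word ?Tev_cat // all_cat aN.
Qed.
Lemma pS_simple N W a : (a < N)%N -> pS W (tperm (inord a) (inord a.+1) : 'S_N.+1) = Tg N.+1 a W.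
Proof. by move=> aN; have := @pS_word N W [:: a]; rewrite /= mul1g hidr aN => ->. Qed.

Lemma recast_heq u v u' v' (f : QHom u v) : u = u' -> v = v' -> heq (recast u' v' f) f.
Proof. by move=> e1 e2; case: _ / e1; case: _ / e2; rewrite recast_id; apply: heq_refl. Qed.
Lemma recast_comp u v w u' v' w' (f : QHom v w) (g : QHom u v) : u = u' -> v = v' -> w = w' ->
  recast u' w' (f ∘ g) = recast v' w' f ∘ recast u' v' g.
Proof. by move=> e1 e2 e3; case: _ / e1; case: _ / e2; case: _ / e3; rewrite !recast_id. Qed.
Lemma recast_hid u u' : u = u' -> recast u' u' (hid u) = hid u'.
Proof. by move=> e; case: _ / e; rewrite recast_id. Qed.
Lemma recast_up u v u' v' (f : QHom u v) : u = u' -> v = v' ->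
  recast (true :: u') (true :: v') (up f) = up (recast u' v' f).
Proof. by move=> e1 e2; case: _ / e1; case: _ / e2; rewrite !recast_id. Qed.
Lemma recast_heq_eq u v u' v' (f : QHom u v) (g : QHom u' v') : heq f g -> recast u' v' f = g.
Proof. by case=> p [q E]; apply: heq_eq; apply: heq_trans (recast_heq f p q) _; exists p, q. Qed.

Definition pn n (w : 'S_n) : QHom (Qp n) (Qp n) := recast (Qp n) (Qp n) (pS [::] w).

Lemma pn_heq n (w : 'S_n) : heq (pn w) (pS [::] w).
Proof. by apply: recast_heq; rewrite cats0. Qed.

Lemma Tg_ups n a i W : n = (a + i.+2)%N -> heq (Tg n i W) (ups a (gS (Qp i ++ W))).
Proof.
move=> ->; elim: a => [|a IH].
  suff -> : gS (Qp i ++ W) = Tg i.+2 i W by exact: heq_refl.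
  by rewrite TgE eqxx.
suff : heq (Tg (a + i.+2).+1 i W) (ups a.+1 (gS (Qp i ++ W))) by [].
by rewrite Tg_up; [exact: heq_wh|lia].
Qed.

Lemma pn_action n : strand_action (@pn n).
Proof.
have e0 : Qp n ++ [::] = Qp n by rewrite cats0.
split.
- by rewrite /pn pS_1 recast_hid.
- by move=> u w; rewrite /pn pS_mul (recast_comp (v' := Qp n)).
case: n e0 => [|N] e0 i j ji; first by case: i ji => i; case: j.
have iN : (i < N)%N by have := ltn_ord j; lia.
have -> : tperm i j = tperm (inord i) (inord i.+1) :> 'S_N.+1.
  by rewrite inord_val; congr (tperm _ _); rewrite -ji inord_val.
apply: heq_eq; apply: heq_trans (pn_heq _) _; rewrite pS_simple //.
rewrite /cross_at; apply: heq_sym; apply: heq_trans (heq_idtor _ _) _; apply: heq_trans (heq_idtol _ _) _.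
apply: heq_sym; apply: heq_trans (@Tg_ups N.+1 (N.+1 - i.+2) i [::] _) _; first by lia.
apply: heq_trans (upsE _ _) _.
by rewrite cats0; apply: heq_refl.
Qed.

Section Affine.
Context (n : nat) (W : word) (P : pred nat).

(** Combinations of products of crossings with coefficients of sum 1: exactly what acts as the
    identity on anything invariant under the crossings in [P]. *)
Inductive Aff : QHom (Qp n ++ W) (Qp n ++ W) -> Prop :=
  | Aff_id : Aff (hid _)
  | Aff_T a f : P a -> (a.+1 < n)%N -> Aff f -> Aff (Tg n a W ∘ f)
  | Aff_mix c f g : Aff f -> Aff g -> Aff (c *: f + (1 - c) *: g).

Lemma Aff_comp f g : Aff f -> Aff g -> Aff (f ∘ g).
Proof.
move=> + Ag; elim=> [|a h Pa an _ IH|c h1 h2 _ IH1 _ IH2]; first by rewrite hidl.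
  by rewrite -hcompA; apply: Aff_T.
by rewrite hcompDl !hcompZl; apply: Aff_mix.
Qed.

Lemma Aff_absr v (X : QHom (Qp n ++ W) v) f :
  (forall a, P a -> (a.+1 < n)%N -> X ∘ Tg n a W = X) -> Aff f -> X ∘ f = X.
Proof.
move=> XT; elim=> [|a h Pa an _ IH|c h1 h2 _ IH1 _ IH2]; first by rewrite hidr.
  by rewrite hcompA XT.
by rewrite hcompDr !hcompZr IH1 IH2 -scalerDl addrC subrK scale1r.
Qed.
Lemma Aff_absl v (X : QHom v (Qp n ++ W)) f :
  (forall a, P a -> (a.+1 < n)%N -> Tg n a W ∘ X = X) -> Aff f -> f ∘ X = X.
Proof.
move=> XT; elim=> [|a h Pa an _ IH|c h1 h2 _ IH1 _ IH2]; first by rewrite hidl.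
  by rewrite -hcompA IH XT.
by rewrite hcompDl !hcompZl IH1 IH2 -scalerDl addrC subrK scale1r.
Qed.
End Affine.

Lemma Aff_up n W P f : Aff (n := n) (W := W) P f -> Aff (n := n.+1) (W := W) P (up f).
Proof.
elim=> [|a h Pa an _ IH|c h1 h2 _ IH1 _ IH2]; first by rewrite wh_id; apply: Aff_id.
  by rewrite wh_comp -Tg_up //; apply: Aff_T => //; lia.
by rewrite whD !whZ; apply: Aff_mix.
Qed.

Lemma Aff_sy n W : Aff xpredT (sy n W).
Proof.
elim: n => [|[|n] IH]; first by rewrite sy0; apply: Aff_id.
  by rewrite sy1; apply: Aff_id.
rewrite syE scalerDr scalerA.
have -> : n.+2%:R^-1 * n.+1%:R = 1 - n.+2%:R^-1 :> k.
  have n2 := natk_neq0 char0 n.+1; apply: (mulfI n2).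
  by rewrite mulrA divff // mul1r mulrBr mulr1 divff // -[n.+2%:R]natr1 addrK.
apply: Aff_mix; first exact: Aff_up.
apply: Aff_comp; last exact: Aff_up.
apply: Aff_comp; first exact: Aff_up.
have -> : gS (Qp n ++ W) = Tg n.+2 n W ∘ hid _ by rewrite hidr TgE eqxx.
by apply: Aff_T => //; apply: Aff_id.
Qed.

Lemma Tg_sy n a W : (a.+1 < n)%N -> Tg n a W ∘ sy n W = sy n W.
Proof.
elim: n => // -[|n] // IH an; rewrite TgE; case: eqP => [_|a_n]; first exact: sy_gSl.
by rewrite -{1}sy_upl // hcompA -wh_comp IH ?sy_upl //; lia.
Qed.

(** The block of the strand i. Strands are counted from the right, so the head of the list is the
    leftmost block and has the largest index. *)
Fixpoint bs (al : seq nat) (i : nat) : nat :=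
  if al is a :: al' then if (i < sumn al')%N then bs al' i else size al' else 0.

Fixpoint Bs al W : QHom (Qp (sumn al) ++ W) (Qp (sumn al) ++ W) :=
  match al return QHom (Qp (sumn al) ++ W) (Qp (sumn al) ++ W) with
  | [::] => hid W
  | a :: al' => recast _ _ (sy a (Qp (sumn al') ++ W) ∘ ups a (Bs al' W))
  end.

Lemma nseqD_cat (b : bool) a s W : nseq a b ++ (nseq s b ++ W) = nseq (a + s) b ++ W.
Proof. by rewrite nseqD catA. Qed.

Lemma heq_gS R R' : R = R' -> heq (gS R) (gS R').
Proof. by move=> ->; apply: heq_refl. Qed.

Lemma Aff_recast_ups P a s W f : Aff (n := s) (W := W) P f ->
  Aff (n := (a + s)%N) (W := W) P (recast _ _ (ups a f)).
Proof.
move=> Af; elim: a => [|a IH] /=; first by rewrite recast_id.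
rewrite recast_up ?nseqD_cat //; exact: Aff_up.
Qed.
Lemma recast_Tg a i s W : (i.+1 < a)%N -> recast (Qp (a + s) ++ W) (Qp (a + s) ++ W) (Tg a i (Qp s ++ W)) = Tg (a + s) (s + i) W.
Proof.
elim: a => // -[|a] // IH ia.
have E : Tg (a + s).+2 (s + i) W = if i == a then gS (Qp (a + s) ++ W) else up (Tg (a + s).+1 (s + i) W).
  by rewrite TgE; congr (if _ then _ else _); apply/idP/idP => /eqP ?; apply/eqP; lia.
rewrite -[Tg (a.+2 + s) _ W]/(Tg (a + s).+2 (s + i) W) E TgE.
case: eqP => [_|i_a].
  apply: recast_heq_eq; exact: heq_gS (nseqD_cat true a s W).
have e := nseqD_cat true a.+1 s W.
have {}IH := IH ltac:(lia); have := recast_up (Tg a.+1 i (Qp s ++ W)) e e; rewrite IH => E2.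
exact: E2.
Qed.
Lemma Aff_recast P a s W f : Aff (n := a) (W := Qp s ++ W) (fun i => P (s + i)%N) f ->
  Aff (n := (a + s)%N) (W := W) P (recast _ _ f).
Proof.
elim=> [|i h Pi ia _ IH|c h1 h2 _ IH1 _ IH2].
- by rewrite recast_hid ?nseqD_cat //; apply: Aff_id.
- rewrite (recast_comp (v' := Qp (a + s) ++ W)) ?nseqD_cat // recast_Tg //.
  by apply: Aff_T => //; lia.
by rewrite recastD !recastZ; apply: Aff_mix.
Qed.
Lemma Aff_sub n W (P Q : pred nat) f : (forall a, (a.+1 < n)%N -> P a -> Q a) ->
  Aff (n := n) (W := W) P f -> Aff (n := n) (W := W) Q f.
Proof.
move=> PQ; elim=> [|a h Pa an _ IH|c h1 h2 _ IH1 _ IH2]; [exact: Aff_id| |exact: Aff_mix].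
by apply: Aff_T => //; apply: PQ.
Qed.

Lemma bs_cons a al i : bs (a :: al) i = if (i < sumn al)%N then bs al i else size al.
Proof. by []. Qed.

Lemma Aff_Bs al W : Aff (fun i => bs al i == bs al i.+1) (Bs al W).
Proof.
elim: al => [|a al IH]; first exact: Aff_id.
rewrite [Bs _ _]/= (recast_comp (v' := Qp (a + sumn al) ++ W)) ?nseqD_cat //.
apply: Aff_comp.
  apply: Aff_recast; apply: Aff_sub (Aff_sy a _) => i ia _.
  rewrite -[X in is_true X]/(bs (a :: al) (sumn al + i) == bs (a :: al) (sumn al + i).+1) !bs_cons.
  by rewrite !ifF //; lia.
apply: Aff_recast_ups; apply: Aff_sub IH => i ia bi.
rewrite -[X in is_true X]/(bs (a :: al) i == bs (a :: al) i.+1) !bs_cons.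
by rewrite !ifT //; lia.
Qed.

Lemma bs_lt al i : (i < sumn al)%N -> (bs al i < size al)%N.
Proof. by elim: al => //= a al IH ia; case: ifP => // /IH; lia. Qed.
Lemma bs_mono al i j : (i <= j)%N -> (j < sumn al)%N -> (bs al i <= bs al j)%N.
Proof.
elim: al => //= a al IH ij ja; case: ifP => i1; case: ifP => j1 //; [exact: IH| |lia].
exact: ltnW (bs_lt i1).
Qed.

Lemma Tg_Bs al i W : bs al i = bs al i.+1 -> (i.+1 < sumn al)%N -> Tg _ i W ∘ Bs al W = Bs al W.
Proof.
elim: al i => [|a al IH] i // E ia; rewrite [Bs _ _]/=.
have nE := nseqD_cat true a (sumn al) W.
rewrite (recast_comp (v' := Qp (a + sumn al) ++ W)) // hcompA.
move: E ia; rewrite !bs_cons -[sumn (a :: al)]/(a + sumn al)%N => E ia; move: E; case: (ltnP i.+1 (sumn al)) => i1.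
  rewrite ifT => [E|]; last by lia.
  have -> : Tg (a + sumn al) i W = recast _ _ (ups a (Tg (sumn al) i W)).
    elim: (a) => [|b IHb] /=; first by rewrite recast_id.
    transitivity (Tg (b + sumn al).+1 i W) => //.
    by rewrite Tg_up; [rewrite IHb recast_up ?nseqD_cat|lia].
  by rewrite -!(recast_comp (v' := Qp (a + sumn al) ++ W)) // -sy_nat -hcompA -ups_comp IH.
case: ltnP => i2 E; first by have := bs_lt i2; lia.
have -> : i = (sumn al + (i - sumn al))%N by lia.
rewrite -recast_Tg; last by lia.
rewrite -(recast_comp (v' := Qp (a + sumn al) ++ W)) // Tg_sy //; lia.
Qed.

Definition rho n (T : 'I_n -> nat) : galg k n :=
  [ffun w : 'S_n => if [forall i, T (w i) == T i] then
     #|[set w : 'S_n | [forall i, T (w i) == T i]]|%:R^-1 else 0].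

Definition gS_map n W (a : galg k n) : QHom (Qp n ++ W) (Qp n ++ W) := \sum_(w : 'S_n) a w *: pS W w.

Lemma rho_sum n (T : 'I_n -> nat) : \sum_w rho T w = 1.
Proof.
rewrite (bigID (fun w : 'S_n => w \in [set w : 'S_n | [forall i, T (w i) == T i]])) /= [X in _ + X]big1 ?addr0.
  rewrite (eq_bigr (fun=> #|[set w : 'S_n | [forall i, T (w i) == T i]]|%:R^-1)) => [|w].
    rewrite sumr_const -[_ *+ _]mulr_natl divff //.
    have : (0 < #|[set w : 'S_n | [forall i, T (w i) == T i]]|)%N.
      by apply/card_gt0P; exists 1%g; rewrite inE; apply/forallP => i; rewrite perm1.
    by case: #|_| => // m _; apply: natk_neq0.
  by rewrite inE ffunE => ->.
by move=> w; rewrite inE ffunE => /negbTE ->.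
Qed.

Lemma rho_mull n (T : 'I_n -> nat) (t w : 'S_n) : (forall i, T (t i) = T i) -> rho T (t * w)%g = rho T w.
Proof.
move=> Tt; rewrite !ffunE; congr (if _ then _ else _).
apply/forallP/forallP => H i; last by rewrite permM (eqP (H _)) Tt.
by have := H (t^-1%g i); rewrite permM permKV => /eqP ->; rewrite -[in X in _ == X](permKV t i) Tt.
Qed.

(** The average X over a Young subgroup satisfies [X ∘ B = X] because B is an affine combination of
    its elements, and [X ∘ B = B] because B is invariant. *)
Lemma gS_map_avg n W (tb : nat -> nat) (B : QHom (Qp n ++ W) (Qp n ++ W)) :
  (forall i j, (i <= j)%N -> (j < n)%N -> (tb i <= tb j)%N) ->
  (forall i, tb i = tb i.+1 -> (i.+1 < n)%N -> Tg n i W ∘ B = B) ->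
  Aff (fun i => tb i == tb i.+1) B -> gS_map W (rho (fun i : 'I_n => tb i)) = B.
Proof.
move=> mono TB AB; set T := fun i : 'I_n => _; set X := gS_map W _.
have XB : X ∘ B = X.
  apply: Aff_absr AB => a /eqP ta an; rewrite /X /gS_map; case: n @T mono B TB an @X => [|N] T mono B TB an X; first by [].
  have aN : (a < N)%N by lia.
  have Tt i : T (tperm (inord a) (inord a.+1) i) = T i.
    by rewrite /T; case: tpermP => [->|->|//]; rewrite !inordK //; lia.
  rewrite -pS_simple // hcomp_suml [RHS](reindex_inj (mulgI (tperm (inord a) (inord a.+1) : 'S_N.+1))).
  by apply: eq_bigr => w _; rewrite hcompZl -pS_mul /= rho_mull.
rewrite -XB /X /gS_map hcomp_suml -[RHS]scale1r -(rho_sum T) scaler_suml.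
apply: eq_bigr => w _; rewrite hcompZl ffunE; case: ifP => [/forallP wT|]; last by rewrite !scale0r.
congr (_ *: _); case: n w @T mono B TB AB @X XB wT => [|N] w T mono B TB AB X XB wT; first by rewrite /= hidl.
have [||u [uN <-]] := @pev_gen N T w.
- by move=> i j ij; apply: mono.
- by move=> i; apply/eqP.
rewrite pS_word; last by apply: sub_all uN => a /andP[].
elim: u uN => [|a u IH] /= => [_|/andP[/andP[aN /eqP ta] uN]]; first by rewrite hidl.
rewrite -hcompA IH //; apply: TB => //.
by move: ta; rewrite /T !inordK //; lia.
Qed.

Lemma gS_map_rho al W : gS_map W (rho (fun i : 'I_(sumn al) => bs al i)) = Bs al W.
Proof.
apply: gS_map_avg => [i j|i|]; [exact: bs_mono|exact: Tg_Bs|exact: Aff_Bs].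
Qed.

Lemma pn_map_heq n (a : galg k n) : heq (galg_map (@pn n) a) (gS_map [::] a).
Proof.
rewrite /galg_map /gS_map; apply: heq_sum; rewrite ?cats0 // => w.
apply: heq_scale; exact: pn_heq.
Qed.

Lemma Bs_tens al R R' : heq (Bs al (R ++ R')) (Bs al R ⊗ hid R').
Proof.
elim: al => [|a al IH]; first by rewrite /= htens_id; apply: heq_refl.
rewrite /=; apply: heq_trans (recast_heq _ _ _) _; rewrite ?nseqD_cat //.
apply: heq_sym; apply: heq_trans (heq_tens (recast_heq _ _ _) (heq_refl _)) _; rewrite ?nseqD_cat //.
rewrite tens_comp; apply: heq_sym; apply: heq_comp.
  by have := sy_tens k lam a (Qp (sumn al) ++ R) R'; rewrite -catA.
apply: heq_trans (heq_ups _ IH) _.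
elim: (a) => [|b IHb] /=; first exact: heq_refl.
by rewrite wh_tens; apply: heq_wh.
Qed.

Lemma Bs_cons_heq a al : heq (Bs (a :: al) [::]) (sy a [::] ⊗ Bs al [::]).
Proof.
rewrite /=; apply: heq_trans (recast_heq _ _ _) _; rewrite ?nseqD_cat //.
rewrite -[sy a [::] ⊗ _](_ : (sy a [::] ⊗ hid _) ∘ (hid (Qp a ++ [::]) ⊗ Bs al [::]) = _).
  apply: heq_comp; first exact: (sy_tens k lam a [::]).
  apply: heq_trans (upsE _ _) _; apply: heq_tens; last exact: heq_refl.
  by rewrite cats0; apply: heq_refl.
by rewrite hinterchange hidl hidr.
Qed.

Lemma Bs_idem al W : hidem (Bs al W).
Proof. by apply: Aff_absl (Aff_Bs al W) => a /eqP; apply: Tg_Bs. Qed.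

End Strands.

End SymmetricAction.
Import SymmetricAction.

(** * Rotation by 180 degrees and downward idempotents *)

Module Rotation.

Local Open Scope ring_scope.
Local Open Scope hom_scope.

Section Strands.
Context (k : fieldType) (char0 : [pchar k] =i pred0).
Context (lam : {fsfun int -> nat with 0%N}).
Local Notation QHom := (QHom k lam).
Local Notation hid := (hid k lam).
Local Notation gU := (gU k lam).
Local Notation gC := (gC k lam).
Local Notation sy := (sy k lam).
Local Notation up f := (wh true f).
Implicit Types u v w R W : word.
Local Notation Qp n := (nseq n true).
Local Notation ms := (ms k lam).

Fixpoint cuq n W : QHom W (nw n (Qp n ++ W)) :=
  match n return QHom W (nw n (Qp n ++ W)) with
  | 0 => hid W
  | n'.+1 => wn n' (gU (Qp n' ++ W)) ∘ cuq n' W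
  end.
Definition capq n R : QHom (Qp n ++ nw n R) R := kq (m := 0) (hid (nw n R)).

Lemma kq_capq n R W (g : QHom W (nw n R)) : kq (m := 0) g = capq n R ∘ ups n g.
Proof. by rewrite -[in LHS](hidl g) (kq_nat (m := 0)). Qed.

Lemma wn_comp n u v w (f : QHom v w) (g : QHom u v) : wn n (f ∘ g) = wn n f ∘ wn n g.
Proof. by elim: n u v w f g => //= n IH u v w f g; rewrite wh_comp IH. Qed.
Lemma kq_wn0 n u v W (f : QHom u v) (g : QHom W (nw n u)) : kq (m := 0) (wn n f ∘ g) = f ∘ kq (m := 0) g.
Proof. exact: (kq_wn (m := 0)). Qed.

Lemma kq_cuq n W : kq (m := 0) (cuq n W) = hid (Qp n ++ W).
Proof.
elim: n => [|n IH] /=; first by rewrite kq0.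
rewrite kqS kq_wn0 IH hidr /kap kp0.
exact: gC_zig.
Qed.

Lemma capq_rec n R : heq (capq n.+1 R) (capq n R ∘ ups n (gC (nw n R))).
Proof.
elim: n R => [|n IH] R.
  rewrite /capq kqS !kq0 /kap /= kp0 wh_id hidr hidl; exact: heq_refl.
have E m : capq m.+1 R = gC R ∘ up (capq m (false :: R)) by rewrite /capq kqS /kap kp0.
rewrite !E -hcompA -wh_comp; apply: heq_comp; first exact: heq_refl.
by apply: heq_wh; apply: IH.
Qed.

Lemma caps_heq n : heq (caps k lam n) (capq n [::]).
Proof.
elim: n => [|n IH] /=; first by rewrite /capq kq0; apply: heq_refl.
apply: heq_trans (heq_idtor _ _) _; apply: heq_trans _ (heq_sym (capq_rec _ _)).
apply: heq_comp => //; apply: heq_sym; apply: heq_trans (upsE _ _) _.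
rewrite /gC; apply: heq_tens; first exact: heq_refl.
have H : heq (hid (nw n [::])) (hid (nseq n false)) by apply: heq_hid; rewrite nwE cats0.
exact: (heq_tens (heq_refl (cl DRCap : QHom _ _)) H).
Qed.

Lemma cups_heq n W : heq (cups k lam n ⊗ hid W) (cuq n W).
Proof.
elim: n => [|n IH] /=; first by rewrite htens_id; apply: heq_refl.
rewrite tens_comp; apply: heq_comp => //; rewrite tens_comp.
have H1 := heq_tens (heq_idto k lam (nseq_cup n)) (heq_refl (hid W)).
apply: (heq_trans (heq_comp H1 (heq_refl _))); rewrite htens_id hidl; apply: heq_sym.
have H2 := wnE n (gU (Qp n ++ W)); apply: (heq_trans H2).
have H3 : heq (gU (Qp n ++ W)) (gU (Qp n) ⊗ hid W) by apply: gU_tens.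
apply: (heq_trans (heq_tens (heq_refl (hid (nseq n false))) H3)).
exact: heqA.
Qed.

Definition rot n (f : QHom (Qp n) (Qp n)) : QHom (nw n [::]) (nw n [::]) :=
  wn n (capq n [::] ∘ (f ⊗ hid (nw n [::]))) ∘ cuq n (nw n [::]).

Lemma rot_heq n (f : QHom (Qp n) (Qp n)) : heq (rotate f) (rot f).
Proof.
have e : nseq n false = nw n [::] by rewrite nwE cats0.
rewrite /rotate /rot wn_comp; apply: heq_comp.
  apply: heq_trans (heq_idtor _ _) _.
  rewrite -hcompA; apply: heq_trans (heq_idtol _ _) _; apply: heq_comp.
    apply: heq_sym; apply: heq_trans (wnE _ _) _; apply: heq_tens; first exact: heq_refl.
    exact: heq_sym (caps_heq n).
  apply: heq_sym; apply: heq_trans (wnE _ _) _; apply: heq_tens; first exact: heq_refl.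
  by apply: heq_tens; [exact: heq_refl|apply: heq_hid].
have H0 : heq (hid (nseq n false)) (hid (nw n [::])) by apply: heq_hid.
apply: (heq_trans (heq_tens (heq_refl (cups k lam n)) H0)); exact: cups_heq.
Qed.

(** Since [kq] is injective, this determines [rot f]: rotation at the target is precomposition with
    [f] at the source, and in particular reverses products. *)
Lemma kq_rot n (f : QHom (Qp n) (Qp n)) W (g : QHom W (nw n [::])) :
  kq (m := 0) (rot f ∘ g) = kq (m := 0) g ∘ (f ⊗ hid W).
Proof.
rewrite /rot -hcompA kq_wn0 kq_nat kq_cuq hidl kq_capq -!hcompA; congr (_ ∘ _).
have E : ups n g = hid (Qp n) ⊗ g by apply: heq_eq; apply: upsE.
by rewrite E -tens_natural.
Qed.

Lemma rot_uniq n (f : QHom (Qp n) (Qp n)) (h : QHom (nw n [::]) (nw n [::])) :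
  kq (m := 0) h = capq n [::] ∘ (f ⊗ hid _) -> rot f = h.
Proof.
by move=> hE; apply: (kq_inj (m := 0)); rewrite -[rot f]hidr kq_rot hE.
Qed.

Lemma rot_comp n (f g : QHom (Qp n) (Qp n)) : rot (f ∘ g) = rot g ∘ rot f.
Proof.
apply: rot_uniq; rewrite kq_rot -[rot f]hidr kq_rot tens_comp.
by rewrite -hcompA.
Qed.
Lemma rotD n (f g : QHom (Qp n) (Qp n)) : rot (f + g) = rot f + rot g.
Proof.
apply: rot_uniq; rewrite kqD htensDl hcompDr -[rot f]hidr -[rot g]hidr !kq_rot.
by [].
Qed.
Lemma rotate_comp n (f g : QHom (Qp n) (Qp n)) : rotate (f ∘ g) = rotate g ∘ rotate f.
Proof.
apply: heq_eq; apply: heq_trans (rot_heq _) _; rewrite rot_comp.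
by apply: heq_comp; apply: heq_sym; apply: rot_heq.
Qed.
Lemma rotateD n (f g : QHom (Qp n) (Qp n)) : rotate (f + g) = rotate f + rotate g.
Proof.
apply: heq_eq; apply: heq_trans (rot_heq _) _; rewrite rotD.
by apply: heqD; apply: heq_sym; apply: rot_heq.
Qed.
Lemma rotate0 n : rotate (0 : QHom (Qp n) (Qp n)) = 0.
Proof.
by apply: (addrI (rotate 0)); rewrite -rotateD !addr0.
Qed.

Lemma nwD a s R : nw (a + s) R = nw s (nw a R).
Proof. by elim: a R => //= a IH R; rewrite -IH. Qed.

Lemma recast_kap u u' R (f : QHom u (false :: R)) : u = u' ->
  kap (m := 0) (recast u' (false :: R) f) = recast (true :: u') R (kap (m := 0) f).
Proof. by move=> e; case: _ / e; rewrite !recast_id. Qed.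

Lemma kq_add a s R W (g : QHom W (nw s (nw a R))) :
  kq (q := (a + s)%N) (m := 0) (recast W (nw (a + s) R) g) =
  recast (Qp (a + s) ++ W) R (kq (m := 0) (q := a) (kq (m := 0) (q := s) g)).
Proof.
elim: a R g => [|a IH] R g; first by rewrite /= kq0 !recast_id.
transitivity (kap (m := 0) (kq (m := 0) (q := (a + s)%N) (recast W (nw (a + s) (false :: R)) g))); first exact: kqS.
rewrite (IH (false :: R) g) kqS; apply: recast_kap; exact: nseqD_cat.
Qed.

(** Rotation reverses the order of the blocks, so the head of the list is placed rightmost, next to
    [R]. *)
Fixpoint Cb al R : QHom (nw (sumn al) R) (nw (sumn al) R) :=
  match al return QHom (nw (sumn al) R) (nw (sumn al) R) with
  | [::] => hid R
  | a :: al' => recast _ _ (Cb al' (nw a R) ∘ wn (sumn al') (ms a R))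
  end.

Lemma kq_Cb al R W (g : QHom W (nw (sumn al) R)) : kq (m := 0) (Cb al R ∘ g) = kq (m := 0) g ∘ Bs k lam al W.
Proof.
elim: al R g => [|a al IH] R g; first by rewrite /= hidl hidr.
rewrite -[Cb _ _]/(recast (nw (a + sumn al) R) (nw (a + sumn al) R) (Cb al (nw a R) ∘ wn (sumn al) (ms a R))).
rewrite -[Bs _ _ _ _]/(recast (Qp (a + sumn al) ++ W) (Qp (a + sumn al) ++ W) (sy a (Qp (sumn al) ++ W) ∘ ups a (Bs k lam al W))).
pose g' := recast W (nw (sumn al) (nw a R)) g.
have gE : g = recast W (nw (a + sumn al) R) g'.
  by apply/esym; apply: recast_heq_eq; apply: recast_heq => //; apply: nwD.
rewrite gE -(recast_comp (v' := nw (a + sumn al) R)) ?nwD // !kq_add -(recast_comp (v' := Qp (a + sumn al) ++ W)) ?nseqD_cat //.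
congr (recast _ _ _); rewrite -hcompA IH kq_wn0 (kq_nat (m := 0)).
transitivity (kq (m := 0) (ups 0 (ms a R) ∘ kq (m := 0) g') ∘ ups a (Bs k lam al W)) => //.
by rewrite kq_ms // hcompA.
Qed.

Lemma Cb_idem al R : hidem (Cb al R).
Proof.
apply: (kq_inj (m := 0)); rewrite kq_Cb -[Cb al R]hidr kq_Cb -hcompA.
by rewrite (Bs_idem char0 lam al (nw (sumn al) R) : _ ∘ _ = _).
Qed.

Lemma Cb_cons_heq a al : heq (Cb (a :: al) [::]) (Cb al [::] ⊗ ms a [::]).
Proof.
rewrite /=; apply: heq_trans (recast_heq _ _ _) _; rewrite ?nwD //.
rewrite -[Cb al [::] ⊗ _](_ : (Cb al [::] ⊗ hid _) ∘ (hid _ ⊗ ms a [::]) = _); last by rewrite hinterchange hidl hidr.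
apply: heq_comp; last first.
  apply: heq_trans (wnE _ _) _; apply: heq_tens; last exact: heq_refl.
  by apply: heq_hid; rewrite nwE cats0.
have gen R R' : heq (Cb al (R ++ R')) (Cb al R ⊗ hid R').
  elim: (al) R => [|b be IH] R; first by rewrite /= htens_id; apply: heq_refl.
  rewrite /=; apply: heq_trans (recast_heq _ _ _) _; rewrite ?nwD //.
  apply: heq_sym; apply: heq_trans (heq_tens (recast_heq _ _ _) (heq_refl _)) _; rewrite ?nwD //.
  rewrite tens_comp; apply: heq_sym; apply: heq_comp; first by have := IH (nw b R); rewrite -nw_cat.
  apply: heq_trans (heq_wn _ (ms_tens _ _ _ _ _)) _; exact: wn_tens.
exact: (gen [::]).
Qed.

Lemma rot_block al (f : QHom (Qp (sumn al)) (Qp (sumn al))) : heq f (Bs k lam al [::]) -> rot f = Cb al [::].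
Proof.
move=> fB; apply: rot_uniq; rewrite -[Cb _ _]hidr kq_Cb; congr (_ ∘ _).
have H : heq (Bs k lam al ([::] ++ nw (sumn al) [::])) (Bs k lam al [::] ⊗ hid (nw (sumn al) [::])) by apply: Bs_tens.
apply: heq_eq; apply: (heq_trans H); exact: (heq_tens (heq_sym fB) (heq_refl _)).
Qed.
End Strands.

End Rotation.
Import Rotation.

(** * Additive functions on idempotents of the group algebra *)

Module GroupAlgebraIdempotents.

Local Open Scope ring_scope.

Lemma mxtrace_idem (F : fieldType) m (M : 'M[F]_m) : M *m M = M -> \tr M = (\rank M)%:R.
Proof.
move=> MM; rewrite -{1}(mulmx_base M) mxtrace_mulC.
suff -> : row_base M *m col_base M = 1%:M by rewrite mxtrace1.
apply: (row_full_inj (col_base_full M)); apply: (row_free_inj (row_base_free M)).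
rewrite /= mulmx1 mulmx_base; transitivity ((col_base M *m row_base M) *m (col_base M *m row_base M)).
  by rewrite !mulmxA.
by rewrite mulmx_base.
Qed.

Section Regular.
Context (R : pzRingType).
Implicit Types a b e f x y z : R.

Definition idem e := e * e = e.
(** For idempotents this is isomorphism of the left ideals they generate. *)
Definition eqv_idem e f := exists x y, e = x * y /\ f = y * x.
Definition idem_additive (V : zmodType) (Phi : R -> V) :=
  (forall e f, idem e -> idem f -> eqv_idem e f -> Phi e = Phi f) /\
  (forall e f, idem e -> idem f -> e * f = 0 -> f * e = 0 -> Phi (e + f) = Phi e + Phi f).

Lemma idem_additive0 (V : zmodType) (Phi : R -> V) : idem_additive Phi -> Phi 0 = 0.
Proof.
case=> _ D; have i0 : idem 0 by rewrite /idem mul0r.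
by have := D 0 0 i0 i0 (mul0r _) (mul0r _); rewrite addr0 => /esym E; apply: (addrI (Phi 0)); rewrite E addr0.
Qed.

Context (reg : forall x, exists y, x * y * x = x).

(** A quasi-inverse w of t = f z e, cut down to w' = e w f, gives the equivalent idempotents w' t
    and t w' below [e] and [f]. *)
Lemma split_common e f z : idem e -> idem f -> f * z * e <> 0 ->
  exists e1 f1, [/\ [/\ idem e1, idem (e - e1), e1 * (e - e1) = 0 & (e - e1) * e1 = 0],
    [/\ idem f1, idem (f - f1), f1 * (f - f1) = 0 & (f - f1) * f1 = 0], eqv_idem e1 f1 & e1 <> 0].
Proof.
move=> ee ff t0; set t := f * z * e in t0.
have te : t * e = t by rewrite /t -mulrA ee.
have ft : f * t = t by rewrite /t !mulrA ff.
clearbody t; have [w tw] := reg t; pose w' := e * w * f.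
have tw' : t * w' * t = t by rewrite /w' -!mulrA ft (mulrA t) te mulrA tw.
have ew : e * w' = w' by rewrite /w' !mulrA ee.
have wf : w' * f = w' by rewrite /w' -mulrA ff.
have i1 : idem (w' * t) by rewrite /idem -mulrA (mulrA t) tw'.
have i2 : idem (t * w') by rewrite /idem mulrA tw'.
have s1 : e * (w' * t) = w' * t by rewrite mulrA ew.
have s2 : w' * t * e = w' * t by rewrite -mulrA te.
have s3 : f * (t * w') = t * w' by rewrite (mulrA f) ft.
have s4 : t * w' * f = t * w' by rewrite -mulrA wf.
exists (w' * t), (t * w'); split.
- split=> //.
  + by rewrite /idem mulrBl !mulrBr ee s1 s2 i1 subrr subr0.
  + by rewrite mulrBr s2 i1 subrr.
  by rewrite mulrBl s1 i1 subrr.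
- split=> //.
  + by rewrite /idem mulrBl !mulrBr ff s3 s4 i2 subrr subr0.
  + by rewrite mulrBr s4 i2 subrr.
  by rewrite mulrBl s3 i2 subrr.
- by exists w', t.
by move=> w0; apply: t0; rewrite -tw' -mulrA w0 mulr0.
Qed.

Context (dm : R -> nat).
Hypothesis dmD : forall e f, idem e -> idem f -> e * f = 0 -> f * e = 0 -> dm (e + f) = (dm e + dm f)%N.
Hypothesis dm0 : forall e, idem e -> dm e = 0%N -> e = 0.

(** As long as some f z e is nonzero, equivalent summands are removed from both lists, which changes
    no difference of additive functions; the total dimension of the first list decreases. *)
Lemma reduce (a b : seq R) : {in a, forall e, idem e} -> {in b, forall e, idem e} ->
  exists a' b' : seq R, [/\ {in a', forall e, idem e}, {in b', forall e, idem e},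
    (forall x y z, x \in a' -> y \in b' -> y * z * x = 0) &
    forall (V : zmodType) (Phi : R -> V), idem_additive Phi ->
      \sum_(x <- a) Phi x - \sum_(x <- b) Phi x = \sum_(x <- a') Phi x - \sum_(x <- b') Phi x].
Proof.
have [t] := ubnP (\sum_(x <- a) dm x)%N; elim: t a b => // t IH a b at' ia ib.
case: (pselect (forall x y z, x \in a -> y \in b -> y * z * x = 0)) => [H|].
  by exists a, b.
move/existsNP => [e /existsNP[f /existsNP[z /not_implyP[ea /not_implyP[fb fze]]]]].
have ie := ia e ea; have jf := ib f fb.
have [e1 [f1 [[i1 i1' o1 o1'] [j1 j1' p1 p1'] ef e10]]] := split_common ie jf fze.
have [|||a' [b' [ia' ib' ab' E]]] := IH (e - e1 :: rem e a) (f - f1 :: rem f b).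
- rewrite big_cons -ltnS; apply: leq_trans at'; rewrite ltnS.
  rewrite (perm_big _ (perm_to_rem ea)) big_cons /= ltn_add2r.
  have Ed : dm e = (dm (e - e1) + dm e1)%N by rewrite -dmD ?subrK.
  rewrite Ed -[X in (X < _)%N]addn0 ltn_add2l lt0n; apply/eqP => /(dm0 i1); exact: e10.
- by move=> x; rewrite inE => /orP[/eqP -> //|/mem_rem]; apply: ia.
- by move=> x; rewrite inE => /orP[/eqP -> //|/mem_rem]; apply: ib.
exists a', b'; split=> // V Phi PA; rewrite -E //; have [Pe PD] := PA.
rewrite (perm_big _ (perm_to_rem ea)) (perm_big _ (perm_to_rem fb)) !big_cons /=.
have -> : Phi e = Phi (e - e1) + Phi e1 by rewrite -PD ?subrK.
have -> : Phi f = Phi (f - f1) + Phi e1 by rewrite (Pe e1 f1) // -PD ?subrK.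
by rewrite [Phi (e - e1) + Phi e1 + _]addrAC [Phi (f - f1) + Phi e1 + _]addrAC opprD addrACA subrr addr0.
Qed.

End Regular.

Section GroupRing.
Context (k : fieldType) (char0 : [pchar k] =i pred0) (n : nat).

Definition GR : Type := {ffun 'S_n -> k^o}.
HB.instance Definition _ := GRing.Lmodule.copy GR {ffun 'S_n -> k^o}.
Implicit Types a b c x y z : GR.

Definition ga_mul a b : GR := gmul (a : galg k n) b.
Definition dlt (w : 'S_n) : GR := [ffun x => (x == w)%:R].

Lemma ga_mulE a b w : ga_mul a b w = \sum_u a u * b (w * u^-1)%g.
Proof. by rewrite ffunE. Qed.
Lemma ga_mulA : associative ga_mul.
Proof.
move=> a b c; apply/ffunP => w; rewrite !ga_mulE.
under [RHS]eq_bigr => u _ do rewrite ga_mulE mulr_suml.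
rewrite exchange_big /=; apply: eq_bigr => v _; rewrite ga_mulE mulr_sumr.
rewrite [RHS](reindex_inj (mulIg v)); apply: eq_bigr => u _.
by rewrite mulgK invMg !mulgA mulrA.
Qed.
Lemma ga_mul1l : left_id (dlt 1) ga_mul.
Proof.
move=> a; apply/ffunP => w; rewrite ga_mulE (bigD1 1%g) //= big1 => [|u u1].
  by rewrite ffunE eqxx mul1r invg1 mulg1 addr0.
by rewrite ffunE (negbTE u1) mul0r.
Qed.
Lemma ga_mul1r : right_id (dlt 1) ga_mul.
Proof.
move=> a; apply/ffunP => w; rewrite ga_mulE (bigD1 w) //= big1 => [|u u1].
  by rewrite ffunE mulgV eqxx mulr1 addr0.
by rewrite ffunE -(inj_eq (mulIg u)) mulgKV mul1g eq_sym (negbTE u1) mulr0.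
Qed.
Lemma ga_mulDl : left_distributive ga_mul +%R.
Proof.
move=> a b c; apply/ffunP => w; rewrite ga_mulE [RHS]ffunE !ga_mulE -big_split.
by apply: eq_bigr => u _; rewrite ffunE mulrDl.
Qed.
Lemma ga_mulDr : right_distributive ga_mul +%R.
Proof.
move=> a b c; apply/ffunP => w; rewrite ga_mulE [RHS]ffunE !ga_mulE -big_split.
by apply: eq_bigr => u _; rewrite ffunE mulrDr.
Qed.
HB.instance Definition _ := GRing.Zmodule_isPzRing.Build GR ga_mulA ga_mul1l ga_mul1r ga_mulDl ga_mulDr.

Lemma gmulE a b : a * b = gmul (a : galg k n) b. Proof. by []. Qed.
Lemma GR_mulE a b w : (a * b) w = \sum_u a u * b (w * u^-1)%g. Proof. exact: ga_mulE. Qed.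

Lemma gr_scalel (s : k) a b : (s *: a) * b = s *: (a * b).
Proof.
apply/ffunP => w; rewrite GR_mulE [RHS]ffunE GR_mulE /GRing.scale /= mulr_sumr.
by apply: eq_bigr => u _; rewrite ffunE mulrA.
Qed.
Lemma gr_scaler (s : k) a b : a * (s *: b) = s *: (a * b).
Proof.
apply/ffunP => w; rewrite GR_mulE [RHS]ffunE GR_mulE /GRing.scale /= mulr_sumr.
by apply: eq_bigr => u _; rewrite ffunE mulrCA.
Qed.

Lemma gr_expand a : a = \sum_w (a w : k) *: dlt w.
Proof.
apply/ffunP => v; rewrite sum_ffunE (bigD1 v) //= big1 ?addr0.
  by rewrite !ffunE eqxx; apply/esym/mulr1.
by move=> w wv; rewrite !ffunE eq_sym (negbTE wv); apply: mulr0.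
Qed.

Lemma dlt_mul u v : dlt u * dlt v = dlt (v * u)%g.
Proof.
apply/ffunP => w; rewrite GR_mulE (bigD1 u) //= big1 ?addr0 => [|x xu].
  by rewrite !ffunE eqxx mul1r -(inj_eq (mulIg u)) mulgKV.
by rewrite ffunE (negbTE xu) mul0r.
Qed.

Definition lin (f : GR -> GR) := forall a, f a = \sum_w (a w : k) *: f (dlt w).
Lemma lin_lr x y : lin (fun z => x * z * y).
Proof.
move=> a; rewrite [in LHS](gr_expand a) mulr_sumr mulr_suml.
by apply: eq_bigr => w _; rewrite gr_scaler gr_scalel.
Qed.

Local Notation N := #|'S_n|.
Definition vec a : 'rV[k]_N := \row_i a (enum_val i).
Definition unvec (v : 'rV[k]_N) : GR := [ffun w => v 0 (enum_rank w)].
Lemma vecK a : unvec (vec a) = a.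
Proof. by apply/ffunP => w; rewrite ffunE mxE enum_rankK. Qed.
Definition mxl (f : GR -> GR) : 'M[k]_N := \matrix_(i, j) f (dlt (enum_val i)) (enum_val j).

Lemma sum_enum (F : 'S_n -> k) : \sum_(i < N) F (enum_val i) = \sum_w F w.
Proof. by rewrite [RHS](reindex (@enum_val _ 'S_n)) //=; apply/onW_bij/enum_val_bij. Qed.

Lemma vec_mxl f a : lin f -> vec (f a) = vec a *m mxl f.
Proof.
move=> fl; apply/rowP => j; rewrite !mxE fl sum_ffunE.
rewrite -(sum_enum (fun w => ((a w : k) *: f (dlt w)) (enum_val j))).
by apply: eq_bigr => i _; rewrite !mxE ffunE.
Qed.
Lemma mxl_comp f g : lin f -> mxl (f \o g) = mxl g *m mxl f.
Proof.
move=> fl; apply/row_matrixP => i; rewrite row_mul.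
have rowE h : row i (mxl h) = vec (h (dlt (enum_val i))) by apply/rowP => j; rewrite !mxE.
by rewrite !rowE -vec_mxl.
Qed.

(** For idempotents this is the dimension of c kS_n a, the space of homomorphisms from kS_n c to
    kS_n a. As a trace it is additive in both arguments and computable from coefficients. *)
Definition tau a c : k := \tr (mxl (fun z => c * z * a)).
Lemma tauE a c : tau a c = \sum_w (c * dlt w * a) w.
Proof. by rewrite /tau /mxtrace -(sum_enum (fun w => (c * dlt w * a) w)); apply: eq_bigr => i _; rewrite mxE. Qed.

Lemma tauDl a b c : tau (a + b) c = tau a c + tau b c.
Proof. by rewrite !tauE -big_split; apply: eq_bigr => w _; rewrite mulrDr ffunE. Qed.
Lemma tauDr a b c : tau a (b + c) = tau a b + tau a c.
Proof. by rewrite !tauE -big_split; apply: eq_bigr => w _; rewrite !mulrDl ffunE. Qed.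

Definition tn a c : nat := \rank (mxl (fun z => c * z * a)).
Lemma tau_tn a c : idem a -> idem c -> tau a c = (tn a c)%:R.
Proof.
move=> ia ic; apply: mxtrace_idem; rewrite -mxl_comp; last exact: lin_lr.
congr mxl; apply/funext => z /=; rewrite !mulrA ic -!mulrA.
by rewrite ia.
Qed.
Lemma tn0 a c : tn a c = 0%N -> forall z, c * z * a = 0.
Proof.
move=> /eqP; rewrite mxrank_eq0 => /eqP M0 z.
by rewrite -[LHS]vecK (vec_mxl (f := fun z => c * z * a)) ?M0 ?mulmx0; [apply/ffunP => w; rewrite !ffunE mxE|apply: lin_lr].
Qed.
Lemma tau_eql e f c : eqv_idem e f -> tau e c = tau f c.
Proof.
case=> x [y [-> ->]].
have E u v : mxl (fun z => c * z * (u * v)) = mxl (fun z => 1 * z * u) *m mxl (fun z => c * z * v).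
  by rewrite -mxl_comp; [congr mxl; apply/funext => z /=; rewrite mul1r !mulrA|apply: lin_lr].
rewrite /tau E mxtrace_mulC -!mxl_comp; last exact: lin_lr.
by congr (\tr (mxl _)); apply/funext => z /=; rewrite !mul1r !mulrA.
Qed.
Lemma tau_eqr e f c : eqv_idem e f -> tau c e = tau c f.
Proof.
case=> x [y [-> ->]].
have E u v : mxl (fun z => (u * v) * z * c) = mxl (fun z => v * z * 1) *m mxl (fun z => u * z * c).
  by rewrite -mxl_comp; [congr mxl; apply/funext => z /=; rewrite mulr1 !mulrA|apply: lin_lr].
rewrite /tau E mxtrace_mulC -!mxl_comp; last exact: lin_lr.
by congr (\tr (mxl _)); apply/funext => z /=; rewrite !mulr1 !mulrA.
Qed.

Lemma natr_inj (i j : nat) : i%:R = j%:R :> k -> i = j.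
Proof.
wlog ij : i j / (i <= j)%N => [H|].
  by case/orP: (leq_total i j) => [ij E|ji E]; [apply: H|apply/esym; apply: H].
move/eqP; rewrite eq_sym -subr_eq0 -natrB //; case ji: (j - i)%N => [|m]; first by move: ji; lia.
have /pcharf0P -> := char0; by [].
Qed.

(** Maschke's argument: a linear quasi-inverse of right multiplication by x, averaged over the
    group, commutes with left multiplications and hence is right multiplication by its value at
    1. *)
Lemma gr_regular x : exists y, x * y * x = x.
Proof.
pose R := mxl (fun z => 1 * z * x); pose P z := unvec (vec z *m pinvmx R).
have PD (c : 'S_n -> k) (F : 'S_n -> GR) : P (\sum_w c w *: F w) = \sum_w c w *: P (F w).
  rewrite /P; apply/ffunP => v; rewrite ffunE sum_ffunE.
  have -> : vec (\sum_w c w *: F w) = \sum_w c w *: vec (F w).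
    apply/rowP => j; rewrite !mxE sum_ffunE summxE; apply: eq_bigr => w _; by rewrite !mxE !ffunE.
  rewrite mulmx_suml summxE; apply: eq_bigr => w _.
  by rewrite -scalemxAl [RHS]ffunE ffunE mxE.
have Px z : P (z * x) * x = z * x.
  have E y : y * x = unvec (vec y *m R).
    by rewrite -(vec_mxl (f := fun z => 1 * z * x)) ?vecK ?mul1r //; apply: lin_lr.
  rewrite [LHS]E (_ : vec (P (z * x)) = vec (z * x) *m pinvmx R); last first.
    by apply/rowP => j; rewrite !mxE ffunE enum_valK mxE.
  have -> : vec (z * x) = vec z *m R.
    by rewrite -(vec_mxl (f := fun z => 1 * z * x)) ?mul1r //; apply: lin_lr.
  by rewrite mulmxKpV ?submxMl // E.
have cN : (n`!%:R : k) != 0.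
  by have := fact_gt0 n; case: n`! => // m _; have /pcharf0P -> := char0.
pose Q z : GR := n`!%:R^-1 *: \sum_g dlt g^-1%g * P (dlt g * z).
have Ql h z : Q (dlt h * z) = dlt h * Q z.
  rewrite /Q gr_scaler; congr (_ *: _); rewrite mulr_sumr [RHS](reindex_inj (mulgI h)) /=.
  by apply: eq_bigr => g _; rewrite [RHS]mulrA dlt_mul invMg mulgKV mulrA dlt_mul.
have Qlin z : Q z = z * Q 1.
  rewrite {2}(gr_expand z) mulr_suml.
  transitivity (\sum_w (z w : k) *: Q (dlt w)); last first.
    by apply: eq_bigr => w _; rewrite gr_scalel -Ql mulr1.
  rewrite /Q {1}(gr_expand z).
  transitivity (n`!%:R^-1 *: (\sum_g \sum_w (z w : k) *: (dlt g^-1%g * P (dlt g * dlt w)))).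
    congr (_ *: _); apply: eq_bigr => g _; rewrite mulr_sumr.
    have -> : \sum_w dlt g * ((z w : k) *: dlt w) = \sum_w (z w : k) *: (dlt g * dlt w).
      by apply: eq_bigr => w _; rewrite gr_scaler.
    by rewrite PD mulr_sumr; apply: eq_bigr => w _; rewrite gr_scaler.
  rewrite exchange_big /= scaler_sumr; apply: eq_bigr => w _.
  by rewrite -scaler_sumr !scalerA mulrC.
exists (Q 1); rewrite -Qlin /Q gr_scalel mulr_suml.
rewrite (eq_bigr (fun=> x)) => [|g _].
  by rewrite sumr_const card_Sn -scaler_nat scalerA mulVf // scale1r.
by rewrite -mulrA Px mulrA dlt_mul mulgV; apply: ga_mul1l.
Qed.

Definition dmn e := tn e 1.
Lemma dmnD e f : idem e -> idem f -> e * f = 0 -> f * e = 0 -> dmn (e + f) = (dmn e + dmn f)%N.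
Proof.
move=> ie jf ef fe; have i1 : idem (1 : GR) by rewrite /idem mul1r.
have ief : idem (e + f) by rewrite /idem mulrDl !mulrDr ie jf ef fe addr0 add0r.
by apply: natr_inj; rewrite natrD -!tau_tn // tauDl.
Qed.
Lemma dmn0 e : idem e -> dmn e = 0%N -> e = 0.
Proof. by move=> _ /tn0 /(_ 1); rewrite !mul1r. Qed.

Lemma tau_addr c : idem_additive (fun a => tau c a).
Proof. by split=> [e f _ _|e f _ _ _ _]; [apply: tau_eqr|apply: tauDr]. Qed.

Lemma tn_pos x : idem x -> x <> 0 -> (0 < tn x x)%N.
Proof. move=> ix x0; rewrite lt0n; apply/eqP => /tn0 /(_ 1); rewrite mulr1 ix; exact: x0. Qed.

(** After cancellation the two families are orthogonal, so the norm of the formal difference is the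
    sum of their norms, each at least the number of members because every nonzero idempotent has
    positive norm. *)
Lemma reduce_norm (a b : seq GR) r : {in a, forall e, idem e} -> {in b, forall e, idem e} ->
  \sum_(x <- a) (\sum_(y <- a) tau x y - \sum_(y <- b) tau x y)
   - \sum_(x <- b) (\sum_(y <- a) tau x y - \sum_(y <- b) tau x y) = r%:R ->
  exists a' b' : seq GR, [/\ forall x, x \in a' -> idem x /\ x <> 0,
    forall x, x \in b' -> idem x /\ x <> 0,
    forall (V : zmodType) (Phi : GR -> V), idem_additive Phi ->
      \sum_(x <- a) Phi x - \sum_(x <- b) Phi x = \sum_(x <- a') Phi x - \sum_(x <- b') Phi x,
    ((\sum_(x <- a') \sum_(y <- a') tn x y) + (\sum_(x <- b') \sum_(y <- b') tn x y))%N = r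
  & (size a' <= \sum_(x <- a') \sum_(y <- a') tn x y)%N /\ (size b' <= \sum_(x <- b') \sum_(y <- b') tn x y)%N].
Proof.
move=> ia ib norm1.
have [a0 [b0 [ia0 ib0 ab0 E0]]] := reduce gr_regular dmnD dmn0 ia ib.
pose a' := [seq x <- a0 | x != 0]; pose b' := [seq x <- b0 | x != 0].
have E (V' : zmodType) (Psi : GR -> V') : idem_additive Psi ->
    \sum_(x <- a) Psi x - \sum_(x <- b) Psi x = \sum_(x <- a') Psi x - \sum_(x <- b') Psi x.
  move=> PsA; rewrite E0 // !big_filter; have Ps0 := idem_additive0 PsA.
  have nz (s : seq GR) : \sum_(x <- s) Psi x = \sum_(x <- s | x != 0) Psi x.
    by rewrite [RHS]big_mkcond; apply: eq_bigr => x _; case: eqP => // ->; rewrite Ps0.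
  by rewrite !nz.
have ia' x : x \in a' -> idem x /\ x <> 0.
  by rewrite mem_filter => /andP[/eqP x0 xa]; split=> //; apply: ia0.
have ib' x : x \in b' -> idem x /\ x <> 0.
  by rewrite mem_filter => /andP[/eqP x0 xa]; split=> //; apply: ib0.
have ab x y : x \in a' -> y \in b' -> tau x y = 0 /\ tau y x = 0.
  rewrite !mem_filter => /andP[_ xa] /andP[_ yb].
  have H z : y * z * x = 0 by apply: ab0.
  have ix := ia0 x xa; have iy := ib0 y yb.
  have H' z : x * z * y = 0.
    have [w W] := gr_regular (x * z * y); rewrite -W.
    have : y * w * x = 0 by apply: H.
    move=> H2; transitivity (x * z * (y * w * x) * z * y); first by rewrite !mulrA.
    by rewrite H2 mulr0 !mul0r.
  split; rewrite tauE big1 // => w _; [by rewrite H ffunE|by rewrite H' ffunE].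
have norm1' : ((\sum_(x <- a') \sum_(y <- a') tn x y) + (\sum_(x <- b') \sum_(y <- b') tn x y))%N = r.
  apply: natr_inj; rewrite natrD !natr_sum -[RHS]norm1.
  have -> : \sum_(x <- a) (\sum_(y <- a) tau x y - \sum_(y <- b) tau x y)
     = \sum_(x <- a) (\sum_(y <- a') tau x y - \sum_(y <- b') tau x y).
    by apply: eq_bigr => x _; apply: (E _ (fun y => tau x y)); apply: tau_addr.
  have -> : \sum_(x <- b) (\sum_(y <- a) tau x y - \sum_(y <- b) tau x y)
     = \sum_(x <- b) (\sum_(y <- a') tau x y - \sum_(y <- b') tau x y).
    by apply: eq_bigr => x _; apply: (E _ (fun y => tau x y)); apply: tau_addr.
  rewrite (E _ (fun x => \sum_(y <- a') tau x y - \sum_(y <- b') tau x y)); last first.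
    split=> [x y ix iy xy|x y _ _ _ _].
      by congr (_ - _); apply: eq_bigr => z _; apply: tau_eql.
    rewrite addrACA -opprD -!big_split; congr (_ - _); apply: eq_bigr => z _; exact: tauDl.
  rewrite -[X in _ = _ - X]opprK opprK; congr (_ + _).
    apply: eq_big_seq => x xa; rewrite [X in _ = _ - X]big1_seq ?subr0 => [|y /= yb].
      by rewrite natr_sum; apply: eq_big_seq => y ya; rewrite tau_tn //; [have [] := ia' x xa|have [] := ia' y ya].
    by have [] := ab x y xa yb.
  rewrite -sumrN; apply: eq_big_seq => y yb; rewrite [X in _ = - (X - _)]big1_seq => [|x /= xa].
    rewrite sub0r opprK natr_sum; apply: eq_big_seq => x xb.
    by rewrite tau_tn //; [have [] := ib' y yb|have [] := ib' x xb].
  by have [] := ab x y xa yb.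
have szle (s : seq GR) : (forall x, x \in s -> idem x /\ x <> 0) -> (size s <= \sum_(x <- s) \sum_(y <- s) tn x y)%N.
  move=> is'; rewrite -sum1_size big_seq [leqRHS]big_seq; apply: leq_sum => x xs.
  have [ix x0] := is' x xs; apply: leq_trans (tn_pos ix x0) _.
  by rewrite (big_rem x xs) /= leq_addr.
exists a', b'; split=> //; split; exact: szle.
Qed.

Lemma recognize0 (a b : seq GR) : {in a, forall e, idem e} -> {in b, forall e, idem e} ->
  \sum_(x <- a) (\sum_(y <- a) tau x y - \sum_(y <- b) tau x y)
   - \sum_(x <- b) (\sum_(y <- a) tau x y - \sum_(y <- b) tau x y) = 0 ->
  forall (V : zmodType) (Phi : GR -> V), idem_additive Phi -> \sum_(x <- a) Phi x = \sum_(x <- b) Phi x.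
Proof.
move=> ia ib norm0 V Phi PA; have [a' [b' [_ _ E nE [sa sb]]]] := reduce_norm (r := 0) ia ib norm0.
apply/eqP; rewrite -subr_eq0 E //; have -> : a' = [::] by apply: size0nil; move: nE sa; lia.
have -> : b' = [::] by apply: size0nil; move: nE sb; lia.
by rewrite !big_nil subrr.
Qed.

(** Norm 1 leaves a single idempotent f up to sign, and the positive pairing with [e] excludes the
    negative sign. A nonzero pairing provides a common summand; it is all of [e] by primitivity, and
    all of f because f has norm 1. *)
Lemma recognize (a b : seq GR) (e : GR) m : {in a, forall e, idem e} -> {in b, forall e, idem e} ->
  idem e -> e <> 0 ->
  (forall x y, idem x -> idem y -> x * y = 0 -> y * x = 0 -> e = x + y -> x = 0 \/ y = 0) ->
  \sum_(x <- a) (\sum_(y <- a) tau x y - \sum_(y <- b) tau x y)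
   - \sum_(x <- b) (\sum_(y <- a) tau x y - \sum_(y <- b) tau x y) = 1 ->
  \sum_(y <- a) tau e y - \sum_(y <- b) tau e y = m.+1%:R ->
  forall (V : zmodType) (Phi : GR -> V), idem_additive Phi ->
    Phi e = \sum_(x <- a) Phi x - \sum_(x <- b) Phi x.
Proof.
move=> ia ib ie e0 prim norm1 pos V Phi PA.
have [a' [b' [ia' ib' E norm1' [sa sb]]]] := reduce_norm (r := 1) ia ib norm1.
rewrite E //; rewrite (E _ (fun y => tau e y)) in pos; last exact: tau_addr.
case: a' sa ia' norm1' pos {E} => [|f [|? ?]] sa ia' norm1' pos; last 2 first.
- have b'0 : b' = [::] by apply: size0nil; move: norm1' sa sb => /=; lia.
  rewrite b'0 !big_seq1 !big_nil !subr0 in pos norm1' *.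
  have [jf f0] := ia' f (mem_head _ _); rewrite addn0 in norm1'.
  have : ~ (forall z, f * z * e = 0).
    move=> H; have : tau e f = 0 by rewrite tauE big1 // => w _; rewrite H ffunE.
    by rewrite pos => /eqP; have /pcharf0P -> := char0.
  move=> /existsNP[z /(split_common gr_regular ie jf)[e1 [f1 [[i1 i1' o1 o1'] [j1 j1' p1 p1'] ef e10]]]].
  have e1E : e = e1.
    have [/e10 []|/eqP] := prim _ _ i1 i1' o1 o1' (esym (subrKC e1 e)).
    by rewrite subr_eq0 => /eqP.
  have f10 : f1 <> 0.
    have [x [y [ex fy]]] := ef; move=> f0'; apply: e10.
    by rewrite -i1 ex -mulrA (mulrA y) -fy f0' mul0r mulr0.
  have f1E : f = f1.
    apply: contrapT => ff1; have f20 : f - f1 <> 0 by move/eqP; rewrite subr_eq0 => /eqP.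
    have : tau f f = (tn f1 f1 + tn f1 (f - f1) + (tn (f - f1) f1 + tn (f - f1) (f - f1)))%:R.
      by rewrite !natrD -!tau_tn // -!tauDr -tauDl subrKC.
    rewrite tau_tn // => /natr_inj; rewrite norm1'.
    case: (tn f1 f1) (tn_pos j1 f10) => // n1 _; case: (tn (f - f1) (f - f1)) (tn_pos j1' f20) => // n2 _.
    by rewrite !addSn !addnS.
  by have [Pe _] := PA; apply: Pe; rewrite // e1E f1E.
- by move: norm1' sa => /=; lia.
have : (\sum_(y <- b') tn e y + m.+1)%:R = 0 :> k.
  rewrite natrD -pos big_nil sub0r natr_sum; apply/eqP; rewrite subr_eq0; apply/eqP.
  by apply: eq_big_seq => y yb; rewrite tau_tn //; have [] := ib' y yb.
by move/eqP; rewrite addnS; have /pcharf0P -> := char0.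
Qed.

End GroupRing.

End GroupAlgebraIdempotents.
Import GroupAlgebraIdempotents.

(** * The form on Young idempotents counts fillings *)

Module Tabloids.

Local Open Scope ring_scope.

Section Orbits.
Context (n N : nat).
Local Notation X := {ffun 'I_n -> 'I_N}.
Definition pact (f : X) (v : 'S_n) : X := [ffun i => f (v i)].
Lemma pactM (f : X) (u v : 'S_n) : pact f (u * v)%g = pact (pact f v) u.
Proof. by apply/ffunP => i; rewrite !ffunE permM. Qed.
Lemma pact1 (f : X) : pact f 1%g = f.
Proof. by apply/ffunP => i; rewrite !ffunE perm1. Qed.

Definition stab (T : 'I_n -> nat) : {set 'S_n} := [set w : 'S_n | [forall i, T (w i) == T i]].
Lemma stabP (T : 'I_n -> nat) (w : 'S_n) : reflect (forall i, T (w i) = T i) (w \in stab T).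
Proof. by rewrite inE; apply: (iffP forallP) => H i; apply/eqP; apply: H. Qed.
Lemma stabM (T : 'I_n -> nat) (u v : 'S_n) : u \in stab T -> v \in stab T -> (u * v)%g \in stab T.
Proof. by move=> /stabP Hu /stabP Hv; apply/stabP => i; rewrite permM Hv Hu. Qed.
Lemma stabV (T : 'I_n -> nat) (u : 'S_n) : u \in stab T -> u^-1%g \in stab T.
Proof. by move=> /stabP Hu; apply/stabP => i; rewrite -[in RHS](permKV u i) Hu. Qed.
Lemma stab_card_gt0 (T : 'I_n -> nat) : (0 < #|stab T|)%N.
Proof. by apply/card_gt0P; exists 1%g; apply/stabP => i; rewrite perm1. Qed.

Definition fixf (f : X) : {set 'S_n} := [set w : 'S_n | pact f w == f].
Lemma fixf_stab (f : X) : fixf f = stab (fun i => f i).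
Proof.
apply/setP => w; rewrite !inE; apply/eqP/forallP => [H i|H].
  by rewrite -{2}H ffunE.
by apply/ffunP => i; rewrite ffunE; apply: val_inj; apply/eqP; exact: H.
Qed.

Definition orb (f : X) : {set X} := [set pact f w | w : 'S_n].

Lemma card_transporter (T : 'I_n -> nat) (f g : X) :
  #|[set v in stab T | pact f v == g]| = if [exists v in stab T, pact f v == g] then #|stab T :&: fixf g| else 0%N.
Proof.
case: ifP => [/existsP[v0 /andP[v0T /eqP v0E]]|/negbT H]; last first.
  apply/eqP; rewrite cards_eq0; apply/eqP/setP => v; rewrite !inE; apply/negP => vv.
  by case/negP: H; apply/existsP; exists v; rewrite inE.
rewrite -[RHS](card_imset _ (mulIg v0)); apply: eq_card => v; apply/idP/imsetP.
  rewrite inE => /andP[vT /eqP vE]; exists (v * v0^-1)%g; last by rewrite mulgKV.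
  rewrite in_setI stabM ?stabV //= inE -{1}v0E -pactM mulgKV vE; exact: eqxx.
case=> u; rewrite in_setI => /andP[uT]; rewrite [in X in X -> _]inE => /eqP uE ->.
by rewrite inE stabM //= pactM v0E uE.
Qed.

Definition ascends (T : 'I_n -> nat) (f : X) : bool :=
  [forall i : 'I_n, forall j : 'I_n, ((i <= j)%N && (T i == T j)) ==> (f i <= f j)%N].
Lemma ascendsP (T : 'I_n -> nat) (f : X) : reflect (forall i j : 'I_n, (i <= j)%N -> T i = T j -> (f i <= f j)%N) (ascends T f).
Proof.
apply: (iffP forallP) => [H i j ij Tij|H i].
  by have /forallP /(_ j) := H i; rewrite ij Tij eqxx.
by apply/forallP => j; apply/implyP => /andP[ij /eqP]; apply: H.
Qed.

(** Rearrangement inequality: a permutation in the stabilizer that maximizes the sum of i times the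
    i-th value leaves no descent inside a block. *)
Lemma ascends_exists (T : 'I_n -> nat) (f : X) : exists v, v \in stab T /\ ascends T (pact f v).
Proof.
pose wt (v : 'S_n) := (\sum_(i < n) i * pact f v i)%N.
have s1 : 1%g \in stab T by apply/stabP => i; rewrite perm1.
case: (@arg_maxnP _ 1%g (fun v => v \in stab T) wt s1) => v vT vmax.
exists v; split=> //; apply/ascendsP => i j ij Tij; rewrite leqNgt; apply/negP => fji.
have nij : i != j by apply/eqP => E; rewrite E ltnn in fji.
have tT : (tperm i j * v)%g \in stab T.
  by apply: stabM => //; apply/stabP => x; case: tpermP => [->|->|].
have := vmax _ tT; apply/negP; rewrite /= -ltnNge.
rewrite /wt (bigD1 i) //= (bigD1 j) 1?eq_sym //= [X in (_ < X)%N](bigD1 i) //= [X in (_ < _ + X)%N](bigD1 j) 1?eq_sym //=.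
rewrite !addnA; have -> : \sum_(x < n | (x != i) && (x != j)) (x * pact f (tperm i j * v) x)%N
   = \sum_(x < n | (x != i) && (x != j)) (x * pact f v x)%N.
  apply: eq_bigr => x /andP[xi xj]; rewrite !ffunE permM tpermD // eq_sym //.
rewrite ltn_add2r !ffunE !permM tpermL tpermR; rewrite !ffunE in fji.
have ij' : (i < j)%N by rewrite ltn_neqAle ij andbT.
nia.
Qed.

Lemma ascends_unique (T : 'I_n -> nat) (f : X) (v : 'S_n) : v \in stab T -> ascends T f -> ascends T (pact f v) -> pact f v = f.
Proof.
move=> vT /ascendsP cf /ascendsP cg; set g := pact f v.
have vE : g = pact f v by []. have /stabP vT' := vT.
have seg c b : [set i | (T i == b) && (f i < c)%N] = [set i | (T i == b) && (g i < c)%N].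
  set A := [set i | _]; set B := [set i | _].
  have cAB : #|A| = #|B|.
    rewrite -[RHS](card_imset _ (@perm_inj _ v)); apply/esym/eq_card => i; apply/imsetP/idP.
      by case=> j; rewrite !inE vE ffunE => /andP[/eqP Tj fj] ->; rewrite vT' Tj eqxx.
    rewrite inE => /andP[/eqP Ti fi]; exists (v^-1%g i); last by rewrite permKV.
    by rewrite inE vE ffunE permKV fi andbT -Ti -[in X in _ == X](permKV v i) vT'.
  case: (boolP (A \subset B)) => [sAB|/subsetPn[i iA iB]].
    by apply/eqP; rewrite eqEcard sAB cAB leqnn.
  apply/eqP; rewrite eq_sym eqEcard cAB leqnn andbT; apply/subsetP => j jB.
  apply/negPn/negP => jA; move: iA iB jA jB; rewrite !inE.
  move=> /andP[/eqP Ti fi]; rewrite Ti eqxx /= -leqNgt => gi + /andP[/eqP Tj gj].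
  rewrite Tj eqxx /= -leqNgt => fj.
  case/orP: (leq_total i j) => ij.
    by have H := cg i j ij (etrans Ti (esym Tj)) : (g i <= g j)%N; lia.
  by have := cf j i ij (etrans Tj (esym Ti)); lia.
apply/ffunP => i; apply: val_inj; apply/eqP; rewrite eqn_leq.
have := seg (f i).+1 (T i) => /setP /(_ i); rewrite !inE !eqxx /= ltnSn ltnS => <-.
by have := seg (g i).+1 (T i) => /setP /(_ i); rewrite !inE !eqxx /= ltnSn ltnS => ->.
Qed.

(** Each filling in the orbit of [S] arises from [#|fixf S|] permutations. Orbit by orbit under
    [stab T], the stabilizers then sum to [#|stab T|], and every such orbit has exactly one
    ascending member. *)
Lemma count_ascends (T : 'I_n -> nat) (S : X) :
  (\sum_(w : 'S_n) #|stab T :&: fixf (pact S w)|)%N = (#|fixf S| * (#|stab T| * #|[set f in orb S | ascends T f]|))%N.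
Proof.
have st0 : stab (fun=> 0%N) = [set: 'S_n] by apply/setP => w; rewrite !inE; apply/forallP.
have cw g : #|[set w : 'S_n | pact S w == g]| = if g \in orb S then #|fixf S| else 0%N.
  have := card_transporter (fun=> 0%N) S g; rewrite st0 setTI.
  have -> : [set v in [set: 'S_n] | pact S v == g] = [set w : 'S_n | pact S w == g] by apply/setP => w; rewrite !inE.
  move=> ->; case: (boolP (g \in orb S)) => [/imsetP[w _ gE]|gO].
    rewrite ifT; last by apply/existsP; exists w; rewrite inE gE eqxx.
    (* conjugate point stabilizers have the same order *)
    rewrite -[RHS](card_imset _ (conjg_inj w^-1%g)); apply/esym/eq_card => u; apply/imsetP/idP.
      case=> v; rewrite inE => /eqP vE ->; rewrite inE gE -pactM /conjg invgK !mulgA mulgKV pactM vE.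
      exact: eqxx.
    rewrite inE => /eqP uE; exists (u ^ w)%g; last by rewrite conjgK.
    by rewrite inE /conjg pactM pactM -gE uE gE -pactM mulVg pact1.
  rewrite ifF //; apply/negbTE; apply: contra gO => /existsP[w /andP[_ /eqP <-]]; exact: imset_f.
transitivity (\sum_(g : X) (if g \in orb S then #|fixf S| else 0) * #|stab T :&: fixf g|)%N.
  rewrite (partition_big (pact S) xpredT) //=; apply: eq_bigr => g _.
  rewrite (eq_bigr (fun=> #|stab T :&: fixf g|)) => [|w /eqP -> //].
  by rewrite sum_nat_const -cw; congr (_ * _)%N; apply: eq_card => w; rewrite inE.
transitivity (\sum_(g in orb S) #|fixf S| * #|stab T :&: fixf g|)%N.
  by rewrite [RHS]big_mkcond; apply: eq_bigr => g _; case: ifP; rewrite ?mul0n.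
rewrite -big_distrr /=; congr (_ * _)%N.
have one g : #|stab T :&: fixf g| = (\sum_(f | ascends T f) #|[set v in stab T | pact f v == g]|)%N.
  have [v [vT vc]] := ascends_exists T g.
  have gE : pact (pact g v) v^-1%g = g by rewrite -pactM mulVg pact1.
  rewrite (bigD1 (pact g v)) //= big1 ?addn0 => [|f /andP[fc fg]].
    by rewrite [RHS]card_transporter ifT //; apply/existsP; exists v^-1%g; rewrite stabV // gE /=.
  rewrite card_transporter ifF //; apply/negbTE/negP => /existsP[u /andP[uT /eqP uE]].
  case/eqP: fg; rewrite -uE -pactM in vc *; apply/esym; apply: ascends_unique vc => //.
  exact: stabM.
under eq_bigr => g _ do rewrite one.
rewrite exchange_big /=.
transitivity (\sum_(f | ascends T f) (f \in orb S) * #|stab T|)%N; last first.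
  rewrite mulnC -sum_nat_const [LHS]big_mkcond [RHS]big_mkcond; apply: eq_bigr => f _; rewrite inE.
  by case: (ascends T f); case: (f \in orb S); rewrite ?mul1n ?mul0n.
apply: eq_bigr => f _.
transitivity (\sum_(g in orb S) \sum_(v in stab T) (pact f v == g))%N.
  by apply: eq_bigr => g _; rewrite -sum1dep_card big_mkcondr /=; apply: eq_bigr => v _; case: eqP.
rewrite exchange_big mulnC -sum_nat_const /=; apply: eq_bigr => v _.
rewrite big_mkcond (bigD1 (pact f v)) //= big1 ?addn0 => [|g gf]; last by rewrite eq_sym (negbTE gf) if_same.
rewrite eqxx; suff -> : (pact f v \in orb S) = (f \in orb S) by case: (f \in _).
apply/imsetP/imsetP => -[w _ E].
  by exists (v^-1 * w)%g => //; rewrite pactM -E -pactM mulVg pact1.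
by exists (v * w)%g => //; rewrite pactM -E.
Qed.

End Orbits.

Section TauRho.
Context (k : fieldType) (char0 : [pchar k] =i pred0) (n N : nat).

Lemma tau_conj (a c : GR k n) : tau a c = \sum_w \sum_u c u * a (w * u^-1 * w^-1)%g.
Proof.
rewrite tauE; apply: eq_bigr => w _; rewrite -mulrA GR_mulE; apply: eq_bigr => u _; congr (_ * _).
rewrite GR_mulE (bigD1 w) //= big1 ?addr0 => [|x xw]; first by rewrite ffunE eqxx mul1r.
by rewrite ffunE (negbTE xw) mul0r.
Qed.

Lemma rhoE (T : 'I_n -> nat) (w : 'S_n) : rho k T w = if w \in stab T then #|stab T|%:R^-1 else 0.
Proof. by rewrite ffunE inE. Qed.

Lemma rho_idem (T : 'I_n -> nat) : idem (rho k T : GR k n).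
Proof.
apply/ffunP => w; rewrite GR_mulE.
have c0 : (#|stab T|%:R : k) != 0.
  by have := stab_card_gt0 T; case: #|_| => // m _; apply/eqP => /eqP; have /pcharf0P -> := char0.
transitivity (\sum_(u in stab T) #|stab T|%:R^-1 * rho k T w).
  rewrite [RHS]big_mkcond; apply: eq_bigr => u _; rewrite [in LHS]rhoE.
  case: ifP => uT; last by rewrite mul0r.
  congr (_ * _); rewrite !rhoE; congr (if _ then _ else _); apply/idP/idP => H.
    by rewrite -(mulgKV u w); apply: stabM.
  by apply: stabM => //; apply: stabV.
by rewrite sumr_const -[_ *+ _]mulr_natl mulrA divff // mul1r.
Qed.

(** The trace counts double cosets of the two Young subgroups, and the ascending fillings in the
    orbit of [S] represent them. *)
Lemma tau_rho (T : 'I_n -> nat) (S : {ffun 'I_n -> 'I_N}) :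
  tau (rho k T) (rho k (fun i => S i)) = #|[set f in orb S | ascends T f]|%:R.
Proof.
have c0 T' : (#|stab (n := n) T'|%:R : k) != 0.
  by have := stab_card_gt0 T'; case: #|_| => // m _; apply/eqP => /eqP; have /pcharf0P -> := char0.
rewrite tau_conj.
transitivity (\sum_w #|stab (fun i => S i)|%:R^-1 * (#|stab T|%:R^-1 * #|stab T :&: fixf (pact S w)|%:R) : k).
  apply: eq_bigr => w _.
  transitivity (\sum_(u in stab (fun i => S i)) #|stab (fun i => S i)|%:R^-1 * rho k T (w * u^-1 * w^-1)%g).
    rewrite [RHS]big_mkcond; apply: eq_bigr => u _; have E := rhoE (fun i => S i) u; have [H|H] := boolP (u \in stab (fun i => S i)).
      by rewrite E H.
    by rewrite E (negbTE H) mul0r.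
  rewrite -mulr_sumr; congr (_ * _).
  transitivity (\sum_(v in fixf (pact S w)) rho k T v).
    rewrite [RHS](reindex (fun u => (w * u^-1 * w^-1)%g)) /=; last first.
      apply: onW_bij; exists (fun v => (w^-1 * v^-1 * w)%g) => u; rewrite !invMg ?invgK !mulgA ?mulVg ?mulgV ?mul1g.
        by rewrite mulgKV.
      by rewrite mulgK.
    apply: eq_bigl => u; rewrite -fixf_stab !inE; apply/eqP/eqP => E.
      have E' : pact S u^-1%g = S by rewrite -{1}E -pactM mulVg pact1.
      by rewrite -pactM mulgKV pactM E'.
    have E' : pact S u^-1%g = S.
      rewrite -pactM mulgKV pactM in E.
      by rewrite -[LHS]pact1 -(mulVg w) pactM E -pactM mulVg pact1.
    by rewrite -{1}E' -pactM mulgV pact1.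
  rewrite -[#|stab T :&: _|]sum1_card natr_sum [in RHS]mulr_sumr [LHS]big_mkcond [RHS]big_mkcond; apply: eq_bigr => v _; rewrite in_setI rhoE.
  by case: (v \in stab T); case: (v \in fixf _); rewrite //= ?mulr1.
rewrite -!mulr_sumr -natr_sum count_ascends !natrM fixf_stab.
by rewrite mulrA mulrACA mulVf // mul1r mulrA mulVf // mul1r.
Qed.

End TauRho.

End Tabloids.
Import Tabloids.

(** * The Jacobi-Trudi identity *)

Module JacobiTrudi.

Local Open Scope ring_scope.

Section JacobiTrudi.
Context (A : comNzRingType) (x : nat -> A).

(** Complete symmetric polynomials in the first [N] variables, split by the exponent of the last
    variable. In [hz] the index is a difference, with value 0 when it would be negative. *)
Fixpoint hs (N r : nat) : A :=
  if N is N'.+1 then \sum_(s < r.+1) x N' ^+ s * hs N' (r - s) else (r == 0%N)%:R.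

Lemma hs0 N : hs N 0 = 1.
Proof. by elim: N => //= N IH; rewrite big_ord1 IH mul1r. Qed.
Lemma hsS N r : hs N.+1 r.+1 = x N * hs N.+1 r + hs N r.+1.
Proof.
rewrite [LHS]/= big_ord_recl expr0 mul1r subn0 addrC; congr (_ + _).
by rewrite /= mulr_sumr; apply: eq_bigr => s _; rewrite mulrA -exprS.
Qed.

Definition hz N a b := if (b <= a)%N then hs N (a - b) else 0.

Lemma hz_diff N a b n :
  hz N.+1 a b = \sum_(s < n) x N ^+ s * hz N a (b + s) + x N ^+ n * hz N.+1 a (b + n).
Proof.
elim: n => [|n IH]; first by rewrite big_ord0 add0r mul1r addn0.
rewrite {}IH big_ord_recr /= -addrA; congr (_ + _).
rewrite exprSr -mulrA -mulrDr; congr (_ * _); rewrite addnS; move: (b + n)%N => {}b.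
rewrite /hz; case: (ltngtP b a) => [ba|ba|<-]; [|by rewrite mulr0 addr0|by rewrite subnn !hs0 mulr0 addr0].
by rewrite -[(a - b)%N](prednK (n := (a - b)%N)) ?subn_gt0 // hsS addrC -subnS.
Qed.

Context (l m : nat).
Local Notation shape := {ffun 'I_l -> 'I_m.+1}.
Implicit Types mu nu : shape.

Definition nx mu (i : nat) : nat := oapp (fun j : 'I_l => mu j : nat) 0%N (insub i.+1).
Definition decr mu := [forall i : 'I_l, nx mu i <= mu i]%N.
Definition interl mu nu := [forall i : 'I_l, (nx mu i <= nu i <= mu i)%N].

(** The branching rule of Schur polynomials: the cells filled with the last variable form a
    horizontal strip, that is, the inner shape interlaces. *)
Fixpoint sc (N : nat) mu : A :=
  if N is N'.+1 then \sum_(nu | interl mu nu) (\prod_i x N' ^+ (mu i - nu i)) * sc N' nu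
  else (mu == [ffun=> ord0])%:R.

Definition jt N mu := \matrix_(i < l, j < l) hz N (mu i + j) i.

Lemma interl_decr mu nu : interl mu nu -> decr nu.
Proof.
move=> /forallP H; apply/forallP => i; have /andP[h1 h2] := H i; apply: leq_trans h1.
rewrite /nx; case: insubP => //= j _ ji; have /andP[_ ] := H j.
by [].
Qed.

Lemma sum_interval (F : nat -> A) a b : (a <= b <= m)%N ->
  \sum_(c < m.+1 | (a <= c <= b)%N) F (b - c)%N = \sum_(s < (b - a).+1) F s.
Proof.
move=> /andP[ab bm].
rewrite -(big_mkord (fun c => a <= c <= b)%N (fun c => F (b - c)%N)) -(big_mkord xpredT).
transitivity (\sum_(a <= c < b.+1) F (b - c)%N).
  rewrite [RHS](big_nat_widen _ _ m.+1) ?ltnS // [RHS](big_nat_widenl _ 0) //.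
  by apply: eq_bigl => c; rewrite /= ltnS andbC.
rewrite -{1}(add0n a) big_addn subSn // big_nat_rev add0n big_nat_cond [RHS]big_nat_cond.
by apply: eq_bigr => c /andP[/andP[_ c1] _]; congr F; lia.
Qed.

(** Row operations of determinant 1 turn each row into a sum, over the row lengths permitted by
    interlacing, of rows in one variable fewer; multilinearity of the determinant then yields the
    branching rule. *)
Lemma jt_step N mu : decr mu ->
  \det (jt N.+1 mu) = \sum_(nu | interl mu nu) (\prod_i x N ^+ (mu i - nu i)) * \det (jt N nu).
Proof.
move=> /forallP dmu.
(* The exponent is the length at which the tail in [hz_diff] becomes the entry of the next row, so
   that subtracting that row removes it; in the last row the tail is already zero. *)
pose U : 'M[A]_l := \matrix_(i, j) if j == i then 1 else if j == i.+1 :> nat then - x N ^+ (mu i - nx mu i).+1 else 0.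
have dU : \det U = 1.
  rewrite -det_tr det_trig; last by apply/is_trig_mxP => i j ij; rewrite !mxE -val_eqE /=; case: eqP => [E|_]; [move: ij; rewrite E ltnn|case: eqP => // E; move: ij; rewrite E; lia].
  by rewrite big1 // => i _; rewrite !mxE eqxx.
have E i j : (U *m jt N.+1 mu) i j = \sum_(c : 'I_m.+1 | (nx mu i <= c <= mu i)%N) x N ^+ (mu i - c) * hz N (c + j) i.
  transitivity (\sum_(c : 'I_m.+1 | (nx mu i <= c <= mu i)%N) (fun s => x N ^+ s * hz N (mu i + j) (i + s)) (mu i - c)%N); last first.
    apply: eq_bigr => c /andP[_ c2]; congr (_ * _); rewrite /hz.
    have -> : (i + (mu i - c) <= mu i + j)%N = (i <= c + j)%N by lia.
    case: ifP => // _.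
    congr (hs _ _).
    lia.
  rewrite (sum_interval (fun s => x N ^+ s * hz N (mu i + j) (i + s))); last by rewrite dmu -ltnS ltn_ord.
  rewrite mxE (bigD1 i) //= !mxE eqxx mul1r (hz_diff _ _ _ (mu i - nx mu i).+1) -[RHS]addr0 -addrA; congr (_ + _).
  rewrite /nx; case: insubP => [j' _ j'i|] /=.
    rewrite (bigD1 j') /=; last by rewrite -val_eqE /= j'i; lia.
    rewrite !mxE ifF; last by rewrite -val_eqE /= j'i; lia.
    rewrite j'i eqxx big1 => [|c /andP[ci cj]]; last first.
      by rewrite !mxE (negbTE ci) ifF ?mul0r // -j'i val_eqE (negbTE cj).
    have nj : nx mu i = mu j'.
      by rewrite /nx; case: insubP => [j2 _ j2i|] /=; [congr (_ (mu _)); apply: val_inj; rewrite j2i|rewrite -j'i ltn_ord].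
    rewrite addr0 nj mulNr; apply/eqP; rewrite subr_eq0; apply/eqP; congr (_ * _).
    have := dmu i; rewrite nj /hz => h.
    have -> : (i + (mu i - mu j').+1 <= mu i + j)%N = (i < mu j' + j)%N by lia.
    case: ifP => // _.
    congr (hs _ _).
    lia.
  rewrite -leqNgt => il; rewrite big1 ?addr0 => [|c ci]; last first.
    by rewrite !mxE (negbTE ci) ifF ?mul0r //; have := ltn_ord c; lia.
  rewrite /hz ifF ?mulr0 //; have := ltn_ord j; lia.
have -> : \det (jt N.+1 mu) = \det (U *m jt N.+1 mu) by rewrite det_mulmx dU mul1r.
rewrite /determinant.
under eq_bigr => s _ do rewrite (eq_bigr _ (fun i _ => E i (s i))) bigA_distr_big_dep big_distrr /=.
rewrite exchange_big /=; apply: eq_big => [nu|nu _].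
  by apply/familyP/forallP => H i; apply: H.
rewrite big_distrr /=; apply: eq_bigr => s _; rewrite big_split /= mulrCA; congr (_ * (_ * _)).
by apply: eq_bigr => i _; rewrite mxE.
Qed.

Lemma jacobi_trudi N mu : decr mu -> \det (jt N mu) = sc N mu.
Proof.
elim: N mu => [|N IH] mu dmu; last first.
  by rewrite jt_step //=; apply: eq_bigr => nu /interl_decr; move=> /IH ->.
have hz00 a b : hz 0 a b = (a == b)%:R by rewrite /hz /=; case: ltngtP => // h; rewrite ?(ltnNge a) //; case: eqP => //; lia.
rewrite /=; case: eqP => [->|mu0].
  rewrite (_ : jt _ _ = 1%:M) ?det1 //; apply/matrixP => i j.
  by rewrite !mxE !ffunE hz00 add0n eq_sym.
have [i i0] : exists i, mu i != ord0.
  by apply/existsP; apply: contra_notT mu0 => /existsPn H; apply/ffunP => i; rewrite ffunE; apply/eqP; rewrite -[_ == _]negbK.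
(* Without variables only degree 0 survives. A nonzero decreasing shape has a nonzero first row, and
   then the first row of the matrix vanishes. *)
have dec j : (j <= i)%N -> forall jl : (j < l)%N, (0 < mu (Ordinal jl))%N.
  move=> ji jl; have [n nE] : exists n, (i - j)%N = n by exists (i - j)%N.
  have i0' : (0 < mu i)%N by rewrite lt0n.
  elim: n j ji jl nE => [|n IHn] j ji jl nE.
    by rewrite (_ : Ordinal jl = i) //; apply: val_inj => /=; lia.
  have j1 : (j.+1 < l)%N by have := ltn_ord i; lia.
  have := IHn j.+1 ltac:(lia) j1 ltac:(lia); move=> h; apply: leq_trans h _.
  have -> : mu (Ordinal j1) = nx mu (Ordinal jl) :> nat by rewrite /nx (insubT (fun i => i < l)%N j1).
  by have /forallP /(_ (Ordinal jl)) := dmu.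
have l0 : (0 < l)%N.
  exact: leq_ltn_trans (leq0n i) (ltn_ord i).
rewrite (expand_det_row _ (Ordinal l0)) big1 // => j _.
rewrite mxE hz00.
by have /prednK <- := dec 0%N (leq0n _) l0; rewrite addSn mul0r.
Qed.

End JacobiTrudi.

Section Complete.
Context (A : comNzRingType) (x : nat -> A) (B : nat).
Local Notation hs := (hs x).

Definition hsum N r : A :=
  \sum_(t : r.-tuple 'I_B | sorted geq (map val t) && all (fun i : 'I_B => i < N)%N t) \prod_(i <- t) x i.

(** A decreasing tuple shows its largest variable first, so splitting on whether the head is the
    last variable gives the recursion [hsS]. *)
Lemma hsum_hs N r : (N <= B)%N -> hsum N r = hs N r.
Proof.
elim: N r => [|N IHN] r NB.
  rewrite /hsum; case: r => [|r].
    rewrite (bigD1 [tuple]) //= big_nil big1 ?addr0 // => t; rewrite (tuple0 t) => /andP[_ /eqP H]; by case: H.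
  by rewrite big1 // => t; rewrite (tuple_eta t) /= andbF.
elim: r => [|r IHr].
  rewrite hs0 /hsum (bigD1 [tuple]) //= big_nil big1 ?addr0 // => t; rewrite (tuple0 t) => /andP[_ /eqP H]; by case: H.
rewrite hsS -IHr -IHN 1?ltnW // /hsum.
pose a0 := Ordinal NB.
rewrite (bigID (fun t : r.+1.-tuple 'I_B => thead t == a0)) /=; congr (_ + _).
  rewrite mulr_sumr (reindex_onto (fun t : r.-tuple 'I_B => [tuple of a0 :: t]) (fun t => [tuple of behead t])) /=; last first.
    by move=> t /andP[_ /eqP ta]; rewrite [RHS]tuple_eta ta; apply: val_inj.
  apply: eq_big => t; last by rewrite big_cons.
  have Et : [tuple of behead [tuple of a0 :: t]] = t by apply: val_inj.
  rewrite Et eqxx andbT theadE eqxx andbT /= ltnSn path_sortedE; last by move=> u v w /= h1 h2; apply: leq_trans h2 h1.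
  have -> : all (geq N) (map val t) = all (fun i : 'I_B => i < N.+1)%N t by rewrite all_map; apply: eq_all.
  by case: all; case: sorted.
apply: eq_bigl => t; rewrite (tuple_eta t) theadE /= path_sortedE; last by move=> u v w /= h1 h2; apply: leq_trans h2 h1.
rewrite all_map -val_eqE /=; set a := thead t.
have tr (p q : nat) : (p <= q)%N -> all (preim val (geq p)) (behead t) -> all (fun i : 'I_B => i < q.+1)%N (behead t).
  by move=> pq; apply: sub_all => c /=; lia.
case: (boolP (all (preim val (geq a)) (behead t))) => //= H; case: (sorted _ _) => //=.
case: (ltngtP a N) => aN; rewrite ?andbF //.
  have -> : (a < N.+1)%N by lia.
  rewrite (tr a N (ltnW aN) H) /=; case: N aN {IHN IHr NB a0} => // N aN; by rewrite (tr a N).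
by have -> : (a < N.+1)%N = false by lia.
Qed.

End Complete.

Lemma sum_tuple_rev (A : nmodType) (T : finType) r (P : pred (seq T)) (F : seq T -> A) :
  \sum_(t : r.-tuple T | P t) F t = \sum_(t : r.-tuple T | P (rev t)) F (rev t).
Proof.
rewrite (reindex_inj (h := fun t : r.-tuple T => [tuple of rev t])) //=.
by move=> s t /(congr1 val) /= /(can_inj (@revK _)) st; apply: val_inj.
Qed.

Definition xvar N (i : nat) : {mpoly int[N]} := oapp (fun j : 'I_N => 'X_j) 0 (insub i).
Lemma xvarE N (i : 'I_N) : xvar N i = 'X_i.
Proof. by rewrite /xvar valK. Qed.

Lemma complete_hs N r : complete_poly N r = hs (xvar N) N r.
Proof.
rewrite -(@hsum_hs _ (xvar N) N N r (leqnn N)) /complete_poly /hsum.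
rewrite (sum_tuple_rev _ (fun t => sorted leq (map val t)) (fun t : seq 'I_N => \prod_(i <- t) 'X_i)).
apply: eq_big => t.
  by rewrite map_rev rev_sorted; case: sorted => //=; apply/esym/allP => i _.
by move=> _; rewrite big_rev; apply: eq_bigr => i _; rewrite xvarE.
Qed.

End JacobiTrudi.
Import JacobiTrudi.

(** * Semistandard tableaux satisfy the branching rule *)

Module Tableaux.

Local Open Scope ring_scope.

Lemma card_down m (Q : pred 'I_m) : (forall i j : 'I_m, (i <= j)%N -> Q j -> Q i) ->
  forall j : 'I_m, (j < #|Q|)%N = Q j.
Proof.
move=> dn j; have Hle (b : nat) (bm : (b <= m)%N) : #|[pred i : 'I_m | (i < b)%N]| = b.
  rewrite -sum1_card -(big_ord_widen_cond m xpredT (fun=> 1%N)) // sum1_card card_ord //.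
apply/idP/idP => [jQ|Qj]; last first.
  rewrite -(Hle j.+1 (ltn_ord j)); apply: subset_leq_card; apply/subsetP => i; rewrite !inE => ij.
  exact: dn Qj.
apply: contraLR jQ => nQ; rewrite -leqNgt -[X in (_ <= X)%N](Hle j (ltnW (ltn_ord j))); apply: subset_leq_card.
apply/subsetP => i Qi; rewrite !inE ltnNge; apply: contra nQ => ji; exact: dn Qi.
Qed.

Section Tableaux.
Context (A : comNzRingType) (x : nat -> A) (l m B : nat).
Local Notation shape := {ffun 'I_l -> 'I_m.+1}.
Local Notation box := {ffun 'I_l * 'I_m -> 'I_B.+1}.
Implicit Types (mu nu : shape) (t : box).

(* Entries are shifted by one, the value 0 marking the cells outside the shape. *)
Definition sst N mu t : Prop :=
  [/\ forall i (j : 'I_m), (0 < t (i, j))%N = (j < mu i)%N,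
      forall i (j : 'I_m), (t (i, j) <= N)%N,
      forall i (j j' : 'I_m), (j <= j' < mu i)%N -> (t (i, j) <= t (i, j'))%N
    & forall (i i' : 'I_l) (j : 'I_m), (i < i')%N -> (j < mu i')%N -> (t (i, j) < t (i', j))%N].

Definition wt t : A := \prod_i \prod_j (if (t (i, j) : nat) is c.+1 then x c else 1).

Lemma shape_ext mu nu : (forall i (j : 'I_m), (j < mu i)%N = (j < nu i)%N) -> mu = nu.
Proof.
move=> H; apply/ffunP => i; apply: val_inj; have hm := ltn_ord (mu i); have hn := ltn_ord (nu i).
case: (ltngtP (mu i) (nu i)) => // h; last first.
  have nm : (nu i < m)%N by lia.
  by have := H i (Ordinal nm); rewrite /= ltnn h.
have nm : (mu i < m)%N by lia.
by have := H i (Ordinal nm); rewrite /= ltnn h.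
Qed.
Lemma shape_le (a b : 'I_m.+1) : (forall j : 'I_m, (j < a)%N -> (j < b)%N) -> (a <= b)%N.
Proof.
move=> H; rewrite leqNgt; apply/negP => ba; have bm : (b < m)%N by have := ltn_ord a; lia.
by have := H (Ordinal bm) ba; rewrite /= ltnn.
Qed.
Lemma nxP mu (i : 'I_l) (i' : 'I_l) : i' = i.+1 :> nat -> nx mu i = mu i'.
Proof. by move=> E; rewrite /nx -E valK. Qed.
Lemma nx_ge mu (i : 'I_l) : (l <= i.+1)%N -> nx mu i = 0%N.
Proof. by move=> E; rewrite /nx insubF //; apply/negbTE; rewrite -leqNgt. Qed.

Definition cut N t : box := [ffun p => if t p == N.+1 :> nat then ord0 else t p].
Definition nuof N t : shape := [ffun i => inord #|[pred j | (0 < t (i, j) <= N)%N]|].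

Lemma nuofE N t i : nuof N t i = #|[pred j | (0 < t (i, j) <= N)%N]| :> nat.
Proof. by rewrite ffunE inordK // ltnS -[X in (_ <= X)%N]card_ord max_card. Qed.

Lemma decr_mono mu (i i' : 'I_l) : decr mu -> (i <= i')%N -> (mu i' <= mu i)%N.
Proof.
move=> /forallP dmu; have [n nE] : exists n, (i' - i)%N = n by exists (i' - i)%N.
elim: n i nE => [|n IH] i nE ii; first by rewrite (_ : i' = i) //; apply: val_inj => /=; lia.
have j1 : (i.+1 < l)%N by have := ltn_ord i'; lia.
apply: leq_trans (IH (Ordinal j1) _ _) _; [rewrite /=; lia|rewrite /=; lia|].
by rewrite -(@nxP mu i) //; apply: dmu.
Qed.

(** Columns increase strictly, so the largest entry occurs at most once per column; deleting it
    leaves an interlacing shape. [sst_fill] is the inverse operation. *)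
Lemma sst_cut N mu t : decr mu -> sst N.+1 mu t ->
  [/\ interl mu (nuof N t), sst N (nuof N t) (cut N t),
      forall i j, t (i, j) = (if (cut N t (i, j) == ord0) && (j < mu i)%N then N.+1 else cut N t (i, j)) :> nat
    & forall i (j : 'I_m), (j < nuof N t i)%N = (0 < t (i, j) <= N)%N].
Proof.
move=> dmu [t1 t2 t3 t4].
have nuE i (j : 'I_m) : (j < nuof N t i)%N = (0 < t (i, j) <= N)%N.
  rewrite nuofE card_down // => j1 j2 j12 /andP[p1 p2].
  rewrite t1 in p1; rewrite /= t1; apply/andP; split; first exact: leq_ltn_trans p1.
  by apply: leq_trans p2; apply: t3; rewrite j12.
have cE i j : (0 < cut N t (i, j))%N = (j < nuof N t i)%N.
  rewrite nuE ffunE; case: (t (i, j) =P N.+1 :> nat) => [E|ne]; first by rewrite E ltnn andbF.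
  have -> : (t (i, j) <= N)%N by move: (t2 i j); rewrite leq_eqVlt ltnS => /orP[/eqP /ne|].
  by rewrite andbT.
have cle i j : (cut N t (i, j) <= N)%N.
  rewrite ffunE; case: (t (i, j) =P N.+1 :> nat) => // ne.
  by move: (t2 i j); rewrite leq_eqVlt ltnS => /orP[/eqP /ne|].
have cin i (j : 'I_m) : (j < nuof N t i)%N -> cut N t (i, j) = t (i, j).
  by rewrite nuE => /andP[_ h]; rewrite ffunE; case: (t (i, j) =P N.+1 :> nat) => // E; rewrite E ltnn in h.
split=> //.
- apply/forallP => i; apply/andP; split; last by apply: shape_le => j; rewrite nuE t1 => /andP[].
  case: (ltnP i.+1 l) => il; last by rewrite nx_ge.
  rewrite (@nxP mu i (Ordinal il)) //; apply: shape_le => j jl; rewrite nuE t1.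
  rewrite (leq_trans jl) /=; last by apply: decr_mono => /=.
  rewrite -ltnS; apply: leq_trans (t4 i (Ordinal il) j (leqnn _) jl) (t2 _ _).
- split=> [//|//|i j j' /andP[jj j'l]|i i' j ii jl].
    rewrite (cin i j') // (cin i j) ?(leq_ltn_trans jj) //; apply: t3; rewrite jj -t1 /=.
    by move: j'l; rewrite nuE => /andP[].
  have h : (j < mu i')%N by move: jl; rewrite nuE t1 => /andP[].
  rewrite (cin i' j) // (cin i j); first exact: t4.
  move: jl; rewrite !nuE !t1 => /andP[_ p]; rewrite (leq_trans h (decr_mono dmu (ltnW ii))).
  exact: leq_trans (ltnW (t4 i i' j ii h)) p.
move=> i j; rewrite -t1; case: (t (i, j) =P N.+1 :> nat) => E.
  have -> : cut N t (i, j) = ord0 by rewrite ffunE E eqxx.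
  by rewrite eqxx E.
have -> : cut N t (i, j) = t (i, j) by rewrite ffunE (introF eqP E).
by rewrite -val_eqE /= lt0n andbN.
Qed.

Definition fill N mu t : box :=
  [ffun p => if (t p == ord0) && (p.2 < mu p.1)%N then inord N.+1 else t p].

Lemma sst_fill N mu nu t : (N < B)%N -> interl mu nu -> sst N nu t ->
  [/\ sst N.+1 mu (fill N mu t), nuof N (fill N mu t) = nu & cut N (fill N mu t) = t].
Proof.
move=> NB /forallP mn [t1 t2 t3 t4].
have nm i : (nu i <= mu i)%N by have /andP[] := mn i.
have fE i j : fill N mu t (i, j) = (if (j < nu i)%N then t (i, j) : nat else if (j < mu i)%N then N.+1 else 0%N) :> nat.
  rewrite ffunE /= -t1 lt0n -val_eqE /=; case: eqP => E //=.
  by case: (j < mu i)%N; rewrite ?inordK //.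
have s1 i j : (0 < fill N mu t (i, j))%N = (j < mu i)%N.
  by rewrite fE; case: ifP => h; [rewrite t1 h (leq_trans h)|case: ifP].
have s2 i (j : 'I_m) : (0 < fill N mu t (i, j) <= N)%N = (j < nu i)%N.
  rewrite fE; case: ifP => h; first by rewrite t1 t2 h.
  by case: ifP; rewrite ?ltnn ?andbF.
split.
- split=> // [i j|i j j' /andP[jj jm]|i i' j ii jm]; rewrite !fE.
  + by case: ifP => _; [apply: leqW|case: ifP].
  + rewrite jm; case: (ltnP j' (nu i)) => j'n.
      by rewrite (leq_ltn_trans jj j'n) t3 // jj.
    by case: ifP => _; [apply: leqW|case: ifP].
  rewrite jm; have jn : (j < nu i)%N.
    have il : (i.+1 < l)%N by apply: leq_ltn_trans ii (ltn_ord i').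
    have /andP[h _] := mn i; apply: leq_trans h; rewrite (@nxP mu i (Ordinal il)) //.
    apply: leq_trans jm _.
    have [n nE] : exists n, (i' - i.+1)%N = n by exists (i' - i.+1)%N.
    have dmu : decr mu by apply/forallP => c; have /andP[a b] := mn c; apply: leq_trans a b.
    exact: decr_mono.
  by rewrite jn; case: ifP => [/(t4 _ _ _ ii)|_] //; rewrite ltnS.
- by apply: shape_ext => i j; rewrite nuofE -s2 card_down // => j1 j2 j12; rewrite /= !s2; apply: leq_ltn_trans.
apply/ffunP => -[i j]; apply: val_inj; rewrite /= ffunE; have E := fE i j.
have t0 : (j < nu i)%N = false -> t (i, j) = 0%N :> nat by move=> h; apply/eqP; rewrite -leqn0 leqNgt t1 h.
case: (fill N mu t (i, j) =P N.+1 :> nat) => F; rewrite E in F *; move: F; case: ifP => // h.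
- by move=> F; have := t2 i j; rewrite F ltnn.
- by rewrite t0.
by rewrite t0 //; case: ifP.
Qed.

Lemma sst_sc N mu : (N <= B)%N -> decr mu -> \sum_(t | `[< sst N mu t >]) wt t = sc x N mu.
Proof.
elim: N mu => [|N IH] mu NB dmu.
  have t0 t : sst 0 mu t -> t = [ffun=> ord0] /\ mu = [ffun=> ord0].
    move=> [t1 t2 _ _]; split.
      by apply/ffunP => -[i j]; rewrite ffunE; apply: val_inj; apply/eqP; rewrite -leqn0 t2.
    by apply: shape_ext => i j; rewrite -t1 ffunE ltn0 ltnNge t2.
  rewrite /=; case: eqP => [->|mu0]; last first.
    by rewrite big1 // => t /asboolP /t0[].
  rewrite (bigD1 [ffun=> ord0]) /=; last first.
    by apply/asboolP; split=> [i j|i j|i j j' _|i i' j _]; rewrite !ffunE.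
  rewrite [X in _ + X]big1 ?addr0 => [|t /andP[/asboolP H] t1]; last first.
    by move: H => [t1' t2 _ _]; case/eqP: t1; apply/ffunP => -[i j]; rewrite ffunE; apply: val_inj; apply/eqP; rewrite -leqn0 t2.
  by rewrite /wt big1 // => i _; rewrite big1 // => j _; rewrite ffunE.
rewrite /=.
transitivity (\sum_(nu | interl mu nu) \sum_(t | `[< sst N nu t >]) (\prod_i x N ^+ (mu i - nu i)) * wt t); last first.
  by apply: eq_bigr => nu i; rewrite -big_distrr /= IH ?(ltnW NB) //; apply: interl_decr i.
rewrite pair_big_dep /= (reindex_onto (fun t => (nuof N t, cut N t)) (fun p => fill N mu p.2)) /=; last first.
  by case=> nu t /= /andP[i /asboolP s]; have [_ -> ->] := sst_fill NB i s.
apply: eq_big => t.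
  apply/asboolP/andP => [s|[/andP[i /asboolP s] /eqP <-]]; last by have [] := sst_fill NB i s.
  have [-> s' tE _] := sst_cut dmu s; split; first exact/asboolP.
  apply/eqP/ffunP => -[i j]; apply: val_inj; rewrite /= tE ffunE /=; case: ifP => _ //.
  by rewrite inordK.
move=> /asboolP s; have [i s' tE nE] := sst_cut dmu s; rewrite /wt -big_split /=; apply: eq_bigr => a _.
have /forallP /(_ a) /andP[_ le] := i.
transitivity (\prod_(j < m) ((if (nuof N t a <= j < mu a)%N then x N else 1) * (if (cut N t (a, j) : nat) is c.+1 then x c else 1))).
  apply: eq_bigr => j _; rewrite tE; have [c1 _ _ _] := s'; have := c1 a j.
  case E : (nat_of_ord (cut N t (a, j))) => [|c] /=; rewrite -val_eqE /= E /=.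
    by move=> /esym; rewrite ltnNge => /negbFE ->; case: ifP; rewrite ?mulr1.
  by move=> /esym; rewrite ltnNge => /negbTE ->; rewrite mul1r.
rewrite big_split /=; congr (_ * _); rewrite -big_mkcond /=.
rewrite prodr_const; congr (_ ^+ _).
have := card_ord m; have lm : (mu a <= m)%N by rewrite -ltnS ltn_ord.
move=> _; rewrite -sum1_card -(big_mkord (fun j => nuof N t a <= j < mu a)%N (fun=> 1%N)).
transitivity (\sum_(nuof N t a <= j < mu a) 1)%N; last by rewrite sum_nat_const_nat muln1.
rewrite [RHS](big_nat_widen _ _ m) // [RHS](big_nat_widenl _ 0) //.
by apply: eq_bigl => c; rewrite andbC.
Qed.

End Tableaux.

End Tableaux.
Import Tableaux.

(** * Row-reading tableaux and monomial coefficients *)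

Module Cells.

Local Open Scope ring_scope.

Section Cells.
Context (mu : seq nat).
Local Notation n := (sumn mu).

Lemma size_cells : size (cells mu) = n.
Proof.
rewrite size_allpairs_dep; congr sumn; rewrite -[RHS](mkseq_nth 0%N) /mkseq.
by apply: eq_map => i; rewrite size_iota.
Qed.
Lemma mem_cells r c : ((r, c) \in cells mu) = (c < nth 0%N mu r)%N.
Proof.
apply/allpairsPdep/idP => [[r' [c' [_ h [-> ->]]]]|h]; first by rewrite mem_iota in h.
exists r, c; split=> //; rewrite mem_iota //= ltnNge; apply: contraL h => h; by rewrite nth_default.
Qed.
Lemma uniq_cells : uniq (cells mu).
Proof.
apply: allpairs_uniq_dep => [|r _|]; rewrite ?iota_uniq //.
by move=> [r c] [r' c'] _ _ /= [-> ->].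
Qed.
Lemma cell_ok (i : 'I_n) : (cell_col mu i < nth 0%N mu (cell_row mu i))%N.
Proof. by rewrite -mem_cells -surjective_pairing mem_nth // size_cells. Qed.
Lemma cell_inj (i j : 'I_n) : cell_row mu i = cell_row mu j -> cell_col mu i = cell_col mu j -> i = j.
Proof.
move=> hr hc; apply: val_inj; apply/eqP; rewrite -(nth_uniq (0, 0)%N _ _ uniq_cells) ?size_cells ?ltn_ord //.
by rewrite [nth _ _ (val i)]surjective_pairing [nth _ _ (val j)]surjective_pairing -/(cell_row mu i) hr -/(cell_col mu i) hc.
Qed.
Lemma cell_of r c : (c < nth 0%N mu r)%N -> exists i : 'I_n, cell_row mu i = r /\ cell_col mu i = c.
Proof.
rewrite -mem_cells => /(nthP (0, 0)%N)[i]; rewrite size_cells => il E.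
by exists (Ordinal il); rewrite /cell_row /cell_col /= E.
Qed.
Lemma nth_sumn r : (nth 0%N mu r <= n)%N.
Proof. by elim: (mu) r => [|a s IH] [|r] //=; [apply: leq_addr|apply: leq_trans (IH r) (leq_addl _ _)]. Qed.
Lemma row_size (i : 'I_n) : (cell_row mu i < size mu)%N.
Proof. by have := cell_ok i; case: (ltnP (cell_row mu i) (size mu)) => // h; rewrite nth_default. Qed.
Lemma col_lt (i : 'I_n) : (cell_col mu i < n)%N.
Proof. exact: leq_trans (cell_ok i) (nth_sumn _). Qed.

Definition pos (i : 'I_n) : 'I_(size mu) * 'I_n := (Ordinal (row_size i), Ordinal (col_lt i)).
Lemma pos_inj : injective pos.
Proof. by move=> i j [hr hc]; apply: cell_inj. Qed.

Definition shp : {ffun 'I_(size mu) -> 'I_n.+1} := [ffun i : 'I_(size mu) => inord (nth 0%N mu i)].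
Lemma shpE i : shp i = nth 0%N mu i :> nat.
Proof. by rewrite ffunE inordK // ltnS nth_sumn. Qed.

Context (muP : is_part mu).
Lemma part_mono i j : (i <= j)%N -> (nth 0%N mu j <= nth 0%N mu i)%N.
Proof.
have /andP[srt _] := muP => ij; case: (ltnP j (size mu)) => jl; last by rewrite nth_default.
have tr : transitive geq by move=> a b c /= h1 h2; apply: leq_trans h2 h1.
apply: (sorted_leq_nth tr (fun a => leqnn a) 0%N srt) => //; rewrite inE //; exact: leq_ltn_trans jl.
Qed.
Lemma shp_decr : decr shp.
Proof.
apply/forallP => i; rewrite shpE /nx; case: insubP => //= j _ ji; rewrite shpE; apply: part_mono.
by rewrite ji.
Qed.
Lemma cell_up (i : 'I_n) r : (r <= cell_row mu i)%N -> exists j : 'I_n, cell_row mu j = r /\ cell_col mu j = cell_col mu i.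
Proof. by move=> ri; apply: cell_of; apply: leq_trans (cell_ok i) (part_mono ri). Qed.

Section Fill.
Context (N : nat).
Local Notation X := {ffun 'I_n -> 'I_N}.
Local Notation sst := (@sst (size mu) n N N shp).

Definition tabl (T : X) : {ffun 'I_(size mu) * 'I_n -> 'I_N.+1} :=
  [ffun p => if [pick k | pos k == p] is Some k then lift ord0 (T k) else ord0].
Lemma tabl_pos T k : tabl T (pos k) = (T k).+1 :> nat.
Proof. by rewrite ffunE; case: pickP => [k' /eqP /pos_inj -> //|/(_ k)]; rewrite eqxx. Qed.
Lemma posP (i : 'I_(size mu)) (j : 'I_n) : (j < nth 0%N mu i)%N -> exists k, pos k = (i, j).
Proof. by move=> /cell_of[k [kr kc]]; exists k; congr (_, _); apply: val_inj. Qed.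
Lemma tabl0 T (i : 'I_(size mu)) (j : 'I_n) : (j < nth 0%N mu i)%N = false -> tabl T (i, j) = ord0.
Proof. by rewrite ffunE; case: pickP => // k /eqP [<- <-]; rewrite /= cell_ok. Qed.
Lemma tabl_inj : injective tabl.
Proof.
move=> T T' TT; apply/ffunP => k; apply: val_inj; apply: succn_inj.
by rewrite -[LHS]tabl_pos TT tabl_pos.
Qed.

Lemma semistandardP (T : X) : reflect
  ((forall i j : 'I_n, cell_row mu i = cell_row mu j -> (cell_col mu i <= cell_col mu j)%N -> (T i <= T j)%N) /\
   (forall i j : 'I_n, cell_col mu i = cell_col mu j -> (cell_row mu i < cell_row mu j)%N -> (T i < T j)%N)) (semistandard T).
Proof.
apply: (iffP forallP) => [H|[H1 H2] i]; last first.
  by apply/forallP => j; apply/andP; split; apply/implyP => /andP[/eqP]; [apply: H1|apply: H2].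
split=> i j e h; have /forallP /(_ j) /andP[/implyP h1 /implyP h2] := H i.
  by apply: h1; rewrite e eqxx.
by apply: h2; rewrite e eqxx.
Qed.

Lemma tabl_sst T : sst (tabl T) <-> semistandard T.
Proof.
split=> [[t1 t2 t3 t4]|/semistandardP[h1 h2]].
  apply/semistandardP; split=> i j e h.
    have pe : pos i = ((pos j).1, (pos i).2) by congr (_, _); apply: val_inj.
    by rewrite -ltnS -(tabl_pos T i) -(tabl_pos T j) pe; apply: t3; rewrite shpE /= h cell_ok.
  have pe : pos i = ((pos i).1, (pos j).2) by congr (_, _); apply: val_inj.
  by rewrite -ltnS -(tabl_pos T i) -(tabl_pos T j) pe; apply: t4; rewrite ?shpE /= ?h ?cell_ok.
split=> [i j|i j|i j j' /andP[jj]|i i' j ii]; rewrite ?shpE.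
- case: (boolP (j < nth 0 mu i)%N) => [/posP[k <-]|/negbTE h]; first by rewrite tabl_pos.
  by rewrite tabl0.
- case: (boolP (j < nth 0 mu i)%N) => [/posP[k <-]|/negbTE h]; last by rewrite tabl0.
  by rewrite tabl_pos.
- move=> j'i; have [k' e'] := posP j'i; have [k e] := posP (leq_ltn_trans jj j'i).
  rewrite -e' -e !tabl_pos ltnS; move: e e' => [r c] [r' c']; apply: h1.
    by move: r r' => /(congr1 val) /= -> /(congr1 val) /= ->.
  by move: c c' => /(congr1 val) /= -> /(congr1 val) /= ->.
move=> ji; have [k' e'] := posP ji; have [k e] := posP (leq_trans ji (part_mono (ltnW ii))).
rewrite -e' -e !tabl_pos ltnS; move: e e' => [r c] [r' c']; apply: h2.
  by move: c c' => /(congr1 val) /= -> /(congr1 val) /= ->.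
by move: r r' => /(congr1 val) /= -> /(congr1 val) /= ->.
Qed.

Lemma sst_tabl t : sst t -> exists T, t = tabl T.
Proof.
move=> st; have [t1 t2 _ _] := st.
have H k : ((t (pos k)).-1 < N)%N.
  have p : (0 < t (pos k))%N by rewrite t1 shpE cell_ok.
  by rewrite prednK // t2.
exists [ffun k => Ordinal (H k)]; apply/ffunP => -[i j]; apply: val_inj.
case: (boolP (j < nth 0 mu i)%N) => [ji|/negbTE h].
  have [k <-] := posP ji; rewrite /= tabl_pos ffunE /= prednK // t1 shpE; exact: cell_ok.
by rewrite tabl0 //=; apply/eqP; rewrite -leqn0 leqNgt t1 shpE h.
Qed.

Lemma schur_sc : schur_poly mu N = sc (xvar N) N shp.
Proof.
rewrite -(sst_sc (xvar N) (leqnn N) shp_decr) /schur_poly.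
have -> : \sum_(t | `[< sst t >]) wt (xvar N) t = \sum_(t in tabl @: [set T | semistandard T]) wt (xvar N) t.
  apply: eq_bigl => t; apply/asboolP/imsetP => [s|[T]]; last by rewrite inE => /tabl_sst s ->.
  by have [T tT] := sst_tabl s; exists T => //; rewrite inE; apply/tabl_sst; rewrite -tT.
rewrite big_imset /=; last by move=> T T' _ _; apply: tabl_inj.
apply: eq_big => [T|T _]; first by rewrite inE.
rewrite /wt pair_bigA /=.
transitivity (\prod_(p in pos @: [set: 'I_n]) (if (tabl T p : nat) is c.+1 then xvar N c else 1)).
  rewrite big_imset /=; last by move=> i j _ _; apply: pos_inj.
  by apply: eq_big => [i|i _]; [rewrite inE|rewrite tabl_pos xvarE].
rewrite big_mkcond; apply: eq_bigr => -[i j] _ /=; case: imsetP => // H.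
rewrite tabl0 //; apply/negP => /posP[k e]; apply: H; exists k; rewrite ?inE //.
Qed.
End Fill.
End Cells.

Section CanonProd.
Context (N : nat).

Lemma ascends_block a : \sum_(g : {ffun 'I_a -> 'I_N} | ascends (fun=> 0%N) g) \prod_i 'X_(g i) = complete_poly N a.
Proof.
rewrite (reindex_onto (fun t : a.-tuple 'I_N => [ffun i => tnth t i]) (fun g => [tuple g i | i < a])) /=; last first.
  by move=> g _; apply/ffunP => i; rewrite ffunE tnth_mktuple.
apply: eq_big => [t|t _]; last by rewrite big_tuple; apply: eq_bigr => i _; rewrite ffunE.
have -> : [tuple [ffun i => tnth t i] i | i < a] = t by apply: eq_from_tnth => i; rewrite tnth_mktuple ffunE.
have ntE (c : 'I_a) : nth 0%N (map val t) c = tnth t c by rewrite (nth_map (tnth t c)) ?size_tuple // -tnth_nth.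
rewrite eqxx andbT; apply/ascendsP/idP => [H|srt i j ij _].
  apply/(sortedP 0%N) => i; rewrite size_map size_tuple => ia.
  have := H (Ordinal (ltnW ia)) (Ordinal ia) (leqnSn i) erefl; rewrite !ffunE.
  by rewrite -(ntE (Ordinal ia)) -(ntE (Ordinal (ltnW ia))).
rewrite !ffunE -!ntE.
by apply: (sorted_leq_nth leq_trans leqnn 0%N srt) => //; rewrite inE size_map size_tuple.
Qed.

Definition glue s a (g : {ffun 'I_s -> 'I_N} * {ffun 'I_a -> 'I_N}) : {ffun 'I_(a + s) -> 'I_N} :=
  [ffun i => match split (cast_ord (addnC a s) i) with inl j => g.1 j | inr j => g.2 j end].

(** A filling ascending on every block is a family of sorted tuples, one per block, and its monomial
    is the product of theirs. *)
Lemma ascends_prod al : \sum_(f : {ffun 'I_(sumn al) -> 'I_N} | ascends (bs al) f) \prod_i 'X_(f i) = \prod_(a <- al) complete_poly N a.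
Proof.
elim: al => [|a al IH].
  rewrite big_nil (bigD1 (finfun (fun i : 'I_0 => ord0_any 'I_N i))) /=; last by apply/ascendsP => -[].
  rewrite big_ord0 big1 ?addr0 // => f /andP[_ /eqP H]; case: H; apply/ffunP; case=> m i.
  by [].
rewrite big_cons -IH -ascends_block [sumn _]/=; set s := sumn al.
have gl i (g : {ffun 'I_s -> 'I_N} * {ffun 'I_a -> 'I_N}) : glue g (cast_ord (addnC s a) (lshift a i)) = g.1 i.
  rewrite ffunE; case: splitP => j /= E; first by congr (g.1 _); apply: val_inj.
  by have := ltn_ord i; rewrite E -[X in (_ < X)%N]addn0 ltn_add2l ltn0.
have gr i (g : {ffun 'I_s -> 'I_N} * {ffun 'I_a -> 'I_N}) : glue g (cast_ord (addnC s a) (rshift s i)) = g.2 i.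
  rewrite ffunE; case: splitP => j /= E; last by congr (g.2 _); apply: val_inj; apply/eqP; rewrite -(eqn_add2l s) E.
  by have := ltn_ord j; rewrite -E -[X in (_ < X)%N]addn0 ltn_add2l ltn0.
have cover (i : 'I_(a + s)) : (exists j, i = cast_ord (addnC s a) (lshift a j)) \/ (exists j, i = cast_ord (addnC s a) (rshift s j)).
  case: (splitP (cast_ord (addnC a s) i)) => j /= E; [left|right]; exists j; exact: val_inj.
rewrite (reindex_onto (@glue s a) (fun f => ([ffun j => f (cast_ord (addnC s a) (lshift a j))], [ffun j => f (cast_ord (addnC s a) (rshift s j))]))) /=; last first.
  by move=> f _; apply/ffunP => i; case: (cover i) => -[j ->]; rewrite ?gl ?gr ffunE.
rewrite mulrC big_distrlr /= pair_big /=; apply: eq_big => [g|g _].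
  have -> : ([ffun j => glue g (cast_ord (addnC s a) (lshift a j))], [ffun j => glue g (cast_ord (addnC s a) (rshift s j))]) = g.
    by case: g => g1 g2; congr (_, _); apply/ffunP => i; rewrite ffunE ?gl ?gr.
  rewrite eqxx andbT; apply/ascendsP/andP => [H|[/ascendsP H1 /ascendsP H2] i j].
    split; apply/ascendsP => i j ij E.
      by rewrite -!gl; apply: H => //; rewrite /= -/s !ltn_ord.
    by rewrite -!gr; apply: H => /=; rewrite ?leq_add2l // -/s !ltnNge !leq_addr.
  case: (cover i) (cover j) => -[i' ->] [] [j' ->]; rewrite /= -/s ?gl ?gr ?ltn_ord.
  - exact: H1.
  - by rewrite ltnNge leq_addr /= => _ E; have := bs_lt (ltn_ord i'); rewrite E ltnn.
  - by move=> h; have := ltn_ord j'; rewrite ltnNge (leq_trans _ h) ?leq_addr.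
  by rewrite leq_add2l => h _; apply: H2.
rewrite (reindex (cast_ord (addnC s a))) /=; last first.
  by exists (cast_ord (addnC a s)) => i _; apply: val_inj.
by rewrite big_split_ord /=; congr (_ * _); apply: eq_bigr => i _; rewrite ?gl ?gr.
Qed.

Definition cont n (f : {ffun 'I_n -> 'I_N}) : 'X_{1..N} := (\sum_i U_(f i))%MM.
Lemma cont_prod n (f : {ffun 'I_n -> 'I_N}) : \prod_i 'X_(f i) = 'X_[cont f] :> {mpoly int[N]}.
Proof. by rewrite mprodXE. Qed.
Lemma contE n (f : {ffun 'I_n -> 'I_N}) c : cont f c = #|[set i | f i == c]|.
Proof.
rewrite /cont mnm_sumE -sum1dep_card [RHS]big_mkcond /=; apply: eq_bigr => i _; rewrite mnm1E; by case: eqP.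
Qed.
Lemma cont_orb n (f S : {ffun 'I_n -> 'I_N}) : (cont f == cont S) = (f \in orb S).
Proof.
apply/eqP/imsetP => [E|[w _ ->]]; last first.
  apply/mnmP => c; rewrite !contE -[LHS](card_imset _ (@perm_inj _ w)); apply: eq_card => i.
  apply/imsetP/idP => [[j]|]; first by rewrite !inE ffunE => h ->.
  by rewrite inE => h; exists (w^-1%g i); rewrite ?permKV // inE ffunE permKV.
have cnt (g : {ffun 'I_n -> 'I_N}) c : count_mem c (codom g) = cont g c.
  by rewrite contE -sum1_card -sum1_count /codom big_image_cond /=; apply: eq_bigl => i; rewrite inE.
have : perm_eq [tuple f i | i < n] [tuple S i | i < n].
  have e (g : {ffun 'I_n -> 'I_N}) : [tuple g i | i < n] = codom g :> seq _ by [].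
  by rewrite !e; apply/allP => c _ /=; rewrite !cnt E.
move/tuple_permP => [w wE]; exists w => //; apply/ffunP => i; rewrite ffunE.
have := congr1 (fun t => tnth t i) (val_inj wE : [tuple f i | i < n] = [tuple tnth [tuple S i | i < n] (w i) | i < n]).
by rewrite !tnth_mktuple.
Qed.

Lemma cont_coef n (P : pred {ffun 'I_n -> 'I_N}) (S : {ffun 'I_n -> 'I_N}) :
  (\sum_(f | P f) \prod_i 'X_(f i) : {mpoly int[N]})@_(cont S) = #|[set f in orb S | P f]|%:Z.
Proof.
rewrite raddf_sum /= -[RHS]natz -sum1_card natr_sum [LHS]big_mkcond [RHS]big_mkcond; apply: eq_bigr => f _.
by rewrite inE andbC; case: (P f) => //=; rewrite cont_prod mcoeffX cont_orb; case: ifP.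
Qed.
End CanonProd.

(** The link between polynomials and idempotents: pairing with the Young idempotent of [S] extracts
    the coefficient of the monomial of [S]. *)
Lemma tau_coef (k : fieldType) (char0 : [pchar k] =i pred0) N n al (S : {ffun 'I_n -> 'I_N}) : n = sumn al ->
  tau (rho k (fun i : 'I_n => bs al i)) (rho k (fun i => S i)) = ((\prod_(a <- al) complete_poly N a)@_(cont S))%:~R.
Proof. by move=> nE; subst n; rewrite tau_rho // -ascends_prod cont_coef. Qed.

End Cells.
Import Cells.

(** * Kostka numbers for the terms of the Jacobi-Trudi determinant *)

Module Kostka.

Local Open Scope ring_scope.

Lemma card_ord_lt n b : (b <= n)%N -> #|[set i : 'I_n | (i < b)%N]| = b.
Proof.
by move=> bn; rewrite cardsE -sum1_card -(big_ord_widen_cond n xpredT (fun=> 1%N)) // sum1_card card_ord.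
Qed.

Lemma bs_drop al r i : (r <= size al)%N -> (i < sumn al)%N -> (bs al i < r)%N = (i < sumn (drop (size al - r) al))%N.
Proof.
elim: al => [|a al IH] //=.
move=> ra ia; case: (ltnP i (sumn al)) => h.
  move: ra; rewrite leq_eqVlt => /orP[/eqP ->|ra].
    by rewrite subnn /= ia (leq_trans (bs_lt h)).
  by rewrite subSn //= IH.
move: ra; rewrite leq_eqVlt => /orP[/eqP ->|ra]; first by rewrite subnn /= ia ltnSn.
rewrite subSn //=; have lr : (r <= size al)%N by [].
rewrite ltnNge lr /=; apply/esym/negbTE; rewrite -leqNgt; apply: leq_trans h.
by rewrite -[X in (_ <= sumn X)%N](cat_take_drop (size al - r)) sumn_cat leq_addl.
Qed.

(* The word whose block of index c in [bs] has size [al c]. *)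
Definition comp_word l (al : nat -> nat) := rev (mkseq al l).
Lemma size_comp_word l al : size (comp_word l al) = l.
Proof. by rewrite size_rev size_mkseq. Qed.
Lemma sumn_comp_word l al : sumn (comp_word l al) = (\sum_(c < l) al c)%N.
Proof. by rewrite sumn_rev sumnE big_map -[l in iota 0 l]subn0 big_mkord. Qed.
Lemma bs_comp_word l al r i : (r <= l)%N -> (i < sumn (comp_word l al))%N ->
  (bs (comp_word l al) i < r)%N = (i < \sum_(c < r) al c)%N.
Proof.
move=> rl il; rewrite bs_drop ?size_comp_word //; congr (_ < _)%N.
by rewrite /comp_word drop_rev size_mkseq subKn // -sumn_comp_word /comp_word /mkseq -map_take take_iota (minn_idPl rl).
Qed.

Lemma cell_row_bs mu i : (i < sumn mu)%N -> cell_row mu i = bs (rev mu) i.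
Proof.
elim/last_ind: mu i => [|mu a IH] i //; rewrite sumn_rcons => ia.
have cE : cells (rcons mu a) = cells mu ++ [seq (size mu, c) | c <- iota 0 a].
  rewrite /cells size_rcons -[in iota 0 _]addn1 iotaD map_cat flatten_cat /= add0n cats0 nth_rcons ltnn eqxx.
  by congr (flatten _ ++ _); apply/eq_in_map => j; rewrite mem_iota /= => jl; rewrite nth_rcons jl.
rewrite rev_rcons [bs _ _]/= sumn_rev size_rev /cell_row cE nth_cat size_cells.
case: ltnP => h; first by rewrite -IH.
by rewrite (nth_map 0%N) // size_iota; lia.
Qed.

Section Kostka.
Context (mu : seq nat) (muP : is_part mu).
Local Notation n := (sumn mu).
Local Notation l := (size mu).

(** Column by column: distinct values below r number at most r and at most the height of the column,
    and the first r rows attain this minimum. *)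
Lemma card_col_inj (f : 'I_n -> nat) r :
  (forall i j : 'I_n, cell_col mu i = cell_col mu j -> f i = f j -> i = j) ->
  (#|[set i | f i < r]| <= #|[set i : 'I_n | cell_row mu i < r]|)%N.
Proof.
move=> inj.
have part (P : pred 'I_n) : #|[set i | P i]| = (\sum_(c < n) #|[set i : 'I_n | P i && (cell_col mu i == c)]|)%N.
  rewrite -sum1dep_card (partition_big (fun i => Ordinal (col_lt i)) xpredT) //=.
  by apply: eq_bigr => c _; rewrite sum1dep_card; apply: eq_card => i; rewrite !inE.
rewrite !part; apply: leq_sum => c _; set F := [set i | _]; set G := [set i | _].
case: (boolP [exists i : 'I_n, (cell_col mu i == c) && (r <= cell_row mu i)%N]) => [/existsP[i0 /andP[/eqP c0 r0]]|/existsPn H]; last first.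
  apply: subset_leq_card; apply/subsetP => i; rewrite !inE => /andP[_ ic]; rewrite ic andbT.
  by have := H i; rewrite ic /= -ltnNge.
apply: (@leq_trans r).
  rewrite -[r](size_iota 0) cardE -(size_map f); apply: uniq_leq_size.
    rewrite map_inj_in_uniq ?enum_uniq // => i j; rewrite !mem_enum !inE => /andP[_ /eqP ci] /andP[_ /eqP cj]; apply: inj.
    by rewrite ci cj.
  by move=> x /mapP[i]; rewrite mem_enum inE mem_iota => /andP[h _] ->.
rewrite -[X in (X <= _)%N](size_iota 0) cardE -(size_map (fun i : 'I_n => cell_row mu i)); apply: uniq_leq_size; first exact: iota_uniq.
move=> x; rewrite mem_iota /= => xr; have [j [jr jc]] := cell_up muP (ltnW (leq_trans xr r0)).
by apply/mapP; exists j; rewrite ?jr // mem_enum inE jr xr jc c0 /=.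
Qed.

Lemma card_rows r : (r <= l)%N -> #|[set i : 'I_n | cell_row mu i < r]%N| = (\sum_(c < r) nth 0%N mu c)%N.
Proof.
move=> rl; have muE : rev mu = comp_word l (nth 0%N mu) by rewrite /comp_word mkseq_nth.
have H (i : 'I_n) : (cell_row mu i < r)%N = (i < \sum_(c < r) nth 0 mu c)%N.
  by rewrite cell_row_bs // muE bs_comp_word // -muE sumn_rev.
transitivity #|[set i : 'I_n | (i < \sum_(c < r) nth 0 mu c)%N]|; first by apply: eq_card => i; rewrite !inE H.
apply: card_ord_lt; rewrite -{2}(mkseq_nth 0%N mu) sumnE big_map -[l in iota 0 l]subn0 big_mkord.
by rewrite (big_ord_widen l (nth 0%N mu)) // [leqRHS](bigID (fun c : 'I_l => c < r)%N) leq_addr.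
Qed.

(** The degrees mu_c + s(c) - c in the Leibniz expansion. [jtok] says that no subtraction is
    truncated; the other permutations contribute zero to the determinant. *)
Definition jtv (s : 'S_l) (c : nat) : nat := (nth 0%N mu c + oapp (fun i => s i : nat) c (insub c) - c)%N.
Definition jtok (s : 'S_l) : bool := [forall i : 'I_l, (i <= nth 0%N mu i + s i)%N].
Definition jtw (s : 'S_l) := comp_word l (jtv s).

Lemma jtvE s (i : 'I_l) : jtv s i = (nth 0%N mu i + s i - i)%N.
Proof. by rewrite /jtv valK. Qed.

Lemma jtv_sum s r : jtok s -> (r <= l)%N ->
  (\sum_(c < r) jtv s c + \sum_(i < l | i < r) i = \sum_(c < r) nth 0 mu c + \sum_(i < l | i < r) s i)%N.
Proof.
move=> /forallP ok rl; rewrite (big_ord_widen l (jtv s)) // (big_ord_widen l (nth 0%N mu)) // -!big_split /=.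
by apply: eq_bigr => i _; rewrite jtvE subnK.
Qed.

Lemma sumn_mu : (\sum_(c < l) nth 0 mu c)%N = n.
Proof. by rewrite -[RHS](congr1 sumn (mkseq_nth 0%N mu)) sumnE big_map -[l in iota 0 l]subn0 big_mkord. Qed.

Lemma sumn_jtw s : jtok s -> n = sumn (jtw s).
Proof.
move=> ok; rewrite sumn_comp_word -sumn_mu; have := jtv_sum ok (leqnn l).
have E (F : 'I_l -> nat) : (\sum_(i < l | i < l) F i = \sum_i F i)%N by apply: eq_bigl => i; rewrite ltn_ord.
have E' : (\sum_i s i = \sum_(i < l) i)%N by rewrite [RHS](reindex_inj (@perm_inj _ s)).
by rewrite !E E' => /eqP; rewrite eqn_add2r => /eqP ->.
Qed.

(** If [s] fixes everything below i, then s(i) is at least i, and the bound at i + 1 gives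
    equality. *)
Lemma perm_dominated (s : 'S_l) : (forall r, (r <= l)%N -> (\sum_(i < l | i < r) s i <= \sum_(i < l | i < r) i)%N) -> s = 1%g.
Proof.
move=> H; apply/permP => i; rewrite perm1; apply: val_inj.
have [m mE] : exists m : nat, m = i by exists i.
elim/ltn_ind: m i mE => m IH i mE.
have sj (j : 'I_l) : (j < i)%N -> s j = j by move=> ji; apply: val_inj; apply: (IH j) => //; rewrite mE.
have si : (i <= s i)%N.
  rewrite leqNgt; apply/negP => h; have := sj _ h => /perm_inj E; by rewrite E ltnn in h.
have := H i.+1 (ltn_ord i).
rewrite (bigD1 i) //= [X in (_ <= X)%N](bigD1 i) //=.
rewrite (eq_bigr (fun j : 'I_l => j : nat)) => [|j /andP[ji jn]]; first by rewrite leq_add2r => h; apply/eqP; rewrite eqn_leq si h.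
by rewrite sj // ltn_neqAle -ltnS ji andbT.
Qed.

(** A filling injective on columns has content dominated by [mu], whereas the contents [jtw s]
    dominate [mu], with partial sums in excess by those of [s] over those of the identity. *)
Lemma jtw_dominated (s : 'S_l) (f : 'I_n -> nat) : jtok s ->
  (forall i j : 'I_n, cell_col mu i = cell_col mu j -> f i = f j -> i = j) ->
  (forall r, (r <= l)%N -> #|[set i | f i < r]%N| = #|[set i : 'I_n | bs (jtw s) i < r]%N|) -> s = 1%g.
Proof.
move=> ok inj cf; apply: perm_dominated => r rl.
have := card_col_inj r inj; rewrite cf // card_rows //.
have -> : #|[set i : 'I_n | bs (jtw s) i < r]%N| = (\sum_(c < r) jtv s c)%N.
  transitivity #|[set i : 'I_n | (i < \sum_(c < r) jtv s c)%N]|.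
    by apply: eq_card => i; rewrite !inE bs_comp_word // -/(jtw s) -sumn_jtw.
  apply: card_ord_lt; rewrite (sumn_jtw ok) sumn_comp_word.
  by rewrite (big_ord_widen l (jtv s)) // [leqRHS](bigID (fun c : 'I_l => c < r)%N) leq_addr.
by have := jtv_sum ok rl; lia.
Qed.

Lemma jtok1 : jtok 1. Proof. by apply/forallP => i; rewrite perm1 leq_addl. Qed.
Lemma jtw1 : jtw 1 = rev mu.
Proof.
rewrite /jtw /comp_word -[X in _ = rev X](mkseq_nth 0%N mu); congr rev; rewrite /mkseq; apply/eq_in_map => c; rewrite mem_iota /= => cl.
by rewrite -[c]/(val (Ordinal cl)) jtvE perm1 addnK.
Qed.

Lemma jt_label (s : 'S_l) : jtok s -> exists S : {ffun 'I_n -> 'I_l}, forall i, S i = bs (jtw s) i :> nat.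
Proof.
move=> ok; have H (i : 'I_n) : (bs (jtw s) i < l)%N.
  by rewrite -[X in (_ < X)%N](size_comp_word l (jtv s)) bs_lt // -/(jtw s) -sumn_jtw.
by exists [ffun i => Ordinal (H i)] => i; rewrite ffunE.
Qed.

Lemma card_pact m N (S : {ffun 'I_m -> 'I_N}) w r : #|[set i | pact S w i < r]%N| = #|[set i | S i < r]%N|.
Proof.
rewrite -[LHS](card_imset _ (@perm_inj _ w)); apply: eq_card => i; apply/imsetP/idP => [[j]|].
  by rewrite !inE ffunE => h ->.
by rewrite inE => h; exists (w^-1%g i); rewrite ?permKV // inE ffunE permKV.
Qed.

(** Semistandard fillings are injective on columns, so domination leaves only s = 1. There, strict
    columns force the entry of a cell to be at least its row, and the content then forces
    equality. *)
Lemma kostka (s : 'S_l) (S : {ffun 'I_n -> 'I_l}) : jtok s -> (forall i, S i = bs (jtw s) i :> nat) ->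
  (schur_poly mu l)@_(cont S) = (s == 1%g)%:Z.
Proof.
move=> ok SE; rewrite /schur_poly cont_coef; congr Posz.
have cS w r : #|[set i | pact S w i < r]%N| = #|[set i : 'I_n | bs (jtw s) i < r]%N|.
  by rewrite card_pact; apply: eq_card => i; rewrite !inE SE.
case: eqP => [s1|s1]; last first.
  apply/eqP; rewrite cards_eq0; apply/eqP/setP => T; rewrite !inE; apply/negP => /andP[/imsetP[w _ ->]].
  move=> /semistandardP[_ h]; apply: s1; apply: (jtw_dominated (f := fun i => pact S w i)) => // i j cij fij.
  apply: cell_inj => //; case: (ltngtP (cell_row mu i) (cell_row mu j)) => // rij.
    by have := h i j cij rij; rewrite fij ltnn.
  by have := h j i (esym cij) rij; rewrite fij ltnn.
have Srow i : S i = cell_row mu i :> nat by rewrite SE s1 jtw1 cell_row_bs.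
apply/eqP/cards1P; exists S; apply/setP => T; rewrite !inE; apply/andP/eqP => [[/imsetP[w _ TE] /semistandardP[_ h]]|->].
  have rT (i : 'I_n) : (cell_row mu i <= T i)%N.
    have [m mE] : exists m : nat, m = cell_row mu i by exists (cell_row mu i).
    elim: m i mE => [|m IH] i mE; first by rewrite -mE.
    have [j [jr jc]] := cell_up muP (i := i) (r := m) ltac:(by rewrite -mE).
    rewrite -mE; apply: leq_ltn_trans (h j i jc _); last by rewrite jr -mE.
    by rewrite -{1}jr; apply: IH.
  apply/ffunP => i; apply: val_inj => /=; rewrite Srow; apply/eqP; rewrite eqn_leq rT andbT -ltnS.
  have eqs r : [set i | T i < r]%N = [set i : 'I_n | cell_row mu i < r]%N.
    apply/eqP; rewrite eqEcard; apply/andP; split.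
      by apply/subsetP => j; rewrite !inE; apply: leq_ltn_trans.
    by rewrite TE cS s1 jtw1 subset_leq_card //; apply/subsetP => j; rewrite !inE cell_row_bs.
  by have := eqs (cell_row mu i).+1 => /setP /(_ i); rewrite !inE ltnSn.
split; first by apply/imsetP; exists 1%g; rewrite ?pact1.
by apply/semistandardP; split=> i j; rewrite !Srow // => ->.
Qed.

Definition jt_words : seq (bool * seq nat) := [seq (s : bool, jtw s) | s : 'S_l <- enum 'S_l & jtok s].

Definition lev (A : pzRingType) (h : nat -> A) (L : seq (bool * seq nat)) : A :=
  \sum_(w <- L) (-1) ^+ w.1 * \prod_(a <- w.2) h a.

Lemma schur_words N : lev (complete_poly N) jt_words = schur_poly mu N.
Proof.
rewrite schur_sc // -jacobi_trudi ?shp_decr // /lev big_map big_filter big_enum_cond /= /determinant.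
rewrite [RHS](bigID jtok) /= [X in _ = _ + X]big1 ?addr0 => [|s /forallPn[i Hi]]; last first.
  by rewrite (bigD1 i) //= mxE shpE /hz (negbTE Hi) mul0r mulr0.
apply: eq_bigr => s /forallP ok; congr (_ * _); rewrite big_rev big_map -[l in iota 0 l]subn0 big_mkord.
by apply: eq_bigr => i _; rewrite mxE shpE /hz ok jtvE complete_hs.
Qed.
End Kostka.

End Kostka.
Import Kostka.

(** * Specht idempotents as signed sums of Young idempotents *)

Module SpechtIdempotents.

Local Open Scope ring_scope.

Definition sg (V : zmodType) (b : bool) (v : V) : V := if b then - v else v.

Section Words.
Context (k : fieldType) (char0 : [pchar k] =i pred0) (n : nat).
Local Notation rw al := (rho k (fun i : 'I_n => bs al i) : GR k n).

Definition posw (L : seq (bool * seq nat)) : seq (GR k n) := [seq rw w.2 | w <- L & ~~ w.1].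
Definition negw (L : seq (bool * seq nat)) : seq (GR k n) := [seq rw w.2 | w <- L & w.1].

Lemma words_sum (V : zmodType) (F : GR k n -> V) L :
  \sum_(x <- posw L) F x - \sum_(x <- negw L) F x = \sum_(w <- L) sg w.1 (F (rw w.2)).
Proof.
rewrite /posw /negw !big_map !big_filter [RHS](bigID (fun w => w.1)) /= addrC -sumrN.
by congr (_ + _); apply: eq_bigr => w; [move=> /negbTE ->|move=> ->].
Qed.
Lemma posw_idem L : {in posw L, forall e, idem e}.
Proof. by move=> e /mapP[w _ ->]; apply: rho_idem. Qed.
Lemma negw_idem L : {in negw L, forall e, idem e}.
Proof. by move=> e /mapP[w _ ->]; apply: rho_idem. Qed.

Lemma words_coef N L (S : {ffun 'I_n -> 'I_N}) : (forall w, w \in L -> n = sumn w.2) ->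
  \sum_(w <- L) sg w.1 (tau (rw w.2) (rho k (fun i => S i))) = ((lev (complete_poly N) L)@_(cont S))%:~R.
Proof.
move=> Ln; rewrite /lev raddf_sum /= rmorph_sum; apply: eq_big_seq => w wL.
rewrite (tau_coef char0 S (Ln w wL)) /sg; case: (w.1); rewrite ?mul1r //.
by rewrite mulN1r raddfN rmorphN.
Qed.

Lemma word_label al : n = sumn al -> exists S : {ffun 'I_n -> 'I_(size al)}, forall i, S i = bs al i :> nat.
Proof.
move=> nE; have H (i : 'I_n) : (bs al i < size al)%N by rewrite bs_lt // -nE.
by exists [ffun i => Ordinal (H i)] => i; rewrite ffunE.
Qed.

Lemma words_norm L :
  \sum_(x <- posw L) (\sum_(y <- posw L) tau x y - \sum_(y <- negw L) tau x y)
   - \sum_(x <- negw L) (\sum_(y <- posw L) tau x y - \sum_(y <- negw L) tau x y)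
  = \sum_(w' <- L) sg w'.1 (\sum_(w <- L) sg w.1 (tau (rw w.2) (rw w'.2))).
Proof.
rewrite words_sum; under eq_bigr => w _ do rewrite words_sum.
have sgs (b : bool) (I : Type) (r : seq I) (F : I -> k) : sg b (\sum_(i <- r) F i) = \sum_(i <- r) sg b (F i).
  by case: b => //=; rewrite -sumrN.
under eq_bigr => w _ do rewrite sgs.
rewrite exchange_big /=; apply: eq_bigr => w' _; rewrite sgs; apply: eq_bigr => w _.
by case: (w.1); case: (w'.1).
Qed.

(** By [words_coef] the signed sum pairs to zero with each of its own terms, so its norm is zero and
    [recognize0] applies. *)
Lemma words_zero L : (forall w, w \in L -> n = sumn w.2) ->
  (forall N (S : {ffun 'I_n -> 'I_N}), (lev (complete_poly N) L)@_(cont S) = 0) ->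
  forall (V : zmodType) (Phi : GR k n -> V), idem_additive Phi -> \sum_(w <- L) sg w.1 (Phi (rw w.2)) = 0.
Proof.
move=> Ln H V Phi PA; rewrite -words_sum; apply/eqP; rewrite subr_eq0; apply/eqP.
apply: recognize0 PA => //; [exact: posw_idem|exact: negw_idem|].
rewrite words_norm big1_seq // => w /= wL; have [S SE] := word_label (Ln w wL).
have -> : rw w.2 = rho k (fun i => S i) by congr (rho k _); apply/funext => i; rewrite SE.
by rewrite words_coef // H; case: (w.1); rewrite /= ?oppr0.
Qed.
End Words.

Section Specht.
Context (k : fieldType) (char0 : [pchar k] =i pred0) (mu : seq nat) (muP : is_part mu).
Local Notation n := (sumn mu).
Local Notation l := (size mu).
Local Notation rw al := (rho k (fun i : 'I_n => bs al i) : GR k n).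
Local Notation kap := (col_sum k mu : GR k n).
Local Notation rs := (row_sum k mu : GR k n).

Lemma rho_dlt (T : 'I_n -> nat) u : u \in stab T -> (rho k T : GR k n) * dlt k u = rho k T.
Proof.
move=> uT; apply/ffunP => w; rewrite GR_mulE (bigD1 (u^-1 * w)%g) //= big1 ?addr0 => [|v vw].
  rewrite [X in _ * X]ffunE invMg invgK mulKVg eqxx mulr1 !rhoE; congr (if _ then _ else _).
  apply/idP/idP => H; last by rewrite stabM ?stabV.
  by rewrite -(mulKVg u w); apply: stabM.
rewrite [X in _ * X]ffunE; case: eqP => [E|_]; last by rewrite mulr0.
by case/eqP: vw; rewrite -E invMg invgK mulgKV.
Qed.

Lemma kap_dlt (t : 'S_n) : (forall i, cell_col mu (t i) = cell_col mu i) -> dlt k t * kap = (-1) ^+ t *: kap.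
Proof.
move=> tC; have tC' i : cell_col mu (t^-1%g i) = cell_col mu i by rewrite -{2}(permKV t i) tC.
apply/ffunP => w; rewrite GR_mulE (bigD1 t) //= big1 ?addr0 => [|v vw]; last by rewrite ffunE (negbTE vw) mul0r.
have -> : dlt k t t = 1 by rewrite ffunE eqxx.
have kE (u : 'S_n) : kap u = [forall i, cell_col mu (u i) == cell_col mu i]%:R * (-1) ^+ u by rewrite ffunE.
rewrite mul1r [RHS]ffunE !kE odd_permM odd_permV signr_addb /GRing.scale /=.
have -> : [forall i, cell_col mu ((w * t^-1)%g i) == cell_col mu i] = [forall i, cell_col mu (w i) == cell_col mu i].
  by apply: eq_forallb => i; rewrite permM tC'.
by rewrite mulrA mulrC.
Qed.

(** If [w] puts two cells of one column into one block, their transposition negates the column sum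
    and is absorbed by the Young idempotent, so the product is its own negative. If no such pair
    exists, [jtw_dominated] forces s = 1. *)
Lemma rho_kap (s : 'S_l) (z : GR k n) : jtok s -> s <> 1%g -> rw (jtw s) * z * kap = 0.
Proof.
move=> ok s1; rewrite (gr_expand z) mulr_sumr mulr_suml big1 // => w _.
rewrite gr_scaler gr_scalel; apply/eqP; rewrite scaler_eq0; apply/orP; right; apply/eqP.
set T := fun i : 'I_n => bs (jtw s) i; rewrite -[rw _]/(rho k T : GR k n).
case: (boolP [exists i : 'I_n, exists j : 'I_n, [&& cell_col mu i == cell_col mu j, T (w i) == T (w j) & i != j]]).
  move=> /existsP[i /existsP[j /and3P[/eqP cij /eqP Tij ij]]].
  set t := tperm i j.
  have tC c : cell_col mu (t c) = cell_col mu c by rewrite /t; case: tpermP => [->|->|].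
  have uT : (t ^ w)%g \in stab T by apply/stabP => c; rewrite tpermJ; case: tpermP => [->|->|].
  have K1 : dlt k w * (dlt k t * kap) = - (dlt k w * kap) by rewrite kap_dlt // odd_tperm ij expr1 scaleN1r mulrN.
  have E : (rho k T : GR k n) * dlt k w * kap = - ((rho k T : GR k n) * dlt k w * kap).
    transitivity ((rho k T : GR k n) * (dlt k w * (dlt k t * kap))); last by rewrite K1 mulrN mulrA.
    rewrite -{1}(rho_dlt uT) -!mulrA; congr (_ * _).
    by rewrite mulrA dlt_mul [RHS]mulrA dlt_mul -conjgC.
  have two : (2%:R : k) != 0 by have /pcharf0P -> := char0.
  have E2 : (2%:R : k) *: ((rho k T : GR k n) * dlt k w * kap) = 0.
    by rewrite scaler_nat mulr2n {1}E addNr.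
  by move/eqP: E2; rewrite scaler_eq0 (negbTE two) => /eqP.
move=> /existsPn H; case: s1; apply: (jtw_dominated muP (f := fun i => T (w i)) ok) => [i j cij fij|r rl].
  by have := H i => /existsPn /(_ j); rewrite cij fij !eqxx /= negbK => /eqP.
rewrite -[LHS](card_imset _ (@perm_inj _ w)); apply: eq_card => i; apply/imsetP/idP => [[j]|]; first by rewrite !inE => h ->.
by rewrite inE => h; exists (w^-1%g i); rewrite ?permKV // inE permKV.
Qed.

Lemma kap_kap : kap * kap = #|[set w : 'S_n | [forall i, cell_col mu (w i) == cell_col mu i]]|%:R *: kap.
Proof.
set C := [set w | _].
have kE w : kap w = if w \in C then (-1) ^+ w else 0 by rewrite ffunE inE; case: [forall _, _]; rewrite ?mul1r ?mul0r.
have CE : C = stab (fun i : 'I_n => cell_col mu i) by apply/setP => w; rewrite !inE.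
apply/ffunP => w; rewrite GR_mulE [RHS]ffunE /GRing.scale /=.
transitivity (\sum_(u in C) kap w); last by rewrite sumr_const mulr_natl.
rewrite [RHS]big_mkcond; apply: eq_bigr => u _; rewrite [in LHS]kE; case: ifP => uC; last by rewrite mul0r.
rewrite !kE odd_permM odd_permV signr_addb.
have -> : ((w * u^-1)%g \in C) = (w \in C).
  rewrite CE in uC *; apply/idP/idP => H; last by rewrite stabM ?stabV.
  by rewrite -(mulgKV u w); apply: stabM.
by case: ifP => _; rewrite ?mulr0 // mulrC -mulrA -signr_addb addbb mulr1.
Qed.

(** Otherwise a = kap rs satisfies a' a = 0, with a' the image of a under inversion. The
    coefficients of a are integers and that of a' a at 1 is the sum of their squares; but a has
    coefficient 1 at the identity, the only permutation preserving both rows and columns. *)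
Lemma row_kap_row : rs * kap * rs <> 0.
Proof.
move=> Z; pose a : GR k n := kap * rs; pose a' : GR k n := rs * kap.
have aa : a' * a = 0.
  by rewrite /a /a' -mulrA (mulrA kap) kap_kap gr_scalel gr_scaler mulrA Z scaler0.
have rV w : rs w^-1%g = rs w.
  rewrite !ffunE; congr (_%:R); congr nat_of_bool; apply/forallP/forallP => H i; apply/eqP.
    by rewrite -{2}(permK w i) (eqP (H _)).
  by rewrite -{2}(permKV w i) (eqP (H _)).
have kV w : kap w^-1%g = kap w.
  rewrite !ffunE odd_permV; congr (_%:R * _); congr nat_of_bool; apply/forallP/forallP => H i; apply/eqP.
    by rewrite -{2}(permK w i) (eqP (H _)).
  by rewrite -{2}(permKV w i) (eqP (H _)).
have a'E u : a' u = a u^-1%g.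
  rewrite !GR_mulE [RHS](reindex_inj (mulIg u^-1%g)) /=; apply: eq_bigr => v _.
  by rewrite invMg invgK mulKg rV mulrC -kV invMg invgK.
pose aZ (u : 'S_n) : int := \sum_(v : 'S_n) ([forall i, cell_col mu (v i) == cell_col mu i]%:R * (-1) ^+ v) * [forall i, cell_row mu ((u * v^-1)%g i) == cell_row mu i]%:R.
have aE u : a u = (aZ u)%:~R.
  rewrite GR_mulE rmorph_sum; apply: eq_bigr => v _; rewrite !ffunE !rmorphM /= rmorph_sign.
  by rewrite !rmorph_nat.
have : (a' * a) 1%g = 0 by rewrite aa ffunE.
rewrite GR_mulE (reindex_inj invg_inj) /=.
rewrite (eq_bigr (fun u => ((`|aZ u| ^ 2)%N%:R : k))) => [|u _]; last first.
  rewrite a'E mul1g !invgK aE; case: (aZ u) => m /=; first by rewrite -pmulrn -natrM mulnn.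
  by rewrite NegzE mulrNz mulrNN -!pmulrn -natrM mulnn.
rewrite -natr_sum => /(natr_inj char0 (j := 0)) /eqP; rewrite sum_nat_eq0 => /forallP /(_ 1%g).
rewrite implyTb expn_eq0 andbT absz_eq0 => /eqP; rewrite /aZ (bigD1 1%g) //= big1 ?addr0 => [|v v1]; last first.
  case: (boolP [forall _, _]) => [/forallP vC|_]; last by rewrite !mul0r.
  rewrite mul1g; case: (boolP [forall _, _]) => [/forallP vR|_]; last by rewrite mulr0.
  case/eqP: v1; apply/permP => i; rewrite perm1; apply: cell_inj; last exact/eqP.
  by rewrite -{2}(permK v i) (eqP (vR _)).
have F (g : nat -> nat) : [forall i : 'I_n, g ((1%g : 'S_n) i) == g i] by apply/forallP => i; rewrite perm1.
by rewrite F invg1 mulg1 F odd_perm1 expr0 !mulr1.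
Qed.

Context (e : galg k n) (eP : specht_idem e).

(** An isomorphism of ideals carries z e to a multiple of the polytabloid kap rs, on which x
    vanishes; injectivity brings this back. [specht_kept] runs the argument in the other
    direction. *)
Lemma specht_killed (x : GR k n) : (forall z, x * z * kap = 0) -> forall z, x * z * (e : GR k n) = 0.
Proof.
move=> xk z; have [_ [f [f1 f2 f3 f4 f5]]] := eP.
have ie b : gideal e (gmul b e) by exists b.
have f0 : f 0 = 0.
  have i0 : gideal e 0 by exists 0; apply/esym; exact: (mul0r (e : GR k n)).
  by have := f2 _ _ i0 i0; rewrite addr0 => /eqP; rewrite -subr_eq0 opprD addrA subrr sub0r oppr_eq0 => /eqP.
apply: f4; [by exists (x * z : GR k n)|by exists 0; apply/esym; exact: (mul0r (e : GR k n))|].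
rewrite f0 -mulrA; have := f3 (x : galg k n) (gmul (z : galg k n) e) (ie _); rewrite /= => E.
transitivity (gmul (x : galg k n) (f (gmul (z : galg k n) e))); first exact: E.
have [b ->] := f1 _ (ie z); have := xk (b : GR k n) => H.
transitivity ((x * b * kap) * rs : GR k n); first by rewrite -!mulrA.
by rewrite H mul0r.
Qed.

Lemma specht_kept (x : GR k n) : (forall z, x * z * (e : GR k n) = 0) -> x * kap * rs = 0.
Proof.
move=> xe; have [_ [f [f1 f2 f3 f4 f5]]] := eP.
have i0 : gideal e 0 by exists 0; apply/esym; exact: (mul0r (e : GR k n)).
have f0 : f 0 = 0.
  by have := f2 _ _ i0 i0; rewrite addr0 => /eqP; rewrite -subr_eq0 opprD addrA subrr sub0r oppr_eq0 => /eqP.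
have [y [b yE] fy] := f5 (polytabloid k mu) (ex_intro _ (1 : GR k n) (esym (mul1r (kap * rs : GR k n)))).
rewrite -mulrA; transitivity (gmul (x : galg k n) (f y)); first by rewrite fy.
rewrite -f3; last by exists b.
rewrite -f0; congr f; rewrite yE; transitivity (x * b * e : GR k n); last exact: xe.
by rewrite -mulrA.
Qed.

Lemma specht_pair (s : 'S_l) : jtok s -> s <> 1%g -> tau (e : GR k n) (rw (jtw s)) = 0.
Proof.
move=> ok s1; rewrite tauE big1 // => w _; rewrite specht_killed ?ffunE // => z.
exact: rho_kap.
Qed.

(** The pairing is a rank. Were it zero, the row average would annihilate the ideal of [e] and hence
    the polytabloid, against [row_kap_row]. *)
Lemma specht_pair1 : exists m, tau (e : GR k n) (rw (jtw (1%g : 'S_l))) = m.+1%:R.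
Proof.
have [[ee e0 _] _] := eP; rewrite tau_tn //; last exact: rho_idem.
case E : (tn _ _) => [|m]; last by exists m.
have := specht_kept (tn0 E); rewrite jtw1 //.
have -> : rw (rev mu) = rho k (fun i : 'I_n => cell_row mu i).
  by congr (rho k _); apply/funext => i; rewrite cell_row_bs.
set T := fun i : 'I_n => cell_row mu i => Z; case: row_kap_row.
suff E2 : rs = #|stab T|%:R *: (rho k T : GR k n).
  by transitivity (#|stab T|%:R *: ((rho k T : GR k n) * kap * rs)); [rewrite {1}E2 !gr_scalel|rewrite Z scaler0].
have c0 : (#|stab T|%:R : k) != 0.
  by have := stab_card_gt0 T; case: #|_| => // c _; have /pcharf0P -> := char0.
apply/ffunP => w; rewrite [RHS]ffunE rhoE !ffunE inE /GRing.scale /=; case: [forall _, _]; rewrite ?mulr0 //.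
by rewrite mulfV.
Qed.

(** The norm is 1 because the coefficients of the Schur polynomial at the terms of its own expansion
    are given by [kostka]; the pairing with [e] only sees the term of s = 1. *)
Theorem specht_words (V : zmodType) (Phi : GR k n -> V) : idem_additive Phi ->
  Phi (e : GR k n) = \sum_(w <- jt_words mu) sg w.1 (Phi (rw w.2)).
Proof.
have [m mE] := specht_pair1; have [[ee e0 prim] _] := eP.
have Ln w : w \in jt_words mu -> n = sumn w.2.
  by move=> /mapP[s]; rewrite mem_filter => /andP[ok _] ->; apply: sumn_jtw.
have one (F : 'S_l -> k) : (forall s, jtok s -> s <> 1%g -> F s = 0) ->
    \sum_(s <- enum 'S_l | jtok s) sg (s : bool) (F s) = F 1%g.
  move=> F0; rewrite big_enum_cond /= (bigD1 1%g) ?jtok1 //= odd_perm1 big1 ?addr0 // => s /andP[ok /eqP s1].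
  by rewrite F0 // /sg oppr0 if_same.
move=> PA; rewrite -words_sum.
apply: (@recognize _ char0 _ _ _ _ m) PA => //; [exact: posw_idem|exact: negw_idem| |].
- rewrite words_norm /jt_words [LHS]big_map big_filter /=.
  transitivity ((1%g == 1%g :> 'S_l)%:R : k); last by rewrite eqxx.
  rewrite -(one (fun s => (s == 1%g)%:R)); last by move=> s _ /eqP/negbTE ->.
  apply: eq_bigr => s ok; congr sg; have [S SE] := jt_label ok.
  have -> : rw (jtw s) = rho k (fun i => S i) by congr (rho k _); apply/funext => i; rewrite SE.
  by rewrite words_coef // schur_words // (kostka muP ok SE) -pmulrn.
rewrite (words_sum (fun y => tau (e : GR k n) y)) /jt_words big_map big_filter /= -mE.
by apply: (one (fun s => tau (e : GR k n) (rw (jtw s)))); apply: specht_pair.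
Qed.
End Specht.

End SpechtIdempotents.
Import SpechtIdempotents.

(** * Images of idempotents in the Grothendieck ring *)

Module GrothendieckImages.

Local Open Scope ring_scope.
Local Open Scope hom_scope.

Section Strands.
Context (k : fieldType) (char0 : [pchar k] =i pred0).
Context (lam : {fsfun int -> nat with 0%N}).
Local Notation QHom := (QHom k lam).
Local Notation hid := (hid k lam).
Local Notation d := (level lam).
Implicit Types u v w R W : word.
Local Notation pn n := (@pn k lam n).

Lemma mdeg_cont N n (f : {ffun 'I_n -> 'I_N}) : mdeg (cont f) = n.
Proof. by rewrite /cont mdeg_sum (eq_bigr (fun=> 1%N)) ?sum1_card ?card_ord // => i _; rewrite mdeg1. Qed.

Lemma galg_mapM n (a c : galg k n) : galg_map (pn n) (gmul a c) = galg_map (pn n) a ∘ galg_map (pn n) c.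
Proof.
have [_ pM _] := pn_action k lam n; rewrite {1}/galg_map.
transitivity (\sum_(w : 'S_n) \sum_(u : 'S_n) (a u * c (w * u^-1)%g) *: pn n w).
  by apply: eq_bigr => w _; rewrite ffunE scaler_suml.
rewrite exchange_big /= /galg_map hcomp_suml; apply: eq_bigr => u _.
rewrite hcomp_sumr (reindex_inj (mulIg u)) /=; apply: eq_bigr => w _.
by rewrite mulgK pM hcompZl hcompZr scalerA.
Qed.
Lemma galg_mapD n (a c : galg k n) : galg_map (pn n) (a + c) = galg_map (pn n) a + galg_map (pn n) c.
Proof. by rewrite /galg_map -big_split; apply: eq_bigr => w _; rewrite ffunE scalerDl. Qed.
Lemma galg_map0 n : galg_map (pn n) (0 : galg k n) = 0.
Proof. by rewrite /galg_map big1 // => w _; rewrite ffunE scale0r. Qed.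

Local Notation QE := (fun b n (a : GR k n) => Qendo (pn n) b (a : galg k n)).

Lemma QendoM b n (a c : GR k n) : QE b n (a * c) = if b then QE b n a ∘ QE b n c else QE b n c ∘ QE b n a.
Proof. by case: b; rewrite /Qendo gmulE galg_mapM ?rotate_comp. Qed.
Lemma QendoD b n (a c : GR k n) : QE b n (a + c) = QE b n a + QE b n c.
Proof. by case: b; rewrite /Qendo /= galg_mapD ?rotateD. Qed.
Lemma Qendo0 b n : QE b n 0 = 0.
Proof. by case: b; rewrite /Qendo /= galg_map0 ?rotate0. Qed.
Lemma Qendo_idem b n (e : GR k n) : idem e -> hidem (QE b n e).
Proof. by move=> ee; have := QendoM b e e; rewrite (ee : e * e = e); case: b => E; apply: esym E. Qed.

Definition k0 (x : kclass k lam) : K0 k lam := cl (x, 0 : kclass k lam).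
Lemma k0D x y : k0 (x + y) = k0 x + k0 y.
Proof. by rewrite /k0 gr_plusE /gp_add /= addr0. Qed.
Lemma k0M x y : k0 (x * y) = k0 x * k0 y.
Proof. by rewrite /k0 -[RHS]/(gr_mul (cl (x, 0)) (cl (y, 0))) gr_mulE /gp_mul /= !mulr0 mul0r !addr0. Qed.
Lemma k01 : k0 1 = 1. Proof. by []. Qed.
Lemma k00 : k0 0 = 0. Proof. by []. Qed.

Lemma k0Mn x c : k0 (x *+ c) = k0 x *+ c.
Proof. by elim: c => [|c IH]; rewrite ?mulr0n // !mulrS k0D IH. Qed.

(** Totalized by 0, so that it has the type of an additive function on all of the group algebra;
    only its values at idempotents matter. *)
Definition Kb b n (e : GR k n) : K0 k lam :=
  if pselect (hidem (QE b n e)) is left H then k0 (kc H) else 0.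

Lemma KbE b n (e : GR k n) (H : hidem (QE b n e)) : Kb b e = K0cl (kobj_of H).
Proof. by rewrite /Kb; case: pselect => // H'; rewrite (Prop_irrelevance H' H). Qed.

Lemma kc_add_idem u (e f : QHom u u) (ee : hidem e) (ff : hidem f) (ef : hidem (e + f)) :
  e ∘ f = 0 -> f ∘ e = 0 -> kc ef = kc ee + kc ff.
Proof.
move=> ef0 fe0; pose g (b : bool) := if b then e else f.
have gg b : hidem (g b) by case: b.
have gb (b c : bool) : g b ∘ g c = if b == c then g b else 0 by case: b; case: c; rewrite /= ?(ee : e ∘ e = e) ?(ff : f ∘ f = f) ?ef0 ?fe0.
rewrite (kc_decomp (V := fun=> u) (e := g) (a := g) ef gg); first by rewrite big_bool; congr (_ + _); apply: kc_heq; apply: heq_refl.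
- by case; rewrite hcompDl /= ?ef0 ?fe0 ?(ee : e ∘ e = e) ?(ff : f ∘ f = f) ?addr0 ?add0r.
- exact: gg.
- by exists g; rewrite big_bool /= (ee : e ∘ e = e) (ff : f ∘ f = f).
move=> w h hE s x; have := congr1 (fun t => g x ∘ t) s; rewrite /= hcomp_sumr hcomp0r.
rewrite (bigD1 x) //= big1 ?addr0 => [|y yx]; last by rewrite hcompA gb eq_sym (negbTE yx) hcomp0l.
by rewrite hcompA gb eqxx hE.
Qed.

Lemma Kb_additive b n : idem_additive (@Kb b n).
Proof.
split=> [e f ie jf [x [y [exy fyx]]]|e f ie jf ef fe].
  rewrite (KbE (Qendo_idem b ie)) (KbE (Qendo_idem b jf)); congr k0.
  (* Cut down by [e] and [f], the two factors become mutually inverse morphisms between the images.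
     On Q_- rotation reverses products, so they exchange roles. *)
  pose x' := e * x * f; pose y' := f * y * e.
  have ex : e * x' = x' by rewrite /x' !mulrA ie.
  have xf : x' * f = x' by rewrite /x' -mulrA jf.
  have fy : f * y' = y' by rewrite /y' !mulrA jf.
  have ye : y' * e = y' by rewrite /y' -mulrA ie.
  have E1 : x * f = e * x by rewrite exy fyx !mulrA.
  have E2 : y * e = f * y by rewrite exy fyx !mulrA.
  have xy : x' * y' = e.
    rewrite /x' /y' -!mulrA (mulrA f f) jf (mulrA x f) E1 !mulrA ie -[e * x * y]mulrA -exy.
    by rewrite ie ie.
  have yx : y' * x' = f.
    rewrite /x' /y' -!mulrA (mulrA e e) ie (mulrA y e) E2 !mulrA jf -[f * y * x]mulrA -fyx.
    by rewrite jf jf.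
  have mT c d : QE true n c ∘ QE true n d = QE true n (c * d) by rewrite QendoM.
  have mF c d : QE false n c ∘ QE false n d = QE false n (d * c) by rewrite QendoM.
  case: b; [apply: (@kc_iso k lam _ _ _ _ _ _ (QE true n x') (QE true n y'))|apply: (@kc_iso k lam _ _ _ _ _ _ (QE false n y') (QE false n x'))];
    by rewrite !(mT, mF, ex, xf, fy, ye, xy, yx).
have ief : idem (e + f) by rewrite /idem mulrDl !mulrDr ie jf ef fe addr0 add0r.
rewrite (KbE (Qendo_idem b ie)) (KbE (Qendo_idem b jf)) (KbE (Qendo_idem b ief)).
rewrite -[LHS]/(k0 (kc (Qendo_idem b ief))) -[K0cl _]/(k0 (kc (Qendo_idem b ie))) -[K0cl _]/(k0 (kc (Qendo_idem b jf))) -k0D; congr k0.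
have D := QendoD b e f; have H : hidem (QE b n e + QE b n f) by rewrite -D; apply: Qendo_idem.
transitivity (kc H); first by apply: kc_heq; apply: eq_heq; exact: D.
have := QendoM b e f; have := QendoM b f e; rewrite ef fe Qendo0.
by move=> h1 h2; apply: kc_add_idem; case: b h1 h2 {D H}.
Qed.

Definition Hb (b : bool) (n : nat) : K0 k lam := k0 (if b then Kplus char0 lam n else Kminus char0 lam n).

Lemma Hb0 b : Hb b 0 = 1.
Proof.
rewrite /Hb -k01; congr k0; rewrite [RHS]/(1 : kclass k lam) -[RHS]/(kc (hidl (hid [::]))).
by case: b; apply: kc_heq; apply: eq_heq; [apply: sy0|apply: ms0].
Qed.

Local Notation rw n al := (rho k (fun i : 'I_n => bs al i) : GR k n).

Lemma Kb_rho_plus n al : n = sumn al -> Kb true (rw n al) = \prod_(a <- al) Hb true a.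
Proof.
move=> nE; subst n; rewrite (KbE (Qendo_idem true (rho_idem char0 _))).
have H : heq (QE true _ (rw (sumn al) al)) (Bs k lam al [::]).
  apply: heq_trans; first exact: pn_map_heq.
  by rewrite gS_map_rho //; apply: heq_refl.
transitivity (k0 (kc (Bs_idem char0 lam al [::]))); first by congr k0; apply: kc_heq.
elim: al {H} => [|a al IH].
  by rewrite big_nil -k01; congr k0; apply: kc_heq; apply: heq_refl.
rewrite big_cons -IH /Hb -k0M; congr k0; rewrite /Kplus kc_tens.
by apply: kc_heq; apply: Bs_cons_heq.
Qed.

Lemma Kb_rho_minus n al : n = sumn al -> Kb false (rw n al) = \prod_(a <- rev al) Hb false a.
Proof.
move=> nE; subst n; rewrite (KbE (Qendo_idem false (rho_idem char0 _))).
have H : heq (galg_map (pn (sumn al)) (rw (sumn al) al)) (Bs k lam al [::]).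
  apply: heq_trans; first exact: pn_map_heq.
  by rewrite gS_map_rho //; apply: heq_refl.
transitivity (k0 (kc (Cb_idem char0 lam al [::]))).
  by congr k0; apply: kc_heq; apply: heq_trans (rot_heq _) _; rewrite (rot_block H); apply: heq_refl.
elim: al {H} => [|a al IH].
  by rewrite big_nil -k01; congr k0; apply: kc_heq; apply: heq_refl.
rewrite rev_cons big_rcons /= -IH /Hb -k0M; congr k0; rewrite /Kminus kc_tens.
by apply: kc_heq; apply: Cb_cons_heq.
Qed.

(** The two orders are two compositions with the same product of complete polynomials, so the
    difference has zero form and [words_zero] applies. *)
Lemma Hb_comm b n m : Hb b n * Hb b m = Hb b m * Hb b n.
Proof.
pose L := [:: (false, [:: n; m]); (true, [:: m; n])].
have Ln (w : bool * seq nat) : w \in L -> (n + m)%N = sumn w.2 by rewrite !inE => /orP[] /eqP -> /=; lia.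
have Lz N (S : {ffun 'I_(n + m) -> 'I_N}) : (lev (complete_poly N) L)@_(cont S) = 0.
  rewrite /lev !big_cons !big_nil /= !mulr1 mul1r addr0 mulN1r mulrC subrr; exact: mcoeff0.
have := words_zero char0 Ln Lz (@Kb_additive b (n + m)).
rewrite !big_cons big_nil addr0 /= => /eqP; rewrite subr_eq0 => /eqP.
have e1 : (n + m = sumn [:: n; m])%N by rewrite /=; lia.
have e2 : (n + m = sumn [:: m; n])%N by rewrite /=; lia.
by case: b; rewrite ?(Kb_rho_plus e1) ?(Kb_rho_plus e2) ?(Kb_rho_minus e1) ?(Kb_rho_minus e2) /= !big_cons !big_nil !mulr1.
Qed.

Lemma Hb_rev b al : \prod_(a <- rev al) Hb b a = \prod_(a <- al) Hb b a.
Proof.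
elim: al => [|a al IH]; first by rewrite !big_nil.
rewrite rev_cons big_rcons big_cons /= IH.
elim: (al) => [|c be IHb]; first by rewrite big_nil mul1r mulr1.
by rewrite big_cons -mulrA IHb !mulrA Hb_comm.
Qed.

Lemma Kb_rho b n al : n = sumn al -> Kb b (rw n al) = \prod_(a <- al) Hb b a.
Proof. by move=> nE; case: b; [apply: Kb_rho_plus|rewrite Kb_rho_minus // Hb_rev]. Qed.

Lemma sym_idem_rho n : sym_idem k n = rho k (fun i : 'I_n => bs [:: n] i).
Proof.
apply/ffunP => w; rewrite !ffunE /=; have F : [forall i : 'I_n, 0%N == 0%N :> nat] by apply/forallP.
rewrite F; congr (_%:R^-1).
by rewrite -(card_Sn n) -cardsT; apply: eq_card => u; rewrite !inE ?F.
Qed.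

Lemma Kb_sym b n : Kb b (sym_idem k n : GR k n) = Hb b n.
Proof. by rewrite sym_idem_rho (@Kb_rho b n [:: n]) /= ?addn0 // big_seq1. Qed.

Lemma Hb_cross n m : d != 0%N -> Hb false n * Hb true m =
  \sum_(r < (minn m n).+1) ('C((d + r).-1, r))%:R * (Hb true (m - r) * Hb false (n - r)).
Proof.
move=> d0; rewrite /Hb -k0M K_cross // (big_morph _ k0D k00); apply: eq_bigr => r _.
by rewrite -k0M mulr_natl k0Mn.
Qed.

(* Homogeneous components of the relation are separated by the monomials they contain. *)
Lemma lev_zero b L : (forall N, lev (complete_poly N) L = 0) -> lev (Hb b) L = 0.
Proof.
move=> Lz; pose M := (\sum_(w <- L) sumn w.2)%N.
have LM (w : bool * seq nat) : w \in L -> (sumn w.2 <= M)%N by move=> wL; rewrite /M (big_rem w wL) leq_addr.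
rewrite /lev (partition_big (fun w : bool * seq nat => inord (sumn w.2) : 'I_M.+1) xpredT) //= big1 // => m _.
pose Lm := [seq w : bool * seq nat <- L | sumn w.2 == m :> nat].
have Ln (w : bool * seq nat) : w \in Lm -> (m : nat) = sumn w.2 by rewrite mem_filter => /andP[/eqP].
transitivity (lev (Hb b) Lm).
  rewrite /lev big_filter big_seq_cond [RHS]big_seq_cond; apply: eq_bigl => w.
  by case: (boolP (w \in L)) => //= /LM wM; rewrite -val_eqE /= inordK.
transitivity (\sum_(w <- Lm) sg w.1 (Kb b (rw m w.2))).
  apply: eq_big_seq => w /Ln mE; rewrite (Kb_rho b mE); case: (w.1); rewrite /= ?mul1r ?mulN1r //.
apply: (words_zero char0 Ln) (@Kb_additive b m) => N S.
transitivity ((lev (complete_poly N) L)@_(cont S)); last by rewrite Lz mcoeff0.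
rewrite /lev big_filter [in RHS](bigID (fun w : bool * seq nat => sumn w.2 == m :> nat)) /= mcoeffD.
rewrite [X in _ = _ + X]raddf_sum /= [X in _ = _ + X]big1 ?addr0 // => w wm.
suff H : (\prod_(a <- w.2) complete_poly N a)@_(cont S) = 0.
  by case: (w.1); rewrite /= ?mul1r ?mulN1r ?mcoeffN H ?oppr0.
rewrite -ascends_prod raddf_sum big1 //= => f _; rewrite cont_prod mcoeffX.
by case: eqP => // E; case/eqP: wm; rewrite -(mdeg_cont f) E mdeg_cont.
Qed.
End Strands.

End GrothendieckImages.
Import GrothendieckImages.

(** * Commutators with power sums *)

Module CommutatorTower.

Local Open Scope ring_scope.

(** The hockey-stick identity followed by absorption of a factor; it makes the two contributions in
    [pw_cross] add up. *)
Lemma sum_binom_diag d q : (0 < d)%N -> (d * \sum_(r < q) 'C((d + r).-1, r) = q * 'C((d + q).-1, q))%N.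
Proof.
case: d => // d _; have S n : (\sum_(r < n.+1) 'C((d.+1 + r).-1, r) = 'C(d.+1 + n, n))%N.
  elim: n => [|n IH]; first by rewrite big_ord1 !bin0.
  by rewrite big_ord_recr /= IH !addSn addnS /= binS addnC.
case: q => [|q]; first by rewrite big_ord0 muln0.
have -> : (d.+1 + q.+1).-1 = (d.+1 + q)%N by lia.
by rewrite S mul_bin_left; congr (_ * _)%N; lia.
Qed.

Section Newton.
Context (A : pzRingType) (d : nat) (hm hp : nat -> A).
Hypothesis d_gt0 : (0 < d)%N.
Hypothesis hm0 : hm 0 = 1.
Local Notation c r := 'C((d + r).-1, r).
Hypothesis cross : forall n m, hm n * hp m = \sum_(r < (minn m n).+1) (hp (m - r) * hm (n - r)) *+ c r.

Fixpoint pow_sums n : seq A :=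
  if n is n'.+1 then rcons (pow_sums n') (hm n *+ n - \sum_(i < n') nth 0 (pow_sums n') i * hm (n' - i)) else [::].
(* The power sum of degree [n.+1] in the complete symmetric functions [hm]. *)
Definition pw n := nth 0 (pow_sums n.+1) n.

Lemma size_pow_sums n : size (pow_sums n) = n.
Proof. by elim: n => //= n IH; rewrite size_rcons IH. Qed.
Lemma nth_pow_sums n i : (i < n)%N -> nth 0 (pow_sums n) i = pw i.
Proof.
elim: n => // n IH; rewrite ltnS leq_eqVlt => /orP[/eqP -> //|ni].
by rewrite /= nth_rcons size_pow_sums ni IH.
Qed.
Lemma newton n : \sum_(i < n) pw i * hm (n.-1 - i) = hm n *+ n.
Proof.
case: n => [|n]; first by rewrite big_ord0 mulr0n.
rewrite big_ord_recr /= subnn hm0 mulr1.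
have -> : pw n = hm n.+1 *+ n.+1 - \sum_(i < n) pw i * hm (n - i).
  rewrite {1}/pw [pow_sums _]/= nth_rcons size_pow_sums ltnn eqxx; congr (_ - _).
  by apply: eq_bigr => i _; rewrite nth_pow_sums.
by rewrite addrC subrK.
Qed.

Lemma pw_comm y n : (forall i, y * hm i = hm i * y) -> y * pw n = pw n * y.
Proof.
move=> yh; elim/ltn_ind: n => n IH; have E := newton n.+1; rewrite big_ord_recr /= subnn hm0 mulr1 in E.
have -> : pw n = hm n.+1 *+ n.+1 - \sum_(i < n) pw i * hm (n - i) by apply/eqP; rewrite eq_sym subr_eq -E addrC.
rewrite mulrBr mulrBl mulrnAr mulrnAl yh mulr_sumr mulr_suml; congr (_ - _).
by apply: eq_bigr => i _; rewrite mulrA IH // -!mulrA yh.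
Qed.

Definition zshift (h : nat -> A) a b := if (b <= a)%N then h (a - b)%N else 0.
Local Notation G := (zshift hp).
Local Notation H := (zshift hm).

Lemma cross_wide K n m : (n < K)%N -> hm n * hp m = \sum_(r < K) (G m r * H n r) *+ c r.
Proof.
move=> nK; rewrite cross (big_ord_widen K (fun r => (hp (m - r) * hm (n - r)) *+ c r)); last by lia.
rewrite big_mkcond; apply: eq_bigr => r _; rewrite ltnS leq_min /zshift.
by case: (r <= m)%N; case: (r <= n)%N; rewrite /= ?mul0r ?mulr0 ?mul0rn.
Qed.

(** Power sums act as derivations. Newton's identity is multiplied by [hp m]; by induction every
    term but the one with the top power sum is known, and that one follows by comparison. *)
Lemma pw_cross n m : pw n * hp m = hp m * pw n + G m n.+1 *+ d.
Proof.
elim/ltn_ind: n m => n IH m; pose N := n.+1.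
have IHG i r : (i < n)%N -> pw i * G m r = G m r * pw i + G m (r + i.+1) *+ d.
  move=> il; rewrite /zshift; case: leqP => rm; last by rewrite mulr0 mul0r add0r ifF ?mul0rn //; lia.
  by rewrite IH //; congr (_ + _ *+ _); rewrite /zshift; have -> : (i.+1 <= m - r)%N = (r + i.+1 <= m)%N by [lia]; rewrite subnDA.
pose E i := \sum_(r < N.+1) ((G m r * pw i + G m (r + i.+1) *+ d) * H (n - i) r) *+ c r.
have Etop : E n = hp m * pw n + G m n.+1 *+ d.
  rewrite /E big_ord_recl big1 ?addr0 => [|r _]; last by rewrite {3}/zshift subnn /= mulr0 mul0rn.
  by rewrite bin0 mulr1n add0n {3}/zshift subnn hm0 mulr1 {1}/zshift subn0.
have Elow i : (i < n)%N -> pw i * (hm (n - i) * hp m) = E i.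
  move=> il; rewrite (cross_wide (K := N.+1)) /N; last by lia.
  rewrite mulr_sumr; apply: eq_bigr => r _; by rewrite mulrnAr mulrA IHG.
(* It remains to see that the conjectured terms [E i] add up correctly. The coefficient of [F r] is
   c_r (N - r) from the terms without commutator, by Newton, and c_r r from the commutators, by
   [sum_binom_diag]. *)
suff tot : \sum_(i < N) E i = hm N * hp m *+ N.
  have := congr1 (fun z => z * hp m) (newton N); rewrite /= mulrnAl -tot /N !big_ord_recr /= mulrDl mulr_suml.
  rewrite (eq_bigr (fun i : 'I_n => E i)) => [|i _]; last by rewrite -mulrA Elow.
  by move=> /addrI; rewrite subnn hm0 mulr1 Etop.
pose F q := G m q * H N q.
have HN i r : (i < N)%N -> H (n - i) r = H N (r + i.+1).
  move=> iN; rewrite /zshift; have -> : (r <= n - i)%N = (r + i.+1 <= N)%N by rewrite /N in iN *; lia.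
  by case: ifP => // _; congr hm; rewrite /N in iN *; lia.
have F0 q : (N < q)%N -> F q = 0 by move=> h; rewrite /F /zshift [(q <= N)%N]leqNgt h mulr0.
have E1 : \sum_(i < N) \sum_(r < N.+1) (G m r * pw i * H (n - i) r) *+ c r = \sum_(r < N.+1) F r *+ (c r * (N - r)).
  rewrite exchange_big /=; apply: eq_bigr => r _; rewrite sumrMnl mulrnA [RHS]mulrnAC; congr (_ *+ _).
  transitivity (G m r * \sum_(i < N) pw i * H (n - i) r).
    by rewrite mulr_sumr; apply: eq_bigr => i _; rewrite mulrA.
  rewrite /F -mulrnAr; congr (_ * _); rewrite {2}/zshift -ltnS ltn_ord -newton.
  rewrite (big_ord_widen N (fun i => pw i * hm ((N - r).-1 - i))) ?leq_subr // [RHS]big_mkcond.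
  apply: eq_bigr => i _; rewrite /zshift; have -> : (r <= n - i)%N = (i < N - r)%N by have := ltn_ord i; rewrite /N; lia.
  by case: ifP => h; rewrite ?mulr0 //; congr (_ * hm _); rewrite /N; lia.
have E2 : \sum_(i < N) \sum_(r < N.+1) ((G m (r + i.+1) *+ d) * H (n - i) r) *+ c r = \sum_(q < N.+1) F q *+ (c q * q).
  transitivity (\sum_(r < N.+1) \sum_(q < N.+1 | (r < q)%N) F q *+ (d * c r)).
    rewrite exchange_big /=; apply: eq_bigr => r _.
    transitivity (\sum_(0 <= i < N) F (i + r.+1)%N *+ (d * c r)).
      rewrite big_mkord; apply: eq_bigr => i _; rewrite HN // mulrnAl mulrnA /F.
      by have -> : (r + i.+1 = i + r.+1)%N by lia.
    transitivity (\sum_(r.+1 <= q < N + r.+1) F q *+ (d * c r)).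
      by rewrite -{2}[r.+1]add0n big_addn addnK.
    rewrite (big_cat_nat (n := N.+1)) /=; [|exact: ltn_ord|by rewrite addnS ltnS leq_addr].
    rewrite [X in _ + X]big_nat [X in _ + X]big1 ?addr0 => [|q /andP[h _]]; last by rewrite F0 ?mul0rn.
    by rewrite (big_nat_widenl _ 0) // big_mkord.
  rewrite (exchange_big_dep xpredT) //=; apply: eq_bigr => q _; rewrite sumrMnr -big_distrr /=; congr (_ *+ _).
  rewrite [RHS]mulnC -sum_binom_diag //; congr (_ * _)%N.
  by rewrite [RHS](big_ord_widen N.+1 (fun r => c r)) // ltnW // ltn_ord.
transitivity (\sum_(r < N.+1) F r *+ (c r * (N - r)) + \sum_(q < N.+1) F q *+ (c q * q)).
  rewrite -E1 -E2 -big_split; apply: eq_bigr => i _; rewrite -big_split; apply: eq_bigr => r _.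
  by rewrite mulrDl mulrnDl.
rewrite -big_split (cross_wide (K := N.+1)) // -sumrMnl; apply: eq_bigr => r _.
by rewrite /= -mulrnDr -mulnDr subnK ?mulrnA // -ltnS.
Qed.
End Newton.

Section Tower.
Context (A B : pzRingType) (f : {rmorphism A -> B}) (d : nat).
Hypothesis d_gt0 : (0 < d)%N.
Hypothesis one_free : forall n : nat, n%:R = 0 :> B -> n = 0%N.

(* Polynomials in the head of the list with coefficients, on the left, in the tower of its tail. *)
Fixpoint tow (xs : seq A) (z : A) : Prop :=
  if xs is x :: xs' then exists K (a : nat -> A), (forall i, tow xs' (a i)) /\ z = \sum_(i < K) a i * x ^+ i
  else exists c : int, z = c%:~R.

Lemma tow_nilP z : tow [::] z <-> exists c : int, z = c%:~R.
Proof. by []. Qed.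
Lemma tow_consP x xs z : tow (x :: xs) z <->
  exists K (a : nat -> A), (forall i, tow xs (a i)) /\ z = \sum_(i < K) a i * x ^+ i.
Proof. by []. Qed.

Lemma tow0 xs : tow xs 0.
Proof.
case: xs => [|x xs]; first by exists 0.
have H : exists a : nat -> A, forall i, tow xs (a i).
  elim: xs => [|y ys [a ta]]; first by exists (fun=> 0) => i; exists 0.
  by exists (fun=> 0) => i; exists 0%N, a; rewrite big_ord0.
by have [a ta] := H; exists 0%N, a; rewrite big_ord0.
Qed.

Lemma towD xs y z : tow xs y -> tow xs z -> tow xs (y + z).
Proof.
elim: xs y z => [|x xs IH] y z; first by move=> /tow_nilP[a ->] /tow_nilP[b ->]; exists (a + b); rewrite rmorphD.
move=> /tow_consP[K [a [ta ->]]] /tow_consP[L [b [tb ->]]]; apply/tow_consP.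
pose a' i := (if (i < K)%N then a i else 0) + (if (i < L)%N then b i else 0).
exists (K + L)%N, a'; split=> [i|]; first by rewrite /a'; apply: IH; case: ifP => _ //; apply: tow0.
rewrite /a' (eq_bigr _ (fun i _ => mulrDl _ _ _)) big_split /=; congr (_ + _).
  by rewrite (big_ord_widen (K + L) (fun i => a i * x ^+ i)) ?leq_addr // big_mkcond; apply: eq_bigr => i _; case: ifP; rewrite ?mul0r.
by rewrite (big_ord_widen (K + L) (fun i => b i * x ^+ i)) ?leq_addl // big_mkcond; apply: eq_bigr => i _; case: ifP; rewrite ?mul0r.
Qed.
Lemma towN xs y : tow xs y -> tow xs (- y).
Proof.
elim: xs y => [|x xs IH] y; first by move=> /tow_nilP[a ->]; exists (- a); rewrite rmorphN.
move=> /tow_consP[K [a [ta ->]]]; apply/tow_consP; exists K, (fun i => - a i); split=> [i|]; first exact: IH.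
by rewrite -sumrN; apply: eq_bigr => i _; rewrite mulNr.
Qed.
Lemma tow_nat xs y n : tow xs y -> tow xs (y *+ n).
Proof. by move=> ty; elim: n => [|n IH]; rewrite ?mulr0n ?mulrS; [apply: tow0|apply: towD]. Qed.
Lemma tow_cons x xs y : tow xs y -> tow (x :: xs) y.
Proof.
move=> ty; apply/tow_consP; exists 1%N, (fun i => if i is 0 then y else 0); split; last by rewrite big_ord1 expr0 mulr1.
by case=> // i; apply: tow0.
Qed.
Lemma tow1 xs : tow xs 1.
Proof. by elim: xs => [|x xs IH]; [exists 1|apply: tow_cons]. Qed.

Lemma tow_comm p xs z : (forall y, y \in xs -> p * y = y * p) -> tow xs z -> p * z = z * p.
Proof.
elim: xs z => [|x xs IH] z px; first by move=> /tow_nilP[c ->]; apply: commr_int.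
move=> /tow_consP[K [a [ta ->]]]; rewrite mulr_sumr mulr_suml; apply: eq_bigr => i _.
have pa : p * a i = a i * p by apply: IH => // y yx; apply: px; rewrite inE yx orbT.
have pX : p * x ^+ i = x ^+ i * p by apply: commrX; apply: px; rewrite mem_head.
by rewrite mulrA pa -!mulrA pX.
Qed.

Fixpoint good (xs : seq A) : Prop :=
  if xs is x :: xs' then (exists p, (forall y, y \in xs' -> p * y = y * p) /\ p * x = x * p + d%:R) /\ good xs' else True.

(** Torsion image in place of zero image: if a nonzero multiple of an element has torsion image, so
    has the element. This absorbs the factors d (i + 1) produced by differentiation. *)
Definition torsion z := exists n, f z *+ n.+1 = 0.

Lemma torsionD y z : torsion y -> torsion z -> torsion (y - z).
Proof.
case=> n yn [m zm]; exists (n.+1 * m.+1).-1; rewrite prednK ?muln_gt0 // raddfB mulrnBl /=.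
by rewrite mulrnA yn mul0rn mulnC mulrnA zm mul0rn subrr.
Qed.
Lemma torsionM p z : torsion z -> torsion (p * z) /\ torsion (z * p).
Proof.
case=> n zn; split; exists n; rewrite rmorphM; first by rewrite -mulrnAr zn mulr0.
by rewrite -mulrnAl zn mul0r.
Qed.

Lemma ad_power (p a x : A) i : p * a = a * p -> p * x = x * p + d%:R ->
  p * (a * x ^+ i) - (a * x ^+ i) * p = (a * x ^+ i.-1) *+ (d * i).
Proof.
move=> pa px; rewrite mulrA pa -!mulrA -mulrBr -mulrnAr; congr (_ * _).
elim: i => [|i IH]; first by rewrite expr0 mulr1 mul1r subrr muln0 mulr0n.
rewrite /= exprS mulrA px mulrDl -!mulrA; have -> : p * x ^+ i = x ^+ i * p + x ^+ i.-1 *+ (d * i).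
  by rewrite -IH addrC subrK.
rewrite mulrDr addrAC [x * (x ^+ i * p) + _ - _]addrAC subrr add0r mulnS mulrnDr addrC mulr_natl; congr (_ + _).
by case: i {IH} => [|i]; rewrite ?muln0 ?mulr0n ?mulr0 // mulrnAr -exprS.
Qed.

(* The commutator with p is d times the derivative with respect to the head of the list. *)
Lemma tow_free xs z : good xs -> tow xs z -> torsion z -> z = 0.
Proof.
elim: xs z => [|x xs IH] z /=.
  move=> _ /tow_nilP[c ->] [n fn]; have : f ((`|c| * n.+1)%N%:R) = 0.
    have -> : (`|c| * n.+1)%N%:R = (if (0 <= c)%R then 1 else -1) * (c%:~R *+ n.+1) :> A.
      by case: c {fn} => c; rewrite /= ?mul1r ?mulN1r natrM mulr_natr -?pmulrn // NegzE mulrNz -mulNrn opprK.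
    by rewrite rmorphM /= raddfMn fn mulr0.
  rewrite rmorph_nat => /one_free /eqP; rewrite muln_eq0 orbF absz_eq0 => /eqP ->; exact: mulr0z.
case=> [[p [pxs px]] gxs] /tow_consP[K [a [ta ->]]] tz.
suff a0 i : (i < K)%N -> a i = 0 by rewrite big1 // => i _; rewrite a0 ?mul0r.
elim: K a ta tz i => // K IHK a ta tz.
have pa i : p * a i = a i * p by apply: tow_comm (ta i).
(* The commutator with [p] has one coefficient fewer and again torsion image, so its coefficients
   vanish by induction on [K]; [a i.+1] itself is then torsion and vanishes by induction on the
   list. *)
have aS i : (i < K)%N -> a i.+1 = 0.
  move=> iK; have tai : tow xs (a i.+1 *+ (d * i.+1)) by apply: tow_nat.
  have H : a i.+1 *+ (d * i.+1) = 0.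
    apply: (IHK (fun i => a i.+1 *+ (d * i.+1))) iK => [j|]; first exact: tow_nat.
    have [t1 t2] := torsionM p tz; have := torsionD t1 t2; congr torsion.
    rewrite mulr_sumr mulr_suml -sumrB big_ord_recl ad_power // muln0 mulr0n add0r.
    by apply: eq_bigr => j _; rewrite ad_power // mulrnAl.
  apply: IH => //; exists (d * i.+1).-1; rewrite prednK ?muln_gt0 ?d_gt0 // -raddfMn H; exact: rmorph0.
case=> [_|i iK]; last exact: aS.
apply: IH => //; move: tz; rewrite big_ord_recl expr0 mulr1 big1 ?addr0 // => i _.
by rewrite aS ?mul0r.
Qed.

Lemma tow_cat xs ys z x : x \in xs -> (forall y, y \in xs -> x * y = y * x) -> tow (xs ++ ys) z -> tow (xs ++ ys) (z * x).
Proof.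
elim: xs z => // y xs IH z; rewrite inE => xy xc /tow_consP[K [a [ta ->]]]; apply/tow_consP.
case: (x =P y) xy => [-> _|_ /= xxs].
  exists K.+1, (fun i => if i is i'.+1 then a i' else 0); split; first by case=> //; apply: tow0.
  by rewrite big_ord_recl mul0r add0r mulr_suml; apply: eq_bigr => i _; rewrite /= -mulrA -exprSr.
exists K, (fun i => a i * x); split=> [i|].
  by apply: IH => // w wx; apply: xc; rewrite inE wx orbT.
rewrite mulr_suml; apply: eq_bigr => i _; rewrite -!mulrA; congr (_ * _).
by apply/esym/commrX; apply: xc; rewrite mem_head.
Qed.
End Tower.

End CommutatorTower.
Import CommutatorTower.

(** * Particle configurations and partial fractions *)

Module FockStates.

Local Open Scope ring_scope.

Section Lagrange.
Context (k : fieldType).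
Definition den (L : seq k) (a : k) := \prod_(b <- L | b != a) (a - b).
Definition lg (L : seq k) (P : {poly k}) := \sum_(a <- L) P.[a] / den L a.

Lemma den_neq0 L a : den L a != 0.
Proof. by rewrite prodf_seq_neq0; apply/allP => b _; apply/implyP => ba; rewrite subr_eq0 eq_sym. Qed.

(** The leading coefficient of Lagrange interpolation. Equivalently, the residues of P / prod (u -
    a) at its poles sum to minus the residue at infinity. *)
Lemma lagrange L (P : {poly k}) : uniq L -> (size P <= size L)%N -> lg L P = P`_(size L).-1.
Proof.
move=> uL sP; case: (posnP (size L)) => [L0|L_gt0].
  by move: sP; rewrite L0 leqn0 size_poly_eq0 => /eqP ->; rewrite (size0nil L0) /lg big_nil coef0.
pose M a := \prod_(b <- L | b != a) ('X - b%:P).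
have ME a : M a = \prod_(b <- [seq b <- L | b != a]) ('X - b%:P) by rewrite big_filter.
have sM a : a \in L -> size [seq b <- L | b != a] = (size L).-1.
  by move=> aL; rewrite size_filter -(count_predC (pred1 a) L) (count_uniq_mem _ uL) aL /= ; congr count.
pose Q := \sum_(a <- L) (P.[a] / den L a) *: M a.
have PQ : P = Q.
  apply/eqP; rewrite -subr_eq0; apply/eqP; apply: (roots_geq_poly_eq0 (rs := L)) => //.
    apply/allP => c cL; rewrite rootE hornerD hornerN subr_eq0 /Q horner_sum (bigD1_seq c) //=.
    rewrite [X in _ + X]big1_seq ?addr0 => [|a /andP[ac aL]]; last first.
      by rewrite hornerZ ME horner_prod (bigD1_seq c) /= ?mem_filter ?cL ?andbT 1?eq_sym ?filter_uniq // hornerXsubC subrr mul0r mulr0.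
    rewrite hornerZ /M horner_prod (eq_bigr (fun b => c - b)) => [|b _]; last by rewrite hornerXsubC.
    by rewrite -/(den L c) divfK ?den_neq0.
  apply: leq_trans (size_polyD _ _) _; rewrite geq_max sP size_polyN.
  apply: leq_trans (size_sum _ _ _) _; apply/bigmax_leqP_seq => a aL _.
  by apply: leq_trans (size_scale_leq _ _) _; rewrite ME size_prod_XsubC sM // prednK.
rewrite {2}PQ /Q coef_sum; apply: eq_big_seq => a aL.
have mM : M a \is monic by rewrite ME monic_prod_XsubC.
have : lead_coef (M a) = 1 by apply/eqP.
by rewrite coefZ lead_coefE ME size_prod_XsubC sM // => ->; rewrite mulr1.
Qed.
End Lagrange.

Section States.
Context (k : fieldType) (char0 : [pchar k] =i pred0).
Local Notation state := (k -> bool).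
Implicit Types (S : state) (a b c : k).

Lemma succ_neq a : (a + 1 == a) = false.
Proof. by rewrite -subr_eq0 addrAC subrr add0r oner_eq0. Qed.
Lemma two_neq0 : (2%:R : k) != 0. Proof. by have /pcharf0P -> := char0. Qed.

(* A state marks the occupied sites of k, almost all of those below each of finitely many starting sites. [flip a] moves a particle
   between a and a + 1: from a if [ok true S a], back to a if [ok false S a]. *)
Definition flip a S : state := fun b => if b == a then S (a + 1) else if b == a + 1 then S a else S b.
Definition ok (e : bool) S a := (S a == e) && (S (a + 1) == ~~ e).
Definition fin S := exists L : seq k, uniq L /\ forall c, S c != S (c + 1) -> c \in L.
Definition bd S : seq k := if pselect (fin S) is left H then projT1 (cid H) else [::].
Definition Rs S (e : bool) : seq k := [seq a <- bd S | ok e S a].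

Lemma flipK a S : flip a (flip a S) = S.
Proof.
apply/funext => b; rewrite /flip !eqxx succ_neq; case: eqP => [->|_] //; case: eqP => [->|] //.
Qed.
Lemma flipC a b S : a != b + 1 -> b != a + 1 -> flip a (flip b S) = flip b (flip a S).
Proof.
move=> ab ba; case: (a =P b) => [-> //|/eqP nab]; apply/funext => c; rewrite /flip.
have e1 : (a + 1 == b + 1) = false by rewrite (inj_eq (addIr _)) (negbTE nab).
have e2 : (b + 1 == a + 1) = false by rewrite eq_sym.
have e3 : (b == a) = false by rewrite eq_sym (negbTE nab).
have e4 : (a + 1 == b) = false by rewrite eq_sym (negbTE ba).
have e5 : (b + 1 == a) = false by rewrite eq_sym (negbTE ab).
rewrite (negbTE nab) (negbTE ab) (negbTE ba) e1 e2 e3 e4 e5.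
by case: (c =P a) => [->|_]; [rewrite (negbTE nab) (negbTE ab)|case: (c =P a + 1) => [->|_]; rewrite ?e1 ?e4].
Qed.

Lemma bdP S : fin S -> uniq (bd S) /\ forall c, S c != S (c + 1) -> c \in bd S.
Proof. by rewrite /bd; case: pselect => // H _; case: (cid H). Qed.
Lemma mem_Rs S e a : fin S -> (a \in Rs S e) = ok e S a.
Proof.
move=> fS; rewrite mem_filter; case: (boolP (ok e S a)) => //= /andP[/eqP h1 /eqP h2].
by have [_ ->] := bdP fS; rewrite // h1 h2; case: e {h1 h2}.
Qed.
Lemma uniq_Rs S e : fin S -> uniq (Rs S e).
Proof. by move=> fS; rewrite filter_uniq //; have [] := bdP fS. Qed.
Lemma count_Rs S e a : fin S -> count_mem a (Rs S e) = ok e S a.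
Proof. by move=> fS; rewrite count_uniq_mem ?uniq_Rs // mem_Rs. Qed.

Lemma flip_fin a S : fin S -> fin (flip a S).
Proof.
case=> L [uL HL]; exists (undup (a :: a - 1 :: a + 1 :: L)); split=> [|c]; first exact: undup_uniq.
rewrite mem_undup !inE /flip; case: (c =P a) => //= /eqP ca; case: (c =P a - 1) => //= /eqP ca1.
case: (c =P a + 1) => //= /eqP ca2.
have -> : (c + 1 == a) = false by apply/negbTE; apply: contra ca1 => /eqP <-; rewrite addrK.
by rewrite (inj_eq (addIr _)) (negbTE ca); apply: HL.
Qed.

Lemma ok_flip e a S : ok e S a -> ok (~~ e) (flip a S) a.
Proof. by case/andP=> /eqP h1 /eqP h2; rewrite /ok /flip eqxx succ_neq eqxx h1 h2 negbK !eqxx. Qed.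

(** Moving a particle from b to b + 1 multiplies prod (u - r) / prod (u - a) by (u - b)^2 / ((u - b
    - 1) (u - b + 1)). Stated as an identity of multisets, it also covers the sites that appear or
    cancel at the neighbours of b. *)
Lemma flip_perm b S : fin S -> ok true S b ->
  perm_eq (Rs (flip b S) false ++ Rs S true ++ [:: b - 1; b + 1]) (Rs S false ++ Rs (flip b S) true ++ [:: b; b]).
Proof.
move=> fS /andP[/eqP Sb /eqP Sb1]; have fS' := flip_fin b fS.
apply/allP => c _; apply/eqP; rewrite /= !count_cat !count_Rs //= !addn0.
have n1 : (b - 1 == b) = false by rewrite -subr_eq0 addrAC subrr add0r oppr_eq0 oner_eq0.
have n2 : (b - 1 == b + 1) = false.
  by apply/negbTE; rewrite -subr_eq0 (_ : b - 1 - (b + 1) = - 2%:R); [rewrite oppr_eq0 two_neq0|ring].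
have n3 : (b + 1 + 1 == b) = false.
  by apply/negbTE; rewrite -subr_eq0 (_ : b + 1 + 1 - b = 2%:R); [exact: two_neq0|ring].
have e1 : b - 1 + 1 = b by rewrite subrK.
case: (c =P b) => [->|/eqP cb].
  by rewrite /ok /flip !eqxx succ_neq Sb Sb1 n1.
case: (c =P b - 1) => [->|/eqP cb1].
  rewrite /ok /flip e1 !eqxx n1 n2 Sb Sb1 [b == b - 1]eq_sym n1 [b + 1 == b - 1]eq_sym n2 /=.
  by case: (S (b - 1)).
case: (c =P b + 1) => [->|/eqP cb2].
  rewrite /ok /flip !eqxx succ_neq n3 succ_neq Sb Sb1 [b == b + 1]eq_sym succ_neq n2 /=.
  by case: (S (b + 1 + 1)).
have n4 : (c + 1 == b) = false by apply/negbTE; apply: contra cb1 => /eqP <-; rewrite addrK.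
have n5 : (c + 1 == b + 1) = false by rewrite (inj_eq (addIr _)) (negbTE cb).
rewrite /ok /flip (negbTE cb) (negbTE cb2) n4 n5 [b - 1 == c]eq_sym (negbTE cb1) [b + 1 == c]eq_sym (negbTE cb2) [b == c]eq_sym (negbTE cb) /=.
lia.
Qed.

(** The residue at an addable site a of the quotient of prod (u - r) over removable sites by the
    same product over addable sites. *)
Definition wt S a := \prod_(r <- Rs S false) (a - r) / den (Rs S true) a.

(** The vanishing factor is replaced by 1, so that the multiset identity [flip_perm] can be
    multiplied out at an addable site without dividing by zero. *)
Definition nz a c := if c == a then 1 else a - c.
Lemma nz_den S a : \prod_(c <- Rs S true) nz a c = den (Rs S true) a.
Proof. by rewrite /den [RHS]big_mkcond; apply: eq_bigr => c _; rewrite /nz; case: eqP. Qed.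
Lemma nz_neq0 a c : nz a c != 0.
Proof. by rewrite /nz; case: (c =P a) => [_|/eqP]; rewrite ?oner_eq0 // subr_eq0 eq_sym. Qed.
Lemma nz_Rs S a : fin S -> ok true S a -> \prod_(c <- Rs S false) nz a c = \prod_(c <- Rs S false) (a - c).
Proof.
move=> fS /andP[/eqP h1 h2]; apply: eq_big_seq => c; rewrite mem_Rs // /nz => /andP[/eqP h3 _].
by case: eqP => // ca; rewrite ca h1 in h3.
Qed.
Lemma wt_neq0 S a : fin S -> ok true S a -> wt S a != 0.
Proof.
move=> fS oa; rewrite /wt -nz_Rs // mulf_neq0 ?invr_eq0 ?den_neq0 //.
by rewrite prodf_seq_neq0; apply/allP => c _; rewrite nz_neq0.
Qed.

Lemma flip_prod b S (F : k -> k) : fin S -> ok true S b ->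
  (\prod_(c <- Rs (flip b S) false) F c) * (\prod_(c <- Rs S true) F c) * (F (b - 1) * F (b + 1)) =
  (\prod_(c <- Rs S false) F c) * (\prod_(c <- Rs (flip b S) true) F c) * (F b * F b).
Proof.
move=> fS ob.
have : \prod_(c <- Rs (flip b S) false ++ Rs S true ++ [:: b - 1; b + 1]) F c =
  \prod_(c <- Rs S false ++ Rs (flip b S) true ++ [:: b; b]) F c by apply: perm_big; exact: flip_perm.
by rewrite !big_cat !big_cons !big_nil /= !mulr1 !mulrA.
Qed.

Lemma wt_flip a b S : fin S -> ok true S a -> ok true S b -> a != b -> ok true (flip b S) a ->
  wt (flip b S) a * ((a - b) ^+ 2 - 1) = wt S a * (a - b) ^+ 2.
Proof.
move=> fS oa ob ab oa'; have fS' := flip_fin b fS.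
have := flip_prod (nz a) fS ob; rewrite !nz_den !nz_Rs // /wt.
have -> : nz a b = a - b by rewrite /nz eq_sym (negbTE ab).
have nb1 : nz a (b - 1) = a - b + 1.
  rewrite /nz; case: eqP => [E|_]; last by ring.
  by move: ob oa; rewrite /ok -E subrK => /andP[/eqP -> _] /andP[_ /eqP].
have nb2 : nz a (b + 1) = a - b - 1.
  rewrite /nz; case: eqP => [E|_]; last by ring.
  by move: ob oa; rewrite /ok -E => /andP[_ /eqP ->] /andP[/eqP].
rewrite nb1 nb2 => H.
have d1 := den_neq0 (Rs S true) a; have d2 := den_neq0 (Rs (flip b S) true) a.
apply: (mulIf d1); apply: (mulIf d2).
transitivity (\prod_(i <- Rs (flip b S) false) (a - i) * den (Rs S true) a * ((a - b + 1) * (a - b - 1))).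
  by move: (\prod_(i <- _) _) => X; field.
by rewrite H; move: (\prod_(i <- _) _) => X; field.
Qed.

Lemma wt_unflip r S : fin S -> ok false S r ->
  wt (flip r S) r * den (r :: Rs S true) r = - \prod_(c <- Rs S false | c != r) (r - c).
Proof.
move=> fS or; set V := flip r S; have fV : fin V by apply: flip_fin.
have ov : ok true V r by apply: (ok_flip or).
have := flip_prod (nz r) fV ov; rewrite /V flipK -/V.
have -> : nz r r = 1 by rewrite /nz eqxx.
have -> : nz r (r - 1) * nz r (r + 1) = -1.
  rewrite /nz succ_neq -[r - 1 == r]subr_eq0 addrAC subrr add0r oppr_eq0 oner_eq0; ring.
rewrite !nz_den (nz_Rs fV ov) /wt => H.
have -> : \prod_(c <- Rs S false | c != r) (r - c) = \prod_(c <- Rs S false) nz r c.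
  by rewrite [LHS]big_mkcond; apply: eq_bigr => c _; rewrite /nz; case: eqP.
have -> : den (r :: Rs S true) r = den (Rs S true) r by rewrite /den big_cons eqxx.
apply: (mulIf (den_neq0 (Rs V true) r)); rewrite mulNr -[X in _ = X]mulrN1 H mulr1.
by have d1 := den_neq0 (Rs V true) r; move: (\prod_(i <- _) _) => X; field.
Qed.

Context (d : nat) (d_gt0 : (0 < d)%N) (cs : k).
(** The conditions say that prod (u - r) / prod (u - a) begins with u^-d + cs u^(-d-1) at infinity.
    By [flip_perm] every move preserves them. *)
Definition gstate S := [/\ fin S, size (Rs S true) = (size (Rs S false) + d)%N &
  \sum_(a <- Rs S true) a - \sum_(a <- Rs S false) a = cs].

Lemma gstate_flip_add b S : fin S -> ok true S b -> gstate S <-> gstate (flip b S).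
Proof.
move=> fS ob; have fS' := flip_fin b fS; have P := flip_perm fS ob.
have := perm_size P; rewrite !size_cat /= => sz.
have sm : \sum_(c <- Rs (flip b S) false ++ Rs S true ++ [:: b - 1; b + 1]) c =
  \sum_(c <- Rs S false ++ Rs (flip b S) true ++ [:: b; b]) c by apply: perm_big.
rewrite !big_cat !big_cons !big_nil /= in sm.
have sm' : \sum_(a <- Rs S true) a - \sum_(a <- Rs S false) a = \sum_(a <- Rs (flip b S) true) a - \sum_(a <- Rs (flip b S) false) a.
  move: sm; move: (\sum_(i <- _) _) => x1; move: (\sum_(i <- _) _) => x2; move: (\sum_(i <- _) _) => x3; move: (\sum_(i <- _) _) => x4 e.
  have -> : x2 = (x1 + (x2 + (b - 1 + (b + 1 + 0)))) - x1 - b - b by ring.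
  by rewrite e; ring.
by split=> -[_ h1 h2]; split=> //; rewrite -?sm' ?h2 // ?sm' ?h2 //; lia.
Qed.
Lemma gstate_flip e b S : gstate S -> ok e S b -> gstate (flip b S).
Proof.
move=> gS; have [fS _ _] := gS; case: e => ob; first by have [H _] := gstate_flip_add fS ob; apply: H.
have ob' : ok true (flip b S) b by apply: (ok_flip ob).
by have [_] := gstate_flip_add (flip_fin b fS) ob'; rewrite flipK; apply.
Qed.

Section Identities.
Context (S : state) (gS : gstate S).
Let fS : fin S. Proof. by case: gS. Qed.
Local Notation A := (Rs S true).
Local Notation R := (Rs S false).
Let n := size A.
Let nE : n = (size R + d)%N. Proof. by case: gS. Qed.
Let N : {poly k} := \prod_(r <- R) ('X - r%:P).
Let sN : size N = (size R).+1. Proof. exact: size_prod_XsubC. Qed.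
Let wtE a : wt S a = N.[a] / den A a.
Proof. by rewrite /wt /N horner_prod; congr (_ / _); apply: eq_bigr => r _; rewrite hornerXsubC. Qed.

(** The coefficient of u^(-j-1) in the expansion at infinity of the rational function whose residues
    are [wt]; the bubble with j dots acts by it. *)
Definition gam j := \sum_(a <- A) wt S a * a ^+ j.
Let gam_lg j : gam j = lg A (N * 'X^j).
Proof. by apply: eq_bigr => a _; rewrite wtE hornerM hornerXn mulrAC. Qed.
Lemma gam_lt j : (j < d.-1)%N -> gam j = 0.
Proof.
move=> jd; rewrite gam_lg lagrange ?uniq_Rs //; last first.
  by apply: leq_trans (size_polyMleq _ _) _; rewrite sN size_polyXn; rewrite -/n nE; lia.
by rewrite coefMXn -/n nE ifF; [rewrite nth_default // sN; lia|lia].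
Qed.
Lemma gam_pred : gam d.-1 = 1.
Proof.
rewrite gam_lg lagrange ?uniq_Rs //; last first.
  by apply: leq_trans (size_polyMleq _ _) _; rewrite sN size_polyXn; rewrite -/n nE; lia.
rewrite coefMXn -/n nE ifF; last by lia.
have -> : ((size R + d).-1 - d.-1 = (size N).-1)%N by rewrite sN; lia.
by apply/eqP; rewrite -[_ == _]/(N \is monic) monic_prod_XsubC.
Qed.
Lemma gam_level : gam d = cs.
Proof.
pose D : {poly k} := \prod_(a <- A) ('X - a%:P).
have sD : size D = n.+1 by rewrite size_prod_XsubC.
have sNX : size (N * 'X^d) = n.+1 by rewrite size_mulXn -?size_poly_eq0 sN // nE; lia.
(* The polynomial has one degree too many for interpolation; subtracting the product over all nodes
   changes none of its values there and removes the top coefficient. *)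
have -> : gam d = lg A (N * 'X^d - D).
  rewrite gam_lg; apply: eq_big_seq => a aA; rewrite hornerD hornerN.
  have -> : D.[a] = 0 by rewrite /D horner_prod (bigD1_seq a) ?uniq_Rs //= hornerXsubC subrr mul0r.
  by rewrite subr0.
have sub : (size (N * 'X^d - D)%R <= n)%N.
  apply/leq_sizeP => j; rewrite leq_eqVlt => /orP[/eqP <-|nj]; last first.
    by rewrite coefB !nth_default ?subr0 // ?sD ?sNX.
  rewrite coefB; have -> : D`_n = 1.
    by rewrite -[n]/(n.+1.-1) -sD; apply/eqP; rewrite -[_ == _]/(D \is monic) monic_prod_XsubC.
  have -> : (N * 'X^d)`_n = 1.
    rewrite coefMXn ifF; last by lia.
    have -> : (n - d = (size N).-1)%N by rewrite sN; lia.
    by apply/eqP; rewrite -[_ == _]/(N \is monic) monic_prod_XsubC.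
  by rewrite subrr.
rewrite lagrange ?uniq_Rs // -/n coefB.
have sub2 (s : seq k) : s != [::] -> (\prod_(c <- s) ('X - c%:P))`_(size s).-1 = - \sum_(c <- s) c.
  by case: s => // c s _; rewrite coefPn_prod_XsubC.
have A0 : A != [::] by rewrite -size_eq0 -/n nE; lia.
rewrite (sub2 A A0 : D`_n.-1 = _) opprK coefMXn; have [_ _ <-] := gS.
case: (posnP (size R)) => [R0|R1].
  rewrite ifT; last by rewrite nE R0; lia.
  by rewrite (size0nil R0) big_nil subr0 add0r.
rewrite ifF; last by rewrite nE; lia.
have -> : (n.-1 - d = (size R).-1)%N by rewrite nE; lia.
by rewrite /N sub2 1?addrC // -size_eq0 -lt0n.
Qed.

Let Nr r : {poly k} := \prod_(c <- R | c != r) ('X - c%:P).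
Let NrE r : r \in R -> N = Nr r * ('X - r%:P).
Proof. by move=> rR; rewrite /N (bigD1_seq r) ?uniq_Rs //= mulrC. Qed.
Let sNr r : r \in R -> (size (Nr r)).+1 = size N.
Proof.
move=> rR; rewrite (NrE rR) size_Mmonic ?monicXsubC ?size_XsubC ?addn2 //.
by rewrite -size_poly_eq0 /Nr -big_filter size_prod_XsubC.
Qed.
Let R_A r a : r \in R -> a \in A -> a - r != 0.
Proof.
rewrite !mem_Rs // => /andP[/eqP h1 _] /andP[/eqP h2 _]; rewrite subr_eq0; apply/eqP => E.
by rewrite E h1 in h2.
Qed.
Let wtr r a : r \in R -> a \in A -> wt S a / (a - r) = (Nr r).[a] / den A a.
Proof.
move=> rR aA; rewrite wtE (NrE rR) hornerM hornerXsubC; have := R_A rR aA; have := den_neq0 A a.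
by move=> h1 h2; field; rewrite h1.
Qed.

(** Dividing by u - r cancels a zero, so these are the residues of a rational function that decays
    at least like u^-2. *)
Lemma wt_frac r j : r \in R -> (j < d)%N -> \sum_(a <- A) wt S a / (a - r) * a ^+ j = 0.
Proof.
move=> rR jd; transitivity (lg A (Nr r * 'X^j)).
  by apply: eq_big_seq => a aA; rewrite wtr // hornerM hornerXn mulrAC.
have sz : (size (Nr r * 'X^j)%R < n)%N.
  by apply: leq_ltn_trans (size_polyMleq _ _) _; rewrite size_polyXn; have := sNr rR; rewrite sN nE; lia.
by rewrite lagrange ?uniq_Rs ?(ltnW sz) // nth_default // -ltnS prednK // (leq_trans _ sz).
Qed.

(** Only one of the two denominators is cancelled by a zero, so [r] becomes an additional node. Its
    own residue vanishes for distinct [r] and [r'], and otherwise gives the right-hand side by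
    [wt_unflip]. *)
Lemma wt_frac2 r r' : r \in R -> r' \in R ->
  \sum_(a <- A) wt S a / ((a - r) * (a - r')) = (r == r')%:R * wt (flip r S) r.
Proof.
move=> rR rR'; have rA : r \notin A by apply/negP => /(R_A rR); rewrite subrr eqxx.
have := lagrange (L := r :: A) (P := Nr r'); rewrite /= rA uniq_Rs //= => H.
have sz : (size (Nr r') <= n)%N by have := sNr rR'; rewrite sN nE; lia.
have := H isT (leqW sz); rewrite [RHS]nth_default // /lg big_cons => /eqP.
rewrite addrC addr_eq0 => /eqP E; rewrite (_ : \sum_(a <- A) _ = \sum_(a <- A) (Nr r').[a] / den (r :: A) a); last first.
  apply: eq_big_seq => a aA; rewrite invfM mulrA mulrAC wtr // -mulrA -invfM; congr (_ / _).
  rewrite /den big_cons ifT 1?mulrC //; by apply: contraNneq rA => ->.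
rewrite E; case: eqP => [<-|/eqP rr'].
  rewrite mul1r; have or : ok false S r by rewrite -mem_Rs.
  have := wt_unflip fS or => U; apply: (mulIf (den_neq0 (r :: A) r)); rewrite U mulNr divfK ?den_neq0 //.
  by congr (- _); rewrite /Nr horner_prod; apply: eq_bigr => c _; rewrite hornerXsubC.
have -> : (Nr r').[r] = 0; last by rewrite !mul0r oppr0.
by apply/eqP; rewrite -[_ == 0]/(root _ _) /Nr -big_filter root_prod_XsubC mem_filter rr'.
Qed.
End Identities.
End States.

End FockStates.
Import FockStates.

(** * Operators of diagrams on paths of configurations *)

Module FockOperators.

Local Open Scope ring_scope.

Section Fock.
Context (k : fieldType) (char0 : [pchar k] =i pred0) (d : nat) (cs : k) (d_gt0 : (0 < d)%N).
Local Notation state := (k -> bool).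
Implicit Types (S : state) (p q : seq k) (u v : word).
Local Notation gstate := (gstate d cs).

Definition run p S : state := foldr (@flip k) S p.
Fixpoint valid u p S : bool :=
  match u, p with
  | [::], [::] => true
  | c :: u', a :: p' => valid u' p' S && ok c (run p' S) a
  | _, _ => false
  end.
(* Paths list the moves made by the strands of a word, the rightmost strand acting first, hence being last in the list. *)
Definition cc (b a : k) : k := if b + 1 == a then 0 else 1 - (b - a)^-1.

(* [fock f S phi p] is phi, extended linearly, evaluated at the image of the path p out of S under f; the crossing acts by
   Young's seminormal form and the cups and caps are normalized by [wt]. *)
Fixpoint fock u v (f : diagram k u v) S (phi : seq k -> k) p : k :=
  match f with
  | DId _ => phi p
  | DComp _ _ _ f g => fock g S (fock f S phi) p
  | DTens u _ _ _ f g =>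
      fock g S (fun q' => fock f (run q' S) (fun q => phi (q ++ q')) (take (size u) p)) (drop (size u) p)
  | DDot => p`_0 * phi p
  | DCross => (p`_0 - p`_1)^-1 * phi p + cc p`_0 p`_1 * phi [:: p`_1; p`_0]
  | DRCup => \sum_(a <- Rs S true) phi [:: a; a]
  | DRCap => if p`_0 == p`_1 then phi [::] else 0
  | DLCup => \sum_(a <- Rs S false) (wt (flip a S) a)^-1 * phi [:: a; a]
  | DLCap => if p`_0 == p`_1 then wt S p`_0 * phi [::] else 0
  | DZero _ _ => 0
  | DAdd _ _ f g => fock f S phi p + fock g S phi p
  | DScale _ _ a f => a * fock f S phi p
  end.

Lemma run_cat p q S : run (p ++ q) S = run p (run q S).
Proof. exact: foldr_cat. Qed.
Lemma valid_size u p S : valid u p S -> size p = size u.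
Proof. by elim: u p => [|c u IH] [|a p] //= /andP[/IH ->]. Qed.
Lemma valid_cat u v p q S : size p = size u ->
  valid (u ++ v) (p ++ q) S = valid v q S && valid u p (run q S).
Proof.
elim: u p => [|c u IH] [|a p] //=; first by rewrite andbT.
by case=> sp; rewrite IH // run_cat andbA.
Qed.
Lemma valid_split u v p S : valid (u ++ v) p S ->
  exists p1 p2, [/\ p = p1 ++ p2, size p1 = size u, valid v p2 S & valid u p1 (run p2 S)].
Proof.
move=> vp; exists (take (size u) p), (drop (size u) p).
have sz : size (take (size u) p) = size u.
  by rewrite size_take (valid_size vp) size_cat; case: ltnP => // h; apply/eqP; rewrite eqn_leq h leq_addr.
by move: vp; rewrite -{1}(cat_take_drop (size u) p) valid_cat // => /andP[]; rewrite cat_take_drop.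
Qed.
Lemma gstate_run u p S : gstate S -> valid u p S -> gstate (run p S).
Proof.
move=> gS; elim: u p => [|c u IH] [|a p] //= /andP[vp oa].
by apply: gstate_flip oa => //; apply: IH.
Qed.
Lemma gfin S : gstate S -> fin S. Proof. by case. Qed.

Lemma ok_flip_far e a b S : a != b -> a + 1 != b -> b + 1 != a -> ok e (flip b S) a = ok e S a.
Proof.
move=> ab ab1 ba1; rewrite /ok /flip (negbTE ab) (negbTE ab1) (inj_eq (addIr _)) (negbTE ab).
by rewrite [a == b + 1]eq_sym (negbTE ba1).
Qed.
Lemma ok2_neq e S a b : ok e S a -> ok e (flip a S) b -> a != b.
Proof.
move=> /andP[/eqP h1 /eqP h2]; rewrite /ok /flip; apply: contraTN => /eqP <-.
by rewrite eqxx h2; case: e {h1 h2}.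
Qed.
Lemma ok_mixed e S a b : ok e S a -> ok (~~ e) (flip a S) b -> a != b ->
  [/\ a + 1 != b, b + 1 != a, ok (~~ e) S b & ok e (flip b S) a].
Proof.
move=> oa ob ab; move: (oa) (ob) => /andP[/eqP h1 /eqP h2] /andP[/eqP h3 /eqP h4].
have n1 : a + 1 != b.
  apply: contraTN isT => /eqP E; move: h3; rewrite -E /flip succ_neq eqxx h1; by case: e {oa ob h1 h2 h4}.
have n2 : b + 1 != a.
  apply: contraTN isT => /eqP E; move: h4; rewrite E /flip eqxx h2; by case: e {oa ob h1 h2 h3}.
split=> //; first by rewrite -(@ok_flip_far _ b a) // eq_sym.
by rewrite ok_flip_far.
Qed.
Lemma ok_same e S a b : ok e S a -> ok e (flip a S) b -> a + 1 != b -> b + 1 != a ->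
  [/\ ok e S b, ok e (flip b S) a & flip a (flip b S) = flip b (flip a S)].
Proof.
move=> oa ob n1 n2; have ab := ok2_neq oa ob.
split; [by rewrite -(@ok_flip_far _ b a) // eq_sym|by rewrite ok_flip_far|].
by rewrite flipC // eq_sym.
Qed.

(** A functional on functions of paths which is a finite combination of evaluations at valid paths
    from S to T. Linearity, and exchange of two functionals, hold for these though not for arbitrary
    ones. *)
Definition fsup S v (T : state) (F : (seq k -> k) -> k) :=
  exists l : seq (k * seq k), (forall x, x \in l -> valid v x.2 S /\ run x.2 S = T) /\
    forall phi, F phi = \sum_(x <- l) x.1 * phi x.2.

Lemma fsup0 S v T : fsup S v T (fun=> 0).
Proof. by exists [::]; split=> // phi; rewrite big_nil. Qed.
Lemma fsupD S v T F G : fsup S v T F -> fsup S v T G -> fsup S v T (fun phi => F phi + G phi).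
Proof.
move=> [l [Hl El]] [m [Hm Em]]; exists (l ++ m); split=> [x|phi]; last by rewrite big_cat El Em.
by rewrite mem_cat => /orP[/Hl|/Hm].
Qed.
Lemma fsupZ S v T a F : fsup S v T F -> fsup S v T (fun phi => a * F phi).
Proof.
move=> [l [Hl El]]; exists [seq (a * x.1, x.2) | x <- l]; split=> [x /mapP[y yl ->]|phi]; first exact: (Hl y yl).
by rewrite big_map El mulr_sumr; apply: eq_bigr => x _ /=; rewrite mulrA.
Qed.
Lemma fsup_pt S v T q : valid v q S -> run q S = T -> fsup S v T (fun phi => phi q).
Proof.
move=> vq rq; exists [:: (1, q)]; split=> [x|phi]; last by rewrite big_seq1 mul1r.
by rewrite inE => /eqP ->.
Qed.
Lemma fsup_sum S v T (I : eqType) (l : seq I) (F : I -> (seq k -> k) -> k) :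
  (forall i, i \in l -> fsup S v T (F i)) -> fsup S v T (fun phi => \sum_(i <- l) F i phi).
Proof.
elim: l => [|i l IH] H.
  by rewrite (_ : (fun _ => _) = fun=> 0) => [|]; [exact: fsup0|apply/funext => phi; rewrite big_nil].
rewrite (_ : (fun _ => _) = fun phi => F i phi + \sum_(i <- l) F i phi); last by apply/funext => phi; rewrite big_cons.
by apply: fsupD; [apply: H; rewrite mem_head|apply: IH => j jl; apply: H; rewrite inE jl orbT].
Qed.
Lemma fsup_bind S v T S' w T' F G : fsup S v T F ->
  (forall q, valid v q S -> run q S = T -> fsup S' w T' (G q)) -> fsup S' w T' (fun phi => F (fun q => G q phi)).
Proof.
move=> [l [Hl El]] HG; rewrite (_ : (fun _ => _) = fun phi => \sum_(x <- l) x.1 * G x.2 phi); last first.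
  by apply/funext => phi; rewrite El.
by apply: fsup_sum => x /Hl[h1 h2]; apply: fsupZ; apply: HG.
Qed.
Lemma fsup_cat S v v' q' T F : fsup (run q' S) v T F -> valid v' q' S ->
  fsup S (v ++ v') T (fun phi => F (fun q => phi (q ++ q'))).
Proof.
move=> H vq; apply: fsup_bind H _ => q vq1 rq; apply: fsup_pt; last by rewrite run_cat.
by rewrite valid_cat ?vq // (valid_size vq1).
Qed.
Lemma fsup_ext S v T F phi psi : fsup S v T F ->
  (forall q, valid v q S -> run q S = T -> phi q = psi q) -> F phi = F psi.
Proof. by move=> [l [Hl El]] H; rewrite !El; apply: eq_big_seq => x /Hl[h1 h2]; rewrite H. Qed.
Lemma fsup_addl S v T F phi psi : fsup S v T F -> F (fun q => phi q + psi q) = F phi + F psi.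
Proof. by move=> [l [Hl El]]; rewrite !El -big_split; apply: eq_bigr => x _; rewrite mulrDr. Qed.
Lemma fsup_scal S v T F a phi : fsup S v T F -> F (fun q => a * phi q) = a * F phi.
Proof. by move=> [l [Hl El]]; rewrite !El mulr_sumr; apply: eq_bigr => x _; rewrite mulrCA. Qed.
Lemma fsup_fubini S v T F S' v' T' F' (Psi : seq k -> seq k -> k) : fsup S v T F -> fsup S' v' T' F' ->
  F (fun q => F' (Psi q)) = F' (fun r => F (Psi^~ r)).
Proof.
move=> [l [Hl El]] [l' [Hl' El']]; rewrite El El'.
rewrite (eq_bigr (fun x => \sum_(y <- l') x.1 * (y.1 * Psi x.2 y.2))) => [|x _]; last by rewrite El' mulr_sumr.
rewrite exchange_big; apply: eq_bigr => y _; rewrite El mulr_sumr; apply: eq_bigr => x _; exact: mulrCA.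
Qed.

Lemma act_fsup u v (f : diagram k u v) S p : gstate S -> valid u p S -> fsup S v (run p S) (fun phi => fock f S phi p).
Proof.
elim: f S p => [w|w1 w2 w3 f IHf g IHg|w1 w2 w3 w4 f IHf g IHg||||||| w1 w2|w1 w2 f IHf g IHg|w1 w2 a f IHf] S p gS vp /=.
- exact: fsup_pt.
- apply: fsup_bind (IHg _ _ gS vp) _ => q vq <-; exact: IHf.
- have [p1 [p2 [-> s1 v2 v1]]] := valid_split vp; rewrite take_size_cat // drop_size_cat // run_cat.
  apply: (fsup_bind (G := fun q' phi => fock f (run q' S) (fun q => phi (q ++ q')) p1) (IHg _ _ gS v2)) => q vq rq.
  apply: (fsup_cat (F := fun phi => fock f (run q S) phi p1)) => //.
  by rewrite -rq; apply: IHf; rewrite ?rq //; apply: gstate_run v2.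
- by case: p vp => [|a [|b p]] //= vp; apply: fsupZ; apply: fsup_pt.
- case: p vp => [|b [|a [|c p]]] //=; rewrite ?andbF // => /andP[oa ob]; apply: fsupD; first by apply: fsupZ; apply: fsup_pt => //=; rewrite oa.
  case: (b + 1 =P a) => [E|/eqP n1].
    by rewrite /cc E eqxx (_ : (fun _ => _) = fun=> 0); [exact: fsup0|apply/funext => phi; rewrite mul0r].
  case: (a + 1 =P b) => [E|/eqP n2].
    rewrite /cc (negbTE n1) -E addrAC subrr add0r invr1 subrr (_ : (fun _ => _) = fun=> 0); [exact: fsup0|].
    by apply/funext => phi; rewrite mul0r.
  have [o1 o2 E] := ok_same oa ob n2 n1.
  by apply: fsupZ; apply: fsup_pt => //=; rewrite o1.
- case: p vp => // _; apply: fsup_sum => a; rewrite (mem_Rs _ _ (gfin gS)) => oa.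
  by apply: fsup_pt; rewrite /= ?flipK // oa (ok_flip oa).
- case: p vp => [|b [|a [|c p]]] //=; rewrite ?andbF // => /andP[oa ob].
  by case: eqP => [->|_]; [rewrite flipK; apply: fsup_pt|exact: fsup0].
- case: p vp => // _; apply: fsup_sum => a; rewrite (mem_Rs _ _ (gfin gS)) => oa.
  by apply: fsupZ; apply: fsup_pt; rewrite /= ?flipK // oa (ok_flip oa).
- case: p vp => [|b [|a [|c p]]] //=; rewrite ?andbF // => /andP[oa ob].
  by case: eqP => [->|_]; [rewrite flipK; apply: fsupZ; apply: fsup_pt|exact: fsup0].
- exact: fsup0.
- by apply: fsupD; [apply: IHf|apply: IHg].
- by apply: fsupZ; apply: IHf.
Qed.

Definition aeq u v (f g : diagram k u v) := forall S p phi, gstate S -> valid u p S -> fock f S phi p = fock g S phi p.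

Lemma act_didto u v (e : u = v) S phi p : fock (didto k e) S phi p = phi p.
Proof. by case: v / e. Qed.

Lemma aeq_comp u v w (f f' : diagram k v w) (g g' : diagram k u v) : aeq f f' -> aeq g g' -> aeq (DComp f g) (DComp f' g').
Proof.
move=> ff gg S p phi gS vp /=; rewrite gg //; apply: (fsup_ext (act_fsup g' gS vp)) => q vq _; exact: ff.
Qed.
Lemma aeq_tens u v u' v' (f f' : diagram k u v) (g g' : diagram k u' v') : aeq f f' -> aeq g g' -> aeq (DTens f g) (DTens f' g').
Proof.
move=> ff gg S p phi gS vp; have [p1 [p2 [-> s1 v2 v1]]] := valid_split vp; rewrite /= take_size_cat // drop_size_cat //.
rewrite gg //; apply: (fsup_ext (act_fsup g' gS v2)) => q vq rq; apply: ff; last by rewrite rq.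
exact: gstate_run vq.
Qed.
(** Morphisms preserve the end of a path, so what happens on the right does not change the
    configuration in which the left factor acts; the exchange is then [fsup_fubini]. *)
Lemma aeq_interchange u v w u' v' w' (f : diagram k v w) (g : diagram k u v)
      (f' : diagram k v' w') (g' : diagram k u' v') :
  aeq (DComp (DTens f f') (DTens g g')) (DTens (DComp f g) (DComp f' g')).
Proof.
move=> S p phi gS vp; have [p1 [p2 [-> s1 v2 v1]]] := valid_split vp; rewrite /= take_size_cat // drop_size_cat //.
apply: (fsup_ext (act_fsup g' gS v2)) => q vq rq; have gS' := gstate_run gS vq.
rewrite -rq in v1.
pose Psi q0 r' := fock f (run r' S) (fun r => phi (r ++ r')) q0.
transitivity (fock g (run q S) (fun q0 => fock f' S (Psi q0) q) p1).
  by apply: (fsup_ext (act_fsup g gS' v1)) => q0 vq0 _; rewrite /= take_size_cat ?drop_size_cat ?(valid_size vq0).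
rewrite (fsup_fubini Psi (act_fsup g gS' v1) (act_fsup f' gS vq)).
by apply: (fsup_ext (act_fsup f' gS vq)) => r vr rr; rewrite /Psi rr.
Qed.
Lemma aeq_unitr u v (f : diagram k u v) :
  aeq (DComp (didto k (cats0 v)) (DTens f (DId [::]))) (DComp f (didto k (cats0 u))).
Proof.
move=> S p phi gS vp; rewrite /= act_didto; have vs := valid_size vp; rewrite size_cat addn0 in vs.
rewrite drop_oversize ?vs // take_oversize ?vs //=; congr (fock f S _ p).
by apply/funext => q; rewrite act_didto cats0.
Qed.
Lemma aeq_tensA u v u' v' u'' v'' (f : diagram k u v) (g : diagram k u' v') (h : diagram k u'' v'') :
  aeq (DComp (didto k (catA v v' v'')) (DTens f (DTens g h))) (DComp (DTens (DTens f g) h) (didto k (catA u u' u''))).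
Proof.
move=> S p phi gS vp; have [p1 [p' [-> s1 v2 v1]]] := valid_split vp.
have [p2 [p3 [-> s2 v3 v2']]] := valid_split v2.
have e : take (size (u ++ u')) (p1 ++ p2 ++ p3) = p1 ++ p2 by rewrite catA take_size_cat // !size_cat s1 s2.
have e' : drop (size (u ++ u')) (p1 ++ p2 ++ p3) = p3 by rewrite catA drop_size_cat // !size_cat s1 s2.
rewrite /= act_didto /= e e' !(take_size_cat _ s1) !(drop_size_cat _ s1) !(take_size_cat _ s2) !(drop_size_cat _ s2).
congr (fock h S _ p3); apply/funext => r; congr (fock g _ _ p2); apply/funext => q; rewrite run_cat.
by congr (fock f _ _ p1); apply/funext => q0; rewrite act_didto catA.
Qed.

Lemma sum_pickg e S b (G : k -> k) : fin S -> (forall a, ok e S a -> a != b -> G a = 0) ->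
  \sum_(a <- Rs S e) G a = if ok e S b then G b else 0.
Proof.
move=> fS H; rewrite -(mem_Rs _ _ fS); case: ifP => bS.
  rewrite (bigD1_seq b) ?uniq_Rs //= big1_seq ?addr0 // => a /andP[ab aS]; apply: H => //; by rewrite -mem_Rs.
rewrite big1_seq // => a /andP[_ aS]; apply: H; first by rewrite -mem_Rs.
by apply: contraFneq bS => <-.
Qed.
Lemma cc_mul x y : x != y -> cc x y * cc y x = 1 - (x - y)^-1 ^+ 2.
Proof.
move=> xy; have xy0 : x - y != 0 by rewrite subr_eq0.
have e : (y - x)^-1 = - (x - y)^-1 by rewrite -invrN opprB.
rewrite /cc e; case: (x + 1 =P y) => [<-|_]; first by rewrite opprD addrA subrr add0r invrN invr1 mul0r sqrrN expr1n subrr.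
case: (y + 1 =P x) => [<-|_]; last by ring.
by rewrite addrAC subrr add0r invr1 mulr0 expr1n subrr.
Qed.
Lemma cc_succ x y : y + 1 = x -> cc x y = 0.
Proof. by move=> <-; rewrite /cc [y + 1 - y]addrAC subrr add0r invr1 subrr; case: ifP. Qed.
Lemma cc_succ' x y : x + 1 = y -> cc x y = 0.
Proof. by move=> <-; rewrite /cc eqxx. Qed.

End Fock.

End FockOperators.
Import FockOperators.

(** * The local relations on the Fock space *)

Module FockRelations.

Local Open Scope ring_scope.

Section FockRelations.
Context (k : fieldType) (char0 : [pchar k] =i pred0).
Context (lam : {fsfun int -> nat with 0%N}).
Local Notation d := (level lam).
Context (d_gt0 : (0 < d)%N).
Local Notation cs := (\sum_(i <- finsupp lam) i%:~R * (lam i)%:R : k).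
Local Notation state := (k -> bool).
Implicit Types (S : state) (p q : seq k).
Local Notation gstate := (gstate d cs).
Local Notation aeq := (@aeq k d cs _ _).
Local Notation diagram := (diagram k).

Local Opaque wt.

Definition scal u (f : diagram u u) S p (c : k) := forall phi, fock f S phi p = c * phi p.

Lemma scal_dots S j a : scal (dots k j) S [:: a] (a ^+ j).
Proof.
elim: j => [|j IH] phi; first by rewrite /= expr0 mul1r.
change (fock (DComp DDot (dots k j)) S phi [:: a] = a ^+ j.+1 * phi [:: a]).
by rewrite /= IH /= mulrA exprSr.
Qed.
Lemma act_bubble S j phi : fock (bubble k j) S phi [::] = gam S j * phi [::].
Proof.
rewrite /= mulr_suml; apply: eq_bigr => a _; rewrite /= (scal_dots S j a) /= eqxx mulrA; congr (_ * _); exact: mulrC.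
Qed.
Lemma act_bigD u v (I : Type) (r : seq I) (P : pred I) (F : I -> diagram u v) S phi p :
  fock (\big[@DAdd k u v/DZero]_(i <- r | P i) F i) S phi p = \sum_(i <- r | P i) fock (F i) S phi p.
Proof. exact: (big_morph (fun f => fock f S phi p)). Qed.
Lemma scal_bigC u (I : Type) (r : seq I) (P : pred I) (F : I -> diagram u u) (x : I -> k) S p :
  (forall i, scal (F i) S p (x i)) ->
  scal (\big[@DComp k u u u/DId u]_(i <- r | P i) F i) S p (\prod_(i <- r | P i) x i).
Proof.
move=> H; apply: (big_ind2 (fun f c => scal f S p c)) => //= [phi|f c g c' Hf Hg phi]; first by rewrite mul1r.
by rewrite /= Hg Hf mulrA [c' * c]mulrC.
Qed.

Definition hc S (n : nat) : k := hess_det (fun m => gam S (d.-1 + m)) n.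

Lemma scal_bubble_det S n : gstate S -> (n < d)%N -> scal (bubble_det k lam n) S [::] (hc S n).
Proof.
move=> gS nd phi; rewrite /bubble_det act_bigD /hc /hess_det mulr_suml; apply: eq_bigr => w _.
rewrite /= (scal_bigC _ _ (x := fun i : 'I_n => gam S (d + w i - i))) => [|i psi]; last exact: act_bubble.
rewrite mulrA; congr (_ * _ * _); apply: eq_bigr => i _; have := ltn_ord i; have := ltn_ord (w i) => h1 h2.
case: ifP => h; first by congr (gam S _); lia.
by rewrite (gam_lt d_gt0 gS) //; lia.
Qed.

Definition rc S (j : nat) (a : k) := \sum_(j <= i < d) a ^+ (i - j) * hc S (d.-1 - i).
Lemma scal_dual S j a : gstate S -> scal (dual_dots k lam j) S [:: a] (rc S j a).
Proof.
move=> gS phi; rewrite /dual_dots act_bigD /rc mulr_suml; apply: eq_big_nat => i /andP[_ id].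
rewrite /= (scal_bubble_det gS) /=; last by lia.
by rewrite (scal_dots S) /= mulrA [hc _ _ * _]mulrC.
Qed.

Lemma mulmx1C_eq m n (A : 'M[k]_(m, n)) (B : 'M[k]_(n, m)) : m = n -> A *m B = 1%:M -> B *m A = 1%:M.
Proof. by move=> E; case: n / E A B => A B; apply: mulmx1C. Qed.

(* The two families of coefficients are inverse square matrices; the other product is computed by Lagrange interpolation. *)
Lemma resolution S a e : gstate S -> a \in Rs S true -> e \in Rs S true ->
  \sum_(c <- Rs S false) (wt (flip c S) c)^-1 * (wt S a / (a - c)) / (e - c)
  + wt S a * (\sum_(j < d) rc S j a * e ^+ j) = (a == e)%:R.
Proof.
move=> gS aA eA; have fS := gfin gS; have [_ sA _] := gS.
pose A := Rs S true; pose R := Rs S false; pose n := size A; pose r := size R.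
pose W c := (wt (flip c S) c)^-1.
pose G1 : 'M[k]_(r, n) := \matrix_(c, i) (A`_i - R`_c)^-1.
pose G2 : 'M[k]_(d, n) := \matrix_(j, i) A`_i ^+ j.
pose K1 : 'M[k]_(n, r) := \matrix_(i, c) (W R`_c * (wt S A`_i / (A`_i - R`_c))).
pose K2 : 'M[k]_(n, d) := \matrix_(i, j) (wt S A`_i * rc S j A`_i).
have toA (F : k -> k) : \sum_(i < n) F A`_i = \sum_(b <- A) F b by rewrite [RHS](big_nth 0) big_mkord.
have toR (F : k -> k) : \sum_(i < r) F R`_i = \sum_(b <- R) F b by rewrite [RHS](big_nth 0) big_mkord.
have RR (c : 'I_r) : R`_c \in R by rewrite mem_nth.
have h11 : G1 *m K1 = 1%:M.
  apply/matrixP => c c'; rewrite !mxE.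
  rewrite (eq_bigr (fun i : 'I_n => W R`_c' * (wt S A`_i / ((A`_i - R`_c) * (A`_i - R`_c'))))) => [|i _]; last first.
    by rewrite !mxE invfM; ring.
  rewrite -mulr_sumr (toA (fun b => wt S b / ((b - R`_c) * (b - R`_c')))) (wt_frac2 char0 d_gt0 gS) //.
  rewrite nth_uniq ?uniq_Rs // -[(_ == _ :> nat)]/(c == c'); case: eqP => [->|_]; last by rewrite mul0r mulr0.
  have := RR c'; rewrite mem_Rs // => oc; rewrite mul1r mulVf // wt_neq0 //; first exact: flip_fin.
  exact: (ok_flip oc).
have h12 : G1 *m K2 = 0.
  apply/matrixP => c j; rewrite !mxE.
  rewrite (eq_bigr (fun i : 'I_n => \sum_(j <= l < d) hc S (d.-1 - l) * (wt S A`_i / (A`_i - R`_c) * A`_i ^+ (l - j)))) => [|i _].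
    rewrite exchange_big big1_seq // => l /andP[_]; rewrite mem_index_iota => /andP[_ ld].
    by rewrite -mulr_sumr (toA (fun b => wt S b / (b - R`_c) * b ^+ (l - j))) (wt_frac d_gt0 gS) ?mulr0 //; lia.
  by rewrite !mxE /rc mulr_sumr mulr_sumr; apply: eq_bigr => l _; ring.
have h21 : G2 *m K1 = 0.
  apply/matrixP => j c; rewrite !mxE.
  rewrite (eq_bigr (fun i : 'I_n => W R`_c * (wt S A`_i / (A`_i - R`_c) * A`_i ^+ j))) => [|i _]; last by rewrite !mxE; ring.
  by rewrite -mulr_sumr (toA (fun b => wt S b / (b - R`_c) * b ^+ j)) (wt_frac d_gt0 gS) ?mulr0.
have h22 : G2 *m K2 = 1%:M.
  apply/matrixP => j j'; rewrite !mxE.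
  rewrite (eq_bigr (fun i : 'I_n => \sum_(j' <= l < d) hc S (d.-1 - l) * (wt S A`_i * A`_i ^+ (j + (l - j'))))) => [|i _]; last first.
    by rewrite !mxE /rc mulr_sumr mulr_sumr; apply: eq_bigr => l _; rewrite exprD; ring.
  rewrite exchange_big /=.
  rewrite (eq_bigr (fun l => hc S (d.-1 - l) * gam S (j + (l - j')))) => [|l _]; last first.
    by rewrite -mulr_sumr (toA (fun b => wt S b * b ^+ (j + (l - j')))).
  have jd := ltn_ord j; have jd' := ltn_ord j'.
  have := big_addn 0 d (nat_of_ord j') xpredT (fun l => hc S (d.-1 - l) * gam S (j + (l - j'))) (op := +%R) (idx := 0).
  rewrite add0n /= => ->; rewrite big_nat_rev /= add0n.
  case: (ltnP j j') => jj.
    have -> : (j == j') = false by apply/negbTE; rewrite -val_eqE /= ltn_eqF.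
    by rewrite big_nat big1 // => s /andP[_ sd]; rewrite (gam_lt d_gt0 gS) ?mulr0 //; lia.
  have -> : (j == j')%:R = (j - j' == 0)%N%:R :> k.
    by congr (_%:R); congr nat_of_bool; rewrite -val_eqE /= subn_eq0 eqn_leq jj andbT.
  rewrite -(hess_det_rec (h := fun m => gam S (d.-1 + m))) ?addn0 ?(gam_pred d_gt0 gS) //.
  rewrite (@big_cat_nat _ _ _ (j - j').+1) //=; last by lia.
  rewrite [X in _ + X]big_nat [X in _ + X]big1 ?addr0 => [|s /andP[s1 s2]]; last first.
    by rewrite (gam_lt d_gt0 gS) ?mulr0 //; lia.
  rewrite big_mkord; apply: eq_bigr => s _; rewrite mulrC; have := ltn_ord s => sj.
  by congr (gam S _ * hc S _); lia.
have GK : col_mx G1 G2 *m row_mx K1 K2 = 1%:M.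
  by rewrite mul_col_row h11 h12 h21 h22 -scalar_mx_block.
have := mulmx1C_eq (esym sA) GK; rewrite mul_row_col => /matrixP.
have iA b : b \in A -> (index b A < n)%N by rewrite index_mem.
move=> /(_ (Ordinal (iA _ aA)) (Ordinal (iA _ eA))); rewrite !mxE /= -val_eqE /=.
have -> : (index a A == index e A) = (a == e).
  by rewrite -[in RHS](nth_index 0 aA) -[in RHS](nth_index 0 eA) nth_uniq ?uniq_Rs // index_mem.
move=> <-; congr (_ + _).
  rewrite -[LHS](toR (fun c => (wt (flip c S) c)^-1 * (wt S a / (a - c)) / (e - c))).
  by apply: eq_bigr => c _; rewrite !mxE /= !nth_index.
rewrite mulr_sumr; apply: eq_bigr => j _; by rewrite !mxE /= !nth_index // mulrA.
Qed.

(** By [wt_flip], the factor by which a move at distance t changes the weight of a site. *)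
Definition rr (t : k) := t ^+ 2 / (t ^+ 2 - 1).

Lemma act_rcross S phi a b : gstate S -> valid [:: true; false] [:: b; a] S ->
  fock (rcross k) S phi [:: b; a] =
  if b == a then \sum_(e <- Rs S true) (e - a)^-1 * phi [:: e; e] else cc a b * phi [:: a; b].
Proof.
move=> gS /= /andP[oa ob]; have fS := gfin gS; case: (b =P a) => [E|/eqP ba].
  rewrite E flipK; apply: eq_big_seq => c; rewrite mem_Rs // => /andP[/eqP h1 _].
  have -> : (c == a) = false by apply/eqP => ca; move: oa; rewrite -ca /ok h1.
  by rewrite ?eqxx mulr0 addr0.
have ab : a != b by rewrite eq_sym.
have [n1 n2 o1 o2] := ok_mixed oa ob ab.
have fS' : fin (flip b (flip a S)) by do 2!apply: flip_fin.
rewrite (sum_pickg (b := a)) //; last by move=> c _ /negbTE ->; rewrite !mulr0 addr0.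
have -> : flip b (flip a S) = flip a (flip b S) by rewrite flipC // eq_sym.
by rewrite (ok_flip o2) eqxx mulr0 add0r.
Qed.

Lemma sqm1 (x y : k) : x + 1 != y -> y + 1 != x -> (x - y) ^+ 2 - 1 != 0.
Proof.
move=> h1 h2; have -> : (x - y) ^+ 2 - 1 = (x - y + 1) * (x - y - 1) by ring.
rewrite mulf_neq0 //; first by rewrite addrAC subr_eq0.
by rewrite -addrA -opprD subr_eq0 eq_sym.
Qed.

Lemma valid2P c1 c2 p S : valid [:: c1; c2] p S -> exists b a, p = [:: b; a].
Proof. by case: p => [|b [|a [|e p]]] //=; rewrite ?andbF // => _; exists b, a. Qed.

Lemma act_lcross S phi a b : gstate S -> valid [:: false; true] [:: b; a] S ->
  fock (lcross k) S phi [:: b; a] =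
  if b == a then \sum_(c <- Rs S false) (wt (flip c S) c)^-1 * (wt S a / (a - c)) * phi [:: c; c]
  else cc a b * rr (a - b) * phi [:: a; b].
Proof.
move=> gS /= /andP[oa ob]; have fS := gfin gS; case: (b =P a) => [E|/eqP ba].
  rewrite E; apply: eq_big_seq => c; rewrite mem_Rs // => /andP[/eqP h1 _].
  have -> : (a == c) = false by apply/eqP => ca; move: oa; rewrite ca /ok h1.
  by rewrite flipK mulr0 addr0; ring.
have ab : a != b by rewrite eq_sym.
have [n1 n2 o1 o2] := ok_mixed oa ob ab.
rewrite (sum_pickg (b := b)) //; last by move=> c _ cb; rewrite [b == c]eq_sym (negbTE cb) !mulr0 addr0 mulr0.
rewrite o1 eqxx mulr0 add0r /=; set T := flip b S.
have fT : fin T by apply: flip_fin.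
have oT : ok true T b by apply: (ok_flip o1).
have H := wt_flip char0 fT oT o2 ba (_ : ok true (flip a T) b).
have {}H := H (etrans (ok_flip_far _ _ ba n2 n1) oT).
have w0 := wt_neq0 fT oT.
have t1 := sqm1 n1 n2.
have -> : wt (flip a T) b = wt T b * rr (a - b).
  have e2 : (a - b) ^+ 2 = (b - a) ^+ 2 by ring.
  have key (X W u z : k) : z != 0 -> X * z = W * u -> X = W * (u / z).
    by move=> z0 XW; apply: (mulIf z0); rewrite XW; field.
  by rewrite /rr e2; apply: key; rewrite -?e2 // e2.
by field.
Qed.

Lemma valid_swap e S a b : valid [:: e; ~~ e] [:: b; a] S -> b != a ->
  valid [:: ~~ e; e] [:: a; b] S /\ (b - a) ^+ 2 - 1 != 0.
Proof.
move=> /= /andP[oa ob] ba; have ab : a != b by rewrite eq_sym.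
have [n1 n2 o1 o2] : [/\ a + 1 != b, b + 1 != a, ok e S b & ok (~~ e) (flip b S) a].
  by have := ok_mixed oa; rewrite negbK => /(_ b ob ab).
split; [by rewrite o1|exact: sqm1].
Qed.
Lemma rr_cancel a b : b != a -> (b - a) ^+ 2 - 1 != 0 -> cc a b * (cc b a * rr (b - a)) = 1.
Proof.
move=> ba t1; have b0 : b - a != 0 by rewrite subr_eq0.
rewrite mulrA cc_mul 1?eq_sym // -[a - b]opprB invrN sqrrN /rr.
by field; rewrite t1 b0.
Qed.

(** On a repeated site the composite is a double sum over addable and removable sites, evaluated by
    [wt_frac2]. On distinct sites the product of the crossing coefficients cancels the change of
    weight [rr]. *)
Lemma aeq_pm : aeq (DComp (lcross k) (rcross k)) (DId [:: true; false]).
Proof.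
move=> S p phi gS vp; have fS := gfin gS; have [b [a pE]] := valid2P vp; rewrite pE in vp *; clear p pE.
change (fock (rcross k) S (fock (lcross k) S phi) [:: b; a] = phi [:: b; a]); rewrite (act_rcross _ gS vp); case: (b =P a) => [E|/eqP ba].
  have oa : ok false S a by case/andP: vp.
  have aR : a \in Rs S false by rewrite mem_Rs.
  rewrite (eq_big_seq (fun e => \sum_(c <- Rs S false) (wt (flip c S) c)^-1 * phi [:: c; c] * (wt S e / ((e - a) * (e - c))))) => [|e eA].
    rewrite exchange_big /= (eq_big_seq (fun c => (wt (flip c S) c)^-1 * phi [:: c; c] * ((a == c)%:R * wt (flip a S) a))) => [|c cR].
      rewrite (sum_pickg (b := a)) // => [|c _ ca]; last by rewrite eq_sym (negbTE ca) mul0r mulr0.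
      rewrite oa eqxx mul1r E mulrAC mulVf ?mul1r // wt_neq0 //; first exact: flip_fin.
      exact: (ok_flip oa).
    by rewrite -mulr_sumr (wt_frac2 char0 d_gt0 gS).
  rewrite mem_Rs // in eA; rewrite act_lcross //; last by rewrite /= eA (ok_flip eA).
  rewrite eqxx mulr_sumr; apply: eq_bigr => c _; rewrite [((e - a) * (e - c))^-1]invfM; ring.
have [vp' t1] := @valid_swap true S a b vp ba.
by rewrite act_lcross // eq_sym (negbTE ba) mulrA rr_cancel // mul1r.
Qed.

(** The repeated sites are where the dotted cups contribute, and there the relation is [resolution];
    distinct sites are as in [aeq_pm]. *)
Lemma aeq_mp : aeq (DId [:: false; true]) (DAdd (DComp (rcross k) (lcross k))
  (\big[@DAdd k [:: false; true] [:: false; true]/DZero]_(j < d)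
     DComp (DComp (DComp (DTens (DId [:: false]) (dots k j)) DRCup) DLCap) (DTens (DId [:: false]) (dual_dots k lam j)))).
Proof.
move=> S p phi gS vp; have fS := gfin gS; have [b [a pE]] := valid2P vp; rewrite pE in vp *; clear p pE.
set D0 := \big[_/_]_(j < d) _; change (phi [:: b; a] = fock (lcross k) S (fock (rcross k) S phi) [:: b; a] + fock D0 S phi [:: b; a]).
rewrite /D0 act_bigD {D0} (act_lcross _ gS vp).
have D (j : 'I_d) : fock (DComp (DComp (DComp (DTens (DId [:: false]) (dots k j)) DRCup) DLCap) (DTens (DId [:: false]) (dual_dots k lam j))) S phi [:: b; a]
    = rc S j a * (if b == a then wt S b * \sum_(e <- Rs S true) e ^+ j * phi [:: e; e] else 0).
  rewrite [LHS](scal_dual j a gS).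
  change (rc S j a * (if b == a then wt S b * (\sum_(e <- Rs S true) fock (dots k j) S (fun q => phi (e :: q)) [:: e]) else 0) = rc S j a * (if b == a then wt S b * \sum_(e <- Rs S true) e ^+ j * phi [:: e; e] else 0)).
  congr (_ * _); case: ifP => // _; congr (_ * _).
  by apply: eq_bigr => e _; rewrite (scal_dots S j e).
rewrite (eq_bigr _ (fun j _ => D j)); case: (b =P a) => [E|/eqP ba]; last first.
  have [vp' t1] := @valid_swap false S a b vp ba.
  rewrite [X in _ + X]big1 ?addr0 => [|j _]; last by rewrite mulr0.
  rewrite act_rcross // eq_sym (negbTE ba) mulrA mulrAC -[a - b]opprB /rr sqrrN -/(rr _).
  by rewrite -/(rr _) mulrAC -(mulrA (cc a b)) [rr _ * cc b a]mulrC rr_cancel // mul1r.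
have oa : ok true S a by case/andP: vp.
have aA : a \in Rs S true by rewrite mem_Rs.
rewrite (eq_big_seq (fun c => \sum_(e <- Rs S true) (wt (flip c S) c)^-1 * (wt S a / (a - c)) / (e - c) * phi [:: e; e])) => [|c cR]; last first.
  rewrite mem_Rs // in cR; rewrite act_rcross //; last by rewrite /= cR (ok_flip cR).
  by rewrite eqxx mulr_sumr; apply: eq_bigr => e _; rewrite mulrA.
rewrite exchange_big /= (eq_bigr (fun j : 'I_d => \sum_(e <- Rs S true) wt S a * (rc S j a * e ^+ j) * phi [:: e; e])) => [|j _]; last first.
  by rewrite E mulr_sumr mulr_sumr; apply: eq_bigr => e _; ring.
rewrite [X in _ + X]exchange_big /= -big_split /= (eq_big_seq (fun e => (a == e)%:R * phi [:: e; e])) => [|e eA].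
  rewrite (sum_pickg (b := a)) // => [|e _ ea]; last by rewrite eq_sym (negbTE ea) mul0r.
  by rewrite oa eqxx mul1r E.
by rewrite -mulr_suml -mulr_suml -mulr_sumr -mulrDl resolution.
Qed.

Lemma valid1P c1 p S : valid [:: c1] p S -> exists a, p = [:: a].
Proof. by case: p => [|a [|e p]] //=; rewrite ?andbF // => _; exists a. Qed.
Lemma valid3P c1 c2 c3 p S : valid [:: c1; c2; c3] p S -> exists c b a, p = [:: c; b; a].
Proof. by case: p => [|c [|b [|a [|e p]]]] //=; rewrite ?andbF // => _; exists c, b, a. Qed.

Local Notation Qp := (DId [:: true] : diagram _ _).
Local Notation Qm := (DId [:: false] : diagram _ _).
Local Notation Qmm := (DId [:: false; false] : diagram _ _).
Local Notation "f ∘ g" := (DComp f g) (at level 40, left associativity).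
Local Notation "f ⊗ g" := (DTens f g) (at level 35, right associativity).
Local Notation x := (DDot : diagram _ _).
Local Notation s := (DCross : diagram _ _).
Local Notation η := (DRCup : diagram _ _).
Local Notation ε := (DRCap : diagram _ _).
Local Notation η' := (DLCup : diagram _ _).
Local Notation ε' := (DLCap : diagram _ _).

Lemma aeq_zigzag1 : aeq ((ε ⊗ Qp) ∘ (Qp ⊗ η)) Qp.
Proof.
move=> S p phi gS vp; have [b pE] := valid1P vp; rewrite pE /= in vp *; have fS := gfin gS.
rewrite (sum_pickg (b := b)) // => [|a _ ab]; last by rewrite eq_sym (negbTE ab).
by rewrite vp eqxx.
Qed.
Lemma aeq_zigzag2 : aeq ((Qp ⊗ ε') ∘ (η' ⊗ Qp)) Qp.
Proof.
move=> S p phi gS vp; have [b pE] := valid1P vp; rewrite pE /= in vp *; have fS := gfin gS.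
rewrite (sum_pickg (b := b)) => [||a _ ab]; [|exact: flip_fin|by rewrite (negbTE ab) mulr0].
by rewrite (ok_flip vp) eqxx flipK mulrA mulVf ?mul1r // wt_neq0.
Qed.
Lemma aeq_zigzag3 : aeq ((Qm ⊗ ε) ∘ (η ⊗ Qm)) Qm.
Proof.
move=> S p phi gS vp; have [b pE] := valid1P vp; rewrite pE /= in vp *; have fS := gfin gS.
rewrite (sum_pickg (b := b)) => [||a _ ab]; [|exact: flip_fin|by rewrite (negbTE ab)].
by rewrite (ok_flip vp) eqxx.
Qed.
Lemma aeq_zigzag4 : aeq ((ε' ⊗ Qm) ∘ (Qm ⊗ η')) Qm.
Proof.
move=> S p phi gS vp; have [b pE] := valid1P vp; rewrite pE /= in vp *; have fS := gfin gS.
rewrite (sum_pickg (b := b)) // => [|a _ ab]; last by rewrite eq_sym (negbTE ab) mulr0.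
rewrite vp eqxx mulrA mulVf ?mul1r // wt_neq0 //; first exact: flip_fin.
exact: (ok_flip vp).
Qed.
Lemma aeq_dot_mates : aeq ((Qm ⊗ ε) ∘ (Qm ⊗ x ⊗ Qm) ∘ (η ⊗ Qm)) ((ε' ⊗ Qm) ∘ (Qm ⊗ x ⊗ Qm) ∘ (Qm ⊗ η')).
Proof.
move=> S p phi gS vp; have [b pE] := valid1P vp; rewrite pE /= in vp *; have fS := gfin gS.
rewrite (sum_pickg (b := b)) => [||a _ ab]; [|exact: flip_fin|by rewrite (negbTE ab) mulr0].
rewrite (ok_flip vp) (sum_pickg (b := b)) // => [|a _ ab]; last by rewrite [b == a]eq_sym (negbTE ab) !mulr0.
have w0 : wt (flip b S) b != 0 by rewrite wt_neq0 //; [exact: flip_fin|exact: (ok_flip vp)].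
by rewrite vp eqxx; move: (phi _) => y; field.
Qed.
(** The closed strand sums over addable sites c the weight over c - a, with a removable after the
    move; this is [wt_frac] with exponent 0. *)
Lemma aeq_curl : aeq ((ε' ⊗ Qp) ∘ (Qm ⊗ s) ∘ (η ⊗ Qp)) DZero.
Proof.
move=> S p phi gS vp; have [a pE] := valid1P vp; rewrite pE /= in vp *; have fS := gfin gS.
have gS' : gstate (flip a S) by apply: gstate_flip vp.
have aR : a \in Rs (flip a S) false by rewrite mem_Rs ?(ok_flip vp) //; apply: flip_fin.
have := wt_frac d_gt0 gS' aR d_gt0 => H.
transitivity (\sum_(c <- Rs (flip a S) true) phi [:: a] * (wt (flip a S) c / (c - a) * c ^+ 0)); last by rewrite -mulr_sumr H mulr0.
apply: eq_big_seq => c cA.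
have -> : (c == a) = false by apply: contraTF cA => /eqP ->; rewrite (mem_Rs _ _ (gfin gS')); case/andP: vp => /eqP h1 /eqP h2; rewrite /ok /flip eqxx h2.
by rewrite eqxx mulr0 addr0 expr0; ring.
Qed.

Lemma valid_pp S b a : valid [:: true; true] [:: b; a] S -> (b - a != 0) /\ a != b.
Proof. by move=> /= /andP[oa ob]; have := ok2_neq oa ob; rewrite subr_eq0 eq_sym => ->. Qed.
Lemma aeq_crossK : aeq (s ∘ s) (DId [:: true; true]).
Proof.
move=> S p phi gS vp; have [b [a pE]] := valid2P vp; rewrite pE in vp *.
have [ba ab] := valid_pp vp; have ba' : b != a by rewrite eq_sym.
have := cc_mul ba'; rewrite /= -[a - b]opprB invrN; move: (cc b a) (cc a b) (phi [:: a; b]) (phi [:: b; a]) (_^-1) => m n z y t e.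
transitivity ((t ^+ 2 + m * n) * y); first by ring.
by rewrite e; ring.
Qed.
Lemma aeq_dot_cross1 : aeq (DAdd (s ∘ (x ⊗ Qp)) (DScale (-1) ((Qp ⊗ x) ∘ s))) (DId [:: true; true]).
Proof.
move=> S p phi gS vp; have [b [a pE]] := valid2P vp; rewrite pE in vp *.
have [ba ab] := valid_pp vp; rewrite /=; move: (cc b a) (phi _) (phi _) => m y z; by field.
Qed.
Lemma aeq_dot_cross2 : aeq (DAdd ((x ⊗ Qp) ∘ s) (DScale (-1) (s ∘ (Qp ⊗ x)))) (DId [:: true; true]).
Proof.
move=> S p phi gS vp; have [b [a pE]] := valid2P vp; rewrite pE in vp *.
have [ba ab] := valid_pp vp; rewrite /=; move: (cc b a) (phi _) (phi _) => m y z; by field.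
Qed.

Lemma valid_ppp S c b a : valid [:: true; true; true] [:: c; b; a] S -> [/\ a != b, b != c & a != c].
Proof.
move=> /= /andP[/andP[oa ob] oc]; have ab := ok2_neq oa ob; have bc := ok2_neq ob oc; split=> //.
move: oa ob oc => /andP[/eqP h1 /eqP h2] /andP[/eqP h3 /eqP h4]; rewrite /ok => /andP[/eqP h5 /eqP h6].
apply/eqP => E; subst c; move: h5 h6; rewrite {1 3}/flip.
rewrite (negbTE ab) [a + 1 == b + 1](inj_eq (addIr _)) (negbTE ab).
case: (a =P b + 1) => [E1 _|_]; last by rewrite /flip eqxx h2.
case: (a + 1 =P b) => [E2 _|_]; last by rewrite /flip succ_neq eqxx h1.
have /eqP := E1; rewrite -E2 -subr_eq0 !opprD !addrA subrr sub0r -opprD oppr_eq0.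
by have /negbTE -> := two_neq0 char0.
Qed.
Lemma aeq_braid : aeq ((s ⊗ Qp) ∘ (Qp ⊗ s) ∘ (s ⊗ Qp)) ((Qp ⊗ s) ∘ (s ⊗ Qp) ∘ (Qp ⊗ s)).
Proof.
move=> S p phi gS vp; have [c [b [a pE]]] := valid3P vp; rewrite pE in vp *; have [ab bc ac] := valid_ppp vp.
have cb : c != b by rewrite eq_sym. have ba : b != a by rewrite eq_sym. have ca : c != a by rewrite eq_sym.
have e1 := cc_mul cb; have e2 := cc_mul ba; have e3 := cc_mul ca.
(* Besides the products from [cc_mul], the braid relation uses only this partial fraction identity
   between the three inverse distances. *)
have eg : (c - b)^-1 * (b - a)^-1 = (c - a)^-1 * ((c - b)^-1 + (b - a)^-1).
  have h1 : c - b != 0 by rewrite subr_eq0.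
  have h2 : b - a != 0 by rewrite subr_eq0.
  have h3 : c - a != 0 by rewrite subr_eq0.
  by field; rewrite h1 h2 h3.
have i1 : (b - c)^-1 = - (c - b)^-1 by rewrite -invrN opprB.
have i2 : (a - b)^-1 = - (b - a)^-1 by rewrite -invrN opprB.
rewrite /= i1 i2.
move: e1 e2 e3 eg; move: (c - b)^-1 (b - a)^-1 (c - a)^-1 => g1 g2 g3.
move: (cc c b) (cc b c) (cc b a) (cc a b) (cc c a) (cc a c) => m1 n1 m2 n2 m3 n3 e1 e2 e3 eg.
move: (phi [:: c; b; a]) (phi [:: c; a; b]) (phi [:: b; c; a]) (phi [:: b; a; c]) (phi [:: a; c; b]) (phi [:: a; b; c]) => y1 y2 y3 y4 y5 y6.
set L := LHS; set Q := RHS.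
(* The difference of the two sides, written as a combination of the relations [e1], [e2] and
   [eg]. *)
have -> : L = Q + (m1 * n1 - (1 - g1 ^+ 2)) * g3 * y1 - (m2 * n2 - (1 - g2 ^+ 2)) * g3 * y1
   + (g1 * g2 - g3 * (g1 + g2)) * ((g1 - g2) * y1 + m1 * y3 - m2 * y2) by rewrite /L /Q; ring.
by rewrite e1 e2 eg !subrr !mul0r subr0 !addr0.
Qed.

Lemma aeq_cross_mates : aeq ((Qmm ⊗ (ε ∘ (Qp ⊗ ε ⊗ Qm))) ∘ (Qmm ⊗ s ⊗ Qmm) ∘ (((Qm ⊗ η ⊗ Qp) ∘ η) ⊗ Qmm))
  (((ε' ∘ (Qm ⊗ ε' ⊗ Qp)) ⊗ Qmm) ∘ (Qmm ⊗ s ⊗ Qmm) ∘ (Qmm ⊗ ((Qp ⊗ η' ⊗ Qm) ∘ η'))).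
Proof.
move=> S p phi gS vp; have [b [a pE]] := valid2P vp; rewrite pE /= in vp *; have fS := gfin gS.
case/andP: vp => oa ob; have fa : fin (flip a S) by apply: flip_fin.
have fU : fin (flip b (flip a S)) by apply: flip_fin.
have oUb := ok_flip ob; have oSa := ok_flip oa.
(* Either the sites are neighbours and the exchanged path has coefficient 0, or they are far apart
   and both orders of the moves are valid. *)
have far : cc b a = 0 \/ [/\ ok false S b, ok false (flip b S) a & flip a (flip b S) = flip b (flip a S)].
  case: (a + 1 =P b) => [E|/eqP n1]; first by left; apply: cc_succ.
  case: (b + 1 =P a) => [E|/eqP n2]; first by left; apply: cc_succ'.
  by right; apply: ok_same oa ob n1 n2.
transitivity ((a - b)^-1 * phi [:: b; a] + cc b a * phi [:: a; b]).
  under eq_bigr => c _ do rewrite big_split /=.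
  rewrite big_split /=; congr (_ + _).
    rewrite (sum_pickg (b := b)) // => [|c _ /negbTE cb]; last by rewrite big1 // => e _; rewrite ?cb ?mulr0.
    rewrite oUb flipK (sum_pickg (b := a)) // => [|e _ /negbTE ea]; last by rewrite ?eqxx ?ea ?mulr0.
    by rewrite oSa !eqxx.
  rewrite (sum_pickg (b := a)) // => [|c _ /negbTE ca]; last by rewrite big1 // => e _; rewrite ?ca ?if_same ?mulr0.
  rewrite (sum_pickg (b := b)) => [||e _ /negbTE eb]; [|exact: flip_fin|by rewrite ?eb ?mulr0].
  rewrite !eqxx; case: far => [->|[o1 o2 E]]; first by rewrite !mul0r !if_same.
  by rewrite -E (ok_flip o2) flipK (ok_flip o1).
symmetry.
under eq_bigr => c _ do (under eq_bigr => e _ do rewrite mulrDr; rewrite big_split /= mulrDr).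
rewrite big_split /=; congr (_ + _).
  rewrite (sum_pickg (b := a)) // => [|c _ ca]; last by rewrite big1 ?mulr0 // => e _; rewrite [a == c]eq_sym (negbTE ca) ?mulr0.
  rewrite oa (sum_pickg (b := b)) // => [|e _ eb]; last by rewrite ?eqxx [b == e]eq_sym (negbTE eb) ?mulr0.
  have w1 := wt_neq0 fa oSa; have w2 := wt_neq0 fU oUb.
  rewrite ob !eqxx flipK; move: (wt _ a) (wt _ b) w1 w2 (_ - _)^-1 (phi _) => W1 W2 w1 w2 t y.
  by field; rewrite w1 w2.
rewrite (sum_pickg (b := b)) // => [|c _ cb]; last by rewrite big1 ?mulr0 // => e _; rewrite [b == c]eq_sym (negbTE cb) ?if_same ?mulr0 ?if_same ?mulr0.
rewrite (sum_pickg (b := a)) => [||e _ ea]; [|exact: flip_fin|by rewrite [a == e]eq_sym (negbTE ea) ?mulr0].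
rewrite !eqxx; case: far => [->|[o1 o2 E]]; first by rewrite !mul0r !mulr0 !if_same !mulr0 ?if_same.
rewrite o1 o2; set T := flip a (flip b S).
have fT : fin T by rewrite /T E.
have oTb : ok true T b by rewrite /T E.
have oTa : ok true T a by apply: (ok_flip o2).
have ab : a != b := ok2_neq oa ob.
have [n1 n2] : a + 1 != b /\ b + 1 != a.
  split; apply/eqP => E1.
    by move: o1 oa; rewrite /ok E1 => /andP[/eqP ->]; rewrite andbF.
  by move: o1 oa; rewrite /ok E1 => /andP[_ /eqP ->].
have oTab : ok true (flip b T) a by rewrite ok_flip_far.
have oTba : ok true (flip a T) b by rewrite ok_flip_far // eq_sym.
have H1 := wt_flip char0 fT oTa oTb ab oTab; have ba : b != a by rewrite eq_sym.
have H2 := wt_flip char0 fT oTb oTa ba oTba.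
have wb := wt_neq0 fT oTb; have wa := wt_neq0 fT oTa.
have -> : flip b S = flip a T by rewrite /T flipK.
have wab : wt (flip a T) b != 0 by apply: wt_neq0 => //; apply: flip_fin.
have t1 := sqm1 n1 n2; have e2 : (b - a) ^+ 2 = (a - b) ^+ 2 by ring.
(* Creating the two particles in either order has the same total weight: both moves rescale the
   other's weight by the same function of the squared distance. *)
rewrite e2 in H2; have K : wt (flip b T) a * wt T b = wt (flip a T) b * wt T a.
  apply: (mulIf t1); rewrite mulrAC H1 [RHS]mulrAC H2; ring.
transitivity (cc b a * phi [:: a; b] * ((wt (flip b T) a * wt T b) / (wt (flip a T) b * wt T a))); last first.
  by rewrite K divff ?mulr1 // mulf_neq0.
rewrite [(wt (flip a T) b * wt T a)^-1]invfM.
by move: (wt (flip a T) b)^-1 (wt T a)^-1 (wt (flip b T) a) (wt T b) (phi _) (cc b a) => z1 z2 z3 z4 z5 z6; ring.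
Qed.

End FockRelations.

End FockRelations.
Import FockRelations.

(** * The trace on paths and the order of the unit class *)

Module FockTrace.

Local Open Scope ring_scope.

Section FockTrace.
Context (k : fieldType) (char0 : [pchar k] =i pred0).
Context (lam : {fsfun int -> nat with 0%N}).
Local Notation d := (level lam).
Context (d_gt0 : (0 < d)%N).
Local Notation cs := (\sum_(i <- finsupp lam) i%:~R * (lam i)%:R : k).
Local Notation gstate := (gstate d cs).

Lemma deq_fock u v (f g : diagram k u v) : deq lam f g -> aeq d cs f g.
Proof.
elim=> {u v f g}.
- by [].
- by move=> u v f g _ IH S p phi gS vp; rewrite IH.
- by move=> u v f g h _ IH _ IH' S p phi gS vp; rewrite IH // IH'.
- by move=> *; apply: aeq_comp.
- by move=> *; apply: aeq_tens.
- by move=> u v f f' g g' _ IH _ IH' S p phi gS vp; rewrite /= IH // IH'.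
- by move=> u v a f g _ IH S p phi gS vp; rewrite /= IH.
- by move=> u v f g h S p phi gS vp; rewrite /= addrA.
- by move=> u v f g S p phi gS vp; rewrite /= addrC.
- by move=> u v f S p phi gS vp; rewrite /= add0r.
- by move=> u v a b f S p phi gS vp; rewrite /= mulrA.
- by move=> u v f S p phi gS vp; rewrite /= mul0r.
- by move=> u v f S p phi gS vp; rewrite /= mul1r.
- by move=> u v a f g S p phi gS vp; rewrite /= mulrDr.
- by move=> u v a b f S p phi gS vp; rewrite /= mulrDl.
- by move=> u v w f f' g S p phi gS vp; apply: (fsup_addl _ _ (act_fsup char0 d_gt0 g gS vp)).
- by [].
- by move=> u v w a f g S p phi gS vp; apply: (fsup_scal _ _ (act_fsup char0 d_gt0 g gS vp)).
- by [].
- move=> u v u' v' f f' g S p phi gS vp; have [p1 [p2 [-> s1 v2 v1]]] := valid_split vp.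
  by rewrite /= take_size_cat // drop_size_cat //; apply: (fsup_addl _ _ (act_fsup char0 d_gt0 g gS v2)).
- by [].
- move=> u v u' v' a f g S p phi gS vp; have [p1 [p2 [-> s1 v2 v1]]] := valid_split vp.
  by rewrite /= take_size_cat // drop_size_cat //; apply: (fsup_scal _ _ (act_fsup char0 d_gt0 g gS v2)).
- by [].
- by [].
- by [].
- by [].
- by move=> u v S p phi gS vp; rewrite /= cat_take_drop.
- by move=> *; apply: aeq_interchange.
- by move=> u v f S p phi gS vp; rewrite /= take0 drop0.
- by move=> *; apply: aeq_unitr.
- by move=> *; apply: aeq_tensA.
- exact: aeq_zigzag1.
- exact: aeq_zigzag2.
- exact: aeq_zigzag3.
- exact: aeq_zigzag4.
- exact: aeq_dot_mates.
- exact: aeq_cross_mates.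
- exact: aeq_crossK.
- exact: aeq_braid.
- exact: aeq_dot_cross1.
- exact: aeq_dot_cross2.
- exact: aeq_mp.
- exact: aeq_pm.
- by move=> j jd S [|? ?] phi gS vp //; rewrite act_bubble (gam_lt d_gt0 gS jd) mul0r.
- by move=> S [|? ?] phi gS vp //; rewrite act_bubble (gam_pred d_gt0 gS) mul1r.
- by move=> S [|? ?] phi gS vp //; rewrite act_bubble (gam_level d_gt0 gS).
- exact: aeq_curl.
Qed.

Context (S0 : k -> bool) (gS0 : gstate S0).

Fixpoint paths (u : word) : seq (seq k) :=
  if u is c :: u' then [seq a :: p | p <- paths u', a <- Rs (run p S0) c] else [:: [::]].
Lemma mem_paths u p : (p \in paths u) = valid u p S0.
Proof.
elim: u p => [|c u IH] [|a p] //=; first by apply/negP => /allpairsPdep[? [? [_ _]]].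
apply/allpairsPdep/andP => [[q [b [qu bq [-> ->]]]]|[vp oa]].
  have vq : valid u q S0 by rewrite -IH.
  split=> //; rewrite -mem_Rs //; exact: gfin (gstate_run char0 d_gt0 gS0 vq).
exists p, a; rewrite IH; split=> //; rewrite mem_Rs //; exact: gfin (gstate_run char0 d_gt0 gS0 vp).
Qed.
Lemma paths_uniq u : uniq (paths u).
Proof.
elim: u => //= c u IH; apply: allpairs_uniq_dep => // [p pu|].
  by apply: uniq_Rs; rewrite mem_paths in pu; apply: gfin (gstate_run char0 d_gt0 gS0 pu).
by move=> [p a] [q b] _ _ /= [-> ->].
Qed.

Let dl (q p : seq k) : k := (p == q)%:R.
Let tr0 u (f : diagram k u u) := \sum_(p <- paths u) fock f S0 (dl p) p.
Let fock_expand u v (f : diagram k u v) p psi : p \in paths u ->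
  fock f S0 psi p = \sum_(q <- paths v) fock f S0 (dl q) p * psi q.
Proof.
rewrite mem_paths => vp; have [l [Hl El]] := act_fsup char0 d_gt0 f gS0 vp.
rewrite El (eq_bigr (fun q => \sum_(x <- l) x.1 * (dl q x.2 * psi q))) => [|q _]; last first.
  by rewrite El mulr_suml; apply: eq_bigr => x _; rewrite mulrA.
rewrite exchange_big; apply: eq_big_seq => x xl; rewrite -mulr_sumr; congr (_ * _).
have [vx _] := Hl x xl; rewrite (bigD1_seq x.2) ?paths_uniq ?mem_paths //= /dl eqxx mul1r big1 ?addr0 // => q.
by rewrite eq_sym => /negbTE ->; rewrite mul0r.
Qed.
Let tr0C u v (f : diagram k v u) (g : diagram k u v) : tr0 (DComp f g) = tr0 (DComp g f).
Proof.
rewrite /tr0 (eq_big_seq (fun p => \sum_(q <- paths v) fock g S0 (dl q) p * fock f S0 (dl p) q)) => [|p pu]; last first.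
  by rewrite -fock_expand.
rewrite exchange_big; apply: eq_big_seq => q qv; rewrite [RHS]/= (fock_expand f (fock g S0 (dl q)) qv).
by apply: eq_bigr => p _; rewrite mulrC.
Qed.

Definition htr u (f : QHom k lam u u) : k := tr0 (rep f).
Lemma htr_cl u (f : diagram k u u) : htr (cl f) = tr0 f.
Proof.
apply: eq_big_seq => p; rewrite mem_paths => vp; apply: deq_fock => //; exact: deq_rep.
Qed.
Lemma htrC u v (f : QHom k lam v u) (g : QHom k lam u v) : htr (hcomp f g) = htr (hcomp g f).
Proof. by elim/quotW: f => f; elim/quotW: g => g; rewrite !hcompE !htr_cl tr0C. Qed.
Lemma htrD u (f g : QHom k lam u u) : htr (f + g) = htr f + htr g.
Proof. by elim/quotW: f => f; elim/quotW: g => g; rewrite (hplusE lam f g) !htr_cl -big_split. Qed.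
Lemma htr0 u : htr (0 : QHom k lam u u) = 0.
Proof. by apply: (addIr (htr (0 : QHom k lam u u))); rewrite -htrD !add0r. Qed.
Lemma htr_id0 : htr (hid k lam [::]) = 1.
Proof. by rewrite htr_cl /tr0 /= big_seq1 /dl eqxx. Qed.

Definition mtr (I : finType) (X : I -> word) (e : mhom k lam X X) : k := \sum_i htr (e i i).
Lemma mtr_iso (I J : finType) (X : I -> word) (Y : J -> word) (e : mhom k lam X X) (e' : mhom k lam Y Y) :
  karoubi_iso e e' -> mtr e = mtr e'.
Proof.
case=> f [g [_ _ <- <-]]; rewrite /mtr /mcomp.
have sumE (I' : finType) u (F : I' -> QHom k lam u u) : htr (\sum_i F i) = \sum_i htr (F i).
  by apply: (big_morph (@htr u)); [exact: htrD|exact: htr0].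
rewrite (eq_bigr _ (fun i _ => sumE _ _ _)) (eq_bigr _ (fun i _ => sumE _ _ _)).
rewrite exchange_big; apply: eq_bigr => j _; apply: eq_bigr => i _; exact: htrC.
Qed.
Definition ktr (A : kobj k lam) : k := mtr (@kidem _ _ A).
Lemma ktr_iso A B : kiso A B -> ktr A = ktr B. Proof. exact: mtr_iso. Qed.
Lemma ktr_sum A B : ktr (ksum A B) = ktr A + ktr B.
Proof. by rewrite /ktr (mtr_iso (ksumE A B)) /mtr big_sumType. Qed.
Lemma ktr_one : ktr (kone k lam) = 1.
Proof. by rewrite /ktr /mtr big_ord1 [LHS]htr_id0. Qed.
Lemma ktr_zero : ktr (kzero k lam) = 0.
Proof. by rewrite /ktr /mtr big_ord0. Qed.

Definition cltr (x : kclass k lam) : k := ktr (rep x).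
Lemma cltr_cl A : cltr (cl A) = ktr A.
Proof. by apply: ktr_iso; apply: (eqv_rep (kiso_equiv k lam)). Qed.
Lemma cltrD (x y : kclass k lam) : cltr (x + y) = cltr x + cltr y.
Proof.
elim/quotW: x => A; elim/quotW: y => B.
by rewrite [(cl A : kclass k lam) + cl B](kc_addE A B) !cltr_cl ktr_sum.
Qed.
Lemma cltr_nat n : cltr (n%:R : kclass k lam) = n%:R.
Proof.
elim: n => [|n IH]; first by rewrite [LHS]cltr_cl ktr_zero.
by rewrite mulrSr cltrD IH [cltr 1]cltr_cl ktr_one -mulrSr.
Qed.

(** Vanishing in the group completion means n + t = t for some class t; the trace is additive on
    classes and takes the unit object to 1, so n is 0 in a field of characteristic zero. *)
Lemma K0_nat_inj n : n%:R = 0 :> K0 k lam -> n = 0%N.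
Proof.
have -> : n%:R = cl (n%:R : kclass k lam, 0 : kclass k lam) :> K0 k lam.
  elim: n => [|n IH] //; transitivity ((cl (n%:R : kclass k lam, 0 : kclass k lam) : K0 k lam) + cl (1 : kclass k lam, 0 : kclass k lam)).
    by rewrite mulrSr IH.
  rewrite [LHS](gr_plusE (n%:R : kclass k lam, 0 : kclass k lam) (1 : kclass k lam, 0 : kclass k lam)).
  congr cl; exact: (congr2 pair (esym (mulrSr 1 n)) (addr0 (0 : kclass k lam))).
move/clP => -[t /= H]; have c0 : cltr 0 = 0 := cltr_nat 0.
have : cltr (n%:R + 0 + t) = cltr (0 + 0 + t) := congr1 cltr H.
rewrite !cltrD c0 !addr0 cltr_nat add0r.
move/(canRL (addrK _)); rewrite subrr => /eqP; have /pcharf0P -> := char0.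
by move/eqP.
Qed.
End FockTrace.

Section InitialState.
Context (k : fieldType) (char0 : [pchar k] =i pred0) (d : nat) (d_gt0 : (0 < d)%N) (cs : k).

(** Steps of 1/d keep the d tops in distinct classes modulo the integers; the term (d - 1) / (2 d)
    compensates the sum of the steps. *)
Let a0 (i : nat) : k := cs / d%:R - (d%:R - 1) / 2%:R / d%:R + i%:R / d%:R.
Let nat0 n : (n%:R == 0 :> k) = (n == 0)%N. Proof. by have /pcharf0P := char0. Qed.
Let d0 : d%:R != 0 :> k. Proof. by rewrite nat0 -lt0n. Qed.
Let nat_inj m n : m%:R = n%:R :> k -> m = n.
Proof.
wlog: m n / (m <= n)%N => [H|mn E]; first by case/orP: (leq_total m n) => h E; [exact: H|symmetry; apply: H].
have /eqP := E; rewrite eq_sym -subr_eq0 -natrB // nat0 subn_eq0 => nm.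
by apply/eqP; rewrite eqn_leq mn nm.
Qed.
Let a0E i j i' j' : a0 i - j%:R = a0 i' - j'%:R -> (i + j' * d = i' + j * d)%N.
Proof.
move=> E; apply: nat_inj; rewrite !natrD !natrM; move: E; rewrite /a0; move: d0 (two_neq0 char0).
move: (i%:R : k) (i'%:R : k) (j%:R : k) (j'%:R : k) (d%:R : k) => z w x y D D0 t2 H.
have e u v : (cs / D - (D - 1) / 2%:R / D + u / D - v) * D = cs - (D - 1) / 2%:R + u - v * D by field; rewrite D0 t2.
have := congr1 (fun t => t * D) H; rewrite !e => K.
by transitivity (cs - (D - 1) / 2%:R + z - x * D - (cs - (D - 1) / 2%:R) + x * D + y * D); [ring|rewrite K; ring].
Qed.

(* d half-lines whose tops lie in distinct classes modulo the integers and sum to [cs]. *)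
Definition state0 : k -> bool := fun c => `[< exists i j, (i < d)%N /\ c = a0 i - j%:R >].

Lemma gstate0 : gstate d cs state0.
Proof.
pose L := [seq a0 i | i <- iota 0 d].
have inS i j : (i < d)%N -> state0 (a0 i - j%:R) by move=> id; apply/asboolP; exists i, j.
have top i : (i < d)%N -> state0 (a0 i + 1) = false.
  move=> id; apply/asboolP => -[i' [j [id' E]]].
  have := @a0E i' j.+1 i 0%N; rewrite mul0n addn0 => H.
  have : i' = (i + j.+1 * d)%N by apply: H; rewrite subr0 -[a0 i](addrK 1) E mulrSr opprD addrA.
  by move: id'; clear; case: d => //; lia.
have stp c : state0 c -> ~~ state0 (c + 1) -> c \in L.
  move=> /asboolP[i [[|j] [id ->]]]; first by rewrite subr0 => _; apply: map_f; rewrite mem_iota.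
  by rewrite mulrSr opprD addrA subrK inS.
have stf c : state0 (c + 1) -> state0 c.
  by move=> /asboolP[i [j [id E]]]; rewrite (_ : c = a0 i - j.+1%:R) ?inS // mulrSr opprD addrA -E addrK.
have uL : uniq L.
  rewrite map_inj_uniq ?iota_uniq // => i i' E; have := @a0E i 0%N i' 0%N.
  by rewrite !subr0 !mul0n !addn0; apply.
have fS : fin state0.
  exists L; split=> // c; case: (boolP (state0 c)) => sc; first by move=> h; apply: stp => //; case: (state0 (c + 1)) h.
  by case: (boolP (state0 (c + 1))) => // /stf; rewrite (negbTE sc).
have pA : perm_eq (Rs state0 true) L.
  apply: uniq_perm => //; first exact: uniq_Rs.
  move=> c; rewrite mem_Rs //; apply/andP/idP => [[/eqP h1 /eqP h2]|/mapP[i]]; first by apply: stp; rewrite ?h1 ?h2.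
  by rewrite mem_iota add0n => /andP[_ id] ->; rewrite top // -[a0 i]subr0 (inS i 0%N).
have R0 : Rs state0 false = [::].
  case E : (Rs state0 false) => [|c r] //; have : c \in Rs state0 false by rewrite E mem_head.
  by rewrite mem_Rs // => /andP[/eqP h1 /eqP /stf]; rewrite h1.
split=> //; first by rewrite (perm_size pA) R0 size_map size_iota.
rewrite (perm_big _ pA) R0 big_nil subr0 big_map.
rewrite (eq_bigr (fun i => (cs / d%:R - (d%:R - 1) / 2%:R / d%:R) + i%:R / d%:R)) // big_split /= -mulr_suml.
have -> : \sum_(i <- iota 0 d) (i%:R : k) = d%:R * (d%:R - 1) / 2%:R.
  have t2 := two_neq0 char0; have -> : iota 0 d = index_iota 0 d by rewrite /index_iota subn0.
  elim: d => [|n IH]; first by rewrite big_geq // !mul0r.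
  rewrite big_nat_recr //= IH -[n.+1%:R]natr1; move: (n%:R : k) => y; by field; rewrite t2.
rewrite big_const_seq count_predT size_iota iter_addr_0 -[X in X + _]mulr_natr.
by have t2 := two_neq0 char0; have D0 := d0; move: (d%:R : k) D0 => D D0; field; rewrite D0 t2.
Qed.
End InitialState.

End FockTrace.
Import FockTrace.

(** * The Heisenberg ring: presentation, normal order, injectivity *)

Module HeisenbergBasis.

Local Open Scope ring_scope.

Section PresentedMorphism.
Context (G : Type) (R : rterm G -> rterm G -> Prop) (A : pzRingType) (v : G -> A).

Lemma rcong_reval : (forall s t, R s t -> reval v s = reval v t) ->
  forall s t, rcong R s t -> reval v s = reval v t.
Proof.
move=> vR s t; elim=> {s t} //=.
- by move=> s t u _ -> _ ->.
- by move=> s s' t t' _ -> _ ->.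
- by move=> t t' _ ->.
- by move=> s s' t t' _ -> _ ->.
- by move=> s t u; rewrite addrA.
- by move=> s t; rewrite addrC.
- by move=> t; rewrite add0r.
- by move=> t; rewrite addNr.
- by move=> s t u; rewrite mulrA.
- by move=> t; rewrite mul1r.
- by move=> t; rewrite mulr1.
- by move=> s t u; rewrite mulrDl.
- by move=> s t u; rewrite mulrDr.
Qed.

Definition presmap (vR : forall s t, R s t -> reval v s = reval v t) (z : presring R) : A := reval v (rep z).
Context (vR : forall s t, R s t -> reval v s = reval v t).
Lemma presmap_cl t : presmap vR (cl t) = reval v t.
Proof. by apply: (rcong_reval vR); apply: (eqv_rep (rcong_equiv R)). Qed.
Fact presmap_zmod : zmod_morphism (presmap vR).
Proof.
move=> x y; elim/quotW: x => s; elim/quotW: y => t.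
have -> : (cl (s : rterm G) : presring R) - (cl (t : rterm G) : presring R) = cl (RAdd s (ROpp t)).
  by rewrite -[LHS]/(pr_add (cl s : presring R) (pr_opp (cl t : presring R))) pr_oppE pr_addE.
by rewrite !presmap_cl.
Qed.
Fact presmap_monoid : monoid_morphism (presmap vR).
Proof.
split; first by rewrite -[LHS]/(presmap vR (cl ROne)) presmap_cl.
move=> x y; elim/quotW: x => s; elim/quotW: y => t.
have -> : (cl (s : rterm G) : presring R) * (cl (t : rterm G) : presring R) = cl (RMul s t).
  by rewrite -[LHS]/(pr_mul (cl s : presring R) (cl t : presring R)) pr_mulE.
by rewrite !presmap_cl.
Qed.
HB.instance Definition _ := GRing.isZmodMorphism.Build (presring R) A (presmap vR) presmap_zmod.
HB.instance Definition _ := GRing.isMonoidMorphism.Build (presring R) A (presmap vR) presmap_monoid.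
End PresentedMorphism.

Lemma reval_cl (G : Type) (R : rterm G -> rterm G -> Prop) (t : rterm G) :
  reval (fun g => cl (RGen g) : presring R) t = cl t.
Proof.
elim: t => //= [s -> t ->|t ->|s -> t ->]; first exact: pr_plusE.
  exact: pr_oppE.
exact: pr_mulE.
Qed.
Lemma reval_RNat (G : Type) (A : pzRingType) (v : G -> A) n : reval v (RNat n) = n%:R.
Proof. by elim: n => //= n ->; rewrite mulrS. Qed.
Lemma reval_sum (G : Type) (A : pzRingType) (v : G -> A) (I : Type) (r : seq I) (P : pred I) (F : I -> rterm G) :
  reval v (\big[@RAdd G/RZero]_(i <- r | P i) F i) = \sum_(i <- r | P i) reval v (F i).
Proof. exact: (big_morph (reval v)). Qed.
Lemma reval_morph (G : Type) (A B : pzRingType) (f : {rmorphism A -> B}) (v : G -> A) t :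
  f (reval v t) = reval (f \o v) t.
Proof.
by elim: t => //= [||s Hs t Ht|t Ht|s Hs t Ht]; rewrite ?rmorph0 ?rmorph1 ?rmorphD ?rmorphN ?rmorphM ?Hs ?Ht.
Qed.

Section SignedWords.
Implicit Types (L M : seq (bool * seq nat)) (P : rterm nat).
Definition negw L := [seq (~~ w.1, w.2) | w <- L].
Definition mulw L M := [seq (w.1 (+) w'.1, w.2 ++ w'.2) | w <- L, w' <- M].
Fixpoint expand P : seq (bool * seq nat) :=
  match P with
  | RGen a => [:: (false, [:: a])]
  | RZero => [::]
  | ROne => [:: (false, [::])]
  | RAdd s t => expand s ++ expand t
  | ROpp t => negw (expand t)
  | RMul s t => mulw (expand s) (expand t)
  end.
Context (A : pzRingType) (h : nat -> A).
Lemma lev_cat L M : lev h (L ++ M) = lev h L + lev h M. Proof. exact: big_cat. Qed.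
Lemma lev_neg L : lev h (negw L) = - lev h L.
Proof.
rewrite /lev big_map -sumrN; apply: eq_bigr => -[b w] _ /=.
by case: b; rewrite /= ?expr0 ?expr1 ?mulN1r ?opprK ?mul1r.
Qed.
Lemma lev_mul L M : lev h (mulw L M) = lev h L * lev h M.
Proof.
rewrite /lev /mulw big_allpairs_dep mulr_suml; apply: eq_bigr => -[b w] _; rewrite mulr_sumr.
apply: eq_bigr => -[b' w'] _; rewrite /= big_cat /=.
by case: b; case: b'; rewrite /= ?expr0 ?expr1 ?mulN1r ?mul1r ?mulrN ?mulNr ?opprK.
Qed.
Lemma lev_expand P : reval h P = lev h (expand P).
Proof.
elim: P => [a|||s Hs t Ht|t Ht|s Hs t Ht] /=.
- by rewrite /lev !big_seq1 /= expr0 mul1r.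
- by rewrite /lev big_nil.
- by rewrite /lev big_seq1 big_nil mulr1.
- by rewrite lev_cat Hs Ht.
- by rewrite lev_neg Ht.
- by rewrite lev_mul Hs Ht.
Qed.
Definition mono_term (w : seq nat) : rterm nat := foldr (fun a t => RMul (RGen a) t) ROne w.
Definition words_term L : rterm nat :=
  foldr (fun w t => RAdd (if w.1 then ROpp (mono_term w.2) else mono_term w.2) t) RZero L.
Lemma reval_words L : reval h (words_term L) = lev h L.
Proof.
have H w : reval h (mono_term w) = \prod_(a <- w) h a.
  by elim: w => [|a w IH]; rewrite ?big_nil //= big_cons IH.
elim: L => [|[b w] L IH]; rewrite /lev ?big_nil //= big_cons -/(lev h L) IH.
by case: b; rewrite /= H ?expr0 ?expr1 ?mulN1r ?mul1r.
Qed.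
End SignedWords.

Section HeisenbergBasis.
Context (d : nat) (d_gt0 : (0 < d)%N).
Local Notation A := (heis d).
Local Notation hm := (hgen d false).
Local Notation hp := (hgen d true).

Lemma heis_reval s t : heis_rel d s t -> reval (fun g => hgen d g.1 g.2) s = reval (fun g => hgen d g.1 g.2) t.
Proof.
move=> H; have E : (fun g : bool * nat => hgen d g.1 g.2) = (fun g => cl (RGen g) : presring (heis_rel d)).
  by apply/funext => -[].
by rewrite E [LHS]reval_cl [RHS]reval_cl; apply/clP; apply: rc_rel.
Qed.
Lemma hgen0 b : hgen d b 0 = 1. Proof. exact: (heis_reval (heis_one d b)). Qed.
Lemma hgen_comm b n m : hgen d b n * hgen d b m = hgen d b m * hgen d b n.
Proof. exact: (heis_reval (heis_comm d b n m)). Qed.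
Lemma hgen_cross n m : hm n * hp m = \sum_(r < (minn m n).+1) (hp (m - r) * hm (n - r)) *+ 'C((d + r).-1, r).
Proof.
rewrite [LHS](heis_reval (heis_cross d n m)) reval_sum.
by apply: eq_bigr => r _; rewrite /= reval_RNat mulr_natl.
Qed.

Lemma pw_minus n m : pw hm n * hp m = hp m * pw hm n + zshift hp m n.+1 *+ d.
Proof. exact: (pw_cross d_gt0 (hgen0 false) hgen_cross). Qed.
(* The plus power sums are built in the opposite ring, where the two families of generators exchange their roles. *)
Definition pwc n : A := @pw A^c hp n.
Lemma pw_plus n m : hm m * pwc n = pwc n * hm m + zshift hm m n.+1 *+ d.
Proof.
apply: (@pw_cross A^c d hp hm d_gt0 (hgen0 true)) => n' m'.
rewrite [LHS]hgen_cross minnC; exact: eq_bigr.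
Qed.
Lemma pwc_comm n m : hp m * pwc n = pwc n * hp m.
Proof. by apply/esym; apply: (pw_comm (A := A^c) (hm := hp) (hgen0 true)) => i; apply: hgen_comm. Qed.

Fixpoint down N : seq nat := if N is N'.+1 then N :: down N' else [::].
Lemma mem_down N n : (n \in down N) = (0 < n <= N)%N.
Proof. by elim: N => [|N IH]; rewrite ?inE ?IH; [case: n|apply/idP/idP; lia]. Qed.
Definition hgens b N := [seq hgen d b n | n <- down N].
Definition tower N : seq A := hgens false N ++ hgens true N.

Lemma zshift_lt h n m : (m < n)%N -> zshift h m n = 0 :> A.
Proof. by rewrite /zshift ltnNge => /negbTE ->. Qed.

(** The power sum of degree M of one sign commutes with the other sign's generators of lower index
    and has commutator d, up to sign, with the one of index M. Listing indices downwards, and minus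
    before plus, leaves only such generators and those of its own sign in the tail. *)
Lemma tower_good N : good d (tower N).
Proof.
have gp M : good d (hgens true M).
  elim: M => //= M IH; split=> //; exists (pw hm M); split.
    move=> y /mapP[m]; rewrite mem_down => mM ->; rewrite pw_minus zshift_lt ?mul0rn ?addr0 //; lia.
  by rewrite pw_minus /zshift leqnn subnn hgen0.
rewrite /tower; elim: {1}N => //= M IH; split=> //; exists (- pwc M); split.
  move=> y; rewrite mem_cat => /orP[] /mapP[m]; rewrite mem_down => mM ->.
    by rewrite mulrN mulNr pw_plus zshift_lt ?mul0rn ?addr0 //; lia.
  by rewrite mulrN mulNr pwc_comm.
by rewrite mulrN mulNr pw_plus /zshift leqnn subnn hgen0 opprD subrK.
Qed.

Local Notation mono b w := (\prod_(a <- w) hgen d b a).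
Inductive spn : A -> Prop :=
  | spn0 : spn 0
  | spnD y z : spn y -> spn z -> spn (y + z)
  | spnN y : spn y -> spn (- y)
  | spn_mono al be : spn (mono true al * mono false be).
Lemma spn_nat y n : spn y -> spn (y *+ n).
Proof. by move=> sy; elim: n => [|n IH]; rewrite ?mulr0n ?mulrS; [exact: spn0|exact: spnD]. Qed.
Lemma spn_hp n z : spn z -> spn (hp n * z).
Proof.
elim=> [|y z' _ IH _ IH'|y _ IH|al be]; rewrite ?mulr0 ?mulrDr ?mulrN.
- exact: spn0.
- exact: spnD.
- exact: spnN.
have -> : hp n * (mono true al * mono false be) = mono true (n :: al) * mono false be by rewrite big_cons mulrA.
exact: spn_mono.
Qed.
(** Normal ordering: the cross relation moves [hm n] past the first plus generator, leaving a
    shorter plus monomial to pass. *)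
Lemma spn_hm n z : spn z -> spn (hm n * z).
Proof.
elim=> [|y z' _ IH _ IH'|y _ IH|al be]; rewrite ?mulr0 ?mulrDr ?mulrN.
- exact: spn0.
- exact: spnD.
- exact: spnN.
elim: al n => [|a al IH] n; first by have := spn_mono [::] (n :: be); rewrite !big_nil big_cons !mul1r.
rewrite big_cons !mulrA hgen_cross -mulrA mulr_suml; apply: (big_ind spn) => [||r _]; [exact: spn0|exact: spnD|].
by rewrite mulrnAl -mulrA; apply: spn_nat; apply: spn_hp; apply: IH.
Qed.
Lemma spn_all z : spn z.
Proof.
have s1 : spn 1 by have := spn_mono [::] [::]; rewrite !big_nil mulr1.
suff H t y : spn y -> spn ((cl t : A) * y) by have := H (rep z) 1 s1; rewrite mulr1 repK.
elim: t y => [[b n]|||s Hs t Ht|t Ht|s Hs t Ht] {}z sz.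
- by case: b; [apply: spn_hp|apply: spn_hm].
- by rewrite -[cl _]/(0 : A) mul0r; apply: spn0.
- by rewrite -[cl _]/(1 : A) mul1r.
- by rewrite -[cl _](pr_plusE (heis_rel d) s t) mulrDl; apply: spnD; [apply: Hs|apply: Ht].
- have -> : (cl (ROpp t) : A) = - (cl t : A) by rewrite [RHS]pr_oppE.
  by rewrite mulNr; apply: spnN; apply: Ht.
- have -> : (cl (RMul s t) : A) = (cl s : A) * (cl t : A) by rewrite [RHS]pr_mulE.
  by rewrite -mulrA; apply: Hs; apply: Ht.
Qed.

(** Each normally ordered monomial is built up by right multiplications, and generators of one sign
    commute, so each finds its place in the list. The statement covers all larger [N'] so that
    summands can share a tower. *)
Lemma tower_span z : exists N, forall N', (N <= N')%N -> tow (tower N') z.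
Proof.
elim: (spn_all z) => {z} [|y z _ [N HN] _ [M HM]|y _ [N HN]|al be].
- by exists 0%N => N' _; apply: tow0.
- exists (maxn N M) => N'; rewrite geq_max => /andP[h1 h2]; apply: towD; [exact: HN|exact: HM].
- by exists N => N' h; apply: towN; apply: HN.
exists (sumn al + sumn be)%N => N' hN.
have step b xs ys w y : xs = hgens b N' -> (sumn w <= N')%N -> tow (xs ++ ys) y -> tow (xs ++ ys) (y * mono b w).
  move=> xE; elim: w y => [|a w IH] y /= wN ty; first by rewrite big_nil mulr1.
  rewrite big_cons mulrA; apply: IH; first by lia.
  case: (posnP a) => [->|a0]; first by rewrite hgen0 mulr1.
  apply: tow_cat => //; first by rewrite xE map_f // mem_down a0; lia.
  by move=> x; rewrite xE => /mapP[m _ ->]; apply: hgen_comm.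
rewrite /tower; apply: (step false) => //; first by lia.
elim: (hgens false N') => [|x xs IH]; last exact: tow_cons.
rewrite /= -[hgens true N']cats0 -[mono true al]mul1r; apply: (step true) => //; first by lia.
exact: tow1.
Qed.

Lemma heis_inj (B : pzRingType) (f : {rmorphism A -> B}) : (forall n : nat, n%:R = 0 :> B -> n = 0%N) -> injective f.
Proof.
move=> one_free y z yz; apply/eqP; rewrite -subr_eq0; apply/eqP.
have [N HN] := tower_span (y - z).
apply: (tow_free (f := f) d_gt0 one_free (tower_good N) (HN N (leqnn N))).
by exists 0%N; rewrite mulr1n rmorphB /= yz subrr.
Qed.
End HeisenbergBasis.

End HeisenbergBasis.
Import HeisenbergBasis.

(** * Assembly of the theorem *)

Local Open Scope ring_scope.

Theorem theorem4p4 (k : fieldType) (char0 : [pchar k] =i pred0)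
    (lam : {fsfun int -> nat with 0%N}) (lam_neq0 : exists i, lam i <> 0%N) :
  exists (p : forall n, 'S_n -> QHom k lam (nseq n true) (nseq n true))
         (f : {rmorphism heis (level lam) -> K0 k lam}),
    [/\ forall n, strand_action (p n),
        injective f,
        forall (b : bool) (mu : seq nat) (e : galg k (sumn mu)),
          is_part mu -> specht_idem e ->
          exists ee : hidem (Qendo (p (sumn mu)) b e),
            f (schur (level lam) b mu) = K0cl (kobj_of ee)
      & forall (b : bool) (n : nat), (1 <= n)%N ->
          exists ee : hidem (Qendo (p n) b (sym_idem k n)),
            f (hgen (level lam) b n) = K0cl (kobj_of ee)].
Proof.
have d_gt0 : (0 < level lam)%N.
  have [i /eqP li] := lam_neq0; rewrite /level (big_rem i) ?mem_finsupp //=.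
  by rewrite ltn_addr // lt0n.
pose v (g : bool * nat) := Hb char0 lam g.1 g.2.
have vR s t : heis_rel (level lam) s t -> reval v s = reval v t.
  case=> [b|b n m|n m] /=; [exact: Hb0|exact: Hb_comm|].
  rewrite [LHS]Hb_cross -?lt0n // reval_sum; apply: eq_bigr => r _.
  by rewrite /= reval_RNat.
pose f : {rmorphism heis (level lam) -> K0 k lam} := presmap vR.
have fgen b n : f (hgen (level lam) b n) = Hb char0 lam b n by rewrite [LHS](presmap_cl vR).
exists (@pn k lam), f; split.
- exact: pn_action.
- apply: (heis_inj d_gt0) => n.
  exact: (K0_nat_inj char0 d_gt0 (gstate0 char0 d_gt0 _)).
- move=> b mu e muP eP; have [[ee _ _] _] := eP.
  exists (Qendo_idem lam b ee); rewrite -KbE (specht_words char0 muP eP (Kb_additive k lam b _)).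
  pose S := fun z : heis (level lam) => exists2 P, schur_expr mu P & z = reval (hgen (level lam) b) P.
  (* The Jacobi-Trudi expansion is one expression of the Schur function, so [xget] returns an
     expression and not its default. *)
  have [P PE ->] : S (schur (level lam) b mu).
    apply: (@classical_sets.xgetPex _ _ S); exists (reval (hgen (level lam) b) (words_term (jt_words mu))).
    by exists (words_term (jt_words mu)) => // N; rewrite reval_words schur_words.
  have fP : f (reval (hgen (level lam) b) P) = lev (Hb char0 lam b) (expand P).
    rewrite reval_morph lev_expand; apply: eq_bigr => w _; congr (_ * _).
    by apply: eq_bigr => a _; apply: fgen.
  (* Whichever expression [P] was returned, it differs from the Jacobi-Trudi expansion by a relation
     between complete polynomials, and such relations hold between the classes. *)
  have : lev (Hb char0 lam b) (expand P ++ negw (jt_words mu)) = 0.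
    by apply: lev_zero => N; rewrite lev_cat lev_neg -lev_expand PE schur_words // subrr.
  rewrite lev_cat lev_neg fP => /eqP; rewrite subr_eq0 => /eqP ->; rewrite /lev; apply: eq_big_seq => -[c w] wJ.
  have wn : sumn mu = sumn w.
    by move: wJ => /mapP[s]; rewrite mem_filter => /andP[js _] [_ ->]; apply: sumn_jtw.
  rewrite (Kb_rho char0 lam b wn); case: c {wJ} => /=; by rewrite ?expr0 ?expr1 ?mulN1r ?mul1r.
- move=> b n _; have ii : idem (sym_idem k n : GR k n) by rewrite sym_idem_rho; exact: rho_idem.
  by exists (Qendo_idem lam b ii); rewrite -KbE Kb_sym fgen.
Qed.
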